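(* Let $H_2=\left\{\varepsilon\begin{pmatrix}a&b\\0&a^{1/2}\end{pmatrix}:a\in(0,\infty),\,b\in\mathbb R,\,\varepsilon\in\{\pm1\}\right\}$ be the shearlet group, let $v:H_2\to(0,\infty)$, $v(h)=|\det(h)|^{7/6}$, let $g=\begin{pmatrix}0&-1\\1&0\end{pmatrix}$, and let $g^{-1}vg:g^{-1}H_2g\to(0,\infty)$, $h\mapsto v(ghg^{-1})$. Then there is some $\psi\in\mathcal S(\mathbb R^2)$ with $$\psi\in\mathrm{Co}\big(L^1_{g^{-1}vg}(\mathbb R^2\rtimes g^{-1}H_2g)\big)\setminus\mathrm{Co}\big(L^1_v(\mathbb R^2\rtimes H_2)\big).$$
   Context: For a closed subgroup $H\le\mathrm{GL}(\mathbb R^d)$ (here $d=2$) with left Haar measure $\mathrm dh$ and modular function $\Delta_H$, $G=\mathbb R^d\rtimes H$ has multiplication $(x,h)(y,k)=(x+hy,hk)$ and left Haar measure $\mathrm dx\,\frac{\mathrm dh}{|\det h|}$, and acts on $L^2(\mathbb R^d)$ by $(\pi(x,h)f)(y)=|\det h|^{-1/2}f(h^{-1}(y-x))$. $W_\psi f(x,h)=\langle f,\pi(x,h)\psi\rangle_{L^2}$ (antilinear in the second slot). Weights $v$ on $H$ are extended to $G$ by $(x,h)\mapsto v(h)$; $L^1_v(G)$ is the space of measurable $f$ on $G$ with $\int_H\int_{\mathbb R^d}|f(x,h)|v(h)\,\mathrm dx\frac{\mathrm dh}{|\det h|}<\infty$. Let $v$ be moderate with respect to a measurable, locally bounded submultiplicative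 $v_0$ on $H$, i.e. $v(hkl)\le v_0(h)v(k)v_0(l)$ (here $v_0=v$ works). With $u^+(h)=\max\{u(h),u(h^{-1})\}$ let $w(h)=v_0(1_H)v_0^+(h)|\det|^+(h)\Delta_H^+(h)$, $\mathcal A_w=\{\psi\in L^2:W_\psi\psi\in L_w^1(G)\}$, and for a fixed $\psi_0\in\mathcal A_w\setminus\{0\}$ let $\mathcal H_w^1=\{f\in L^2(\mathbb R^d):W_{\psi_0}f\in L_w^1(G)\}$ with norm $\|W_{\psi_0}f\|_{L_w^1}$. $(\mathcal H_w^1)^\neg$ is the space of bounded antilinear functionals on $\mathcal H_w^1$, with $W_{\psi_0}f(x,h):=f(\pi(x,h)\psi_0)$. $\mathrm{Co}(L_v^1(G))=\{f\in(\mathcal H_w^1)^\neg:W_{\psi_0}f\in L_v^1(G)\}$; this is independent of the choice of $\psi_0$. $L^2(\mathbb R^d)$ is regarded as a subspace of $(\mathcal H_w^1)^\neg$ via $f\mapsto\langle f,\cdot\rangle_{L^2}$, so for $f\in L^2$ membership in $\mathrm{Co}(L^1_v(G))$ means $W_{\psi_0}f\in L^1_v(G)$. *)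

(* Defs.v *)
From HB Require Import structures.
From mathcomp Require Import all_boot all_order all_algebra.
From mathcomp Require Import all_classical all_reals all_analysis.
From mathcomp.real_closed Require Import complex.

Set Implicit Arguments.
Unset Strict Implicit.
Unset Printing Implicit Defensive.

Import Order.TTheory GRing.Theory Num.Theory.
Import numFieldNormedType.Exports.

Local Open Scope classical_set_scope.
Local Open Scope ring_scope.

(* The complex numbers are R[i] from real_closed.  This type carries no
   measurable or normed structure over R, so measurability, integration and
   smoothness of complex functions are taken on real and imaginary parts. *)

Definition plane (R : realType) : Type :=
  (measurableTypeR R * measurableTypeR R)%type.

Definition leb2 (R : realType) : {measure set (plane R) -> \bar R} :=
  ((@lebesgue_measure R) \x (@lebesgue_measure R))%E.

Definition borelM (R : realType) := g_sigma_algebraType (@open 'M[R]_2).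

Definition mxact (R : realType) (h : 'M[R]_2) (y : R * R) : R * R :=
  (h ord0 ord0 * y.1 + h ord0 ord_max * y.2,
   h ord_max ord0 * y.1 + h ord_max ord_max * y.2).

Section L2.
Variable R : realType.

Definition L2 : set (R * R -> R[i]) :=
  [set f : R * R -> R[i] |
    [/\ measurable_fun setT (fun x : plane R => complex.Re (f x)),
        measurable_fun setT (fun x : plane R => complex.Im (f x)) &
        (\int[leb2 R]_x ((Normc.normc (f x)) ^+ 2)%:E < +oo)%E]].

(* [dotL2 f] is the antilinear functional <f, .>, i.e. f seen as an element of
   the antidual *)
Definition dotL2 (f phi : R * R -> R[i]) : R[i] :=
  Complex (\int[leb2 R]_x complex.Re (f x * conjc (phi x)))
          (\int[leb2 R]_x complex.Im (f x * conjc (phi x))).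

Definition nonzeroL2 (f : R * R -> R[i]) : Prop :=
  ~ {ae leb2 R, forall x, f x = 0}.

Definition quasireg (x : R * R) (h : 'M[R]_2) (f : R * R -> R[i]) :
    R * R -> R[i] :=
  fun y => real_complex R (`|\det h| `^ (- 2^-1)) * f (mxact (invmx h) (y - x)).

(* [voice psi F] is (x, h) |-> F (pi(x, h) psi); for F = dotL2 f it is the
   transform W_psi f of a function f in L^2. *)
Definition voice (psi : R * R -> R[i]) (F : (R * R -> R[i]) -> R[i])
    (x : R * R) (h : 'M[R]_2) : R[i] := F (quasireg x h psi).

End L2.

Section Haar.
Variables (R : realType) (H : set 'M[R]_2).

(* A left Haar measure on H, seen as a measure on matrices concentrated on H.
   A closed subgroup of GL(R^2) is second countable and locally compact, so
   regularity follows from finiteness on compact sets. *)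
Definition left_haar (mu : {measure set (borelM R) -> \bar R}) : Prop :=
  [/\ mu (~` H) = 0%E,
      mu H <> 0%E,
      (forall K : set 'M[R]_2, compact K -> K `<=` H -> (mu K < +oo)%E) &
      (forall (h : 'M[R]_2) (A : set (borelM R)), H h -> measurable A ->
         A `<=` H -> mu [set h *m k | k in (A : set 'M[R]_2)] = mu A)].

Definition modular_function (mu : {measure set (borelM R) -> \bar R})
    (Delta : 'M[R]_2 -> R) : Prop :=
  forall h : 'M[R]_2, H h -> 0 < Delta h /\
    forall A : set (borelM R), measurable A -> A `<=` H ->
      mu [set k *m h | k in (A : set 'M[R]_2)] = ((Delta h)%:E * mu A)%E.

End Haar.

Section Coorbit.
Variables (R : realType) (H : set 'M[R]_2).
Variable mu : {measure set (borelM R) -> \bar R}.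

Definition L1norm (v : 'M[R]_2 -> R) (F : R * R -> 'M[R]_2 -> R[i]) : \bar R :=
  (\int[mu]_(h in H)
     \int[leb2 R]_x (Normc.normc (F x h) * v h / `|\det (h : 'M[R]_2)|)%:E)%E.

Definition L1 (v : 'M[R]_2 -> R) : set (R * R -> 'M[R]_2 -> R[i]) :=
  [set F : R * R -> 'M[R]_2 -> R[i] |
    [/\ measurable_fun (setT `*` H : set (plane R * borelM R))
          (fun z : plane R * borelM R => complex.Re (F z.1 z.2)),
        measurable_fun (setT `*` H : set (plane R * borelM R))
          (fun z : plane R * borelM R => complex.Im (F z.1 z.2)) &
        (L1norm v F < +oo)%E]].

Definition symmax (u : 'M[R]_2 -> R) (h : 'M[R]_2) : R :=
  Num.max (u h) (u (invmx h)).

Definition control_weight (v0 Delta : 'M[R]_2 -> R) (h : 'M[R]_2) : R :=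
  v0 1%:M * symmax v0 h * symmax (fun k => `|\det k|) h * symmax Delta h.

Definition analyzing (w : 'M[R]_2 -> R) : set (R * R -> R[i]) :=
  [set psi : R * R -> R[i] | L2 psi /\ L1 w (voice psi (dotL2 psi))].

Definition H1 (w : 'M[R]_2 -> R) (psi0 : R * R -> R[i]) :
    set (R * R -> R[i]) :=
  [set f : R * R -> R[i] | L2 f /\ L1 w (voice psi0 (dotL2 f))].

Definition H1norm (w : 'M[R]_2 -> R) (psi0 f : R * R -> R[i]) : \bar R :=
  L1norm w (voice psi0 (dotL2 f)).

(* Bounded antilinear functionals on H1.  Elements of H1 are functions rather
   than a.e. classes; functions equal a.e. have the same voice transform, so
   boundedness makes the functional well defined on classes. *)
Definition antidual (w : 'M[R]_2 -> R) (psi0 : R * R -> R[i]) :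
    set ((R * R -> R[i]) -> R[i]) :=
  [set F : (R * R -> R[i]) -> R[i] |
     (forall (a : R[i]) (f1 f2 : R * R -> R[i]),
        H1 w psi0 f1 -> H1 w psi0 f2 ->
        F (fun x => a * f1 x + f2 x) = conjc a * F f1 + F f2) /\
     (exists C : R, forall f : R * R -> R[i], H1 w psi0 f ->
        ((Normc.normc (F f))%:E <= C%:E * H1norm w psi0 f)%E)].

Definition Co (Delta v0 v : 'M[R]_2 -> R) (psi0 : R * R -> R[i]) :
    set ((R * R -> R[i]) -> R[i]) :=
  [set F : (R * R -> R[i]) -> R[i] |
     antidual (control_weight v0 Delta) psi0 F /\ L1 v (voice psi0 F)].

End Coorbit.

Section Schwartz.
Variable R : realType.

Definition pderiv (i : bool) (f : R * R -> R) : R * R -> R :=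
  fun x => 'D_((if i then (0, 1) else (1, 0)) : R * R) f x.

Definition schwartz_real (f : R * R -> R) : Prop :=
  forall s : seq bool,
    (forall x, differentiable (foldr pderiv f s) x) /\
    (forall m n : nat, exists C : R, forall x : R * R,
       `|x.1 ^+ m * x.2 ^+ n * foldr pderiv f s x| <= C).

Definition schwartz (f : R * R -> R[i]) : Prop :=
  schwartz_real (fun x => complex.Re (f x)) /\
  schwartz_real (fun x => complex.Im (f x)).

End Schwartz.

Section Shearlet.
Variable R : realType.

Definition mx22 (a b c d : R) : 'M[R]_2 :=
  \matrix_(i, j) if i == ord0 then if j == ord0 then a else b
                 else if j == ord0 then c else d.

Definition shearlet_group : set 'M[R]_2 :=
  [set h | exists e a b : R, [/\ e = 1 \/ e = -1, 0 < a &
             h = e *: mx22 a b 0 (a `^ 2^-1)]].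

Definition rot90 : 'M[R]_2 := mx22 0 (-1) 1 0.

Definition conj_group (g : 'M[R]_2) (H : set 'M[R]_2) : set 'M[R]_2 :=
  [set invmx g *m h *m g | h in H].

Definition conj_weight (g : 'M[R]_2) (v : 'M[R]_2 -> R) : 'M[R]_2 -> R :=
  fun h => v (g *m h *m invmx g).

Definition det_weight : 'M[R]_2 -> R := fun h => `|\det h| `^ (7 / 6).

End Shearlet.

(* Main.v *)
Require Import Defs.
From HB Require Import structures.
From mathcomp Require Import all_boot all_order all_algebra.
From mathcomp Require Import all_classical all_reals all_analysis.
From mathcomp Require Import measurable_realfun.
From mathcomp Require Import ring lra.
From mathcomp.real_closed Require Import complex.
Import Order.TTheory GRing.Theory Num.Theory.
Import numFieldNormedType.Exports.
Set Implicit Arguments.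
Unset Strict Implicit.
Unset Printing Implicit Defensive.

Local Open Scope classical_set_scope.
Local Open Scope ring_scope.

(** The witness is [psi y = (1 - y2^2) exp (- |y|^2 / 2)].

    For the shearlet group, let [F] be a Gaussian smoothing of the real or
    imaginary part of [psi0].  If [W psi] were integrable against [|det|^(7/6)],
    then translating the Haar integral by matrices whose scale tends to infinity
    and Fatou's lemma would give [int (1 - u^2) exp (- u^2 / 2) F (c u, 0) du = 0]
    for all [c].  The left-hand side is, up to the factor [- c], the derivative
    in [c] of [int exp (- u^2 / 2) F (c u, 0) du], which tends to a multiple of
    [F 0] at [c = 0] and to [0] at infinity.  Hence [F 0 = 0] for all Gaussian
    smoothings, and [psi0 = 0].

    The conjugate group consists of lower triangular matrices, determined by
    their bottom row [eta].  Let [K (., k)] have Fourier transform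
    [xi2^4 exp (- |xi|^2 / 2) exp (- t^2 |k^T xi|^2 / 2)].  Then the integral of
    [K (y - k z, k)] over [eta] is the product of [psi y] with a Gaussian in [z],
    so that [<psi, f>] is a pairing of [W f] with [K].  The kernel decays like
    [(1 + eta2^2 + eta1^2 / (1 + |eta2|))^-2], and [d eta / |det k|] is a right
    Haar measure.  For general [f] this bounds [<psi, .>] on [H^1_w]; for
    [f = pi (x, h) psi0] it gives [W psi] in [L^1_v] by left invariance. *)

(** Why this witness: up to sign it is the second [y2]-derivative of a Gaussian, so its Fourier
    transform, a multiple of [xi2^2 exp (- |xi|^2 / 2)], vanishes on the axis [xi2 = 0] but not on
    [xi1 = 0]. The action [h^T xi] of the shearlet group has the open orbit [xi1 != 0], that of the
    conjugate group [xi2 != 0]; the decay of the transform is decided by the vanishing on the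
    omitted axis. Why the weight works on both sides: for [|det|^alpha] the quantity moved by
    translation on the shearlet side carries the factor [|s|^(3 alpha - 3/2)], while on the
    conjugate side the integral over [eta] has the tail [|eta2|^(3 alpha / 2 - 13/4)]. At
    [alpha = 7/6] these are [s^2], which grows, and [|eta2|^(-3/2)], which is integrable. The
    obstacle is generality. Of [psi0] little more than nonvanishing in L^2 is available, hence the
    Gaussian smoothing on one side and, on the other, a window of free width and centre, chosen so
    that its pairing with [psi0] is nonzero. The Haar measure is arbitrary and the modular function
    is not known to be measurable, so the chart by [eta] is compared with them through a uniqueness
    argument. *)

Notation push_measure :=
  measure_function_pushforward__canonical__measure_function_Measure.
Notation leb1 R := (@lebesgue_measure R).

(** * Measurability and integration *)

Section measurability.
Context d (T : measurableType d) (R : realType).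
Implicit Types (f g : T -> R) (D : set T).

Lemma measurable_fun_expR D f : measurable_fun D f ->
  measurable_fun D (fun x => expR (f x)).
Proof. by move=> mf; exact: (measurableT_comp (@measurable_expR R)). Qed.

Lemma measurable_fun_norm D f : measurable_fun D f ->
  measurable_fun D (fun x => `|f x|).
Proof. by move=> mf; exact: (measurableT_comp (@normr_measurable R setT)). Qed.

Lemma measurable_fun_cont (h : R -> R) D f : continuous h -> measurable_fun D f ->
  measurable_fun D (fun x => h (f x)).
Proof.
by move=> ch mf; exact: (measurableT_comp (continuous_measurable_fun ch)).
Qed.

Lemma measurable_fun_cos D f : measurable_fun D f ->
  measurable_fun D (fun x => cos (f x)).
Proof. by apply: measurable_fun_cont; exact: continuous_cos. Qed.

Lemma measurable_fun_sin D f : measurable_fun D f ->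
  measurable_fun D (fun x => sin (f x)).
Proof. by apply: measurable_fun_cont; exact: continuous_sin. Qed.

Lemma measurable_fun_sqrt D f : measurable_fun D f ->
  measurable_fun D (fun x => Num.sqrt (f x)).
Proof. by apply: measurable_fun_cont; exact: sqrt_continuous. Qed.

End measurability.

(** Inversion is discontinuous at 0, so it is written through [expR] and [ln] on each open
    half-line, with the value [0^-1 = 0]. *)
Lemma measurable_inv (R : realType) : measurable_fun [set: R] (fun x : R => x^-1 : R).
Proof.
rewrite (_ : (fun x : R => x^-1 : R) = fun x : R => if x == 0 then 0 else
   if 0 < x then expR (- ln x) else - expR (- ln (- x))); last first.
  apply/funext => x; case: eqP => [->|/eqP x0]; first by rewrite invr0.
  case: ifPn => [xp|]; first by rewrite expRN lnK// posrE.
  rewrite -leNgt => xn; rewrite expRN lnK ?posrE ?oppr_gt0 ?lt_neqAle ?x0//.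
  by rewrite invrN opprK.
apply: measurable_fun_ifT => //=; first exact: measurable_fun_eqr.
apply: measurable_fun_ifT => /=; first exact: measurable_fun_ltr.
- apply: measurable_fun_expR; apply: measurableT_comp => //; exact: measurable_ln.
- apply: measurableT_comp => //; apply: measurable_fun_expR; apply: measurableT_comp => //.
  by apply: (@measurableT_comp _ _ _ _ _ _ (@ln R)) => //; exact: measurable_funN.
Qed.

Section measurability2.
Context d (T : measurableType d) (R : realType).
Implicit Types (f g : T -> R) (D : set T).

Lemma measurable_fun_inv D f : measurable_fun D f ->
  measurable_fun D (fun x => (f x)^-1 : R).
Proof. by move=> mf; exact: (measurableT_comp (@measurable_inv R)). Qed.

Lemma measurable_fun_powR p D f : measurable_fun D f ->
  measurable_fun D (fun x => f x `^ p).
Proof. by move=> mf; exact: (measurableT_comp (@measurable_powR R p)). Qed.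

End measurability2.

(** The image measure scaled by [|a|] agrees with Lebesgue measure on the intervals []u, v]], hence
    everywhere. For [a < 0] the preimage is closed at the other end, which leaves its length
    unchanged. *)
Lemma ge0_integral_affine (R : realType) (a b : R) (f : R -> \bar R) : a != 0 ->
  measurable_fun setT f -> (forall x, (0 <= f x)%E) ->
  (\int[leb1 R]_x f (a * x + b)%R = (`|a|^-1)%:E * \int[leb1 R]_x f x)%E.
Proof.
move=> a0 mf f0.
have na : 0 < `|a| by rewrite normr_gt0.
have mphi : measurable_fun [set: measurableTypeR R]
  ((fun x : R => a * x + b) : measurableTypeR R -> measurableTypeR R).
  by apply: measurable_funD => //; exact: measurable_funM.
have m'E A : measurable A -> leb1 R A =
    mscale (NngNum (normr_ge0 a)) (push_measure (leb1 R) mphi) A.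
  apply: lebesgue_measure_unique => _ [[u v]] _ <-.
  transitivity (`|a|%:E * leb1 R ((fun x : R => (a * x + b)%R) @^-1` `]u, v]))%E; last by [].
  have [ap|an] := ltP 0 a.
    have -> : (fun x : R => a * x + b) @^-1` `]u, v] = `](u - b) / a, (v - b) / a]%classic.
      apply/seteqP; split=> x /=; rewrite !in_itv/=.
        by rewrite ltr_pdivrMr// ler_pdivlMr// mulrC ltrBlDr lerBrDr.
      by rewrite ltr_pdivrMr// ler_pdivlMr// mulrC ltrBlDr lerBrDr.
    rewrite !lebesgue_measure_itv/= !lte_fin ltr_pM2r ?invr_gt0// ltrD2r.
    case: ifPn => uv; rewrite ?mule0// -!EFinD -EFinM gtr0_norm//; congr EFin.
    by field.
  have {}an : a < 0 by rewrite lt_neqAle a0.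
  have -> : (fun x : R => a * x + b) @^-1` `]u, v] = `[(v - b) / a, (u - b) / a[%classic.
    apply/seteqP; split=> x /=; rewrite !in_itv/=.
      by rewrite ltr_ndivlMr// ler_ndivrMr// mulrC ltrBlDr lerBrDr andbC.
    by rewrite ltr_ndivlMr// ler_ndivrMr// mulrC ltrBlDr lerBrDr andbC.
  rewrite !lebesgue_measure_itv/= !lte_fin ltr_nM2r ?invr_lt0// ltrD2r.
  case: ifPn => uv; rewrite ?mule0// -!EFinD -EFinM ltr0_norm//; congr EFin.
  by field.
rewrite [X in (_ * X)%E](eq_measure_integral (mscale (NngNum (normr_ge0 a)) (push_measure (leb1 R) mphi))); last by move=> A mA _; exact: m'E.
rewrite ge0_integral_mscale//= ge0_integral_pushforward// preimage_setT /=.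
by rewrite muleA -EFinM mulVf ?mul1e ?gt_eqF.
Qed.

Section integration_tools.
Context d (T : measurableType d) (R : realType).
Variable mu : {measure set T -> \bar R}.

Lemma integrable_dominated (f g : T -> R) : measurable_fun setT f ->
  mu.-integrable setT (EFin \o g) -> (forall x, `|f x| <= g x) ->
  mu.-integrable setT (EFin \o f).
Proof.
move=> mf ig fg; apply: le_integrable ig => //; first exact/measurable_EFinP.
by move=> x _; rewrite /= lee_fin (le_trans (fg x))// ler_norm.
Qed.

Lemma cvg_Rintegral_dominated (f_ : nat -> T -> R) (f g : T -> R) :
  (forall n, measurable_fun setT (f_ n)) ->
  (forall x, f_ n x @[n --> \oo] --> f x) ->
  mu.-integrable setT (EFin \o g) -> (forall n x, `|f_ n x| <= g x) ->
  \int[mu]_x f_ n x @[n --> \oo] --> \int[mu]_x f x.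
Proof.
move=> mf_ f_f ig fg.
have f_fE x : (f_ n x)%:E @[n --> \oo] --> (f x)%:E by apply: cvg_EFin; [exact: nearW|exact: f_f].
have mf_E n : measurable_fun setT (fun x => (f_ n x)%:E) by exact/measurable_EFinP.
have [||||fi _] := @dominated_convergence _ _ R mu setT measurableT
  (fun n x => (f_ n x)%:E) (EFin \o f) (EFin \o g) mf_E.
- exact: (emeasurable_fun_cvg _ _ mf_E).
- by apply: aeW => x _; exact: f_fE.
- exact: ig.
- by apply: aeW => x n _ /=; rewrite lee_fin.
move=> H; apply: fine_cvg; rewrite fineK//; exact: integrable_fin_num.
Qed.

Section scaled_map.
Variables (phi : T -> T) (c : R).
Hypothesis mphi : measurable_fun setT phi.
Hypothesis c0 : 0 <= c.
Hypothesis phiE : forall f : T -> \bar R, measurable_fun setT f ->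
  (forall x, (0 <= f x)%E) -> (\int[mu]_x f (phi x) = c%:E * \int[mu]_x f x)%E.

Lemma integrable_scaled_map (f : T -> R) : mu.-integrable setT (EFin \o f) ->
  mu.-integrable setT (EFin \o (f \o phi)).
Proof.
move=> /integrableP[mf fi]; apply/integrableP; split.
  by apply: measurableT_comp mf mphi.
rewrite (phiE (f := fun x => `|(f x)%:E|%E))//; last exact: measurableT_comp.
by rewrite lte_mul_pinfty ?lee_fin.
Qed.

(** Positive and negative parts have finite integrals, so [phiE] for nonnegative functions yields
    the signed case. All changes of variables below pass through this lemma. *)
Lemma Rintegral_scaled_map (f : T -> R) : mu.-integrable setT (EFin \o f) ->
  \int[mu]_x f (phi x) = c * \int[mu]_x f x.
Proof.
move=> fi; have mf : measurable_fun setT (EFin \o f) by case/integrableP: fi.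
rewrite /Rintegral (integralE _ _ (EFin \o (f \o phi))) (integralE _ _ (EFin \o f)).
rewrite (funepos_comp (EFin \o f) phi) (funeneg_comp (EFin \o f) phi).
rewrite (phiE (f := (EFin \o f)^\+%E))//; last exact: measurable_funepos.
rewrite (phiE (f := (EFin \o f)^\-%E))//; last exact: measurable_funeneg.
have p := integrable_pos_fin_num measurableT fi.
have n := integrable_neg_fin_num measurableT fi.
move: p n; case: (integral _ _ _) => // p _; case: (integral _ _ _) => // n _.
by rewrite /= mulrBr.
Qed.

End scaled_map.

End integration_tools.

Section one_dim.
Variable R : realType.
Implicit Types f : R -> R.

Lemma measurable_affine (a b : R) : measurable_fun [set: R] (fun x : R => a * x + b).
Proof. by apply: measurable_funD => //; exact: measurable_funM. Qed.

Lemma integrable_affine (a b : R) f : a != 0 ->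
  (leb1 R).-integrable setT (EFin \o f) ->
  (leb1 R).-integrable setT (EFin \o (fun x => f (a * x + b))).
Proof.
move=> a0; refine (@integrable_scaled_map _ _ _ (leb1 R) (fun x => a * x + b) `|a^-1| _ _ _ f).
- exact: measurable_affine.
- exact: normr_ge0.
- by move=> g mg g0; rewrite normfV; exact: ge0_integral_affine.
Qed.

Lemma Rintegral_affine (a b : R) f : a != 0 ->
  (leb1 R).-integrable setT (EFin \o f) ->
  \int[leb1 R]_x f (a * x + b) = `|a|^-1 * \int[leb1 R]_x f x.
Proof.
move=> a0; rewrite -normfV; refine (@Rintegral_scaled_map _ _ _ (leb1 R) (fun x => a * x + b) `|a^-1| _ f).
by move=> g mg g0; rewrite normfV; exact: ge0_integral_affine.
Qed.

Lemma Rintegral_odd f : (leb1 R).-integrable setT (EFin \o f) ->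
  (forall x, f (- x) = - f x) -> \int[leb1 R]_x f x = 0.
Proof.
move=> fi fodd; have N1 : (-1 : R) != 0 by rewrite oppr_eq0 oner_eq0.
have := Rintegral_affine 0 N1 fi.
rewrite normrN1 invr1 mul1r.
under eq_Rintegral do rewrite addr0 mulN1r fodd -mulN1r.
rewrite RintegralZl// mulN1r; lra.
Qed.

(** The fundamental theorem on [[- (n + 1), n + 1]], and dominated convergence with [|dh|] as
    majorant. *)
Lemma Rintegral_derive0 (h dh : R -> R) :
  (forall x : R, is_derive x 1 h (dh x)) -> continuous dh ->
  (leb1 R).-integrable setT (EFin \o dh) ->
  h x @[x --> +oo] --> (0 : R) -> h (- x) @[x --> +oo] --> (0 : R) ->
  \int[leb1 R]_x dh x = 0.
Proof.
move=> hd cdh idh hy hNy.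
pose fn (n : nat) x := (dh \_ `[- n.+1%:R, n.+1%:R]) x.
have FTC n : (\int[leb1 R]_x (fn n x)%:E = (h n.+1%:R - h (- n.+1%:R))%:E)%E.
  have n0 : - n.+1%:R < n.+1%:R :> R by rewrite gtrN.
  rewrite EFinB -(@continuous_FTC2 R dh h _ _ n0).
  - by rewrite [RHS]integral_mkcond; apply: eq_integral => x _; rewrite restrict_EFin.
  - exact: continuous_subspaceT.
  - split=> [x _|//|].
    + exact: ex_derive.
    + apply: cvg_at_right_filter.
      by apply: differentiable_continuous; apply/derivable1_diffP; exact: ex_derive.
    + apply: cvg_at_left_filter.
      by apply: differentiable_continuous; apply/derivable1_diffP; exact: ex_derive.
  - by move=> x _; rewrite derive1E derive_val.
have H : \int[leb1 R]_x fn n x @[n --> \oo] --> \int[leb1 R]_x dh x.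
  refine (@cvg_Rintegral_dominated _ _ R (leb1 R) fn dh (fun x => `|dh x|) _ _ _ _).
  - move=> n; rewrite /fn; apply/(measurable_restrictT _ _).1 => //.
    by apply: measurable_funTS; exact: continuous_measurable_fun.
  - move=> x; apply: cvg_near_cst; near=> n.
    rewrite /fn /patch ifT// inE /= in_itv/= -ler_norml.
    apply: ltW; apply: (lt_trans (_ : _ < n%:R)); last by rewrite ltr_nat.
    by near: n; exact: nbhs_infty_gtr.
  - exact: integrable_norm.
  - by move=> n x; rewrite /fn /patch; case: ifPn => // _; rewrite normr0.
have H0 : \int[leb1 R]_x fn n x @[n --> \oo] --> (0 - 0 : R).
  rewrite [X in X @ _ --> _](_ : _ = (fun n => h n.+1%:R - h (- n.+1%:R)) :> (nat -> R)); last first.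
    by apply/funext => n; rewrite /Rintegral FTC.
  apply: cvgB; first by rewrite (cvg_shiftS (fun n => h n%:R)); exact: (cvg_comp _ _ cvgr_idn hy).
  by rewrite (cvg_shiftS (fun n => h (- n%:R))); exact: (cvg_comp _ _ cvgr_idn hNy).
by rewrite subr0 in H0; exact: (cvg_unique _ H H0).
Unshelve. all: by end_near. Qed.
End one_dim.

(** * Gaussian integrals and their cosine and sine transforms *)

Section gaussian.
Variable R : realType.
Implicit Types x u : R.

Definition gs x : R := expR (- (x ^+ 2 / 2)).

Lemma gs_ge0 x : 0 <= gs x. Proof. exact: expR_ge0. Qed.

Lemma gs_le1 x : gs x <= 1.
Proof. by rewrite -expR0 ler_expR oppr_le0 divr_ge0// sqr_ge0. Qed.

Lemma gsN x : gs (- x) = gs x. Proof. by rewrite /gs sqrrN. Qed.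

Lemma is_derive_gs x : is_derive x 1 gs (- x * gs x).
Proof.
have d1 : is_derive x 1 (fun y : R => - (y ^+ 2 / 2)) (- x).
  have -> : (fun y : R => - (y ^+ 2 / 2)) = (- 2^-1) *: (id ^+ 2 : R -> R).
    by apply/funext => y; rewrite -[RHS]/(- 2^-1 * (y ^+ 2)); field.
  by apply: is_derive_eq; rewrite /= expr1 !scalerA /GRing.scale/=; field.
by have /is_derive_eq := @is_derive1_comp R expR (fun y => - (y ^+ 2 / 2)) x _ _ (is_derive_expR (- (x ^+ 2 / 2))) d1; apply; rewrite mulrC.
Qed.

Lemma continuous_derivable (f df : R -> R) : (forall x, is_derive x 1 f (df x)) ->
  continuous f.
Proof.
move=> fd x; apply: differentiable_continuous; apply/derivable1_diffP.
exact: ex_derive.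
Qed.

Lemma continuous_gs : continuous gs.
Proof. exact: continuous_derivable is_derive_gs. Qed.

Lemma measurable_gs : measurable_fun [set: R] gs.
Proof. exact: continuous_measurable_fun continuous_gs. Qed.

(** A wider Gaussian with [gs = gs4 * gs4]: one factor absorbs any polynomial, the other remains as
    a common integrable majorant. *)
Definition gs4 x : R := expR (- (x ^+ 2 / 4)).

Lemma integrable_gs4 : (leb1 R).-integrable setT (EFin \o gs4).
Proof.
have h : (2^-1 : R) != 0 by [].
have := integrable_affine 0 h (@integrableT_gauss R).
apply: eq_integrable => // x _; rewrite /= /gauss_fun /gs4; congr (expR _)%:E.
by field.
Qed.

Lemma gs_mono_bound k : exists2 C : R, 0 <= C &
  forall x, `|x| ^+ k * gs x <= C * gs4 x.
Proof.
(* The 1 accounts for [|x| <= 1]; the rest comes from [y^k <= k! exp y] at [y = x^2 / 4]. *)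
exists (1 + 4 ^+ k * k`!%:R); first by rewrite addr_ge0// mulr_ge0.
move=> x; have -> : gs x = gs4 x * gs4 x.
  by rewrite /gs /gs4 -expRD; congr expR; field.
rewrite mulrA ler_wpM2r ?expR_ge0//.
rewrite -ler_pdivlMr ?expR_gt0// /gs4 -expRN opprK.
have E1 : 1 <= expR (x ^+ 2 / 4) by rewrite -expR0 ler_expR divr_ge0// sqr_ge0.
apply: (@le_trans _ _ (1 + (x ^+ 2) ^+ k)).
  have [x1|x1] := leP `|x| 1.
    by rewrite (le_trans (exprn_ile1 k (normr_ge0 x) x1))// lerDl exprn_ge0// sqr_ge0.
  rewrite -real_normK ?num_real// -exprM mulnC exprM expr2.
  rewrite (le_trans (ler_peMl _ (exprn_ege1 k (ltW x1))))// ?exprn_ge0// lerDr.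
  by rewrite ler01.
rewrite mulrDl mul1r lerD//.
set y := x ^+ 2 / 4; have y0 : 0 <= y by rewrite divr_ge0// sqr_ge0.
have -> : x ^+ 2 = 4 * y by rewrite /y; field.
rewrite exprMn -mulrA ler_wpM2l ?exprn_ge0//.
case: k => [|k]; first by rewrite expr0 mul1r -expR0 ler_expR.
rewrite mulrC -ler_pdivrMr ?ltr0n ?fact_gt0//.
by rewrite (le_trans _ (expR_ge1Dxn k y0))// lerDr.
Qed.

Lemma cvg0_gs4_bound (h : R -> R) C : (forall x, `|h x| <= C * gs4 x) ->
  h x @[x --> +oo] --> (0 : R).
Proof.
move=> hC.
have e0 : C * expR (- x) @[x --> +oo] --> (0 : R).
  by rewrite -(mulr0 C); apply: cvgMr; exact: cvgr_expR.
apply: norm_cvg0; apply: (@squeeze_cvgr _ _ _ _ (cst 0) (fun x => C * expR (- x))) => //;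
  last exact: cvg_cst.
near=> x; rewrite normr_ge0/= (le_trans (hC x))// ler_wpM2l//.
  by have := hC 0; rewrite /gs4 expr0n mul0r oppr0 expR0 mulr1; exact: le_trans.
rewrite ler_expR lerN2 ler_pdivlMr// mulrC expr2 ler_wpM2r//.
Unshelve. all: by end_near. Qed.

Lemma measurable_mono_gs (t : R -> R) k : continuous t ->
  measurable_fun [set: R] (fun u => t u * (u ^+ k * gs u)).
Proof.
move=> ct; apply: measurable_funM; first exact: continuous_measurable_fun.
by apply: measurable_funM; [exact: measurable_funX|exact: measurable_gs].
Qed.

Lemma integrable_mono_gs (t : R -> R) k : continuous t -> (forall u, `|t u| <= 1) ->
  (leb1 R).-integrable setT (EFin \o (fun u => t u * (u ^+ k * gs u))).
Proof.
move=> ct t1; have [C C0 gC] := gs_mono_bound k.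
apply: (@integrable_dominated _ _ _ (leb1 R) _ (fun u => C * gs4 u)).
- exact: measurable_mono_gs.
- have := integrableZl measurableT C integrable_gs4.
  by apply: eq_integrable => // x _; rewrite /= EFinM.
- move=> u; rewrite !normrM normrX (ger0_norm (gs_ge0 u)).
  by rewrite (le_trans _ (gC u))// ler_piMl// mulr_ge0// ?gs_ge0.
Qed.

Lemma continuous_cosM x : continuous (fun u => cos (u * x)).
Proof.
by move=> u; apply: continuous_comp; [exact: mulrr_continuous|exact: continuous_cos].
Qed.

Lemma continuous_sinM x : continuous (fun u => sin (u * x)).
Proof.
by move=> u; apply: continuous_comp; [exact: mulrr_continuous|exact: continuous_sin].
Qed.

(** Real and imaginary parts of the Fourier transform of [u^k gs u], kept apart so that only real
    integrals occur. *)
Definition Cgs k x := \int[leb1 R]_u (cos (u * x) * (u ^+ k * gs u)).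
Definition Sgs k x := \int[leb1 R]_u (sin (u * x) * (u ^+ k * gs u)).

Lemma normr_cos_le1 x : `|cos x| <= 1.
Proof. by rewrite ler_norml cos_geN1 cos_le1. Qed.

Lemma normr_sin_le1 x : `|sin x| <= 1.
Proof. by rewrite ler_norml sin_geN1 sin_le1. Qed.

Lemma integrable_Cgs k x :
  (leb1 R).-integrable setT (EFin \o (fun u => cos (u * x) * (u ^+ k * gs u))).
Proof.
apply: (@integrable_mono_gs (fun u => cos (u * x))); first exact: continuous_cosM.
by move=> u; exact: normr_cos_le1.
Qed.

Lemma integrable_Sgs k x :
  (leb1 R).-integrable setT (EFin \o (fun u => sin (u * x) * (u ^+ k * gs u))).
Proof.
apply: (@integrable_mono_gs (fun u => sin (u * x))); first exact: continuous_sinM.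
by move=> u; exact: normr_sin_le1.
Qed.

Lemma is_derive_mulr x u : is_derive u 1 (fun v : R => v * x) x.
Proof.
have -> : (fun v : R => v * x) = x *: (id : R -> R).
  by apply/funext => v; rewrite -[RHS]/(x * v) mulrC.
by apply: is_derive_eq; rewrite /GRing.scale/= mulr1.
Qed.

Lemma is_derive_cosM x u : is_derive u 1 (fun v => cos (v * x)) (- (x * sin (u * x))).
Proof.
have /is_derive_eq := @is_derive1_comp R cos (fun v => v * x) u _ _ (is_derive_cos (u * x)) (is_derive_mulr x u).
by apply; rewrite mulNr mulrC.
Qed.

Lemma is_derive_sinM x u : is_derive u 1 (fun v => sin (v * x)) (x * cos (u * x)).
Proof.
have /is_derive_eq := @is_derive1_comp R sin (fun v => v * x) u _ _ (is_derive_sin (u * x)) (is_derive_mulr x u).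
by apply; rewrite mulrC.
Qed.

Lemma is_derive_mono_gs k u :
  is_derive u 1 (fun v => v ^+ k * gs v) (k%:R * (u ^+ k.-1 * gs u) - u ^+ k.+1 * gs u).
Proof.
have dX : is_derive u 1 (fun v : R => v ^+ k) (k%:R * u ^+ k.-1).
  have -> : (fun v : R => v ^+ k) = (id : R -> R) ^+ k.
    apply/funext => v; elim: k => [|k IH]; first by rewrite expr0.
    by rewrite exprS IH exprS.
  by apply: is_derive_eq; rewrite /GRing.scale/= mulr1.
have := is_deriveM dX (is_derive_gs u).
move=> /is_derive_eq; apply; rewrite /GRing.scale/= exprSr; ring.
Qed.

Lemma mono_gs_cvg0 (t : R -> R) k : (forall u, `|t u| <= 1) ->
  t u * (u ^+ k * gs u) @[u --> +oo] --> (0 : R) /\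
  t (- u) * ((- u) ^+ k * gs (- u)) @[u --> +oo] --> (0 : R).
Proof.
move=> t1; have [C C0 gC] := gs_mono_bound k.
have H u : `|t u * (u ^+ k * gs u)| <= C * gs4 u.
  rewrite !normrM normrX (ger0_norm (gs_ge0 u)).
  by rewrite (le_trans _ (gC u))// ler_piMl// mulr_ge0// ?gs_ge0.
split; first exact: cvg0_gs4_bound H.
apply: (@cvg0_gs4_bound (fun u => t (- u) * ((- u) ^+ k * gs (- u))) C) => u.
by rewrite (le_trans (H _))// /gs4 sqrrN.
Qed.

(** Integration by parts from [(u^k gs u)' = k u^(k-1) gs u - u^(k+1) gs u]. At [k = 0] the
    truncated predecessor is harmless because of the factor [k%:R]. *)
Lemma mono_gs_ibp (t dt : R -> R) k : (forall u, is_derive u 1 t (dt u)) ->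
  continuous dt -> (forall u, `|t u| <= 1) -> (exists C, forall u, `|dt u| <= C) ->
  \int[leb1 R]_u (t u * (u ^+ k.+1 * gs u)) =
  k%:R * \int[leb1 R]_u (t u * (u ^+ k.-1 * gs u)) +
  \int[leb1 R]_u (dt u * (u ^+ k * gs u)).
Proof.
move=> td cdt t1 [C dtC].
have ct : continuous t by exact: continuous_derivable td.
have i1 := integrable_mono_gs k.+1 ct t1.
have i2 := integrable_mono_gs k.-1 ct t1.
have C0 : 0 <= C by rewrite (le_trans _ (dtC 0)).
have i3 : (leb1 R).-integrable setT (EFin \o (fun u => dt u * (u ^+ k * gs u))).
  (* Division by [C + 1], positive even if [C = 0], brings [dt] under the bound 1 that
     [integrable_mono_gs] expects. *)
  have cdt' : continuous (fun u => (C + 1)^-1 * dt u).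
    by move=> u; apply: continuous_comp; [exact: cdt|exact: mulrl_continuous].
  have dt1 u : `|(C + 1)^-1 * dt u| <= 1.
    rewrite normrM ger0_norm ?invr_ge0 ?addr_ge0// ler_pdivrMl ?ltr_wpDl// mulr1.
    by rewrite (le_trans (dtC u))// lerDl.
  have := integrableZl measurableT (C + 1) (integrable_mono_gs k cdt' dt1).
  apply: eq_integrable => // u _; rewrite /= -EFinM; congr EFin.
  by field; rewrite gt_eqF// ltr_wpDl.
pose h u := t u * (u ^+ k * gs u).
pose dh u := k%:R * (t u * (u ^+ k.-1 * gs u)) + dt u * (u ^+ k * gs u) -
             t u * (u ^+ k.+1 * gs u).
have hd u : is_derive u 1 h (dh u).
  have /is_derive_eq := is_deriveM (td u) (is_derive_mono_gs k u).
  apply; rewrite /GRing.scale/= /dh; ring.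
have cmg j : continuous (fun u => u ^+ j * gs u).
  exact: continuous_derivable (is_derive_mono_gs j).
have cdh : continuous dh.
  move=> u; apply: cvgB; [apply: cvgD|].
  - by apply: cvgMr; apply: cvgM; [exact: ct|exact: cmg].
  - by apply: cvgM; [exact: cdt|exact: cmg].
  - by apply: cvgM; [exact: ct|exact: cmg].
have i2k : (leb1 R).-integrable setT
    (EFin \o (fun u => k%:R * (t u * (u ^+ k.-1 * gs u)))).
  exact: (integrableZl measurableT k%:R i2).
have i23 : (leb1 R).-integrable setT (EFin \o (fun u =>
    k%:R * (t u * (u ^+ k.-1 * gs u)) + dt u * (u ^+ k * gs u))).
  exact: (integrableD measurableT i2k i3).
have idh : (leb1 R).-integrable setT (EFin \o dh).
  exact: (integrableB measurableT i23 i1).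
have [h1 h2] := mono_gs_cvg0 k t1.
have := Rintegral_derive0 hd cdh idh h1 h2.
rewrite /dh RintegralB// RintegralD// RintegralZl//.
by move/eqP; rewrite subr_eq0 => /eqP <-.
Qed.

Lemma Cgs_rec k x : Cgs k.+1 x = k%:R * Cgs k.-1 x - x * Sgs k x.
Proof.
rewrite /Cgs (mono_gs_ibp k (is_derive_cosM x)).
- congr (_ + _); rewrite -mulNr -RintegralZl//; last exact: integrable_Sgs.
  by apply: eq_Rintegral => u _; ring.
- move=> u; apply: cvgN; apply: cvgMr; exact: continuous_sinM.
- by move=> u; exact: normr_cos_le1.
- exists `|x| => u; rewrite normrN normrM ler_piMr//; exact: normr_sin_le1.
Qed.

Lemma Sgs_rec k x : Sgs k.+1 x = k%:R * Sgs k.-1 x + x * Cgs k x.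
Proof.
rewrite /Sgs (mono_gs_ibp k (is_derive_sinM x)).
- congr (_ + _); rewrite -RintegralZl//; last exact: integrable_Cgs.
  by apply: eq_Rintegral => u _; ring.
- move=> u; apply: cvgMr; exact: continuous_cosM.
- by move=> u; exact: normr_sin_le1.
- exists `|x| => u; rewrite normrM ler_piMr//; exact: normr_cos_le1.
Qed.

Lemma Sgs0 x : Sgs 0 x = 0.
Proof.
apply: Rintegral_odd; first exact: integrable_Sgs.
by move=> u; rewrite mulNr sinN gsN !expr0 mulNr.
Qed.

Lemma Rintegral_gs : \int[leb1 R]_u gs u = Num.sqrt (pi *+ 2).
Proof.
have h : (Num.sqrt 2)^-1 != 0 :> R by rewrite invr_eq0 gt_eqF// sqrtr_gt0.
have := Rintegral_affine 0 h (@integrableT_gauss R).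
rewrite normfV invrK ger0_norm ?sqrtr_ge0//.
rewrite [X in _ * X](_ : _ = Num.sqrt pi); last by rewrite /Rintegral integralT_gauss.
rewrite -sqrtrM// mulr_natl => <-; apply: eq_Rintegral => u _.
rewrite /gauss_fun /gs addr0; congr (expR (- _)).
by rewrite exprMn exprVn sqr_sqrtr// mulrC.
Qed.

Lemma is_derive_Cgs0 x : is_derive x 1 (Cgs 0) (- Sgs 1 x).
Proof.
pose f (x u : R) := cos (u * x) * (u ^+ 0 * gs u).
have fd (y u : R) : is_derive y 1 (f ^~ u) (- (u * (sin (u * y) * gs u))).
  have d1 : is_derive y 1 (fun z => cos (u * z)) (- (u * sin (u * y))).
    have -> : (fun z => cos (u * z)) = (fun z => cos (z * u)).
      by apply/funext => z; rewrite mulrC.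
    by rewrite (mulrC u y); exact: is_derive_cosM.
  have /is_derive_eq := is_deriveM d1 (is_derive_cst (u ^+ 0 * gs u) y 1).
  by apply; rewrite /GRing.scale/= mulr0 add0r expr0; ring.
have fi y : `]x - 1, x + 1[%classic y -> (leb1 R).-integrable setT (EFin \o f y).
  by move=> _; exact: integrable_Cgs.
have xI : `]x - 1, x + 1[%classic x by rewrite /= in_itv/= ltrBlDr ltrDl ltr01.
have iG : (leb1 R).-integrable setT (EFin \o (fun u : R => `|1 * (u ^+ 1 * gs u)|)).
  apply: integrable_norm; apply: (@integrable_mono_gs (fun=> 1)) => //.
    by move=> u; exact: cvg_cst.
  by move=> u; rewrite normr1.
have df y u : `]x - 1, x + 1[%classic y -> setT u -> derivable (f ^~ u) y 1.
  by move=> _ _; exact: ex_derive.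
have Gub y u : `]x - 1, x + 1[%classic y -> setT u ->
    `|partial1of2 f y u| <= `|1 * (u ^+ 1 * gs u)|.
  move=> _ _; rewrite partial1of2E derive_val normrN mul1r expr1 !normrM.
  by rewrite ler_wpM2l// ler_piMl//; exact: normr_sin_le1.
have G0 u : 0 <= `|1 * (u ^+ 1 * gs u)| by [].
have D := @derivable_under_integral R _ _ (leb1 R) f setT measurableT x _ _ xI fi df _ G0 iG Gub.
have E := @differentiation_under_integral R _ _ (leb1 R) f setT measurableT x _ _ xI fi df _ G0 iG Gub.
have -> : - Sgs 1 x = 'D_1 (Cgs 0) x.
  rewrite -derive1E /Cgs E -mulN1r -RintegralZl//; last exact: integrable_Sgs.
  apply: eq_Rintegral => u _; rewrite partial1of2E derive_val; ring.
exact: derivableP.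
Qed.

(** Since [Sgs 1 x = x * Cgs 0 x], the function [Cgs 0] solves the same equation [y' = - x y] as
    [gs]. Hence their quotient [q] is constant, equal to the Gaussian integral at 0. *)
Lemma Cgs0 x : Cgs 0 x = Num.sqrt (pi *+ 2) * gs x.
Proof.
pose q x := Cgs 0 x * expR (x ^+ 2 / 2).
have dq (y : R) : is_derive y 1 q 0.
  have de : is_derive y 1 (fun z : R => expR (z ^+ 2 / 2)) (y * expR (y ^+ 2 / 2)).
    have d1 : is_derive y 1 (fun y : R => y ^+ 2 / 2) y.
      have -> : (fun y : R => y ^+ 2 / 2) = 2^-1 *: (id ^+ 2 : R -> R).
        by apply/funext => z; rewrite -[RHS]/(2^-1 * (z ^+ 2)) mulrC.
      by apply: is_derive_eq; rewrite /= expr1 !scalerA /GRing.scale/=; field.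
    by have /is_derive_eq := @is_derive1_comp R expR (fun y => y ^+ 2 / 2) y _ _ (is_derive_expR (y ^+ 2 / 2)) d1; apply; rewrite mulrC.
  have /is_derive_eq := is_deriveM (is_derive_Cgs0 y) de.
  apply; rewrite /GRing.scale/= Sgs_rec mul0r add0r; ring.
have := @is_derive_0_is_cst R q x 0 dq.
rewrite /q expr0n mul0r expR0 mulr1.
rewrite [Cgs 0 0](_ : _ = Num.sqrt (pi *+ 2)); last first.
  rewrite -Rintegral_gs; apply: eq_Rintegral => u _.
  by rewrite mulr0 cos0 expr0 !mul1r.
by move=> <-; rewrite -mulrA /gs expRN mulfV ?mulr1// gt_eqF// expR_gt0.
Qed.

(** The polynomials are Hermite polynomials, [- He_2] here and [He_4] below. The factor [1 - y2^2]
    of the witness is this one: it is the transform of [u^2 gs u]. *)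
Lemma Cgs2 x : Cgs 2 x = Num.sqrt (pi *+ 2) * ((1 - x ^+ 2) * gs x).
Proof. by rewrite Cgs_rec Sgs_rec /= mul0r Cgs0; ring. Qed.

Lemma Cgs4 x : Cgs 4 x = Num.sqrt (pi *+ 2) * ((3 - 6 * x ^+ 2 + x ^+ 4) * gs x).
Proof.
rewrite Cgs_rec Sgs_rec /= Cgs2 Sgs_rec /= Cgs0; ring.
Qed.

End gaussian.

(** Follows the syntax of the function; measurability hypotheses of the context close the leaves.
    Subtraction is tried before addition, of which it is an instance. *)
Ltac mstep :=
  match goal with
  | |- measurable_fun _ (fun z => z) => exact: measurable_id
  | |- measurable_fun _ (fun _ => ?c) => exact: measurable_cst
  | |- measurable_fun _ fst => exact: measurable_fst
  | |- measurable_fun _ snd => exact: measurable_snd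
  | |- measurable_fun _ (fun z => (@?f z, @?g z)) => apply: measurable_fun_pair
  | |- measurable_fun _ (fun z => @GRing.add _ (@?f z) (@GRing.opp _ (@?g z))) =>
       apply: (@measurable_funB _ _ _ _ f g)
  | |- measurable_fun _ (fun z => @GRing.add _ (@?f z) (@?g z)) =>
       apply: (@measurable_funD _ _ _ _ f g)
  | |- measurable_fun _ (fun z => @GRing.mul _ (@?f z) (@?g z)) =>
       apply: (@measurable_funM _ _ _ _ f g)
  | |- measurable_fun _ (fun z => @GRing.opp _ (@?f z)) =>
       apply: (@measurable_funN _ _ _ _ f)
  | |- measurable_fun _ (fun z => @GRing.inv _ (@?f z)) =>
       apply: (@measurable_fun_inv _ _ _ _ f)
  | |- measurable_fun _ (fun z => @GRing.exp _ (@?f z) ?n) =>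
       apply: (@measurable_funX _ _ _ _ f n)
  | |- measurable_fun _ (fun z => expR (@?f z)) =>
       apply: (@measurable_fun_expR _ _ _ _ f)
  | |- measurable_fun _ (fun z => cos (@?f z)) =>
       apply: (@measurable_fun_cos _ _ _ _ f)
  | |- measurable_fun _ (fun z => sin (@?f z)) =>
       apply: (@measurable_fun_sin _ _ _ _ f)
  | |- measurable_fun _ (fun z => Num.sqrt (@?f z)) =>
       apply: (@measurable_fun_sqrt _ _ _ _ f)
  | |- measurable_fun _ (fun z => `|(@?f z : _)|) =>
       apply: (@measurable_fun_norm _ _ _ _ f)
  | |- measurable_fun _ (fun z => (@?f z) `^ ?p) =>
       apply: (@measurable_fun_powR _ _ _ p _ f)
  | |- measurable_fun _ (fun z => (@?f z)%:E) =>
       apply/measurable_EFinP; rewrite /comp/=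
  | |- measurable_fun _ (fun z => fst (@?f z)) =>
       apply: (measurableT_comp measurable_fst)
  | |- measurable_fun _ (fun z => snd (@?f z)) =>
       apply: (measurableT_comp measurable_snd)
  | H : measurable_fun [set: _] ?p |- measurable_fun _ ?p =>
       exact: H
  | H : measurable_fun [set: _] ?p |- measurable_fun _ (fun z => ?p (@?g z)) =>
       apply: (measurableT_comp H)
  | H : measurable_fun [set: _] ?p |- measurable_fun _ ?p =>
       exact: (measurable_funTS H)
  | |- measurable_fun _ (fun z => gs (@?f z)) =>
       apply: (measurableT_comp (@measurable_gs _))
  end.
Ltac mfun := do ?mstep.

(** * Fubini for sigma-finite measures and changes of variables in the plane *)

Section sigma_finite_of.
Context d (T : measurableType d) (R : realType) (m : {measure set T -> \bar R}).
Hypothesis sf : sigma_finite setT m.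

(** A copy of [m] on which the sigma-finite structure can be declared from a proof; the vacuous
    [let] makes that proof a parameter of the copy. *)
Definition sigma_finite_of : set T -> \bar R := let _ := sf in m.
HB.instance Definition _ := Measure.on sigma_finite_of.
HB.instance Definition _ := Measure_isSigmaFinite.Build _ _ _ sigma_finite_of sf.

End sigma_finite_of.

Section sigma_finite_fubini.
Context d1 d2 (T1 : measurableType d1) (T2 : measurableType d2) (R : realType).
Variables (m1 : {measure set T1 -> \bar R}) (m2 : {measure set T2 -> \bar R}).
Hypotheses (sf1 : sigma_finite setT m1) (sf2 : sigma_finite setT m2).

Let s1 := sigma_finite_of sf1.
Let s2 := sigma_finite_of sf2.

Lemma sigma_finite_tonelli (f : T1 * T2 -> \bar R) : measurable_fun setT f ->
  (forall z, (0 <= f z)%E) ->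
  (\int[m1]_x \int[m2]_y f (x, y) = \int[m2]_y \int[m1]_x f (x, y))%E.
Proof. by move=> mf f0; exact: (@fubini_tonelli _ _ _ _ _ s1 s2). Qed.

Lemma measurable_tonelli_F (f : T1 * T2 -> \bar R) : measurable_fun setT f ->
  (forall z, (0 <= f z)%E) -> measurable_fun setT (fun x => \int[m2]_y f (x, y))%E.
Proof. by move=> mf f0; exact: (@measurable_fun_fubini_tonelli_F _ _ _ _ _ s2). Qed.

Lemma measurable_tonelli_G (f : T1 * T2 -> \bar R) : measurable_fun setT f ->
  (forall z, (0 <= f z)%E) -> measurable_fun setT (fun y => \int[m1]_x f (x, y))%E.
Proof. by move=> mf f0; exact: (@measurable_fun_fubini_tonelli_G _ _ _ _ _ s1). Qed.

Lemma sigma_finite_product : sigma_finite setT (m1 \x m2)%E.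
Proof.
have /sigma_finiteP[F [TF ndF Foo]] := sf1.
have /sigma_finiteP[G [TG ndG Goo]] := sf2.
exists (fun n => F n `*` G n).
 rewrite -setXTT TF TG predeqE => -[x y]; split.
    move=> [/= [n _ Fnx] [k _ Gky]]; exists (maxn n k) => //; split.
    - by move: x Fnx; exact/subsetPset/ndF/leq_maxl.
    - by move: y Gky; exact/subsetPset/ndG/leq_maxr.
  by move=> [n _ []/= ? ?]; split; exists n.
move=> k; have [? ?] := Foo k; have [? ?] := Goo k.
split; first exact: measurableX.
rewrite (product_measure1E s1 s2)// lte_mul_pinfty// ge0_fin_numE//.
Qed.

Section signed.
Variable f : T1 * T2 -> R.
Hypothesis mf : measurable_fun setT f.
Hypothesis fi : (\int[m1]_x \int[m2]_y `|f (x, y)|%:E < +oo)%E.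

Let imf : (s1 \x s2)%E.-integrable setT (EFin \o f).
Proof. by apply/integrable12ltyP => //; exact/measurable_EFinP. Qed.

Lemma sigma_finite_fubini :
  (\int[m1]_x \int[m2]_y (f (x, y))%:E = \int[m2]_y \int[m1]_x (f (x, y))%:E)%E.
Proof. exact: (@Fubini _ _ _ _ _ s1 s2 (EFin \o f) imf). Qed.

Lemma ae_integrable_section1 : {ae m1, forall x, m2.-integrable setT (fun y => (f (x, y))%:E)}.
Proof. exact: (@ae_integrable1 _ _ _ _ _ s1 s2 (EFin \o f) imf). Qed.

Lemma ae_integrable_section2 : {ae m2, forall y, m1.-integrable setT (fun x => (f (x, y))%:E)}.
Proof. exact: (@ae_integrable2 _ _ _ _ _ s1 s2 (EFin \o f) imf). Qed.

Lemma measurable_section_integral :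
  measurable_fun setT (fun x => \int[m2]_y (f (x, y))%:E)%E.
Proof. exact: (@measurable_fubini_F _ _ _ _ _ s1 s2 (EFin \o f) imf). Qed.

(** The inner [Rintegral] is [fine] of an extended integral, which may be infinite on a null set of
    sections; off that set [fineK] applies. *)
Lemma Rfubini : \int[m1]_x \int[m2]_y f (x, y) = \int[m2]_y \int[m1]_x f (x, y).
Proof.
rewrite /Rintegral; congr fine.
transitivity (\int[m1]_x \int[m2]_y (f (x, y))%:E)%E.
  apply: ae_eq_integral => //.
  - apply/measurable_EFinP.
    exact: (measurableT_comp (fine_measurable measurableT) measurable_section_integral).
  - exact: measurable_section_integral.
  - apply: filterS ae_integrable_section1 => x ix _; rewrite fineK//.
    exact: integrable_fin_num.
rewrite sigma_finite_fubini; apply: ae_eq_integral => //.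
- exact: (@measurable_fubini_G _ _ _ _ _ s1 s2 (EFin \o f) imf).
- apply/measurable_EFinP.
  apply: (measurableT_comp (fine_measurable measurableT)).
  exact: (@measurable_fubini_G _ _ _ _ _ s1 s2 (EFin \o f) imf).
- apply: filterS ae_integrable_section2 => x ix _; rewrite fineK//.
  exact: integrable_fin_num.
Qed.

End signed.
End sigma_finite_fubini.

Section two_dim.
Variable R : realType.

Lemma sigma_finite_leb1 : sigma_finite setT (leb1 R).
Proof. exact: sigma_finiteT. Qed.

Lemma sigma_finite_leb2 : sigma_finite setT (leb2 R).
Proof. exact: (sigma_finite_product sigma_finite_leb1 sigma_finite_leb1). Qed.

Lemma leb2_int12 (f : plane R -> \bar R) : measurable_fun setT f ->
  (forall z, (0 <= f z)%E) ->
  (\int[leb2 R]_z f z = \int[leb1 R]_x \int[leb1 R]_y f (x, y))%E.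
Proof. by move=> mf f0; exact: (@fubini_tonelli1 _ _ _ _ _ (leb1 R) (leb1 R) f mf f0). Qed.

Lemma leb2_int21 (f : plane R -> \bar R) : measurable_fun setT f ->
  (forall z, (0 <= f z)%E) ->
  (\int[leb2 R]_z f z = \int[leb1 R]_y \int[leb1 R]_x f (x, y))%E.
Proof. by move=> mf f0; exact: (@fubini_tonelli2 _ _ _ _ _ (leb1 R) (leb1 R) f mf f0). Qed.

Lemma leb2_Rint12 (f : plane R -> R) : (leb2 R).-integrable setT (EFin \o f) ->
  \int[leb2 R]_z f z = \int[leb1 R]_x \int[leb1 R]_y f (x, y).
Proof.
move=> fi; have mf : measurable_fun setT f by apply/measurable_EFinP; case/integrableP: fi.
have fi' : (\int[leb1 R]_x \int[leb1 R]_y `|f (x, y)|%:E < +oo)%E.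
  have /integrableP[_] := fi; rewrite leb2_int12//.
  by apply: measurableT_comp => //; exact/measurable_EFinP.
rewrite /Rintegral; congr fine.
transitivity (\int[leb1 R]_x \int[leb1 R]_y (f (x, y))%:E)%E.
  exact/esym/(@integral12_prod_meas1 _ _ _ _ _ (leb1 R) (leb1 R) (EFin \o f) fi).
have sf := sigma_finite_leb1; apply: ae_eq_integral => //.
- exact: (measurable_section_integral sf sf mf fi').
- apply/measurable_EFinP.
  exact: (measurableT_comp (fine_measurable measurableT) (measurable_section_integral sf sf mf fi')).
- apply: filterS (ae_integrable_section1 sf sf mf fi') => x ix _; rewrite fineK//.
  exact: integrable_fin_num.
Qed.

Variables (a d e : R) (b : R -> R).
Hypotheses (a0 : a != 0) (d0 : d != 0) (mb : measurable_fun setT b).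

(** The shear [b] may be any measurable function, since the inner affine substitution is made with
    the outer coordinate fixed. Translations are the case of constant [b]; a nonlinear [b] occurs
    for [ktr], which contains a square root. *)
Definition skew1 (x : plane R) : plane R := (a * x.1 + b x.2, d * x.2 + e).
Definition skew2 (x : plane R) : plane R := (a * x.1 + e, d * x.2 + b x.1).

Lemma measurable_skew1 : measurable_fun setT skew1.
Proof. rewrite /skew1; mfun. Qed.

Lemma measurable_skew2 : measurable_fun setT skew2.
Proof. rewrite /skew2; mfun. Qed.

Lemma ge0_integral_skew1 (f : plane R -> \bar R) : measurable_fun setT f ->
  (forall z, (0 <= f z)%E) ->
  (\int[leb2 R]_x f (skew1 x) = (`|a * d|^-1)%:E * \int[leb2 R]_x f x)%E.
Proof.
move=> mf f0; have mfs : measurable_fun setT (f \o skew1).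
  exact: measurableT_comp mf measurable_skew1.
apply: (etrans (@leb2_int21 (f \o skew1) mfs _)); first by move=> z; exact: f0.
rewrite [X in _ = (_ * X)%E](@leb2_int21 f mf f0) /=.
pose F y := (\int[leb1 R]_x f (x, y))%E.
have mF : measurable_fun setT F.
  exact: (@measurable_fun_fubini_tonelli_G _ _ _ _ _ (leb1 R) f mf f0).
have F0 y : (0 <= F y)%E by exact: integral_ge0.
under eq_integral => y _.
  rewrite (@ge0_integral_affine _ a (b y) (fun x => f (x, d * y + e)))//; last first.
    by apply: (measurableT_comp mf); mfun.
  over.
have mFs : measurable_fun [set: R] (fun y : R => F (d * y + e)).
  exact: (@measurableT_comp _ _ _ _ _ _ F _ _ mF (measurable_affine d e)).
rewrite (@ge0_integralZl _ _ R (leb1 R) setT measurableT (fun y => F (d * y + e)) mFs _ (fun y _ => F0 _)); last first.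
  by rewrite lee_fin invr_ge0.
by rewrite (@ge0_integral_affine _ d e F)// muleA -EFinM normrM invfM.
Qed.

Lemma ge0_integral_skew2 (f : plane R -> \bar R) : measurable_fun setT f ->
  (forall z, (0 <= f z)%E) ->
  (\int[leb2 R]_x f (skew2 x) = (`|a * d|^-1)%:E * \int[leb2 R]_x f x)%E.
Proof.
move=> mf f0; have mfs : measurable_fun setT (f \o skew2).
  exact: measurableT_comp mf measurable_skew2.
apply: (etrans (@leb2_int12 (f \o skew2) mfs _)); first by move=> z; exact: f0.
rewrite [X in _ = (_ * X)%E](@leb2_int12 f mf f0) /=.
pose F y := (\int[leb1 R]_x f (y, x))%E.
have mF : measurable_fun setT F.
  exact: (@measurable_fun_fubini_tonelli_F _ _ _ _ _ (leb1 R) f mf f0).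
have F0 y : (0 <= F y)%E by exact: integral_ge0.
under eq_integral => y _.
  rewrite (@ge0_integral_affine _ d (b y) (fun x => f (a * y + e, x)))//; last first.
    by apply: (measurableT_comp mf); mfun.
  over.
have mFs : measurable_fun [set: R] (fun y : R => F (a * y + e)).
  exact: (@measurableT_comp _ _ _ _ _ _ F _ _ mF (measurable_affine a e)).
rewrite (@ge0_integralZl _ _ R (leb1 R) setT measurableT (fun y => F (a * y + e)) mFs _ (fun y _ => F0 _)); last first.
  by rewrite lee_fin invr_ge0.
by rewrite (@ge0_integral_affine _ a e F)// muleA -EFinM normrM [in RHS]mulrC invfM.
Qed.

Let mu := leb2 R.

Lemma integrable_skew1 (f : plane R -> R) : mu.-integrable setT (EFin \o f) ->
  mu.-integrable setT (EFin \o (f \o skew1)).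
Proof.
refine (@integrable_scaled_map _ _ _ (leb2 R) skew1 (`|a * d|^-1) _ _ _ f).
- exact: measurable_skew1.
- by rewrite invr_ge0.
- exact: ge0_integral_skew1.
Qed.

Lemma integrable_skew2 (f : plane R -> R) : mu.-integrable setT (EFin \o f) ->
  mu.-integrable setT (EFin \o (f \o skew2)).
Proof.
refine (@integrable_scaled_map _ _ _ (leb2 R) skew2 (`|a * d|^-1) _ _ _ f).
- exact: measurable_skew2.
- by rewrite invr_ge0.
- exact: ge0_integral_skew2.
Qed.

Lemma Rintegral_skew1 (f : plane R -> R) : mu.-integrable setT (EFin \o f) ->
  \int[mu]_x f (skew1 x) = `|a * d|^-1 * \int[mu]_x f x.
Proof.
refine (@Rintegral_scaled_map _ _ _ (leb2 R) skew1 (`|a * d|^-1) _ f).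
exact: ge0_integral_skew1.
Qed.

Lemma Rintegral_skew2 (f : plane R -> R) : mu.-integrable setT (EFin \o f) ->
  \int[mu]_x f (skew2 x) = `|a * d|^-1 * \int[mu]_x f x.
Proof.
refine (@Rintegral_scaled_map _ _ _ (leb2 R) skew2 (`|a * d|^-1) _ f).
exact: ge0_integral_skew2.
Qed.

End two_dim.

(** * Two by two matrices and Haar integrals *)

Section matrices.
Variable R : realType.
Implicit Types h k : 'M[R]_2.

Lemma mx22E h : h = mx22 (h ord0 ord0) (h ord0 ord_max) (h ord_max ord0) (h ord_max ord_max).
Proof.
apply/matrixP => i j; rewrite mxE.
by case: i => [[|[|//]] Hi]; case: j => [[|[|//]] Hj]; rewrite /eq_op/=;
  congr (h _ _); exact: val_inj.
Qed.

Lemma mx22_eq (a b c d a' b' c' d' : R) : a = a' -> b = b' -> c = c' -> d = d' ->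
  mx22 a b c d = mx22 a' b' c' d'.
Proof. by move=> -> -> -> ->. Qed.

Lemma mx22_00 (a b c d : R) : mx22 a b c d ord0 ord0 = a.
Proof. by rewrite mxE. Qed.
Lemma mx22_01 (a b c d : R) : mx22 a b c d ord0 ord_max = b.
Proof. by rewrite mxE. Qed.
Lemma mx22_10 (a b c d : R) : mx22 a b c d ord_max ord0 = c.
Proof. by rewrite mxE. Qed.
Lemma mx22_11 (a b c d : R) : mx22 a b c d ord_max ord_max = d.
Proof. by rewrite mxE. Qed.
Definition mx22_ij := (mx22_00, mx22_01, mx22_10, mx22_11).

Lemma mulmx_entry h k i j :
  (h *m k) i j = h i ord0 * k ord0 j + h i ord_max * k ord_max j.
Proof.
rewrite mxE big_ord_recl big_ord1; congr (_ + h i _ * k _ j); exact: val_inj.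
Qed.

Lemma mulmx22 (a b c d a' b' c' d' : R) : mx22 a b c d *m mx22 a' b' c' d' =
  mx22 (a * a' + b * c') (a * b' + b * d') (c * a' + d * c') (c * b' + d * d').
Proof. by rewrite [LHS]mx22E; apply: mx22_eq; rewrite mulmx_entry !mx22_ij. Qed.

Lemma det22 h : \det h = h ord0 ord0 * h ord_max ord_max - h ord0 ord_max * h ord_max ord0.
Proof.
rewrite (expand_det_row _ ord0) big_ord_recl big_ord1 /cofactor !det_mx11 !mxE /=.
rewrite expr0 expr1 mul1r mulN1r mulrN.
by congr (_ * h _ _ - h _ _ * h _ _); exact: val_inj.
Qed.

Lemma det_mx22E (a b c d : R) : \det (mx22 a b c d) = a * d - b * c.
Proof. by rewrite det22 !mx22_ij. Qed.

Lemma mx22_1 : 1%:M = mx22 1 0 0 1 :> 'M[R]_2.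
Proof. by rewrite [LHS]mx22E; apply: mx22_eq; rewrite !mxE. Qed.

Lemma invmx_mx22 (a b c d : R) : a * d - b * c != 0 ->
  invmx (mx22 a b c d) = mx22 (d / (a * d - b * c)) (- b / (a * d - b * c))
                              (- c / (a * d - b * c)) (a / (a * d - b * c)).
Proof.
move=> D0; set N := mx22 (d / _) _ _ _.
have MN : mx22 a b c d *m N = 1%:M.
  by rewrite mulmx22 mx22_1; apply: mx22_eq; field.
have U : mx22 a b c d \in unitmx by rewrite unitmxE det_mx22E unitfE.
by rewrite -[RHS]mul1mx -(mulVmx U) -mulmxA MN mulmx1.
Qed.

Lemma mxact_mul h k (x : R * R) : mxact (h *m k) x = mxact h (mxact k x).
Proof. by rewrite /mxact !mulmx_entry; congr pair; rewrite /=; ring. Qed.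

Lemma mxactB h (x y : R * R) : mxact h (x - y) = mxact h x - mxact h y.
Proof. by rewrite /mxact /= ; congr pair; rewrite /=; ring. Qed.

Lemma continuous_entry (i j : 'I_2) : continuous (fun h : 'M[R]_2 => h i j).
Proof.
move=> h A /nbhs_ballP[e e0 eA]; apply/nbhs_ballP; exists e => // k hk.
by apply: eA; case: hk => _ /(_ i j).
Qed.

Lemma measurable_entry (i j : 'I_2) :
  measurable_fun [set: borelM R] (fun h : 'M[R]_2 => h i j).
Proof.
refine (@measurability _ _ (borelM R) _ setT
  (fun h : 'M[R]_2 => h i j) (@RGenOInfty.G R) _ _); first exact: RGenOInfty.measurableE.
move=> _ [_ [x ->] <-]; rewrite setTI; apply: sub_sigma_algebra.
apply: (open_comp (f := fun h : 'M[R]_2 => h i j)).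
  by move=> h _; exact: continuous_entry.
exact: interval_open.
Qed.

(** Every open set of matrices is a countable union of boxes [B (q, n)] with rational centre [q] and
    radius [1 / (n + 1)], and membership in a box is a condition on finitely many entries. *)
Lemma measurable_fun_borelM d (T : measurableType d) (D : set T) (f : T -> 'M[R]_2) :
  (forall i j, measurable_fun D (fun t => f t i j)) ->
  measurable_fun D (f : T -> borelM R).
Proof.
move=> mf mD.
apply: (@measurability _ _ T (borelM R) D f (@open 'M[R]_2)) => //.
move=> _ [U oU <-].
pose B (t : 'M[rat]_2 * nat) : set 'M[R]_2 :=
  [set h | forall i j, `|h i j - ratr (t.1 i j)| < t.2.+1%:R^-1].
have -> : U = \bigcup_(t in [set t | B t `<=` U]) B t.
  apply/seteqP; split=> [x Ux|x [t tU Btx]]; last exact: tU.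
  have /nbhs_ballP[e /= e0 eU] : nbhs x U by exact: open_nbhs_nbhs.
  (* Two points of the box are each within [e / 2] of its centre, so the box around a rational point
     near [x] stays in the ball of radius [e]. *)
  have [n nE] : exists n, (n.+1%:R^-1 : R) < e / 2.
    have e20 : 0 < e / 2 by rewrite divr_gt0.
    have [n] := ltr_add_invr e20.
    by rewrite add0r; exists n.
  have n0 : 0 < n.+1%:R^-1 :> R by rewrite invr_gt0.
  have qP i j : exists q : rat, `|x i j - ratr q| < n.+1%:R^-1.
    have xn : x i j < x i j + n.+1%:R^-1 by rewrite ltrDl.
    have [q] := rat_in_itvoo xn.
    rewrite in_itv/= => /andP[q1 q2]; exists q.
    by rewrite distrC gtr0_norm ?subr_gt0// ltrBlDl.
  have [q qE] : exists q : 'M[rat]_2, forall i j, `|x i j - ratr (q i j)| < n.+1%:R^-1.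
    exists (\matrix_(i, j) projT1 (cid (qP i j))) => i j; rewrite mxE.
    exact: (projT2 (cid (qP i j))).
  exists (q, n) => //= y yq; apply: eU; split=> // i j.
  rewrite /ball/= (_ : x i j - y i j = (x i j - ratr (q i j)) - (y i j - ratr (q i j))); last ring.
  rewrite (le_lt_trans (ler_normB _ _))// [ltRHS](splitr e).
  by rewrite ltrD// (lt_trans _ nE)//; exact: yq.
rewrite preimage_bigcup setI_bigcupr; rewrite bigcup_mkcond; apply: countable_bigcupT_measurable.
  exact: countableP.
move=> t; case: ifPn => // _.
have -> : D `&` f @^-1` B t = \bigcap_(i in [set: 'I_2 * 'I_2])
    (D `&` [set s | `|f s i.1 i.2 - ratr (t.1 i.1 i.2)| < t.2.+1%:R^-1]).
  apply/seteqP; split=> [s [Ds Bs] i _|s sB]; first by split => //; exact: Bs.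
  split; first by have [] := sB (ord0, ord0) I.
  by move=> i j; have [_] := sB (i, j) I.
apply: fin_bigcap_measurable; first exact: finite_finset.
move=> [i j] _ /=.
have mfij : measurable_fun D (fun s => `|f s i j - ratr (t.1 i j)|).
  by apply: measurable_fun_norm; apply: measurable_funB; [exact: mf|exact: measurable_cst].
have := mfij mD _ (measurable_itv (`]-oo, (t.2.+1%:R^-1 : R)[)).
rewrite (_ : _ @^-1` _ = [set s | `|f s i j - ratr (t.1 i j)| < t.2.+1%:R^-1])//.
Qed.

End matrices.

Section integral_monotone.
Local Open Scope ereal_scope.
Context d (T : measurableType d) (R : realType) (mu : {measure set T -> \bar R}).

(* Unlike [ge0_le_integral] this needs no measurability: the modular function
   occurring in the control weight is not known to be measurable. *)
Lemma ge0_le_integral_any (D : set T) (f g : T -> \bar R) :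
  (forall x, D x -> 0 <= f x) -> (forall x, D x -> f x <= g x) ->
  \int[mu]_(x in D) f x <= \int[mu]_(x in D) g x.
Proof.
move=> f0 fg; have g0 x : D x -> 0 <= g x by move=> Dx; exact: (le_trans (f0 _ Dx) (fg _ Dx)).
rewrite !ge0_integralE//; apply: ereal_sup_le => _ /= [h hf <-].
exists h => // x; apply: (le_trans (hf x)).
rewrite /patch; case: ifPn => // xD; apply: fg; rewrite inE in xD; exact: xD.
Qed.

End integral_monotone.

Section haar_integrals.
Variables (R : realType) (H : set 'M[R]_2) (mu : {measure set (borelM R) -> \bar R}).
Hypothesis mH : measurable (H : set (borelM R)).
Hypothesis Hunit : forall h, H h -> h \in unitmx.
Hypothesis HM : forall h k, H h -> H k -> H (h *m k).
Hypothesis HV : forall h, H h -> H (invmx h).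
Hypothesis haar_mu : left_haar H mu.

Lemma measurable_mulmxl (l : 'M[R]_2) :
  measurable_fun [set: borelM R] ((fun h => l *m h) : borelM R -> borelM R).
Proof.
apply: measurable_fun_borelM => i j.
under eq_fun do rewrite mulmx_entry.
by apply: measurable_funD; apply: measurable_funM => //; exact: measurable_entry.
Qed.

Lemma measurable_mulmxr (l : 'M[R]_2) :
  measurable_fun [set: borelM R] ((fun h => h *m l) : borelM R -> borelM R).
Proof.
apply: measurable_fun_borelM => i j.
under eq_fun do rewrite mulmx_entry.
by apply: measurable_funD; apply: measurable_funM => //; exact: measurable_entry.
Qed.

Lemma haar_setI (A : set (borelM R)) : measurable A -> mu (A `&` H) = mu A.
Proof.
move=> mA; have [muH _ _ _] := haar_mu.
rewrite [in RHS](_ : A = (A `&` H) `|` (A `&` ~` H)); last by rewrite -setIUr setUv setIT.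
rewrite measureU; last 3 first.
- exact: measurableI.
- by apply: measurableI => //; exact: measurableC.
- by rewrite setIACA setICr setI0.
rewrite [X in (_ + X)%E](_ : _ = 0%E) ?adde0//.
apply/eqP; rewrite eq_le measure_ge0 andbT -muH le_measure ?inE//; first last.
- exact: measurableC.
- by apply: measurableI => //; exact: measurableC.
Qed.

(** Invariance in [left_haar] is stated for images of subsets of [H], whereas a pushforward produces
    preimages; the two are exchanged by passing to the inverse of [l]. *)
Lemma preimage_mulmxl (l : 'M[R]_2) (A : set 'M[R]_2) : H l ->
  ((fun h => l *m h) @^-1` A) `&` H = [set invmx l *m k | k in A `&` H].
Proof.
move=> Hl; have lu := Hunit Hl; apply/seteqP; split=> [h [Ah Hh]|_ [k [Ak Hk] <-]].
  by exists (l *m h); [split=> //; exact: HM|rewrite mulKmx].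
split; first by rewrite /= mulKVmx.
by apply: HM => //; exact: HV.
Qed.

Lemma preimage_mulmxr (l : 'M[R]_2) (A : set 'M[R]_2) : H l ->
  ((fun h => h *m l) @^-1` A) `&` H = [set k *m invmx l | k in A `&` H].
Proof.
move=> Hl; have lu := Hunit Hl; apply/seteqP; split=> [h [Ah Hh]|_ [k [Ak Hk] <-]].
  by exists (h *m l); [split=> //; exact: HM|rewrite mulmxK].
split; first by rewrite /= mulmxKV.
by apply: HM => //; exact: HV.
Qed.

Lemma group_mull l h : H l -> H (l *m h) <-> H h.
Proof.
move=> Hl; split=> [Hlh|]; last exact: HM.
by rewrite -(mulKmx (Hunit Hl) h); apply: HM => //; exact: HV.
Qed.

Lemma group_mulr l h : H l -> H (h *m l) <-> H h.
Proof.
move=> Hl; split=> [Hlh|Hh]; last exact: HM.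
by rewrite -(mulmxK (Hunit Hl) h); apply: HM => //; exact: HV.
Qed.

Lemma haar_left_integral l (f : 'M[R]_2 -> \bar R) : H l ->
  measurable_fun (H : set (borelM R)) (f : borelM R -> \bar R) ->
  (forall h, H h -> (0 <= f h)%E) ->
  (\int[mu]_(h in H) f (l *m h) = \int[mu]_(h in H) f h)%E.
Proof.
move=> Hl mf f0; have [_ _ _ inv] := haar_mu.
pose nu := push_measure mu (measurable_mulmxl l).
have nuE (A : set (borelM R)) : measurable A -> mu A = nu A.
  move=> mA; transitivity (mu ((fun h => l *m h) @^-1` A)) => //.
  rewrite -[RHS]haar_setI; last first.
    by rewrite -[X in measurable X]setTI; exact: measurable_mulmxl.
  rewrite preimage_mulmxl// inv ?haar_setI//.
  - exact: HV.
  - exact: measurableI.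
rewrite [RHS](eq_measure_integral nu); last by move=> A mA _; exact: nuE.
rewrite /nu (@ge0_integral_pushforward _ _ _ _ _ _ (measurable_mulmxl l) mu H f)//.
  by congr (integral _ _ _); apply/seteqP; split=> h /=; rewrite group_mull.
by move=> h; rewrite inE; exact: f0.
Qed.

(** The preimage of a set under [h |-> h l] is its image under right multiplication by [invmx l],
    hence the modular factor at the inverse. *)
Lemma haar_right_integral (Delta : 'M[R]_2 -> R) l (f : 'M[R]_2 -> \bar R) :
  modular_function H mu Delta -> H l ->
  measurable_fun (H : set (borelM R)) (f : borelM R -> \bar R) ->
  (forall h, H h -> (0 <= f h)%E) ->
  (\int[mu]_(h in H) f (h *m l) =
   (Delta (invmx l))%:E * \int[mu]_(h in H) f h)%E.
Proof.
move=> mod Hl mf f0; have [D0 inv] := mod _ (HV Hl).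
pose nu := push_measure mu (measurable_mulmxr l).
have nuE (A : set (borelM R)) : measurable A ->
    mscale (NngNum (ltW D0)) mu A = nu A.
  move=> mA; transitivity (mu ((fun h => h *m l) @^-1` A)) => //.
  rewrite -[RHS]haar_setI; last first.
    by rewrite -[X in measurable X]setTI; exact: measurable_mulmxr.
  rewrite preimage_mulmxr// inv ?haar_setI//; exact: measurableI.
rewrite -(ge0_integral_mscale _ mH (NngNum (ltW D0)))//.
rewrite [RHS](eq_measure_integral nu); last by move=> A mA _; exact: nuE.
rewrite /nu (@ge0_integral_pushforward _ _ _ _ _ _ (measurable_mulmxr l) mu H f)//.
  by congr (integral _ _ _); apply/seteqP; split=> h /=; rewrite group_mulr.
by move=> h; rewrite inE; exact: f0.
Qed.

(** The compact sets cover only [H]; adding the null set of matrices outside [H] to each of them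
    gives a cover of the whole space. *)
Lemma haar_sigma_finite (K : nat -> set 'M[R]_2) : (forall n, compact (K n)) ->
  (forall n, measurable (K n : set (borelM R))) ->
  H = \bigcup_n K n -> sigma_finite setT mu.
Proof.
move=> cK mK HE; have [muH _ fin _] := haar_mu.
exists (fun n => K n `|` ~` H).
  apply/esym/seteqP; split=> // h _; have [Hh|nHh] := pselect (H h).
    by move: (Hh); rewrite {1}HE => -[n _ Kn]; exists n => //; left.
  by exists 0%N => //; right.
move=> n; have mC : measurable (~` H : set (borelM R)) by exact: measurableC.
split; first exact: measurableU.
apply: (le_lt_trans (measureU2 _ (mK n) mC)).
rewrite [X in (_ + X)%E](_ : _ = 0%E) ?adde0//.
by apply: fin => //; rewrite HE => h Kh; exists n.
Qed.

End haar_integrals.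

Section measurable_param.
Context d1 d2 (T1 : measurableType d1) (T2 : measurableType d2) (R : realType)
  (m2 : {measure set T2 -> \bar R}).
Hypothesis sf2 : sigma_finite setT m2.

(** The integral is the difference of the integrals of the positive and negative parts, each
    measurable by Tonelli, and this formula persists where they are infinite. *)
Lemma measurable_param_integral (f : T1 -> T2 -> R) :
  measurable_fun setT (fun z : T1 * T2 => f z.1 z.2) ->
  measurable_fun setT (fun x => \int[m2]_y (f x y)%:E)%E.
Proof.
move=> mf; have mfE : measurable_fun setT (fun z : T1 * T2 => (f z.1 z.2)%:E).
  exact/measurable_EFinP.
have -> : (fun x => \int[m2]_y (f x y)%:E)%E = (fun x =>
    \int[m2]_y ((fun z : T1 * T2 => (f z.1 z.2)%:E)^\+ (x, y)) -
    \int[m2]_y ((fun z : T1 * T2 => (f z.1 z.2)%:E)^\- (x, y)))%E.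
  apply/funext => x; rewrite integralE.
  by congr (_ - _)%E; apply: eq_integral => y _; rewrite ?funeposE ?funenegE.
apply: emeasurable_funB.
- apply: (@measurable_tonelli_F _ _ _ _ R m2 sf2) => //; exact: measurable_funepos.
- apply: (@measurable_tonelli_F _ _ _ _ R m2 sf2) => //; exact: measurable_funeneg.
Qed.

Lemma measurable_param_Rintegral (f : T1 -> T2 -> R) :
  measurable_fun setT (fun z : T1 * T2 => f z.1 z.2) ->
  measurable_fun setT (fun x => \int[m2]_y f x y).
Proof.
move=> mf; apply: (measurableT_comp (fine_measurable measurableT)).
exact: measurable_param_integral.
Qed.

End measurable_param.

(** * Square integrable functions and density of Gaussians *)

Section square_integrable.
Context d (T : measurableType d) (R : realType) (mu : {measure set T -> \bar R}).

Definition sqint (p : T -> R) : Prop :=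
  measurable_fun setT p /\ mu.-integrable setT (EFin \o (fun x => p x ^+ 2)).

(** Takes the place of the Cauchy-Schwarz inequality wherever only finiteness matters. *)
Lemma normM_le_sqr (x y : R) : `|x * y| <= x ^+ 2 + y ^+ 2.
Proof.
rewrite normrM -(real_normK (num_real x)) -(real_normK (num_real y)).
have := sqr_ge0 (`|x| - `|y|); rewrite sqrrB => H.
have : 0 <= `|x| ^+ 2 + `|y| ^+ 2 by rewrite addr_ge0// sqr_ge0.
by move: H; rewrite -mulr_natl; lra.
Qed.

Lemma integrable_sqintM (p q : T -> R) : sqint p -> sqint q ->
  mu.-integrable setT (EFin \o (fun x => p x * q x)).
Proof.
move=> [mp ip] [mq iq].
apply: (@integrable_dominated _ _ _ mu _ (fun x => p x ^+ 2 + q x ^+ 2)).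
- exact: measurable_funM.
- exact: (integrableD measurableT ip iq).
- by move=> x; exact: normM_le_sqr.
Qed.

Lemma sqint_bounded_integrable (q : T -> R) (C : R) : measurable_fun setT q ->
  mu.-integrable setT (EFin \o q) -> (forall x, `|q x| <= C) -> sqint q.
Proof.
move=> mq iq qC; split=> //.
apply: (@integrable_dominated _ _ _ mu _ (fun x => C * `|q x|)).
- exact: measurable_funX.
- exact: (integrableZl measurableT C (integrable_norm iq)).
- by move=> x; rewrite normrX expr2 ler_wpM2r.
Qed.

Lemma sqintD (p q : T -> R) : sqint p -> sqint q -> sqint (fun x => p x + q x).
Proof.
move=> sp sq; have [mp ip] := sp; have [mq iq] := sq.
split; first exact: measurable_funD.
have ipq := integrable_sqintM sp sq.
have := integrableD measurableT (integrableD measurableT ip iq)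
  (integrableZl measurableT 2 ipq).
by apply: eq_integrable => // x _; rewrite /= -!EFinM -!EFinD; congr EFin; ring.
Qed.

Lemma sqintZ (k : R) (p : T -> R) : sqint p -> sqint (fun x => k * p x).
Proof.
move=> [mp ip]; split; first by apply: measurable_funM.
have := integrableZl measurableT (k ^+ 2) ip.
by apply: eq_integrable => // x _; rewrite /= -!EFinM; congr EFin; ring.
Qed.

Lemma cvg_Rintegral_dominated_ae (f_ : nat -> T -> R) (f g : T -> R) :
  (forall n, measurable_fun setT (f_ n)) -> measurable_fun setT f ->
  {ae mu, forall x, f_ n x @[n --> \oo] --> f x} ->
  mu.-integrable setT (EFin \o g) -> (forall n x, `|f_ n x| <= g x) ->
  \int[mu]_x f_ n x @[n --> \oo] --> \int[mu]_x f x.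
Proof.
move=> mf_ mf f_f ig fg.
have mf_E n : measurable_fun setT (fun x => (f_ n x)%:E) by exact/measurable_EFinP.
have [||||fi _] := @dominated_convergence _ _ R mu setT measurableT
  (fun n x => (f_ n x)%:E) (EFin \o f) (EFin \o g) mf_E.
- exact/measurable_EFinP.
- by apply: filterS f_f => x fx _; apply: cvg_EFin; [exact: nearW|exact: fx].
- exact: ig.
- by apply: aeW => x n _ /=; rewrite lee_fin.
move=> H; apply: fine_cvg; rewrite fineK//; exact: integrable_fin_num.
Qed.

(** The sets on whose preimage the integral vanishes form a lambda-system. It is applied with [phi]
    a coordinate projection or the identity. *)
Lemma dynkin_integral0 d' (T' : measurableType d') (phi : T -> T') (f : T -> R)
    (G : set (set T')) :
  measurable_fun setT phi -> mu.-integrable setT (EFin \o f) ->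
  @measurable _ T' = <<s G >> -> setI_closed G ->
  (\int[mu]_x (f x)%:E = 0)%E ->
  (forall A, G A -> \int[mu]_(x in phi @^-1` A) (f x)%:E = 0)%E ->
  forall A, measurable A -> (\int[mu]_(x in phi @^-1` A) (f x)%:E = 0)%E.
Proof.
move=> mphi fi GE GI f0 GA A mA.
have mpre (B : set T') : measurable B -> measurable (phi @^-1` B).
  by move=> mB; rewrite -[X in measurable X]setTI; exact: mphi.
apply: (@dynkin_induction _ T' G (fun A => \int[mu]_(x in phi @^-1` A) (f x)%:E = 0)%E) => //.
- move=> B mB B0; have := f0.
  rewrite -(setUv (phi @^-1` B)) (@integral_setU _ _ _ mu)//.
  + by rewrite B0 add0e.
  + exact: mpre.
  + by apply: measurableC; exact: mpre.
  + by rewrite setUv; case/integrableP: fi.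
  + by apply/disj_setPS; rewrite setICr.
- move=> F mF tF F0; rewrite preimage_bigcup (@integral_bigcup _ _ _ mu).
  + by rewrite eseries0// => i _ _; exact: F0.
  + move/trivIsetP : tF => tF; apply/trivIsetP => i j _ _ ij.
    by rewrite -preimage_setI tF// preimage_set0.
  + by move=> k; exact: mpre.
  + by apply: (integrableS measurableT) fi => //; apply: bigcup_measurable => k _; exact: mpre.
- by rewrite -GE.
Qed.

End square_integrable.

Section density.
Variable R : realType.
Implicit Types (p : plane R -> R) (A B : set R).

Lemma measurable_ocitv A : ocitv A -> measurable (A : set (measurableTypeR R)).
Proof. by move=> oA; exact: sub_sigma_algebra. Qed.

Lemma measurable_indicT (A : set R) : measurable (A : set (measurableTypeR R)) ->
  measurable_fun [set: R] (\1_A : R -> R).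
Proof. by move=> mA; exact: measurable_indic. Qed.

Lemma indicM_patch d (T : measurableType d) (mu : {measure set T -> \bar R}) (f : T -> R)
    (E : set T) :
  (\int[mu]_(x in E) (f x)%:E = \int[mu]_x (f x * \1_E x)%:E)%E.
Proof.
rewrite [LHS]integral_mkcond; apply: eq_integral => x _.
by rewrite /patch indicE; case: ifPn => _; rewrite ?mulr1 ?mulr0.
Qed.

Lemma indic_idem (T : Type) (E : set T) (x : T) : \1_E x * \1_E x = \1_E x :> R.
Proof. by rewrite indicE; case: (_ \in _); rewrite ?mulr1 ?mulr0. Qed.

Lemma indicI_at (T : Type) (E F : set T) (x : T) : \1_(E `&` F) x = \1_E x * \1_F x :> R.
Proof. by rewrite indicI. Qed.

(** The function is only locally integrable, so it is cut off to the squares [I n * I n]; countably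
    many null sets then combine. *)
Lemma ae_eq0_of_rect p : measurable_fun setT p ->
  (forall A B, ocitv A -> ocitv B -> (leb2 R).-integrable setT
     (EFin \o (fun z => p z * (\1_A z.1 * \1_B z.2)))) ->
  (forall A B, ocitv A -> ocitv B ->
     \int[leb2 R]_z (p z * (\1_A z.1 * \1_B z.2)) = 0) ->
  {ae leb2 R, forall z, p z = 0}.
Proof.
move=> mp ip rp0.
have rp0E A B : ocitv A -> ocitv B ->
    (\int[leb2 R]_z (p z * (\1_A z.1 * \1_B z.2))%:E = 0)%E.
  move=> oA oB; have := rp0 _ _ oA oB; rewrite /Rintegral => H.
  by rewrite -[LHS]fineK ?H//; exact: (integrable_fin_num measurableT (ip _ _ oA oB)).
pose I (n : nat) : set R := `]- n%:R, n%:R]%classic.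
have oI n : ocitv (I n) by exact: is_ocitv.
suff H n : {ae leb2 R, forall z, p z * (\1_(I n) z.1 * \1_(I n) z.2) = 0}.
  have : {ae leb2 R, forall z n, p z * (\1_(I n) z.1 * \1_(I n) z.2) = 0}.
    exact/ae_foralln.
  apply: filterS => z Hz; have [n] : exists n, `|z.1| < n%:R /\ `|z.2| < n%:R.
    exists (maxn (Num.bound `|z.1|) (Num.bound `|z.2|)); split.
      by rewrite (lt_le_trans (archi_boundP (normr_ge0 _)))// ler_nat leq_maxl.
    by rewrite (lt_le_trans (archi_boundP (normr_ge0 _)))// ler_nat leq_maxr.
  move=> [z1 z2]; have := Hz n.
  have zI (x : R) : `|x| < n%:R -> \1_(I n) x = 1 :> R.
    by rewrite ltr_norml indicE => /andP[x1 x2]; rewrite mem_set// /I /= in_itv/= x1 ltW.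
  by rewrite !zI// !mulr1.
pose f z := p z * (\1_(I n) z.1 * \1_(I n) z.2).
have fi : (leb2 R).-integrable setT (EFin \o f) by exact: ip.
have mI A : ocitv A -> measurable (A : set (measurableTypeR R)) by exact: measurable_ocitv.
have ind_int (E : set (plane R)) : measurable E ->
    (leb2 R).-integrable setT (EFin \o (fun z => f z * \1_E z)).
  move=> mE; apply: (@integrable_dominated _ _ _ (leb2 R) _ (fun z => `|f z|)).
  - apply: measurable_funM; last exact: measurable_indic.
    by apply/measurable_EFinP; case/integrableP: fi.
  - exact: integrable_norm.
  - by move=> z; rewrite normrM ler_piMr// indicE; case: (_ \in _); rewrite ?normr1 ?normr0.
have mfst A : measurable (A : set (measurableTypeR R)) -> measurable (fst @^-1` A : set (plane R)).
  by move=> mA; rewrite -[X in measurable X]setTI; exact: measurable_fst.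
have msnd A : measurable (A : set (measurableTypeR R)) -> measurable (snd @^-1` A : set (plane R)).
  by move=> mA; rewrite -[X in measurable X]setTI; exact: measurable_snd.
have base A B : ocitv A -> ocitv B ->
    (\int[leb2 R]_z (f z * (\1_A z.1 * \1_B z.2))%:E = 0)%E.
  move=> oA oB; rewrite -[RHS](rp0E _ _ (ocitvI (oI n) oA) (ocitvI (oI n) oB)).
  by apply: eq_integral => z _; rewrite /f !indicI_at; congr EFin; ring.
(* Three lambda-system arguments: the first side of the rectangle becomes a Borel set, then the
   second, and finally the rectangle becomes a Borel set of the plane. *)
have step1 A B : measurable (A : set (measurableTypeR R)) -> ocitv B ->
    (\int[leb2 R]_(z in fst @^-1` A) (f z * \1_(snd @^-1` B) z)%:E = 0)%E.
  move=> mA oB.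
  refine (@dynkin_integral0 _ _ R (leb2 R) _ (measurableTypeR R) fst
    (fun z => f z * \1_(snd @^-1` B) z) (@ocitv R : set (set (measurableTypeR R))) _ _ _ _ _ _ A mA) => //.
  - by apply: ind_int; apply: msnd; exact: mI.
  - exact: ocitvI.
  - rewrite -[RHS](base _ _ (oI n) oB); apply: eq_integral => z _; congr EFin.
    rewrite /f -[\1_(snd @^-1` B) z]/(\1_B z.2 : R) -{1}(indic_idem (I n) z.1).
    by ring.
  - move=> A' oA'; rewrite indicM_patch -[RHS](base _ _ oA' oB).
    by apply: eq_integral => z _; congr EFin; rewrite -mulrA [X in _ * X]mulrC.
have step2 A B : measurable (A : set (measurableTypeR R)) ->
    measurable (B : set (measurableTypeR R)) ->
    (\int[leb2 R]_(z in snd @^-1` B) (f z * \1_(fst @^-1` A) z)%:E = 0)%E.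
  move=> mA mB.
  refine (@dynkin_integral0 _ _ R (leb2 R) _ (measurableTypeR R) snd
    (fun z => f z * \1_(fst @^-1` A) z) (@ocitv R : set (set (measurableTypeR R))) _ _ _ _ _ _ B mB) => //.
  - by apply: ind_int; apply: mfst.
  - exact: ocitvI.
  - rewrite -[RHS](step1 _ _ mA (oI n)) [RHS]indicM_patch.
    apply: eq_integral => z _; congr EFin.
    rewrite /f -[\1_(fst @^-1` A) z]/(\1_A z.1 : R) -[\1_(snd @^-1` I n) z]/(\1_(I n) z.2 : R).
    by rewrite -{1}(indic_idem (I n) z.2); ring.
  - move=> B' oB'; rewrite -[RHS](step1 _ _ mA oB') [LHS]indicM_patch [RHS]indicM_patch.
    by apply: eq_integral => z _; congr EFin; rewrite mulrAC.
have step3 E : measurable E -> (\int[leb2 R]_(z in E) (f z)%:E = 0)%E.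
  move=> mE.
  refine (@dynkin_integral0 _ _ R (leb2 R) _ (plane R) id f
    [set A `*` B | A in measurable & B in measurable] _ _ _ _ _ _ E mE) => //.
  - exact: measurable_prod_measurableType.
  - move=> _ _ [A1 mA1 [B1 mB1 <-]] [A2 mA2 [B2 mB2 <-]].
    exists (A1 `&` A2); first exact: measurableI.
    by exists (B1 `&` B2); [exact: measurableI|rewrite setXI].
  - rewrite -[RHS](base _ _ (oI n) (oI n)); apply: eq_integral => z _; congr EFin.
    by rewrite /f -{1}(indic_idem (I n) z.2) -{1}(indic_idem (I n) z.1); ring.
  - move=> _ [A mA [B mB <-]]; rewrite -[RHS](step2 _ _ mA mB) [LHS]indicM_patch [RHS]indicM_patch.
    apply: eq_integral => z _; congr EFin; rewrite -mulrA; congr (_ * _).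
    rewrite -[LHS]/(\1_(A `*` B) z : R) -[\1_(fst @^-1` A) z]/(\1_A z.1 : R).
    rewrite -[\1_(snd @^-1` B) z]/(\1_B z.2 : R).
    by rewrite !indicE in_setX; case: (z.1 \in A); case: (z.2 \in B); rewrite /= ?mulr1 ?mulr0.
have := @integral_ae_eq _ _ R (leb2 R) setT measurableT (cst 0%E) (EFin \o f) fi.
case.
- exact: measurable_cst.
- by move=> E _ mE; rewrite step3// integral0.
- move=> N [mN N0 sN]; exists N; split=> // z /= nz; apply: sN => /= H; apply: nz.
  by have [] := H Logic.I.
Qed.

Definition gs2 (r1 r2 : R) (u : plane R) : R := gs (u.1 / r1) * gs (u.2 / r2).

Lemma measurable_gs2 (r1 r2 : R) : measurable_fun setT (gs2 r1 r2).
Proof. rewrite /gs2; mfun. Qed.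

Lemma gs2_ge0 r1 r2 u : 0 <= gs2 r1 r2 u.
Proof. by rewrite mulr_ge0// gs_ge0. Qed.

Lemma gs2_le1 r1 r2 u : gs2 r1 r2 u <= 1.
Proof. by rewrite mulr_ile1// ?gs_ge0// gs_le1. Qed.

Lemma integrable_tensor (f g : R -> R) :
  (leb1 R).-integrable setT (EFin \o f) -> (leb1 R).-integrable setT (EFin \o g) ->
  (leb2 R).-integrable setT (EFin \o (fun z : plane R => f z.1 * g z.2)).
Proof.
move=> fi gi; have mf : measurable_fun [set: R] f by apply/measurable_EFinP; case/integrableP: fi.
have mg : measurable_fun [set: R] g by apply/measurable_EFinP; case/integrableP: gi.
have mfg : measurable_fun setT (fun z : plane R => f z.1 * g z.2) by mfun.
apply/integrableP; split; first exact/measurable_EFinP.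
rewrite leb2_int12//; last by apply: measurableT_comp => //; exact/measurable_EFinP.
have -> : (\int[leb1 R]_x \int[leb1 R]_y `|(EFin \o (fun z : plane R => (f z.1 * g z.2)%R)) (x, y)| =
   \int[leb1 R]_x (`|f x|%:E * \int[leb1 R]_y `|g y|%:E))%E.
  apply: eq_integral => x _.
  rewrite -(@ge0_integralZl_EFin _ _ R (leb1 R) setT measurableT (fun y => `|g y|%:E))//; first last.
  - by mfun.
  by apply: eq_integral => y _; rewrite /= normrM EFinM.
rewrite (@ge0_integralZr _ _ R (leb1 R) setT measurableT (fun y => `|f y|%:E))//; first last.
- exact: integral_ge0.
- by mfun.
rewrite lte_mul_pinfty//.
- exact: integral_ge0.
- have /integrableP[_] := integrable_norm fi.
  rewrite ge0_fin_numE; last exact: integral_ge0.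
  by under eq_integral do rewrite /= normr_id.
- by have /integrableP[_] := gi.
Qed.

Lemma Rintegral_tensor (f g : R -> R) :
  (leb1 R).-integrable setT (EFin \o f) -> (leb1 R).-integrable setT (EFin \o g) ->
  \int[leb2 R]_z (f z.1 * g z.2) = (\int[leb1 R]_x f x) * \int[leb1 R]_x g x.
Proof.
move=> fi gi; rewrite leb2_Rint12; last exact: integrable_tensor.
rewrite -RintegralZr//; apply: eq_Rintegral => x _; by rewrite -RintegralZl.
Qed.

Lemma Rintegral_gs_scale (r : R) : r != 0 ->
  \int[leb1 R]_x gs (x / r) = `|r| * Num.sqrt (pi *+ 2).
Proof.
move=> r0; have r10 : r^-1 != 0 by rewrite invr_eq0.
have i0 : (leb1 R).-integrable setT (EFin \o (@gs R)).
  have c1 : continuous (fun _ : R => 1 : R) by move=> u; exact: cvg_cst.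
  have n1 (u : R) : `|1 : R| <= 1 by rewrite normr1.
  by apply: eq_integrable (integrable_mono_gs 0 c1 n1) => // u _ /=; rewrite expr0 !mul1r.
have := Rintegral_affine 0 r10 i0; rewrite Rintegral_gs normfV invrK => <-.
by apply: eq_Rintegral => x _; rewrite addr0 mulrC.
Qed.

Lemma integrable_gs_scale (r : R) : r != 0 ->
  (leb1 R).-integrable setT (EFin \o (fun u => gs (u / r))).
Proof.
move=> r0; have c1 : continuous (fun _ : R => 1 : R) by move=> u; exact: cvg_cst.
have i0 : (leb1 R).-integrable setT (EFin \o (@gs R)).
  have n1 (u : R) : `|1 : R| <= 1 by rewrite normr1.
  by apply: eq_integrable (integrable_mono_gs 0 c1 n1) => // u _ /=; rewrite expr0 !mul1r.
have r10 : r^-1 != 0 by rewrite invr_eq0.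
have := integrable_affine 0 r10 i0.
by apply: eq_integrable => // u _ /=; rewrite addr0 mulrC.
Qed.

Lemma integrable_gs2 (r1 r2 : R) : r1 != 0 -> r2 != 0 ->
  (leb2 R).-integrable setT (EFin \o gs2 r1 r2).
Proof.
move=> r10 r20.
exact: (@integrable_tensor (fun u => gs (u / r1)) (fun u => gs (u / r2))
  (integrable_gs_scale r10) (integrable_gs_scale r20)).
Qed.

Lemma sqint_gs2 (r1 r2 : R) : r1 != 0 -> r2 != 0 -> sqint (leb2 R) (gs2 r1 r2).
Proof.
move=> r10 r20; apply: (@sqint_bounded_integrable _ _ _ (leb2 R) _ 1).
- exact: measurable_gs2.
- exact: integrable_gs2.
- by move=> u; rewrite ger0_norm ?gs2_ge0// gs2_le1.
Qed.

Lemma Rintegral_gs2 (r1 r2 : R) : r1 != 0 -> r2 != 0 ->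
  \int[leb2 R]_z gs2 r1 r2 z = `|r1 * r2| * (pi *+ 2).
Proof.
move=> r10 r20; rewrite (@Rintegral_tensor (fun u => gs (u / r1)) (fun u => gs (u / r2)));
  [|exact: integrable_gs_scale|exact: integrable_gs_scale].
rewrite !Rintegral_gs_scale// normrM mulrACA -expr2 sqr_sqrtr//.
by rewrite mulrn_wge0// pi_ge0.
Qed.

(** Away from its two endpoints the indicator of an interval is locally constant. *)
Lemma cvg_indic_ocitv (a b t v : R) : t != a -> t != b ->
  \1_(`]a, b]%classic : set R) (t - n.+1%:R^-1 * v) @[n --> \oo] -->
  (\1_(`]a, b]%classic : set R) t : R).
Proof.
move=> ta tb.
have tv : t - n.+1%:R^-1 * v @[n --> \oo] --> t.
  rewrite -[X in _ --> X]subr0; apply: cvgB; first exact: cvg_cst.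
  by rewrite -(mul0r v); apply: cvgMl; exact: cvg_harmonic.
have [lta|gta] := ltP t a.
  apply: cvg_near_cst; near=> n; rewrite !indicE !memNset//= in_itv/= => /andP[h _].
    by move: h; rewrite ltNge (ltW lta).
  by move: h; apply/negP; rewrite -leNgt ltW//; near: n; exact: (cvgr_lt _ tv).
have {}gta : a < t by rewrite lt_neqAle eq_sym ta.
have [gtb|ltb] := ltP b t.
  apply: cvg_near_cst; near=> n; rewrite !indicE !memNset//= in_itv/= => /andP[_ h].
    by move: h; rewrite leNgt gtb.
  by move: h; apply/negP; rewrite -ltNge; near: n; exact: (cvgr_gt _ tv).
have {}ltb : t < b by rewrite lt_neqAle tb.
apply: cvg_near_cst; near=> n; rewrite !indicE !mem_set//= in_itv/=.
  by rewrite gta ltW.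
apply/andP; split; last apply: ltW.
  by near: n; exact: (cvgr_gt _ tv).
by near: n; exact: (cvgr_lt _ tv).
Unshelve. all: by end_near. Qed.

Lemma ae_coord1_neq (a : R) : {ae leb2 R, forall z : plane R, z.1 != a}.
Proof.
exists ([set a] `*` setT); split.
- by apply: measurableX.
- transitivity (leb1 R [set a] * leb1 R setT)%E; first exact: product_measure1E.
  by rewrite [X in (X * _)%E]lebesgue_measure_set1 mul0e.
- by move=> z /= /negP; rewrite negbK => /eqP.
Qed.

Lemma ae_coord2_neq (a : R) : {ae leb2 R, forall z : plane R, z.2 != a}.
Proof.
exists (setT `*` [set a]); split.
- by apply: measurableX.
- transitivity (leb1 R setT * leb1 R [set a])%E; first exact: product_measure1E.
  by rewrite [X in (_ * X)%E]lebesgue_measure_set1 mule0.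
- by move=> z /= /negP; rewrite negbK => /eqP.
Qed.

(* A function orthogonal to all Gaussian bumps is zero: the bumps are an
   approximate identity, so its integral over every rectangle vanishes. *)
Lemma ae_eq0_of_gauss p : sqint (leb2 R) p ->
  (forall (x : plane R) (r : R), 0 < r ->
     \int[leb2 R]_z (p z * gs2 r r (z.1 - x.1, z.2 - x.2)) = 0) ->
  {ae leb2 R, forall z, p z = 0}.
Proof.
move=> sp gp0; have [mp ip] := sp.
pose ind A B (z : plane R) : R := \1_A z.1 * \1_B z.2.
have mind A B : ocitv A -> ocitv B -> measurable_fun setT (ind A B).
  move=> oA oB; have mA := measurable_indicT (measurable_ocitv oA).
  have mB := measurable_indicT (measurable_ocitv oB).
  by rewrite /ind; mfun.
have iind A B : ocitv A -> ocitv B -> (leb2 R).-integrable setT (EFin \o ind A B).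
  move=> [[a b]] _ <- [[c d]] _ <-.
  by apply: integrable_tensor; apply: integrable_indic_itv.
have ind01 A B z : 0 <= ind A B z <= 1.
  by rewrite /ind !indicE; do 2 case: (_ \in _); rewrite ?mulr0 ?mul0r ?mulr1 ?ler01 ?lexx.
have sind A B : ocitv A -> ocitv B -> sqint (leb2 R) (ind A B).
  move=> oA oB; apply: (@sqint_bounded_integrable _ _ _ (leb2 R) _ 1).
  - exact: mind.
  - exact: iind.
  - by move=> z; have /andP[z0 z1] := ind01 A B z; rewrite ger0_norm.
have sqtr (s : plane R) (q : plane R -> R) : sqint (leb2 R) q ->
    sqint (leb2 R) (fun z => q (z.1 + s.1, z.2 + s.2)).
  move=> [mq iq]; split; first by mfun.
  have := @integrable_skew1 R 1 1 s.2 (fun=> s.1) (oner_neq0 _) (oner_neq0 _)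
    (measurable_cst _) _ iq.
  by apply: eq_integrable => // z _ /=; rewrite /skew1 !mul1r.
apply: ae_eq0_of_rect => // A B oA oB; first exact: (integrable_sqintM sp (sind _ _ oA oB)).
have [a [b [c [d [EA EB]]]]] : exists a b c d, A = `]a, b]%classic /\ B = `]c, d]%classic.
  by case: oA => -[a b] _ <-; case: oB => -[c d] _ <-; exists a, b, c, d.
have mi := mind _ _ oA oB; have mg := measurable_gs2 1 1.
have sAB := sind _ _ oA oB.
pose K := \int[leb2 R]_x (ind A B x ^+ 2 + p x ^+ 2).
(* [I] is the correlation of [p] with the rectangle, and [I (0, 0)] is the integral to be shown
   zero. By Fubini and [z = x + r u], the Gaussian average of [I] at every scale [r] vanishes; then
   [r = 1 / (n + 1)] tends to 0. *)
pose I (s : plane R) := \int[leb2 R]_x (ind A B x * p (x.1 + s.1, x.2 + s.2)).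
have KE : (K%:E = \int[leb2 R]_x (ind A B x ^+ 2)%:E + \int[leb2 R]_x (p x ^+ 2)%:E)%E.
  rewrite /K /Rintegral fineK; last first.
    exact: (integrable_fin_num measurableT (integrableD measurableT sAB.2 ip)).
  rewrite -ge0_integralD//.
  - by move=> x _; rewrite lee_fin sqr_ge0.
  - by mfun.
  - by move=> x _; rewrite lee_fin sqr_ge0.
  - by mfun.
have Kb (s : plane R) :
    (\int[leb2 R]_x `|ind A B x * p (x.1 + s.1, x.2 + s.2)|%:E <= K%:E)%E.
  rewrite KE -[X in (_ <= _ + X)%E]mul1e.
  have := @ge0_integral_skew1 R 1 1 s.2 (fun=> s.1) (oner_neq0 _) (oner_neq0 _)
    (measurable_cst _) (fun x => (p x ^+ 2)%:E).
  rewrite mulr1 normr1 invr1 => <-; first last.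
  - by move=> z; rewrite lee_fin sqr_ge0.
  - by mfun.
  rewrite -ge0_integralD//; first last.
  - by rewrite /skew1; mfun.
  - by move=> x _; rewrite lee_fin sqr_ge0.
  - by mfun.
  - by move=> x _; rewrite lee_fin sqr_ge0.
  apply: ge0_le_integral => //.
  - by mfun.
  - by rewrite /skew1; apply: emeasurable_funD; mfun.
  - by move=> x _; rewrite -EFinD lee_fin /skew1 !mul1r; exact: normM_le_sqr.
have K0 : 0 <= K by apply: Rintegral_ge0 => x _; rewrite addr_ge0// sqr_ge0.
have step1 r : 0 < r -> \int[leb2 R]_u (gs2 1 1 u * I (r * u.1, r * u.2)) = 0.
  move=> r0; have r0' : r != 0 by rewrite gt_eqF.
  pose Phi (w : plane R * plane R) : R :=
    gs2 1 1 w.1 * (ind A B w.2 * p (w.2.1 + r * w.1.1, w.2.2 + r * w.1.2)).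
  have mPhi : measurable_fun setT Phi by rewrite /Phi; mfun.
  have fPhi : (\int[leb2 R]_u \int[leb2 R]_x `|Phi (u, x)|%:E < +oo)%E.
    apply: (@le_lt_trans _ _ (\int[leb2 R]_u (K%:E * (gs2 1 1 u)%:E))%E); last first.
      rewrite ge0_integralZl//; first last.
      - by move=> u _; rewrite lee_fin gs2_ge0.
      - by mfun.
      rewrite lte_mul_pinfty ?lee_fin//.
      exact: (integrable_lty measurableT (integrable_gs2 (oner_neq0 R) (oner_neq0 R))).
    apply: ge0_le_integral_any => u _; first exact: integral_ge0.
    rewrite muleC; apply: (le_trans _ (lee_wpmul2l _ (Kb (r * u.1, r * u.2)))); last first.
      by rewrite lee_fin gs2_ge0.
    rewrite -ge0_integralZl_EFin//; first last.
    - exact: gs2_ge0.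
    - by mfun.
    apply: ge0_le_integral_any => x _ //.
    by rewrite -EFinM lee_fin /Phi/= normrM ger0_norm ?gs2_ge0.
  have H := @Rfubini _ _ _ _ R (leb2 R) (leb2 R) (@sigma_finite_leb2 R) (@sigma_finite_leb2 R) Phi mPhi fPhi.
  transitivity (\int[leb2 R]_x \int[leb2 R]_u Phi (u, x)).
    rewrite -H; apply: eq_Rintegral => u _; rewrite /Phi/= /I.
    have iu := integrable_sqintM sAB (sqtr (r * u.1, r * u.2) p sp).
    by rewrite (RintegralZl _ measurableT iu).
  transitivity (\int[leb2 R]_(x in [set: plane R]) (0 : R)); last first.
    by rewrite /Rintegral integral0.
  apply: eq_Rintegral => x _.
  pose q z := p z * gs2 r r (z.1 - x.1, z.2 - x.2).
  have iq : (leb2 R).-integrable setT (EFin \o q).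
    apply: (integrable_sqintM sp).
    exact: (sqtr (- x.1, - x.2) (gs2 r r) (sqint_gs2 r0' r0')).
  have := @Rintegral_skew1 R r r x.2 (fun=> x.1) r0' r0' (measurable_cst _) q iq.
  rewrite (gp0 x r r0) mulr0 => q0.
  have iq' := @integrable_skew1 R r r x.2 (fun=> x.1) r0' r0' (measurable_cst _) q iq.
  rewrite -(mulr0 (ind A B x)) -q0 -(RintegralZl _ measurableT iq').
  apply: eq_Rintegral => u _; rewrite /Phi /q /skew1 /gs2 /= !addrK !divr1.
  have rK (k : R) : r * k / r = k by rewrite mulrAC divff// mul1r.
  rewrite (rK u.1) (rK u.2) [r * _ + _]addrC [r * u.2 + _]addrC.
  have E : forall a b c e : R, a * b * (c * e) = c * (e * (a * b)) by move=> *; ring.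
  exact: E.
have Ii (s : plane R) : (leb2 R).-integrable setT
    (EFin \o (fun x : plane R => ind A B x * p (x.1 + s.1, x.2 + s.2))).
  by apply: integrable_sqintM; [exact: sAB|exact: (sqtr s p sp)].
have Ib s : `|I s| <= K.
  rewrite /I (le_trans (le_normr_Rintegral measurableT (Ii s)))//.
  rewrite -lee_fin /Rintegral fineK ?Kb//.
  exact: (integrable_fin_num measurableT (integrable_norm (Ii s))).
have Ic (u : plane R) : I (n.+1%:R^-1 * u.1, n.+1%:R^-1 * u.2) @[n --> \oo] --> I (0, 0).
  (* The shift is moved from [p], which need not be continuous, to the indicator, which converges
     off the lines carrying the sides. *)
  have IE s : I s = \int[leb2 R]_x (ind A B (x.1 - s.1, x.2 - s.2) * p x).
    have := @Rintegral_skew1 R 1 1 (- s.2) (fun=> - s.1) (oner_neq0 _) (oner_neq0 _)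
      (measurable_cst _) _ (Ii s).
    rewrite mulr1 normr1 invr1 mul1r /I => <-; apply: eq_Rintegral => x _.
    by rewrite /skew1 /= !mul1r !subrK -surjective_pairing.
  rewrite IE; under eq_fun do rewrite IE/=.
  (* All shifts are at most [|u.1|] and [|u.2|], so the indicator of this enlarged rectangle
     dominates every shifted one. *)
  pose A' : set R := `]a - (`|u.1| + 1), b + (`|u.1| + 1)]%classic.
  pose B' : set R := `]c - (`|u.2| + 1), d + (`|u.2| + 1)]%classic.
  apply: (@cvg_Rintegral_dominated_ae _ _ _ (leb2 R)
    (fun n x => ind A B (x.1 - n.+1%:R^-1 * u.1, x.2 - n.+1%:R^-1 * u.2) * p x)
    (fun x => ind A B (x.1 - 0, x.2 - 0) * p x) (fun x => `|ind A' B' x * p x|)).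
  - by move=> n; mfun.
  - by mfun.
  - near=> x; rewrite !subr0 -surjective_pairing; apply: cvgMl; rewrite /ind EA EB.
    apply: cvgM; apply: cvg_indic_ocitv; near: x; [exact: ae_coord1_neq|
      exact: ae_coord1_neq|exact: ae_coord2_neq|exact: ae_coord2_neq].
  - apply: integrable_norm; apply: integrable_sqintM => //.
    by apply: sind; exact: is_ocitv.
  - move=> n x; rewrite !normrM; apply: ler_wpM2r; first exact: normr_ge0.
    have nind E (v : R) : `|\1_E v| = \1_E v :> R by rewrite ger0_norm// indicE.
    rewrite !nind /= EA EB.
    have n1 (v : R) : `|n.+1%:R^-1 * v| <= `|v|.
      by rewrite normrM ler_piMl// ger0_norm ?invr_ge0// invf_le1// ler1n.
    have sub (e f t v : R) : \1_(`]e, f]%classic : set R) (t - n.+1%:R^-1 * v) <=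
        \1_(`]e - (`|v| + 1), f + (`|v| + 1)]%classic : set R) t :> R.
      rewrite !indicE; case: (boolP (_ \in `]e, f]%classic)) => [|_]; last exact: ler0n.
      rewrite inE/= in_itv/= => /andP[t1 t2].
      rewrite mem_set//= in_itv/=; move: t1 t2 (n1 v).
      move: (n.+1%:R^-1 * v) => q t1 t2; rewrite ler_norml => /andP[v1 v2].
      by apply/andP; split; lra.
    by apply: ler_pM; [rewrite indicE|rewrite indicE|exact: sub|exact: sub].
have lim : \int[leb2 R]_u (gs2 1 1 u * I (n.+1%:R^-1 * u.1, n.+1%:R^-1 * u.2))
    @[n --> \oo] --> \int[leb2 R]_u (gs2 1 1 u * I (0, 0)).
  apply: (@cvg_Rintegral_dominated _ _ _ (leb2 R)
    (fun n u => gs2 1 1 u * I (n.+1%:R^-1 * u.1, n.+1%:R^-1 * u.2))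
    (fun u => gs2 1 1 u * I (0, 0)) (fun u => K * gs2 1 1 u)).
  - move=> n; apply: measurable_funM => //.
    refine (@measurable_param_Rintegral _ _ _ _ R (leb2 R) (@sigma_finite_leb2 R)
      (fun u x : plane R => ind A B x * p (x.1 + n.+1%:R^-1 * u.1, x.2 + n.+1%:R^-1 * u.2)) _).
    by mfun.
  - by move=> u; apply: cvgMr; exact: Ic.
  - exact: (integrableZl measurableT K (integrable_gs2 (oner_neq0 R) (oner_neq0 R))).
  - by move=> n u; rewrite normrM ger0_norm ?gs2_ge0// mulrC ler_wpM2r// gs2_ge0.
have lim0 : \int[leb2 R]_u (gs2 1 1 u * I (0, 0)) = 0.
  move: lim; under eq_fun do rewrite step1 ?invr_gt0//.
  move=> lim; exact: (cvg_unique (@Rhausdorff R) lim (cvg_cst _)).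
move: lim0; rewrite RintegralZr//; last exact: (integrable_gs2 (oner_neq0 R) (oner_neq0 R)).
rewrite Rintegral_gs2 ?oner_neq0// mulr1 normr1 mul1r => /eqP.
rewrite mulf_eq0 mulrn_eq0/= gt_eqF ?pi_gt0//= => /eqP <-.
by apply: eq_Rintegral => x _; rewrite /ind /= !addr0 -surjective_pairing mulrC.
Unshelve. all: by end_near. Qed.

End density.

(** * The witness is a Schwartz function *)

Section schwartz_gauss.
Variable R : realType.

(** Polynomials times the Gaussian are closed under differentiation, [P] becoming [P' - X P]. Hence
    all iterated partial derivatives of the witness are tensor products [thg], and one bound treats
    them all. *)
Definition hg (P : {poly R}) (x : R) : R := P.[x] * gs x.

Lemma is_derive_hg P (x : R) : is_derive x 1 (hg P) (hg (P^`() - 'X * P) x).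
Proof.
have dP : is_derive (x : R) 1 (horner P) P^`().[x] by exact: is_derive_poly.
have := @is_deriveM _ _ (horner P) (@gs R) x 1 _ _ dP (is_derive_gs x).
rewrite /hg !hornerE => H; apply: is_derive_eq H _.
by rewrite -[LHS]/(P.[x] * (- x * gs x) + gs x * P^`().[x]); ring.
Qed.

Lemma hg_mono_bound P m : exists C : R, forall x, `|x ^+ m * hg P x| <= C.
Proof.
elim/poly_ind: P m => [|P c IH] m.
  by exists 0 => x; rewrite /hg horner0 mul0r mulr0 normr0.
have [C1 HC1] := IH m.+1; have [C2 C20 HC2] := @gs_mono_bound R m.
exists (C1 + `|c| * C2) => x.
have -> : x ^+ m * hg (P * 'X + c%:P) x = x ^+ m.+1 * hg P x + c * (x ^+ m * gs x).
  by rewrite /hg hornerMXaddC exprS; ring.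
rewrite (le_trans (ler_normD _ _))// lerD// normrM ler_wpM2l// normrM normrX.
rewrite (ger0_norm (gs_ge0 x)) (le_trans (HC2 x))// ler_piMr//.
by rewrite /gs4 -expR0 ler_expR oppr_le0 divr_ge0// sqr_ge0.
Qed.

Definition thg (PQ : {poly R} * {poly R}) (y : R * R) : R := hg PQ.1 y.1 * hg PQ.2 y.2.

Lemma differentiable_hg P (x : R) : differentiable (hg P) x.
Proof. by have [d _] := is_derive_hg P x; exact/derivable1_diffP. Qed.

Lemma differentiable_comp_fst (f : R -> R) (a : R * R) :
  differentiable f a.1 -> differentiable (fun y : R * R => f y.1) a.
Proof.
move=> df; apply: (@differentiable_comp R (R * R)%type R R fst f) => //.
by apply: (@linear_differentiable R (R * R)%type R fst) => x; exact: cvg_fst.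
Qed.

Lemma differentiable_comp_snd (f : R -> R) (a : R * R) :
  differentiable f a.2 -> differentiable (fun y : R * R => f y.2) a.
Proof.
move=> df; apply: (@differentiable_comp R (R * R)%type R R snd f) => //.
by apply: (@linear_differentiable R (R * R)%type R snd) => x; exact: cvg_snd.
Qed.

Lemma differentiable_thg PQ (a : R * R) : differentiable (thg PQ) a.
Proof.
apply: (@differentiableM R (R * R)%type (fun y => hg PQ.1 y.1) (fun y => hg PQ.2 y.2)).
- by apply: differentiable_comp_fst; exact: differentiable_hg.
- by apply: differentiable_comp_snd; exact: differentiable_hg.
Qed.

(** In a partial derivative of a tensor product, the factor in the other variable is differentiated
    along the direction 0. *)
Lemma is_derive_along0 (f : R -> R) (x : R) : differentiable f x -> is_derive x 0 f 0.
Proof.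
move=> df; split; first exact: diff_derivable.
by rewrite deriveE// linear0.
Qed.

Lemma is_derive_thg PQ (a v : R * R) d1 d2 :
  is_derive a.1 v.1 (hg PQ.1) d1 -> is_derive a.2 v.2 (hg PQ.2) d2 ->
  is_derive a v (thg PQ) (hg PQ.1 a.1 * d2 + hg PQ.2 a.2 * d1).
Proof.
move=> D1 D2.
have E1 : is_derive a v (fun y : R * R => hg PQ.1 y.1) d1.
  by case: D1 => e1 e2; split.
have E2 : is_derive a v (fun y : R * R => hg PQ.2 y.2) d2.
  by case: D2 => e1 e2; split.
exact: (@is_deriveM R (R * R)%type _ _ a v _ _ E1 E2).
Qed.

Definition pderiv_thg (i : bool) (PQ : {poly R} * {poly R}) :=
  if i then (PQ.1, PQ.2^`() - 'X * PQ.2) else (PQ.1^`() - 'X * PQ.1, PQ.2).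

Lemma pderiv_thgE i PQ : pderiv i (thg PQ) = thg (pderiv_thg i PQ).
Proof.
apply/funext => a; rewrite /pderiv; case: i => /=.
  have := @is_derive_thg PQ a (0, 1) _ _
    (is_derive_along0 (differentiable_hg _ _)) (is_derive_hg _ _).
  by case=> _ ->; rewrite /thg/= mulr0 addr0.
have := @is_derive_thg PQ a (1, 0) _ _ (is_derive_hg _ _)
  (is_derive_along0 (differentiable_hg _ _)).
by case=> _ ->; rewrite /thg/= mulr0 add0r mulrC.
Qed.

Lemma schwartz_thg PQ : schwartz_real (thg PQ).
Proof.
move=> s; have [PQ' ->] : exists PQ', foldr (@pderiv R) (thg PQ) s = thg PQ'.
  elim: s => [|i s [PQ' IH]]; first by exists PQ.
  by exists (pderiv_thg i PQ'); rewrite /= IH pderiv_thgE.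
split=> [x|m n]; first exact: differentiable_thg.
have [C1 H1] := hg_mono_bound PQ'.1 m; have [C2 H2] := hg_mono_bound PQ'.2 n.
exists (C1 * C2) => x; rewrite /thg mulrACA normrM.
exact: ler_pM.
Qed.

(** Minus the second [y2]-derivative of [exp (- |y|^2 / 2)]: it oscillates in [y2] only. *)
Definition psiR (y : plane R) : R := (1 - y.2 ^+ 2) * (gs y.1 * gs y.2).

Lemma schwartz_psiR : schwartz (fun y => real_complex R (psiR y)).
Proof.
split => /=.
  suff -> : psiR = thg (1, 1 - 'X^2) by exact: schwartz_thg.
  apply/funext => y; rewrite /thg /hg /psiR /= !hornerE.
  by congr (_ * _); exact: mulrC.
suff -> : (fun _ : R * R => 0 : R) = thg (0, 0) by exact: schwartz_thg.
by apply/funext => y; rewrite /thg /hg /= !horner0 !mul0r.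
Qed.

End schwartz_gauss.

(** * The Mexican hat and Gaussian means over dilations *)

Section mexican_hat.
Variable R : realType.

Lemma integrable_bounded_mono_gs (f : R -> R) (C : R) k : measurable_fun [set: R] f ->
  (forall x, `|f x| <= C) ->
  (leb1 R).-integrable setT (EFin \o (fun u => f u * (u ^+ k * gs u))).
Proof.
move=> mf fC; have [D D0 gD] := @gs_mono_bound R k.
apply: (@integrable_dominated _ _ _ (leb1 R) _ (fun u => C * (D * gs4 u))).
- apply: measurable_funM => //; apply: measurable_funM; last exact: measurable_gs.
  exact: measurable_funX.
- exact: (integrableZl measurableT C (integrableZl measurableT D (@integrable_gs4 R))).
- move=> u; rewrite normrM; apply: ler_pM => //.
  by rewrite normrM normrX (ger0_norm (gs_ge0 u)).
Qed.

Definition hat (t : R) : R := (1 - t ^+ 2) * gs t.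

Lemma hat_bound : exists2 C : R, 0 <= C & forall t, `|hat t| <= C * gs4 t.
Proof.
have [C C0 H] := @gs_mono_bound R 0; have [D D0 K] := @gs_mono_bound R 2.
exists (C + D) => [|t]; first exact: addr_ge0.
rewrite /hat mulrBl (le_trans (ler_normB _ _))// mulrDl; apply: lerD.
  by have := H t; rewrite expr0 !mul1r (ger0_norm (gs_ge0 t)).
by rewrite normrM normrX (ger0_norm (gs_ge0 t)).
Qed.

Lemma integrable_bounded_hat (f : R -> R) (C : R) : measurable_fun [set: R] f ->
  (forall x, `|f x| <= C) ->
  (leb1 R).-integrable setT (EFin \o (fun u => f u * hat u)).
Proof.
move=> mf fC; have := integrableB measurableT (integrable_bounded_mono_gs 0 mf fC)
  (integrable_bounded_mono_gs 2 mf fC).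
by apply: eq_integrable => // u _; rewrite /= /hat -EFinB; congr EFin; ring.
Qed.

Section dilation.
Variables (f : R -> R) (C : R).
Hypotheses (mf : measurable_fun [set: R] f) (fC : forall x, `|f x| <= C).

Definition dilation_mean (s : R) := \int[leb1 R]_y (f y * (s * gs (s * y))).

(** The substitution [t = s y] moves the scale into the argument of [f], the form in which limits in
    [s] follow by dominated convergence. *)
Lemma dilation_meanE s : 0 < s ->
  dilation_mean s = \int[leb1 R]_t (f (s^-1 * t) * gs t).
Proof.
move=> s0; have s0' : s != 0 by rewrite gt_eqF.
have mfs : measurable_fun [set: R] (fun t => f (s^-1 * t)) by mfun.
have ifs := @integrable_bounded_mono_gs _ C 0 mfs (fun x => fC _).
have := Rintegral_affine 0 s0' ifs; rewrite /= gtr0_norm// => H.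
rewrite (_ : \int[leb1 R]_t _ = \int[leb1 R]_t (f (s^-1 * t) * (t ^+ 0 * gs t))); last first.
  by apply: eq_Rintegral => t _; rewrite expr0 mul1r.
have iz : (leb1 R).-integrable setT (EFin \o (fun y => f y * (s * gs (s * y)))).
  have := integrableZl measurableT s (integrable_affine 0 s0' ifs).
  apply: eq_integrable => // t _; rewrite /= -EFinM addr0 expr0 mul1r mulKf//.
  by congr EFin; ring.
apply: (mulfI (invr_neq0 s0')); rewrite -H -(RintegralZl _ measurableT iz).
apply: eq_Rintegral => t _; rewrite addr0 expr0 mul1r mulKf//.
by rewrite mulrCA mulKf.
Qed.

(** The point is that [d/ds (s gs (s y)) = hat (s y)]; the rest is differentiation under the
    integral. *)
Lemma is_derive_dilation_mean (s : R) : 0 < s ->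
  is_derive s 1 dilation_mean (\int[leb1 R]_y (f y * hat (s * y))).
Proof.
move=> s0; pose F (s y : R) := f y * (s * gs (s * y)).
have d (x y : R) : is_derive x 1 (F ^~ y) (f y * hat (x * y)).
  have d1 : is_derive x 1 (fun z : R => gs (z * y)) (y * (- (x * y) * gs (x * y))).
    have /is_derive_eq := @is_derive1_comp R (@gs R) (fun z => z * y) x _ _
      (is_derive_gs (x * y)) (is_derive_mulr y x).
    by apply; rewrite mulrC.
  have d2 : is_derive x 1 (fun z : R => z * gs (z * y)) (hat (x * y)).
    have /is_derive_eq := is_deriveM (is_derive_id x 1) d1.
    by apply; rewrite /hat /GRing.scale/=; ring.
  have /is_derive_eq := is_deriveM (is_derive_cst (f y) x 1) d2.
  by apply; rewrite /GRing.scale/=; ring.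
(* On this neighbourhood the scale stays above [s / 2], so [gs4 (s / 2 * y)] dominates the
   derivatives uniformly. *)
have sI : `]s / 2, s * 2[%classic s.
  rewrite /= in_itv/=; apply/andP; split; first by rewrite ltr_pdivrMr// ltr_pMr// ltr1n.
  by rewrite ltr_pMr// ltr1n.
have I0 x : `]s / 2, s * 2[%classic x -> s / 2 < x /\ 0 < x.
  rewrite /= in_itv/= => /andP[x1 _]; split=> //; apply: lt_trans x1.
  by rewrite divr_gt0.
have Fi x : `]s / 2, s * 2[%classic x -> (leb1 R).-integrable setT (EFin \o F x).
  move=> /I0[_ x0]; have x0' : x != 0 by rewrite gt_eqF.
  have mfs : measurable_fun [set: R] (fun t => f (x^-1 * t)) by mfun.
  have ifs := @integrable_bounded_mono_gs _ C 0 mfs (fun x => fC _).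
  have := integrableZl measurableT x (integrable_affine 0 x0' ifs).
  apply: eq_integrable => // t _; rewrite /= -EFinM addr0 expr0 mul1r mulKf//.
  by congr EFin; rewrite /F; ring.
have [D D0 hD] := hat_bound.
pose G y := C * (D * gs4 (s / 2 * y)).
have C0 : 0 <= C by apply: le_trans (fC 0); exact: normr_ge0.
have G0 y : 0 <= G y by rewrite !mulr_ge0// expR_ge0.
have s20 : s / 2 != 0 by rewrite gt_eqF// divr_gt0.
have iG : (leb1 R).-integrable setT (EFin \o G).
  have := integrable_affine 0 s20 (@integrable_gs4 R) => H.
  have := integrableZl measurableT C (integrableZl measurableT D H).
  by apply: eq_integrable => // y _ /=; rewrite /G addr0.
have df x y : `]s / 2, s * 2[%classic x -> setT y -> derivable (F ^~ y) x 1.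
  by move=> _ _; exact: ex_derive.
have Gub x y : `]s / 2, s * 2[%classic x -> setT y -> `|partial1of2 F x y| <= G y.
  move=> /I0[x1 x0] _; rewrite partial1of2E derive_val normrM /G ler_pM//.
  rewrite (le_trans (hD _))// ler_wpM2l// ler_expR lerN2 ler_pM2r// !exprMn.
  rewrite ler_wpM2r ?sqr_ge0//.
  by rewrite -exprMn lerXn2r ?nnegrE ?(ltW x0) ?(ltW x1) ?divr_ge0 ?(ltW s0)//.
have DD := @derivable_under_integral R _ _ (leb1 R) F setT measurableT s _ _ sI Fi df _ G0 iG Gub.
have E := @differentiation_under_integral R _ _ (leb1 R) F setT measurableT s _ _ sI Fi df _ G0 iG Gub.
have -> : \int[leb1 R]_y (f y * hat (s * y)) = 'D_1 dilation_mean s.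
  rewrite -derive1E /dilation_mean E.
  by apply: eq_Rintegral => u _; rewrite partial1of2E derive_val.
exact: derivableP.
Qed.

(* The hat is minus the derivative of the dilations of the Gaussian, so the
   Gaussian means of f at all scales agree; compare scales 0 and oo. *)
Lemma eq0_of_hat_dilations :
  (forall x, x != 0 -> \int[leb1 R]_t (hat t * f (x * t)) = 0) ->
  (forall t, f (n.+1%:R^-1 * t) @[n --> \oo] --> f 0) ->
  (forall t, t != 0 -> f (n.+1%:R * t) @[n --> \oo] --> (0 : R)) ->
  f 0 = 0.
Proof.
move=> j0 f0 foo.
have D0 (s : R) : 0 < s -> \int[leb1 R]_y (f y * hat (s * y)) = 0.
  move=> s0; have s0' : s != 0 by rewrite gt_eqF.
  have mfs : measurable_fun [set: R] (fun t => f (s^-1 * t)) by mfun.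
  have ifs := @integrable_bounded_hat _ C mfs (fun x => fC _).
  have := Rintegral_affine 0 s0' ifs.
  rewrite (_ : \int[leb1 R]_x (f (s^-1 * x) * hat x) = 0); last first.
    by rewrite -(j0 (s^-1)) ?invr_eq0//; apply: eq_Rintegral => t _; rewrite mulrC.
  rewrite mulr0 => <-; apply: eq_Rintegral => t _.
  by rewrite addr0 mulKf.
have V1 (s t : R) : 0 < s -> s < t -> dilation_mean s = dilation_mean t.
  move=> s0 st.
  have d (x : R) : 0 < x -> is_derive x 1 dilation_mean 0.
    by move=> x0; have := is_derive_dilation_mean x0; rewrite D0.
  have [||c cst] := @MVT R dilation_mean (fun=> 0) s t st.
  - by move=> x; rewrite in_itv/= => /andP[sx _]; apply: d; exact: lt_trans sx.
  - apply: derivable_within_continuous => x; rewrite in_itv/= => /andP[sx _].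
    have x0 := lt_le_trans s0 sx; have [] := d _ x0 => //.
  - by rewrite mul0r => /eqP; rewrite subr_eq0 eq_sym => /eqP.
have V (n : nat) : dilation_mean n.+1%:R = dilation_mean 1.
  case: n => [//|n]; apply/esym; apply: V1 => //; by rewrite ltr1n.
have W (n : nat) : dilation_mean n.+1%:R^-1 = dilation_mean 1.
  case: n => [|n]; first by rewrite invr1.
  by apply: V1; rewrite ?invr_gt0// invf_lt1// ltr1n.
have igs : (leb1 R).-integrable setT (EFin \o (fun t => C * gs t)).
  have mC : measurable_fun [set: R] (fun _ : R => C) by [].
  have := @integrable_bounded_mono_gs _ `|C| 0 mC (fun=> lexx _).
  by apply: eq_integrable => // t _ /=; rewrite expr0 mul1r.
have mfs (a : R) : measurable_fun [set: R] (fun t => f (a * t) * gs t) by mfun.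
have fb (a t : R) : `|f (a * t) * gs t| <= C * gs t.
  by rewrite normrM (ger0_norm (gs_ge0 t)) ler_wpM2r ?gs_ge0.
(* Scales tending to infinity contract the argument of [f] to 0; scales tending to 0 send it to
   infinity, except at [t = 0]. *)
have L1 : dilation_mean n.+1%:R @[n --> \oo] --> \int[leb1 R]_t (f 0 * gs t).
  under eq_fun do rewrite dilation_meanE//.
  apply: (@cvg_Rintegral_dominated _ _ _ (leb1 R)
    (fun n t => f (n.+1%:R^-1 * t) * gs t) _ (fun t => C * gs t)) => //.
  - by move=> n; exact: mfs.
  - by move=> t; apply: cvgMl; exact: f0.
have L2 : dilation_mean n.+1%:R^-1 @[n --> \oo] --> \int[leb1 R]_(t in [set: R]) (0 : R).
  under eq_fun do rewrite dilation_meanE ?invr_gt0// invrK.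
  apply: (@cvg_Rintegral_dominated_ae _ _ _ (leb1 R)
    (fun n t => f (n.+1%:R * t) * gs t) _ (fun t => C * gs t)) => //.
  - by move=> n; exact: mfs.
  - exists [set 0]; split; [exact: measurable_set1|exact: lebesgue_measure_set1|].
    move=> t /= H; apply: contrapT => /eqP t0; apply: H.
    by rewrite -(mul0r (gs t)); apply: cvgMl; exact: foo.
have E1 : dilation_mean 1 = f 0 * Num.sqrt (pi *+ 2).
  move: L1; under eq_fun do rewrite V.
  move=> /(cvg_unique (@Rhausdorff R) (cvg_cst _)) ->.
  rewrite RintegralZl ?Rintegral_gs//.
  have c1 : continuous (fun _ : R => 1 : R) by move=> u; exact: cvg_cst.
  have n1 (u : R) : `|1 : R| <= 1 by rewrite normr1.
  by apply: eq_integrable (integrable_mono_gs 0 c1 n1) => // u _ /=; rewrite expr0 !mul1r.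
have E2 : dilation_mean 1 = 0.
  move: L2; under eq_fun do rewrite W.
  by move=> /(cvg_unique (@Rhausdorff R) (cvg_cst _)) ->; rewrite /Rintegral integral0.
move: E1; rewrite E2 => /esym/eqP; rewrite mulf_eq0 => /orP[/eqP//|].
by rewrite gt_eqF// sqrtr_gt0 mulrn_wgt0// pi_gt0.
Qed.

End dilation.

End mexican_hat.

(** * Gaussian smoothing of a square integrable function *)

Section bump_average.
Variable R : realType.
Variables (p : plane R -> R) (r : R).
Hypotheses (sp : sqint (leb2 R) p) (r0 : 0 < r).

Let r0' : r != 0. Proof. by rewrite gt_eqF. Qed.
Let mp : measurable_fun setT p. Proof. by have [] := sp. Qed.
Let ip2 : (leb2 R).-integrable setT (EFin \o (fun z => p z ^+ 2)).
Proof. by have [] := sp. Qed.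

Definition gbump (w z : plane R) : R := gs2 r r (w.1 - z.1, w.2 - z.2).
(** Unlike [p] itself, its smoothing is bounded, sequentially continuous and vanishes along
    horizontal lines at infinity, which is what restriction to such a line requires. *)
Definition bump_avg (w : plane R) : R := \int[leb2 R]_z (p z * gbump w z).

Lemma measurable_bump d (T : measurableType d) (f g : T -> plane R) :
  measurable_fun setT f -> measurable_fun setT g ->
  measurable_fun setT (fun t => gbump (f t) (g t)).
Proof. by move=> mf mg; rewrite /gbump /gs2 /=; mfun. Qed.

Lemma bump_ge0 w z : 0 <= gbump w z. Proof. exact: gs2_ge0. Qed.
Lemma bump_le1 w z : gbump w z <= 1. Proof. exact: gs2_le1. Qed.

Lemma reflect_skew1 (w : plane R) :
  (fun z : plane R => (w.1 - z.1, w.2 - z.2)) = skew1 (-1) (-1) w.2 (fun=> w.1).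
Proof. by apply/funext => z; rewrite /skew1 !mulN1r ![- _ + _]addrC. Qed.

Let N10 : (-1 : R) != 0. Proof. by rewrite oppr_eq0 oner_eq0. Qed.

Lemma integrable_reflect (w : plane R) (q : plane R -> R) :
  (leb2 R).-integrable setT (EFin \o q) ->
  (leb2 R).-integrable setT (EFin \o (fun z => q (w.1 - z.1, w.2 - z.2))).
Proof.
move=> iq; have := @integrable_skew1 R (-1) (-1) w.2 (fun=> w.1) N10 N10 (measurable_cst _) q iq.
by rewrite -reflect_skew1.
Qed.

Lemma Rintegral_reflect (w : plane R) (q : plane R -> R) :
  (leb2 R).-integrable setT (EFin \o q) ->
  \int[leb2 R]_z q (w.1 - z.1, w.2 - z.2) = \int[leb2 R]_z q z.
Proof.
move=> iq; have := @Rintegral_skew1 R (-1) (-1) w.2 (fun=> w.1) N10 N10 (measurable_cst _) q iq.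
by rewrite -reflect_skew1 mulrNN mulr1 normr1 invr1 mul1r.
Qed.

Lemma integrable_bump w : (leb2 R).-integrable setT (EFin \o gbump w).
Proof. exact: integrable_reflect (integrable_gs2 r0' r0'). Qed.

Lemma sqint_bump w : sqint (leb2 R) (gbump w).
Proof.
apply: (@sqint_bounded_integrable _ _ _ (leb2 R) _ 1); last 2 first.
- exact: integrable_bump.
- by move=> z; rewrite ger0_norm ?bump_ge0// bump_le1.
- by apply: measurable_bump; [exact: measurable_cst|exact: measurable_id].
Qed.

Lemma integrable_avg w : (leb2 R).-integrable setT (EFin \o (fun z => p z * gbump w z)).
Proof. exact: integrable_sqintM sp (sqint_bump w). Qed.

Lemma measurable_bump_avg : measurable_fun setT bump_avg.
Proof.
apply: (@measurable_param_Rintegral _ _ _ _ R (leb2 R) (@sigma_finite_leb2 R)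
  (fun w z : plane R => p z * gbump w z)).
by apply: measurable_funM; [mfun|apply: measurable_bump; mfun].
Qed.

Lemma integrable_sqr_bump w :
  (leb2 R).-integrable setT (EFin \o (fun z => p z ^+ 2 * gbump w z)).
Proof.
apply: (@integrable_dominated _ _ _ (leb2 R) _ (fun z => p z ^+ 2)) => //.
- by apply: measurable_funM; [mfun|apply: measurable_bump; mfun].
- move=> z; rewrite normrM (ger0_norm (bump_ge0 w z)) ger0_norm ?sqr_ge0//.
  by rewrite ler_piMr ?sqr_ge0// bump_le1.
Qed.

(** Integrates [|p| <= p^2 / l + l] against the bump, whose mass is [2 pi r^2]. The choice [l = 1]
    gives boundedness, a small [l] gives decay. *)
Lemma bump_avg_bound w (l : R) : 0 < l -> `|bump_avg w| <=
  l^-1 * \int[leb2 R]_z (p z ^+ 2 * gbump w z) + l * (`|r * r| * (pi *+ 2)).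
Proof.
move=> l0; rewrite (le_trans (le_normr_Rintegral measurableT (integrable_avg w)))//.
have -> : `|r * r| * (pi *+ 2) = \int[leb2 R]_z gbump w z.
  by rewrite (Rintegral_reflect w (integrable_gs2 r0' r0')) Rintegral_gs2.
have i1 := integrable_sqr_bump w; have i2 := integrable_bump w.
rewrite -!RintegralZl// -RintegralD//; first last.
- exact: (integrableZl measurableT l i2).
- exact: (integrableZl measurableT l^-1 i1).
apply: le_Rintegral => //.
- exact: (integrable_norm (integrable_avg w)).
- exact: (integrableD measurableT (integrableZl measurableT l^-1 i1)
    (integrableZl measurableT l i2)).
move=> z _; rewrite normrM (ger0_norm (bump_ge0 w z)) mulrA -mulrDl.
rewrite ler_wpM2r ?bump_ge0// -(real_normK (num_real (p z))).
rewrite -(ler_pM2l l0) mulrDr mulrA divff ?gt_eqF// mul1r.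
have := sqr_ge0 (`|p z| - l); rewrite sqrrB => H.
have : 0 <= l * `|p z| by rewrite mulr_ge0// ltW.
by move: H; rewrite -mulr_natl; nra.
Qed.

Lemma bump_avg_bounded : exists2 C : R, 0 <= C & forall w, `|bump_avg w| <= C.
Proof.
exists (\int[leb2 R]_z (p z ^+ 2) + `|r * r| * (pi *+ 2)).
  rewrite addr_ge0//; first by apply: Rintegral_ge0 => z _; exact: sqr_ge0.
  by rewrite mulr_ge0// mulrn_wge0// pi_ge0.
move=> w; rewrite (le_trans (bump_avg_bound w ltr01))// invr1 !mul1r lerD2r.
apply: le_Rintegral => //; first exact: integrable_sqr_bump.
by move=> z _; rewrite ler_piMr ?sqr_ge0// bump_le1.
Qed.

(** The difference of the exponents is the square [(x + 2 d)^2 / 4]. Bounded shifts of a Gaussian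
    thus have a common majorant, at the price of a constant and some width. *)
Lemma gs_shift_bound (x d : R) : gs (x + d) <= expR (d ^+ 2 / 2) * gs4 x.
Proof.
rewrite /gs /gs4 -expRD ler_expR.
rewrite -subr_ge0 (_ : _ - _ = (x + 2 * d) ^+ 2 / 4); last by field.
by rewrite divr_ge0// sqr_ge0.
Qed.

Lemma cvg_bump_avg (w : nat -> plane R) (w0 : plane R) :
  (w n).1 @[n --> \oo] --> w0.1 -> (w n).2 @[n --> \oo] --> w0.2 ->
  bump_avg (w n) @[n --> \oo] --> bump_avg w0.
Proof.
move=> w1 w2.
(* A convergent sequence of centres stays at bounded distance from its limit, which makes the
   majorant from [gs_shift_bound] uniform in [n]. *)
have [M M0 HM] : exists2 M : R, 0 <= M &
    forall n, `|(w n).1 - w0.1| <= M /\ `|(w n).2 - w0.2| <= M.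
  have c1 : (w n).1 - w0.1 @[n --> \oo] --> (0 : R).
    by rewrite -(subrr w0.1); apply: cvgB => //; exact: cvg_cst.
  have c2 : (w n).2 - w0.2 @[n --> \oo] --> (0 : R).
    by rewrite -(subrr w0.2); apply: cvgB => //; exact: cvg_cst.
  have /cvg_seq_bounded[M1 [_ /(_ _ (ltr_pwDr ltr01 (ler_norm M1))) H1]] := cvgP _ c1.
  have /cvg_seq_bounded[M2 [_ /(_ _ (ltr_pwDr ltr01 (ler_norm M2))) H2]] := cvgP _ c2.
  exists ((`|M1| + 1) + (`|M2| + 1)); first by rewrite !addr_ge0.
  move=> n; split.
    by rewrite (le_trans (H1 n I))// lerDl addr_ge0.
  by rewrite (le_trans (H2 n I))// lerDr addr_ge0.
pose K := expR ((M / r) ^+ 2 / 2).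
pose G (z : plane R) := gs4 ((w0.1 - z.1) / r) * gs4 ((w0.2 - z.2) / r).
have gs40 (x : R) : 0 <= gs4 x by exact: expR_ge0.
have m4 : measurable_fun [set: R] (@gs4 R) by rewrite /gs4; mfun.
have i4 : (leb1 R).-integrable setT (EFin \o (fun x => gs4 (x / r))).
  have r10 : r^-1 != 0 by rewrite invr_eq0.
  have := integrable_affine 0 r10 (@integrable_gs4 R).
  by apply: eq_integrable => // u _ /=; rewrite addr0 mulrC.
have sG : sqint (leb2 R) G.
  apply: (@sqint_bounded_integrable _ _ _ (leb2 R) _ 1).
  - by rewrite /G; mfun.
  - exact: (integrable_reflect w0 (integrable_tensor i4 i4)).
  - move=> z; rewrite ger0_norm ?mulr_ge0// mulr_ile1//.
    + by rewrite /gs4 -expR0 ler_expR oppr_le0 divr_ge0// sqr_ge0.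
    + by rewrite /gs4 -expR0 ler_expR oppr_le0 divr_ge0// sqr_ge0.
have gK (x y z : R) : `|x - y| <= M -> gs ((x - z) / r) <= K * gs4 ((y - z) / r).
  move=> xy; rewrite (_ : (x - z) / r = (y - z) / r + (x - y) / r); last by field.
  rewrite (le_trans (gs_shift_bound _ _))// ler_wpM2r// ler_expR ler_pM2r//.
  rewrite -(real_normK (num_real ((x - y) / r))) lerXn2r// ?nnegrE.
  - by rewrite divr_ge0// ltW.
  - by rewrite normrM normfV (gtr0_norm r0) ler_pM2r ?invr_gt0.
have K0 : 0 <= K by exact: expR_ge0.
apply: (@cvg_Rintegral_dominated _ _ _ (leb2 R)
  (fun n z => p z * gbump (w n) z) _ (fun z => (K * K) * `|p z * G z|)).
- by move=> n; apply: measurable_funM; [mfun|apply: measurable_bump; mfun].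
- move=> z; apply: cvgMr; rewrite /gbump /gs2 /=; apply: cvgM.
  + apply: continuous_cvg; first exact: continuous_gs.
    by apply: cvgMl; apply: cvgB => //; exact: cvg_cst.
  + apply: continuous_cvg; first exact: continuous_gs.
    by apply: cvgMl; apply: cvgB => //; exact: cvg_cst.
- exact: (integrableZl measurableT (K * K) (integrable_norm (integrable_sqintM sp sG))).
- move=> n z; rewrite (normrM (p z)) (normrM (p z)) mulrCA; apply: ler_wpM2l => //.
  rewrite (ger0_norm (bump_ge0 _ _)) ger0_norm ?mulr_ge0// /G mulrACA /gbump /gs2 /=.
  have [h1 h2] := HM n.
  by rewrite ler_pM ?gs_ge0// gK.
Qed.

(** The term with [p^2] in [bump_avg_bound] tends to 0 by dominated convergence for each fixed [l];
    the other term is small with [l]. *)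
Lemma cvg0_bump_avg (w : nat -> plane R) :
  (forall x, gs (((w n).1 - x) / r) @[n --> \oo] --> (0 : R)) ->
  bump_avg (w n) @[n --> \oo] --> (0 : R).
Proof.
move=> w0; have A0 : \int[leb2 R]_z (p z ^+ 2 * gbump (w n) z) @[n --> \oo] -->
    \int[leb2 R]_(z in [set: plane R]) (0 : R).
  apply: (@cvg_Rintegral_dominated _ _ _ (leb2 R)
    (fun n z => p z ^+ 2 * gbump (w n) z) _ (fun z => p z ^+ 2)) => //.
  - by move=> n; apply: measurable_funM; [mfun|apply: measurable_bump; mfun].
  - move=> z; rewrite -(mulr0 (p z ^+ 2)); apply: cvgMr.
    apply: (squeeze_cvgr _ (cvg_cst 0) (w0 z.1)); apply: nearW => n.
    by rewrite bump_ge0 /gbump /gs2 /= ler_piMr ?gs_ge0// gs_le1.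
  - move=> n z; rewrite normrM (ger0_norm (bump_ge0 _ z)) ger0_norm ?sqr_ge0//.
    by rewrite ler_piMr ?sqr_ge0// bump_le1.
have Z0 : \int[leb2 R]_(z in [set: plane R]) (0 : R) = 0 by rewrite /Rintegral integral0.
move: A0; rewrite Z0.
move=> A0; apply/cvgr0Pnorm_le => e e0.
pose B := `|r * r| * (pi *+ 2) : R.
have B0 : 0 <= B by rewrite mulr_ge0// mulrn_wge0// pi_ge0.
(* With this choice [l * B <= e / 2]; the denominator [B + 1] avoids a division by zero. *)
pose l := e / 2 / (B + 1).
have l0 : 0 < l by rewrite !divr_gt0// ltr_pwDr.
have le0 : 0 < l * (e / 2) by rewrite mulr_gt0// divr_gt0.
have /cvgr0Pnorm_le hA := A0; have {}hA := hA _ le0.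
near=> n; rewrite (le_trans (bump_avg_bound (w n) l0))// [leRHS]splitr lerD//.
  rewrite ler_pdivrMl// (le_trans (ler_norm _))//.
  by near: n.
have : l * B <= e / 2; last by [].
by rewrite /l mulrAC ler_pdivrMr ?ltr_pwDr// ler_wpM2l ?divr_ge0 ?(ltW e0)// lerDl.
Unshelve. all: by end_near. Qed.

End bump_average.

(** * Structure of the shearlet group *)

Section shearlet_group_structure.
Variable R : realType.

(** The sign and the scale are merged into one parameter [s = e a^(1/2)], so that [e a = s |s|] and
    products become polynomial in [s], [|s|] and [b]. *)
Definition shr (s b : R) : 'M[R]_2 := mx22 (s * `|s|) b 0 s.

Lemma shearletP (h : 'M[R]_2) :
  shearlet_group h <-> exists s b, s != 0 /\ h = shr s b.
Proof.
split=> [[e [a [b [e1 a0 ->]]]]|[s [b [s0 ->]]]].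
  have e2 : e * e = 1 by case: e1 => ->; rewrite ?mulrNN mulr1.
  exists (e * Num.sqrt a), (e * b); split.
    rewrite mulf_neq0//; last by rewrite gt_eqF// sqrtr_gt0.
    by apply/eqP => e0; move: e2; rewrite e0 mul0r => /esym/eqP; rewrite oner_eq0.
  have ne : `|e| = 1 by case: e1 => ->; rewrite ?normrN normr1.
  rewrite /shr normrM ne mul1r ger0_norm ?sqrtr_ge0// -mulrA -expr2 sqr_sqrtr ?ltW//.
  rewrite powR12_sqrt ?ltW//; apply/matrixP => i j; rewrite !mxE.
  by case: ifP => _; case: ifP => _ //; rewrite mulr0.
exists (Num.sg s), (s ^+ 2), (Num.sg s * b); split.
- by have [|] := ltrP s 0 => [/ltr0_sg ->|]; [right|rewrite le_eqVlt eq_sym (negbTE s0)/= => /gtr0_sg ->; left].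
- by rewrite exprn_even_gt0.
- have sgs : Num.sg s * Num.sg s = 1 by rewrite -expr2 sqr_sg s0.
  rewrite /shr powR12_sqrt ?sqr_ge0// sqrtr_sqr; apply/matrixP => i j; rewrite !mxE.
  case: ifP => _; case: ifP => _; rewrite ?mulr0 ?mulrA ?sgs ?mul1r//.
    by rewrite normrEsg mulrCA mulrA.
  by rewrite -numEsg.
Qed.

Lemma shr_mul s b t c : shr s b *m shr t c = shr (s * t) (s * `|s| * c + b * t).
Proof. by rewrite /shr mulmx22 normrM; apply: mx22_eq; ring. Qed.

Lemma det_shr s b : \det (shr s b) = s ^+ 2 * `|s|.
Proof. by rewrite det_mx22E; ring. Qed.

Lemma shr_unit s b : s != 0 -> shr s b \in unitmx.
Proof. by move=> s0; rewrite unitmxE det_shr unitfE mulf_neq0 ?normr_eq0 ?expf_neq0. Qed.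

Lemma normr_det_shr s b : `|\det (shr s b)| = `|s| ^+ 3.
Proof. by rewrite det_shr normrM normrX normr_id -exprSr. Qed.

Lemma invmx_shr s b : s != 0 ->
  invmx (shr s b) = mx22 ((s * `|s|)^-1) (- b / (s ^+ 2 * `|s|)) 0 s^-1.
Proof.
move=> s0; have n0 : `|s| != 0 by rewrite normr_eq0.
rewrite /shr invmx_mx22; first by apply: mx22_eq; rewrite ?oppr0 ?mul0r//; field; rewrite ?n0 ?s0.
by rewrite mulr0 subr0 !mulf_neq0.
Qed.

Lemma shearlet_unit (h : 'M[R]_2) : shearlet_group h -> h \in unitmx.
Proof. by move=> /shearletP[s [b [s0 ->]]]; exact: shr_unit. Qed.

Lemma shearletM (h k : 'M[R]_2) : shearlet_group h -> shearlet_group k ->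
  shearlet_group (h *m k).
Proof.
move=> /shearletP[s [b [s0 ->]]] /shearletP[t [c [t0 ->]]].
by apply/shearletP; exists (s * t), (s * `|s| * c + b * t); rewrite shr_mul mulf_neq0.
Qed.

Lemma shearletV (h : 'M[R]_2) : shearlet_group h -> shearlet_group (invmx h).
Proof.
move=> /shearletP[s [b [s0 ->]]]; apply/shearletP.
exists s^-1, (- b / (s ^+ 2 * `|s|)); rewrite invr_eq0 s0; split=> //.
by rewrite invmx_shr// /shr normfV invfM.
Qed.

Lemma shearlet_entryP (h : 'M[R]_2) : shearlet_group h <->
  [/\ h ord_max ord0 = 0, h ord_max ord_max != 0 &
      h ord0 ord0 = h ord_max ord_max * `|h ord_max ord_max|].
Proof.
split=> [/shearletP[s [b [s0 ->]]]|[h10 h11 h00]]; first by rewrite !mx22_ij.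
apply/shearletP; exists (h ord_max ord_max), (h ord0 ord_max); split=> //.
by rewrite [LHS]mx22E /shr h10 h00.
Qed.

Lemma measurable_shearlet : measurable (@shearlet_group R : set (borelM R)).
Proof.
have me i j := @measurable_entry R i j.
have -> : @shearlet_group R = ((fun h : borelM R => h ord_max ord0) @^-1` [set 0]) `&`
    ~` ((fun h : borelM R => h ord_max ord_max) @^-1` [set 0]) `&`
    ((fun h : borelM R => h ord0 ord0 - h ord_max ord_max * `|h ord_max ord_max|) @^-1` [set 0]).
  apply/seteqP; split=> h.
    by move=> /shearlet_entryP[h10 h11 h00]; split; [split=> //=; exact/eqP|rewrite /= h00 subrr].
  move=> [[h10 h11] /= /eqP]; rewrite subr_eq0 => /eqP h00.
  by apply/shearlet_entryP; split=> //; exact/eqP.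
have H0 (f : borelM R -> R) : measurable_fun setT f -> measurable (f @^-1` [set 0]).
  by move=> mf; rewrite -[X in measurable X]setTI; apply: mf => //; exact: measurable_set1.
apply: measurableI; first apply: measurableI.
- exact: H0.
- by apply: measurableC; exact: H0.
- by apply: H0; have m1 := me ord_max ord_max; have m2 := me ord0 ord0; mfun.
Qed.

End shearlet_group_structure.

Section gaussian_limits.
Variable R : realType.

Lemma cvg0_gs_arith (a b : R) : b != 0 -> gs (a + n.+1%:R * b) @[n --> \oo] --> (0 : R).
Proof.
move=> b0; have b20 : 0 < b ^+ 2 / 4 by rewrite divr_gt0// exprn_even_gt0.
pose K : R := expR (a ^+ 2 / 2) * (b ^+ 2 / 4)^-1.
have K0 : K * n.+1%:R^-1 @[n --> \oo] --> (0 : R).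
  by rewrite -(mulr0 K); apply: cvgMr; exact: cvg_harmonic.
apply: (squeeze_cvgr _ (cvg_cst 0) K0); apply: nearW => n.
rewrite gs_ge0 addrC (le_trans (gs_shift_bound _ _))// /K -mulrA ler_wpM2l ?expR_ge0//.
rewrite /gs4 expRN -invfM lef_pV2 ?posrE ?expR_gt0//; last by rewrite mulr_gt0.
rewrite (le_trans _ (expR_ge1Dx _))// (@le_trans _ _ ((n.+1%:R * b) ^+ 2 / 4))//.
  rewrite exprMn -[leRHS]mulrA [leLHS]mulrC; apply: ler_wpM2r; first exact: ltW.
  by rewrite expr2 ler_peMl// ler1n.
by rewrite lerDr.
Qed.

End gaussian_limits.

Section Rintegral_abs.
Context d (T : measurableType d) (R : realType) (mu : {measure set T -> \bar R}).

(** When the integral of [f] is infinite, its [fine] value is 0, so the bound persists. *)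
Lemma normr_Rintegral_le (f : T -> R) : measurable_fun setT f ->
  (`|\int[mu]_x f x|%:E <= \int[mu]_x `|f x|%:E)%E.
Proof.
move=> mf; apply: (@le_trans _ _ `|\int[mu]_x (f x)%:E|%E).
  have fineE (z : \bar R) : (`|fine z|%:E <= `|z|)%E.
    by case: z => [s||]; rewrite /= ?normr0 ?lexx ?leey.
  exact: fineE.
by apply: (le_abse_integral mu measurableT); exact/measurable_EFinP.
Qed.

End Rintegral_abs.

(** * Smoothing the voice transform of the witness *)

Section shearlet_test.
Variable R : realType.

Lemma psiR_tensor (y : plane R) : psiR y = gs y.1 * hat y.2.
Proof. by rewrite /psiR /hat mulrCA. Qed.

Lemma integrable_gs : (leb1 R).-integrable setT (EFin \o (@gs R)).
Proof.
have m1 : measurable_fun [set: R] (fun _ : R => 1 : R) by [].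
have n1 (u : R) : `|1 : R| <= 1 by rewrite normr1.
by apply: eq_integrable (integrable_bounded_mono_gs 0 m1 n1) => // u _ /=; rewrite expr0 !mul1r.
Qed.

Lemma integrable_hat : (leb1 R).-integrable setT (EFin \o (@hat R)).
Proof.
have m1 : measurable_fun [set: R] (fun _ : R => 1 : R) by [].
have n1 (u : R) : `|1 : R| <= 1 by rewrite normr1.
by apply: eq_integrable (integrable_bounded_hat m1 n1) => // u _ /=; rewrite mul1r.
Qed.

Lemma integrable_psiR : (leb2 R).-integrable setT (EFin \o (@psiR R)).
Proof.
have := integrable_tensor integrable_gs integrable_hat.
by apply: eq_integrable => // y _; rewrite /= psiR_tensor.
Qed.

Lemma measurable_psiR : measurable_fun setT (@psiR R).
Proof. by rewrite /psiR; mfun. Qed.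

Lemma sqint_psiR : sqint (leb2 R) (@psiR R).
Proof.
have [C C0 HC] := @hat_bound R.
apply: (@sqint_bounded_integrable _ _ _ (leb2 R) _ C).
- exact: measurable_psiR.
- exact: integrable_psiR.
- move=> y; rewrite psiR_tensor normrM (ger0_norm (gs_ge0 _)) -[C]mul1r.
  apply: ler_pM; rewrite ?gs_ge0 ?gs_le1// (le_trans (HC _))// ler_piMr//.
  by rewrite /gs4 -expR0 ler_expR oppr_le0 divr_ge0// sqr_ge0.
Qed.

Variables (p : plane R -> R) (r : R) (x0 : plane R).
Hypotheses (sp : sqint (leb2 R) p) (r0 : 0 < r).

Let mp : measurable_fun setT p. Proof. by have [] := sp. Qed.

Let F := bump_avg p r.
Let mF : measurable_fun setT F. Proof. exact: measurable_bump_avg. Qed.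

(* The voice transform smoothed by a gbump that is carried along by the
   dilation with matrix [[a, b], [0, d]]. *)
Lemma smoothed_voice_le (a b d : R) : a != 0 -> d != 0 ->
  (`|\int[leb2 R]_y (psiR y * F (x0.1 + (a * y.1 + b * y.2), x0.2 + d * y.2))|%:E <=
   `|a * d|%:E * \int[leb2 R]_x `|\int[leb2 R]_y (psiR y *
      p (a * (y.1 - x.1) + b * (y.2 - x.2), d * (y.2 - x.2)))|%:E)%E.
Proof.
move=> a0 d0; have mpsi := measurable_psiR.
have ad0 : 0 < `|a * d| by rewrite normr_gt0 mulf_neq0.
have Na : - a != 0 by rewrite oppr_eq0. have Nd : - d != 0 by rewrite oppr_eq0.
pose ky (y : plane R) : plane R := (a * y.1 + b * y.2, d * y.2).
pose tau (z : plane R) := gs2 r r (x0.1 + z.1, x0.2 + z.2).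
have mtau : measurable_fun setT tau by rewrite /tau /gs2 /=; mfun.
pose P (y x : plane R) := p (a * (y.1 - x.1) + b * (y.2 - x.2), d * (y.2 - x.2)).
have sub q : measurable_fun setT q -> (leb2 R).-integrable setT (EFin \o q) -> forall y : plane R,
    (leb2 R).-integrable setT (EFin \o (fun x : plane R =>
      q (a * (y.1 - x.1) + b * (y.2 - x.2), d * (y.2 - x.2)))) /\
    \int[leb2 R]_(x in [set: plane R]) q (a * (y.1 - x.1) + b * (y.2 - x.2), d * (y.2 - x.2)) =
      `|a * d|^-1 * \int[leb2 R]_z q z.
  move=> mq iq y; have mb : measurable_fun [set: R] (fun x2 : R => (ky y).1 - b * x2) by mfun.
  have sE (x : plane R) : skew1 (- a) (- d) (ky y).2 (fun x2 => (ky y).1 - b * x2) x =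
      (a * (y.1 - x.1) + b * (y.2 - x.2), d * (y.2 - x.2)).
    by rewrite /skew1 /=; congr (_, _); ring.
  split.
    have := @integrable_skew1 R (- a) (- d) (ky y).2 _ Na Nd mb q iq.
    by apply: eq_integrable => // x _; rewrite /= sE.
  have := @Rintegral_skew1 R (- a) (- d) (ky y).2 _ Na Nd mb q iq.
  by rewrite mulrNN => <-; apply: eq_Rintegral => x _; rewrite sE.
(* The smoothing centre moves with [y] exactly so that, after substituting for the integration
   variable, the bump depends on [x] alone. It then comes out of the integral over [y] and is
   bounded by 1. *)
have tauE (y x : plane R) : tau (a * x.1 + b * x.2, d * x.2) =
    gbump r (x0.1 + (ky y).1, x0.2 + (ky y).2)
      (a * (y.1 - x.1) + b * (y.2 - x.2), d * (y.2 - x.2)).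
  have E1 (u c e x1 x2 y1 y2 : R) :
      u + (c * y1 + e * y2) - (c * (y1 - x1) + e * (y2 - x2)) = u + (c * x1 + e * x2) by ring.
  have E2 (u c x2 y2 : R) : u + c * y2 - c * (y2 - x2) = u + c * x2 by ring.
  by rewrite /tau /gbump /ky /= E1 E2.
pose T (x : plane R) := tau (a * x.1 + b * x.2, d * x.2).
have mT : measurable_fun setT T by rewrite /T; mfun.
have T0 x : 0 <= T x by exact: gs2_ge0.
have mbump (w : plane R) : measurable_fun setT (gbump r w).
  by apply: measurable_bump; [exact: measurable_cst|exact: measurable_id].
have FE (y : plane R) : F (x0.1 + (a * y.1 + b * y.2), x0.2 + d * y.2) =
    `|a * d| * \int[leb2 R]_x (P y x * T x).
  set w : plane R := (_, _).
  have mq : measurable_fun setT (fun z => p z * gbump r w z) by have mw := mbump w; mfun.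
  have [_ H] := sub _ mq (integrable_avg sp r0 w) y.
  have ad0' := lt0r_neq0 ad0.
  rewrite (_ : \int[leb2 R]_x (P y x * T x) = `|a * d|^-1 * F w); first by rewrite mulVKf.
  by rewrite -H; apply: eq_Rintegral => x _; rewrite /P /T (tauE y).
(* Absolute convergence for Fubini comes from the smoothing of [|p|], which is bounded. *)
have sap : sqint (leb2 R) (fun z => `|p z|).
  split; first by mfun.
  have [_] := sp; apply: eq_integrable => // z _; congr EFin.
  by rewrite /= real_normK// num_real.
have [K K0 HK] := bump_avg_bounded sap r0.
pose Phi (w : plane R * plane R) := psiR w.1 * (P w.1 w.2 * T w.2).
have mPhi : measurable_fun setT Phi by rewrite /Phi /P; mfun.
have fPhi : (\int[leb2 R]_y \int[leb2 R]_x `|Phi (y, x)|%:E < +oo)%E.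
  apply: (@le_lt_trans _ _ (\int[leb2 R]_y ((K / `|a * d|)%:E * `|psiR y|%:E))%E); last first.
    rewrite ge0_integralZl//; first last.
    - by rewrite lee_fin divr_ge0.
    - by mfun.
    rewrite lte_mul_pinfty ?lee_fin ?divr_ge0//.
    exact: (integrable_lty measurableT (integrable_norm integrable_psiR)).
  apply: ge0_le_integral_any => y _; first exact: integral_ge0.
  pose w : plane R := (x0.1 + (ky y).1, x0.2 + (ky y).2).
  have mq : measurable_fun setT (fun z => `|p z| * gbump r w z) by have mw := mbump w; mfun.
  have [i1 H] := sub _ mq (integrable_avg sap r0 w) y.
  have -> : (\int[leb2 R]_x `|Phi (y, x)|%:E = (`|psiR y| * (`|a * d|^-1 * bump_avg (fun z => `|p z|) r w))%:E)%E.
    rewrite -H -RintegralZl// /Rintegral fineK; last first.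
      exact: (integrable_fin_num measurableT (integrableZl measurableT `|psiR y| i1)).
    apply: eq_integral => x _; congr EFin.
    rewrite /Phi (normrM (psiR y)) (normrM (P y x)) /= (ger0_norm (T0 x)).
    by rewrite /P /T (tauE y).
  rewrite -EFinM lee_fin mulrC ler_wpM2r// mulrC ler_wpM2r ?invr_ge0//.
  exact: le_trans (ler_norm _) (HK w).
have FubE := @Rfubini _ _ _ _ R (leb2 R) (leb2 R) (@sigma_finite_leb2 R) (@sigma_finite_leb2 R)
  Phi mPhi fPhi.
pose I (x : plane R) := \int[leb2 R]_y (psiR y * P y x).
have mI : measurable_fun setT I.
  apply: (@measurable_param_Rintegral _ _ (plane R) (plane R) R (leb2 R) (@sigma_finite_leb2 R)
    (fun x y : plane R => psiR y * P y x)).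
  by rewrite /P; mfun.
have sP (x : plane R) : sqint (leb2 R) (fun y => P y x).
  split; first by rewrite /P; mfun.
  have mb : measurable_fun [set: R] (fun y2 : R => b * (y2 - x.2) - a * x.1) by mfun.
  have E3 (u1 u2 v1 v2 : R) : a * u1 + (b * (u2 - v2) - a * v1) =
    a * (u1 - v1) + b * (u2 - v2) by ring.
  have E4 (u2 v2 : R) : d * u2 + - (d * v2) = d * (u2 - v2) by ring.
  have sE (y : plane R) : skew1 a d (- (d * x.2)) (fun y2 : R => b * (y2 - x.2) - a * x.1) y =
      (a * (y.1 - x.1) + b * (y.2 - x.2), d * (y.2 - x.2)).
    by rewrite /skew1 E3 E4.
  have -> : (fun y => P y x ^+ 2) = (fun z => p z ^+ 2) \o
      skew1 a d (- (d * x.2)) (fun y2 : R => b * (y2 - x.2) - a * x.1).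
    by apply/funext => y; rewrite [RHS]/= sE.
  exact: (@integrable_skew1 R a d (- (d * x.2)) _ a0 d0 mb _ sp.2).
have main : \int[leb2 R]_y (psiR y * F (x0.1 + (a * y.1 + b * y.2), x0.2 + d * y.2)) =
    `|a * d| * \int[leb2 R]_x (I x * T x).
  have i0 : (leb2 R).-integrable setT (EFin \o (fun y : plane R =>
      psiR y * F (x0.1 + (a * y.1 + b * y.2), x0.2 + d * y.2))).
    have [K' K0' HK'] := bump_avg_bounded sp r0.
    apply: (@integrable_dominated _ _ _ (leb2 R) _ (fun y => K' * `|psiR y|)).
    - by mfun.
    - exact: (integrableZl measurableT K' (integrable_norm integrable_psiR)).
    - by move=> y; rewrite normrM mulrC ler_wpM2r.
  have ad0' := lt0r_neq0 ad0; apply: (mulfI (invr_neq0 ad0')).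
  rewrite (mulKf ad0') -(RintegralZl _ measurableT i0).
  transitivity (\int[leb2 R]_y \int[leb2 R]_x Phi (y, x)).
    apply: eq_Rintegral => y _; rewrite FE mulrCA (mulKf ad0').
    have mq : measurable_fun setT (fun z => p z * gbump r (x0.1 + (ky y).1, x0.2 + (ky y).2) z).
      by have mw := mbump (x0.1 + (ky y).1, x0.2 + (ky y).2); mfun.
    have [i1 _] := sub _ mq (integrable_avg sp r0 _) y.
    have i2 : (leb2 R).-integrable setT (EFin \o (fun x : plane R => P y x * T x)).
      rewrite (_ : (fun x : plane R => P y x * T x) = fun x : plane R =>
        p (a * (y.1 - x.1) + b * (y.2 - x.2), d * (y.2 - x.2)) *
        gbump r (x0.1 + (ky y).1, x0.2 + (ky y).2)
          (a * (y.1 - x.1) + b * (y.2 - x.2), d * (y.2 - x.2))); first exact: i1.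
      by apply/funext => x; rewrite /P /T (tauE y).
    by rewrite -(RintegralZl _ measurableT i2).
  rewrite FubE; apply: eq_Rintegral => x _.
  have i2 : (leb2 R).-integrable setT (EFin \o (fun y : plane R => psiR y * P y x)).
    apply: integrable_sqintM; first exact: sqint_psiR.
    exact: sP.
  by rewrite /I -(RintegralZr _ measurableT i2); apply: eq_Rintegral => y _; rewrite /Phi /= mulrA.
rewrite main normrM (ger0_norm (ltW ad0)) EFinM; apply: lee_wpmul2l; first by rewrite lee_fin ltW.
apply: (le_trans (normr_Rintegral_le _ _)); first by mfun.
apply: ge0_le_integral_any => x _; first by rewrite lee_fin.
have H : `|I x * T x| <= `|I x|; last exact: H.
rewrite (normrM (I x)) (ger0_norm (T0 x)); apply: ler_piMr; first exact: normr_ge0.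
exact: gs2_le1.
Qed.

End shearlet_test.

Section ge0_scale.
Context d (T : measurableType d) (R : realType) (mu : {measure set T -> \bar R}).

Lemma ge0_integralZl_real (D : set T) (f : T -> R) (k : R) : measurable D -> 0 <= k ->
  (forall x, D x -> 0 <= f x) -> measurable_fun D (fun x => (f x)%:E) ->
  (\int[mu]_(x in D) (k * f x)%:E = k%:E * \int[mu]_(x in D) (f x)%:E)%E.
Proof.
move=> mD k0 f0 mf.
have f0' x : D x -> (0 <= (f x)%:E)%E by move=> Dx; rewrite lee_fin f0.
by have := @ge0_integralZl_EFin _ _ R mu D mD (fun x => (f x)%:E) f0' mf k k0.
Qed.

Lemma filterS_ae (P Q : T -> Prop) : (forall x, P x -> Q x) ->
  {ae mu, forall x, P x} -> {ae mu, forall x, Q x}.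
Proof. by move=> PQ; apply: filterS. Qed.

End ge0_scale.

(** * The shearlet group *)

Section shearlet_obstruction.
Variable R : realType.

(** For [p] the real or imaginary part of [psi0] this is, up to sign, the corresponding part of the
    transform of the witness; the obstruction is derived for each part alone. *)
Definition psi_voice (p : plane R -> R) (x : R * R) (h : 'M[R]_2) : R :=
  `|\det h| `^ (- 2^-1) * \int[leb2 R]_y (psiR y * p (mxact (invmx h) (y - x))).

Lemma mxact_invmx_shr (s b : R) (x : R * R) : s != 0 ->
  mxact (invmx (shr s b)) x =
  ((s * `|s|)^-1 * x.1 + - b / (s ^+ 2 * `|s|) * x.2, s^-1 * x.2).
Proof. by move=> s0; rewrite invmx_shr// /mxact !mx22_ij mul0r add0r. Qed.

(** As [|det| = |s|^3], the exponent is [3 (- 1/2 + 7/6 - 1) = - 1]. *)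
Lemma det_weight_shr (s b : R) : s != 0 ->
  `|\det (shr s b)| `^ (- 2^-1) * det_weight (shr s b) / `|\det (shr s b)| = `|s|^-1.
Proof.
move=> s0; have n0 : `|s| != 0 by rewrite normr_eq0.
rewrite /det_weight !normr_det_shr -powRD ?expf_neq0 ?implybT//.
rewrite (_ : - 2^-1 + 7 / 6 = 2%:R / 3%:R :> R); last by field.
rewrite -powR_mulrn// -powRrM (_ : 3%:R * (2%:R / 3%:R) = 2%:R :> R); last by field.
by rewrite !powR_mulrn//; field.
Qed.

Variable p : plane R -> R.
Hypothesis sp : sqint (leb2 R) p.
Let mp : measurable_fun setT p. Proof. by have [] := sp. Qed.
Let mpsi := @measurable_psiR R.

Section smoothing.
Variables (r : R) (x0 : plane R).
Hypothesis r0 : 0 < r.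

Let F := bump_avg p r.
Let mF : measurable_fun setT F. Proof. exact: measurable_bump_avg. Qed.

Definition smoothed (a b d : R) : R :=
  \int[leb2 R]_y (psiR y * F (x0.1 + (a * y.1 + b * y.2), x0.2 + d * y.2)).

Lemma cvg_smoothed (a b d : nat -> R) (a0 b0 d0 : R) : a n @[n --> \oo] --> a0 ->
  b n @[n --> \oo] --> b0 -> d n @[n --> \oo] --> d0 ->
  smoothed (a n) (b n) (d n) @[n --> \oo] --> smoothed a0 b0 d0.
Proof.
move=> ca cb cd; have [C C0 FC] := bump_avg_bounded sp r0.
apply: (@cvg_Rintegral_dominated _ _ _ (leb2 R)
  (fun n y => psiR y * F (x0.1 + (a n * y.1 + b n * y.2), x0.2 + d n * y.2)) _
  (fun y => C * `|psiR y|)).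
- by move=> n; mfun.
- move=> y; apply: cvgMr; apply: cvg_bump_avg => //=.
    apply: cvgD; first exact: cvg_cst.
    by apply: cvgD; apply: cvgMl.
  by apply: cvgD; [exact: cvg_cst|apply: cvgMl].
- exact: (integrableZl measurableT C (integrable_norm (@integrable_psiR R))).
- by move=> n y; rewrite normrM mulrC ler_wpM2r.
Qed.

Lemma measurable_smoothed d (T : measurableType d) (a b e : T -> R) :
  measurable_fun setT a -> measurable_fun setT b -> measurable_fun setT e ->
  measurable_fun setT (fun t => smoothed (a t) (b t) (e t)).
Proof.
move=> ma mb me; apply: (@measurable_param_Rintegral _ _ T (plane R) R (leb2 R)
  (@sigma_finite_leb2 R) (fun t (y : plane R) =>
    psiR y * F (x0.1 + (a t * y.1 + b t * y.2), x0.2 + e t * y.2))).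
by mfun.
Qed.

(** The arguments of [smoothed] are the entries of the inverse of [h]. The factor [s^2] is [|s|^-1],
    from [det_weight_shr], divided by the Jacobian [|s|^-3] of [smoothed_voice_le]. Writing it in
    matrix entries makes it measurable on all matrices. *)
Definition smoothed_at (h : 'M[R]_2) : R := h ord_max ord_max ^+ 2 *
  `|smoothed (h ord0 ord0)^-1 (- h ord0 ord_max / (h ord0 ord0 * h ord_max ord_max))
      (h ord_max ord_max)^-1|.

Lemma smoothed_at_shr (s b : R) : smoothed_at (shr s b) =
  s ^+ 2 * `|smoothed (s * `|s|)^-1 (- b / (s ^+ 2 * `|s|)) s^-1|.
Proof.
have E : s * `|s| * s = s ^+ 2 * `|s| by rewrite mulrAC.
by rewrite /smoothed_at !mx22_ij E.
Qed.

Lemma measurable_smoothed_at :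
  measurable_fun setT (smoothed_at : borelM R -> R).
Proof.
have me i j := @measurable_entry R i j; rewrite /smoothed_at.
have m00 := me ord0 ord0; have m01 := me ord0 ord_max; have m11 := me ord_max ord_max.
apply: measurable_funM; first exact: measurable_funX.
apply: measurable_fun_norm; apply: measurable_smoothed.
- exact: measurable_fun_inv.
- apply: measurable_funM; first exact: measurable_funN.
  by apply: measurable_fun_inv; exact: measurable_funM.
- exact: measurable_fun_inv.
Qed.

Lemma smoothed_at_le (h : 'M[R]_2) : shearlet_group h -> ((smoothed_at h)%:E <=
  \int[leb2 R]_x (`|psi_voice p x h| * det_weight h / `|\det h|)%:E)%E.
Proof.
move=> /shearletP[s [b [s0 ->]]]; rewrite smoothed_at_shr.
have n0 : 0 < `|s| by rewrite normr_gt0.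
set a := (s * `|s|)^-1; set b' := - b / _; set d := s^-1.
have a0 : a != 0 by rewrite invr_eq0 mulf_neq0// gt_eqF.
have d0 : d != 0 by rewrite invr_eq0.
pose I (x : plane R) := \int[leb2 R]_y (psiR y *
  p (a * (y.1 - x.1) + b' * (y.2 - x.2), d * (y.2 - x.2))).
have mI : measurable_fun setT I.
  apply: (@measurable_param_Rintegral _ _ (plane R) (plane R) R (leb2 R)
    (@sigma_finite_leb2 R) (fun x y : plane R => psiR y *
      p (a * (y.1 - x.1) + b' * (y.2 - x.2), d * (y.2 - x.2)))).
  by mfun.
have VE (x : plane R) : `|psi_voice p x (shr s b)| * det_weight (shr s b) / `|\det (shr s b)| =
    `|s|^-1 * `|I x|.
  rewrite /psi_voice normrM ger0_norm ?powR_ge0// -(det_weight_shr b s0).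
  have -> : \int[leb2 R]_y (psiR y * p (mxact (invmx (shr s b)) (y - x))) = I x.
    by apply: eq_Rintegral => y _; rewrite mxact_invmx_shr.
  have E (A B C D : R) : A * B * C / D = A * C / D * B by ring.
  exact: E.
have -> : (\int[leb2 R]_x (`|psi_voice p x (shr s b)| * det_weight (shr s b) /
    `|\det (shr s b)|)%:E = (`|s|^-1)%:E * \int[leb2 R]_x `|I x|%:E)%E.
  have mIE : measurable_fun setT (fun x => `|I x|%:E) by mfun.
  have s10 : 0 <= `|s|^-1 by rewrite invr_ge0.
  rewrite -(@ge0_integralZl_real _ _ R (leb2 R) setT _ _ measurableT s10
    (fun x _ => normr_ge0 (I x)) mIE).
  by apply: eq_integral => x _; rewrite VE.
have H := @smoothed_voice_le R p r x0 sp r0 a b' d a0 d0.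
apply: (@le_trans _ _ ((s ^+ 2)%:E * (`|a * d|%:E * \int[leb2 R]_x `|I x|%:E))%E).
  by rewrite EFinM; apply: lee_wpmul2l; [rewrite lee_fin sqr_ge0|exact: H].
rewrite muleA -EFinM (_ : s ^+ 2 * `|a * d| = `|s|^-1)//.
rewrite /a /d -invfM normfV !normrM normr_id -(real_normK (num_real s)).
by field; rewrite gt_eqF.
Qed.

Variable mu : {measure set (borelM R) -> \bar R}.
Hypothesis haar_mu : left_haar (@shearlet_group R) mu.
Hypothesis fin : (\int[mu]_(h in @shearlet_group R)
  \int[leb2 R]_x (`|psi_voice p x h| * det_weight h / `|\det h|)%:E < +oo)%E.

Let mH := @measurable_shearlet R.

(* Left translation by matrices whose scale tends to infinity squeezes
   invmx h y onto the horizontal axis, while the Haar integral of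
   smoothed_at is unchanged and its weight grows. *)
Lemma smoothed_axis_eq0 (c : R) : {ae mu, forall h, shearlet_group h ->
  smoothed 0 (c / (h ord_max ord_max * `|h ord_max ord_max|)) 0 = 0}.
Proof.
have m11 := @measurable_entry R ord_max ord_max.
(* With [N = n + 1], the inverse of [t n * h] has diagonal entries of order [N^-2] and [N^-1]; the
   power [N^3] is chosen so that its off-diagonal entry tends to [c / (s |s|)]. *)
pose t n : 'M[R]_2 := shr n.+1%:R (- c * n.+1%:R ^+ 3).
have Ht n : shearlet_group (t n).
  by apply/shearletP; exists n.+1%:R, (- c * n.+1%:R ^+ 3).
have mS := measurable_smoothed_at.
have S0 h : 0 <= smoothed_at h by rewrite mulr_ge0 ?sqr_ge0.
pose M := (\int[mu]_(h in @shearlet_group R) (smoothed_at h)%:E)%E.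
have M0 : (0 <= M)%E by apply: integral_ge0 => h _; rewrite lee_fin.
have Moo : (M < +oo)%E.
  apply: le_lt_trans fin; apply: ge0_le_integral_any => h Hh; first by rewrite lee_fin.
  exact: smoothed_at_le.
(* Dividing by [N^2] cancels the growth of the factor [s^2] of [smoothed_at] under the translation,
   so [G n] has a pointwise limit, while left invariance makes its integral [M / N^2]. *)
pose G n (h : 'M[R]_2) := ((n.+1%:R ^- 2)%:E * (smoothed_at (t n *m h))%:E)%E.
have mG n : measurable_fun setT (G n : borelM R -> \bar R).
  have ml := @measurable_mulmxl R (t n).
  by apply: emeasurable_funM => //; apply/measurable_EFinP; exact: measurableT_comp mS ml.
have G0 n h : (0 <= G n h)%E by rewrite /G -EFinM lee_fin mulr_ge0// invr_ge0 exprn_ge0.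
have IG n : (\int[mu]_(h in @shearlet_group R) G n h = (n.+1%:R ^- 2)%:E * M)%E.
  have mSt : measurable_fun (@shearlet_group R : set (borelM R))
      (fun h : borelM R => (smoothed_at (t n *m h))%:E).
    apply: measurable_funTS; apply/measurable_EFinP.
    exact: measurableT_comp mS (@measurable_mulmxl R (t n)).
  have n20 : 0 <= n.+1%:R ^- 2 :> R by rewrite invr_ge0 exprn_ge0.
  have HZ := @ge0_integralZl_real _ _ R mu _ _ _ mH n20 (fun h _ => S0 (t n *m h)) mSt.
  have mS' : measurable_fun (@shearlet_group R : set (borelM R))
      (fun h : borelM R => (smoothed_at h)%:E).
    by apply: measurable_funTS; apply/measurable_EFinP.
  have S0' h : shearlet_group h -> (0 <= (smoothed_at h)%:E)%E by move=> _; rewrite lee_fin.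
  have L := @haar_left_integral R _ mu mH (@shearlet_unit R) (@shearletM R) (@shearletV R)
    haar_mu (t n) (fun h => (smoothed_at h)%:E) (Ht n) mS' S0'.
  by rewrite L in HZ; exact: HZ.
pose G' (h : 'M[R]_2) := h ord_max ord_max ^+ 2 *
  `|smoothed 0 (c / (h ord_max ord_max * `|h ord_max ord_max|)) 0|.
have mG' : measurable_fun setT (G' : borelM R -> R).
  apply: measurable_funM; first exact: measurable_funX.
  apply: measurable_fun_norm; apply: measurable_smoothed; [exact: measurable_cst| |exact: measurable_cst].
  apply: measurable_funM => //; apply: measurable_fun_inv; apply: measurable_funM => //.
  exact: measurable_fun_norm.
have limG h : shearlet_group h -> G n h @[n --> \oo] --> (G' h)%:E.
  move=> /shearletP[s [b [s0 ->]]]; have n0 : `|s| != 0 by rewrite normr_eq0.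
  have GE n : G n (shr s b) = (s ^+ 2 * `|smoothed
      (n.+1%:R^-1 * (n.+1%:R^-1 * (s * `|s|)^-1))
      (c / (s * `|s|) - n.+1%:R^-1 * (b / (s ^+ 2 * `|s|))) (n.+1%:R^-1 * s^-1)|)%:E.
    rewrite /G /t shr_mul smoothed_at_shr -EFinM; congr EFin.
    have N0 : (n.+1%:R : R) != 0 by rewrite pnatr_eq0.
    rewrite [`|n.+1%:R * s|]normrM [`|n.+1%:R|]ger0_norm//.
    move: (n.+1%:R : R) N0 => N N0.
    have -> : (N * s * (N * `|s|))^-1 = N^-1 * (N^-1 * (s * `|s|)^-1).
      by field; rewrite n0 s0 N0.
    have -> : - (N * N * b + - c * N ^+ 3 * s) / ((N * s) ^+ 2 * (N * `|s|)) =
        c / (s * `|s|) - N^-1 * (b / (s ^+ 2 * `|s|)).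
      by field; rewrite n0 s0 N0.
    have -> : (N * s)^-1 = N^-1 * s^-1 by field; rewrite s0 N0.
    by rewrite (mulrA (N ^- 2)) exprMn (mulKf (expf_neq0 2 N0)).
  rewrite /G' !mx22_ij.
  under eq_fun do rewrite GE.
  apply: cvg_EFin; first exact: nearW.
  have h0 := @cvg_harmonic R.
  apply: cvgMr; apply: cvg_norm; apply: cvg_smoothed.
  - rewrite -(mul0r (0 * (s * `|s|)^-1)); apply: cvgM => //; exact: cvgMl.
  - rewrite -[X in _ --> X]subr0 -(mul0r (b / (s ^+ 2 * `|s|))).
    by apply: cvgB; [exact: cvg_cst|exact: cvgMl].
  - by rewrite -(mul0r s^-1); exact: cvgMl.
(* Fatou: the integral of the limit is at most the lower limit of [M / N^2], and [M] is finite. *)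
have IG' : (\int[mu]_(h in @shearlet_group R) `|(G' h)%:E| = 0)%E.
  apply/eqP; rewrite eq_le integral_ge0// andbT.
  have := @fatou _ _ R mu _ mH (fun n h => G n h) (fun n => measurable_funTS (mG n))
    (fun n h _ => G0 n h).
  rewrite [X in (X <= _)%E -> _](_ : _ = \int[mu]_(h in @shearlet_group R) `|(G' h)%:E|)%E; last first.
    apply: eq_integral => h; rewrite inE => Hh.
    have [-> _] := cvg_limn_einf_sup (limG h Hh).
    by rewrite gee0_abs// lee_fin mulr_ge0 ?sqr_ge0.
  move=> /le_trans; apply; under eq_fun do rewrite IG.
  have [m mE] : exists m, M = m%:E by exists (fine M); rewrite fineK// ge0_fin_numE.
  rewrite mE; have c0 : ((n.+1%:R ^- 2)%:E * m%:E)%E @[n --> \oo] --> (0%:E : \bar R).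
    have -> : (fun n : nat => (n.+1%:R ^- 2)%:E * m%:E)%E =
        (fun n : nat => (n.+1%:R^-1 * (n.+1%:R^-1 * m))%:E).
      by apply/funext => n; rewrite -EFinM -exprVn expr2 mulrA.
    apply: cvg_EFin; first exact: nearW.
    rewrite -(mul0r (0 * m)); have h0 := @cvg_harmonic R.
    by apply: cvgM => //; exact: cvgMl.
  by have [-> _] := cvg_limn_einf_sup c0.
have mG'E : measurable_fun (@shearlet_group R : set (borelM R)) (fun h : borelM R => (G' h)%:E).
  by apply: measurable_funTS; apply/measurable_EFinP.
have [+ _] := ae_eq_integral_abs mu mH mG'E.
move=> /(_ IG'); apply: filterS_ae => h /= Gh Hh; have := Gh Hh.
move: Hh => /shearlet_entryP[_ h11 _] [] /eqP.
by rewrite mulf_eq0 expf_eq0/= (negbTE h11)/= normr_eq0 => /eqP.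
Qed.

(** The exceptional null set depends on [c], so [c] is first restricted to the rationals. As [H] is
    not null, a single [h] serves all rational [c]; density and continuity of [smoothed] give every
    [x]. *)
Lemma smoothed_axis_eq0_all (x : R) : smoothed 0 x 0 = 0.
Proof.
have muH : mu (@shearlet_group R) <> 0%E by have [] := haar_mu.
have aeq : {ae mu, forall h, forall n : nat, shearlet_group h ->
    forall c : rat, unpickle n = Some c ->
    smoothed 0 (ratr c / (h ord_max ord_max * `|h ord_max ord_max|)) 0 = 0}.
  apply/ae_foralln => n.
  case E : (@unpickle rat n) => [c|]; last by apply: aeW.
  by apply: filterS_ae (smoothed_axis_eq0 (ratr c)) => h Hh Hs c' [<-]; exact: Hh.
have [h [Hh Hc]] : exists h, shearlet_group h /\ forall c : rat,
    smoothed 0 (ratr c / (h ord_max ord_max * `|h ord_max ord_max|)) 0 = 0.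
  apply: contrapT => nex; apply: muH; case: aeq => N [mN N0 HN].
  apply/eqP; rewrite eq_le measure_ge0 andbT -N0 le_measure ?inE//.
  move=> h Hh; apply: HN => /= Hn; apply: nex; exists h; split=> // c.
  by apply: (Hn (pickle c)) => //; rewrite pickleK.
move: Hh => /shearlet_entryP[_ h11 _]; move: h11 Hc.
move: (h ord_max ord_max) => s s0 Hc.
have ss0 : s * `|s| != 0 by rewrite mulf_neq0// normr_eq0.
have qP (n : nat) : exists q : rat, x * (s * `|s|) < ratr q < x * (s * `|s|) + n.+1%:R^-1.
  have /rat_in_itvoo[q] : x * (s * `|s|) < x * (s * `|s|) + n.+1%:R^-1 by rewrite ltrDl.
  by rewrite in_itv/=; exists q.
have /choice[q qE] := qP.
have cq : (ratr (q n) : R) @[n --> \oo] --> x * (s * `|s|).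
  have c1 : x * (s * `|s|) + n.+1%:R^-1 @[n --> \oo] --> x * (s * `|s|).
    rewrite -[X in _ --> X]addr0; apply: cvgD; first exact: cvg_cst.
    exact: cvg_harmonic.
  apply: (squeeze_cvgr _ (cvg_cst (x * (s * `|s|))) c1); apply: nearW => n.
  by have /andP[/ltW -> /ltW ->] := qE n.
have c2 : smoothed 0 (ratr (q n) / (s * `|s|)) 0 @[n --> \oo] --> smoothed 0 x 0.
  apply: cvg_smoothed; [exact: cvg_cst| |exact: cvg_cst].
  by rewrite -(mulfK ss0 x); apply: cvgMl.
move: c2; under eq_fun do rewrite Hc.
by move=> /(cvg_unique (@Rhausdorff R) (cvg_cst _)).
Qed.

(** [psiR] is a tensor product whose first factor has nonzero integral, so the vanishing of
    [smoothed 0 x 0] says that the restriction of the smoothing to the horizontal line through [x0]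
    is orthogonal to the hat at all dilations. *)
Lemma bump_avg_eq0 : bump_avg p r x0 = 0.
Proof.
have [C C0 FC] := bump_avg_bounded sp r0.
pose f (t : R) := F (x0.1 + t, x0.2).
have mf : measurable_fun [set: R] f.
  have m1 : measurable_fun [set: R] (fun t => x0.1 + t) by apply: measurable_funD.
  exact: measurableT_comp mF (measurable_fun_pair m1 (measurable_cst _)).
have fC t : `|f t| <= C by exact: FC.
have f00 : f 0 = 0; last first.
  by move: f00; rewrite /f addr0 -surjective_pairing.
apply: (@eq0_of_hat_dilations R f C mf fC).
- move=> x _; have := smoothed_axis_eq0_all x; rewrite /smoothed => H.
  have mxt : measurable_fun [set: R] (fun t : R => x * t) by mfun.
  have mfx : measurable_fun [set: R] (fun t => f (x * t)) := measurableT_comp mf mxt.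
  have ihf : (leb1 R).-integrable setT (EFin \o (fun t => hat t * f (x * t))).
    have := integrable_bounded_hat mfx (fun t => fC (x * t)).
    by apply: eq_integrable => // t _; rewrite /= mulrC.
  have := Rintegral_tensor (@integrable_gs R) ihf.
  have -> : \int[leb2 R]_z (gs z.1 * (hat z.2 * f (x * z.2))) = 0.
    rewrite -[RHS]H; apply: eq_Rintegral => y _.
    by rewrite psiR_tensor /f !mul0r add0r addr0 mulrA.
  rewrite Rintegral_gs => /esym/eqP; rewrite mulf_eq0 => /orP[|/eqP//].
  by rewrite gt_eqF// sqrtr_gt0 mulrn_wgt0// pi_gt0.
- move=> t; apply: cvg_bump_avg => //=; last exact: cvg_cst.
  apply: cvgD; first exact: cvg_cst.
  by rewrite -(mul0r t); apply: cvgMl; exact: cvg_harmonic.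
- move=> t t0; apply: cvg0_bump_avg => // z /=.
  have tr : t / r != 0 by rewrite mulf_neq0// invr_eq0 gt_eqF.
  have := @cvg0_gs_arith R ((x0.1 - z) / r) _ tr.
  have E (n : nat) : (x0.1 - z) / r + n.+1%:R * (t / r) = (x0.1 + n.+1%:R * t - z) / r.
    by field; rewrite gt_eqF.
  by under eq_fun do rewrite E.
Qed.

End smoothing.

Lemma shearlet_obstruction (mu : {measure set (borelM R) -> \bar R}) :
  left_haar (@shearlet_group R) mu ->
  (\int[mu]_(h in @shearlet_group R)
    \int[leb2 R]_x (`|psi_voice p x h| * det_weight h / `|\det h|)%:E < +oo)%E ->
  {ae leb2 R, forall z, p z = 0}.
Proof.
move=> haar_mu fin; apply: ae_eq0_of_gauss => // x r r0.
rewrite -[RHS](bump_avg_eq0 x r0 haar_mu fin); apply: eq_Rintegral => z _.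
rewrite /gbump /gs2 /= -[in RHS](gsN ((x.1 - z.1) / r)) -[in RHS](gsN ((x.2 - z.2) / r)).
by rewrite -!mulNr !opprB.
Qed.

End shearlet_obstruction.

(** * Integrability of the decay profile of the kernel *)

Section one_dim_tails.
Variable R : realType.

(** The antiderivative is controlled only inside the open half-line, so the fundamental theorem is
    applied on [[1 / (n + 2), n + 2]] and Fatou gives the limit. *)
Lemma half_line_integral_le (f F : R -> R) (C : R) :
  (forall x : R, 0 < x -> is_derive x 1 F (f x)) ->
  (forall x : R, 0 < x -> {for x, continuous f}) ->
  (forall x, 0 < x -> 0 <= f x) -> (forall x, 0 < x -> 0 <= F x <= C) ->
  measurable_fun [set: R] f ->
  (\int[leb1 R]_(x in `]0%R, +oo[) (f x)%:E <= C%:E)%E.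
Proof.
move=> dF cf f0 FC mf.
pose I n : set R := `[(n.+2%:R)^-1, n.+2%:R]%classic.
pose fn n (x : R) : \bar R := (f x * \1_(I n) x)%:E.
have m0 : measurable (`]0%R, +oo[%classic : set (measurableTypeR R)) by exact: measurable_itv.
have mfn n : measurable_fun [set: R] (fn n).
  apply/measurable_EFinP; apply: measurable_funM => //.
  by apply: measurable_indic; exact: measurable_itv.
have fn0 n x : `]0%R, +oo[%classic x -> (0 <= fn n x)%E.
  rewrite /= in_itv/= andbT => x0; by rewrite lee_fin mulr_ge0 ?f0.
have Ifn n : (\int[leb1 R]_(x in `]0%R, +oo[) fn n x <= C%:E)%E.
  have n0 : 0 < (n.+2%:R)^-1 :> R by rewrite invr_gt0.
  have n1 : (n.+2%:R)^-1 < n.+2%:R :> R.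
    rewrite (@lt_trans _ _ 1)//; last by rewrite ltr1n.
    by rewrite invf_lt1// ltr1n.
  have pos (x : R) : x \in `[(n.+2%:R)^-1, n.+2%:R] -> 0 < x.
    by rewrite in_itv/= => /andP[h _]; exact: lt_le_trans h.
  have := @continuous_FTC2 R f F _ _ n1.
  rewrite (_ : (\int[leb1 R]_(x in `]0%R, +oo[) fn n x =
    \int[leb1 R]_(x in I n) (f x)%:E)%E); last first.
    rewrite [LHS]integral_mkcond [RHS]integral_mkcond; apply: eq_integral => x _.
    rewrite /patch /fn indicE; case: ifPn => [|].
      by rewrite inE => _; case: (x \in I n) => /=; rewrite ?mulr1 ?mulr0.
    move=> x0; case: ifPn => // xI; exfalso; move/negP: x0; apply; rewrite inE/= in_itv/= andbT.
    by apply: pos; move: xI; rewrite inE.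
  move=> ->.
  - have /andP[_ Fb] := FC n.+2%:R (ltr0Sn _ _); have /andP[Fa _] := FC _ n0.
    by rewrite -EFinB lee_fin (le_trans _ Fb)// gerBl.
  - apply: continuous_in_subspaceT => x; rewrite inE => /pos x0; exact: cf.
  - split.
    + move=> x; rewrite in_itv/= => /andP[h _]; have x0 := lt_trans n0 h.
      by have [] := dF _ x0.
    + apply: cvg_at_right_filter; apply: differentiable_continuous.
      by apply/derivable1_diffP; have [] := dF _ n0.
    + apply: cvg_at_left_filter; apply: differentiable_continuous.
      by apply/derivable1_diffP; have [] := dF n.+2%:R (ltr0Sn _ _).
  - move=> x; rewrite in_itv/= => /andP[h _]; have x0 := lt_trans n0 h.
    by rewrite derive1E; have [_ ->] := dF _ x0.
have := @fatou _ _ R (leb1 R) _ m0 fn (fun n => measurable_funTS (mfn n)) fn0.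
rewrite [X in (X <= _)%E -> _](_ : _ = \int[leb1 R]_(x in `]0%R, +oo[) (f x)%:E)%E; last first.
  apply: eq_integral => x; rewrite inE/= in_itv/= andbT => x0.
  have cv : fn n x @[n --> \oo] --> (f x)%:E.
    apply: cvg_EFin; first exact: nearW.
    apply: cvg_near_cst; near=> n; rewrite /= indicE mem_set ?mulr1//.
    rewrite /I /= in_itv/=; apply/andP; split.
      rewrite invf_ple ?posrE//; near: n; exists (Num.bound x^-1) => // n /= bn.
      have := archi_boundP (ltW (_ : 0 < x^-1)); rewrite invr_gt0 => /(_ x0) /ltW h.
      by rewrite (le_trans h)// ler_nat (leq_trans bn)// !leqW.
    near: n; exists (Num.bound x) => // n /= bn.
    have /ltW h := archi_boundP (ltW x0).
    by rewrite (le_trans h)// ler_nat (leq_trans bn)// !leqW.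
  by have [-> _] := cvg_limn_einf_sup cv.
move=> /le_trans; apply; rewrite limn_einf_lim.
apply: lime_le; first exact: is_cvg_einfs.
apply: nearW => n; apply: (le_trans _ (Ifn n)); apply: ereal_inf_lbound.
by exists n => /=.
Unshelve. all: by end_near. Qed.

(** The restriction of [f] to the open half-line plus its reflection is [f |x|] except at 0. *)
Lemma integral_abs_half_line (f : R -> R) : measurable_fun [set: R] f ->
  (forall x, 0 <= f x) ->
  (\int[leb1 R]_x (f `|x|)%:E = 2%:E * \int[leb1 R]_(x in `]0%R, +oo[) (f x)%:E)%E.
Proof.
move=> mf f0; pose P : set R := `]0%R, +oo[%classic.
have mP : measurable (P : set (measurableTypeR R)) by exact: measurable_itv.
have mfa : measurable_fun [set: R] (fun x => f `|x|) by mfun.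
pose g x := f x * \1_P x.
have mg : measurable_fun [set: R] g by apply: measurable_funM => //; exact: measurable_indic.
have g0 x : 0 <= g x by rewrite mulr_ge0// indicE.
have gE : (\int[leb1 R]_(x in P) (f x)%:E = \int[leb1 R]_x (g x)%:E)%E by exact: indicM_patch.
have N1 : (-1 : R) != 0 by rewrite oppr_eq0 oner_eq0.
have gN : (\int[leb1 R]_x (g (- x))%:E = \int[leb1 R]_x (g x)%:E)%E.
  have mgE : measurable_fun [set: R] (fun x => (g x)%:E) by exact/measurable_EFinP.
  have := @ge0_integral_affine R (-1) 0 (fun x => (g x)%:E) N1 mgE (fun x => g0 x).
  rewrite normrN1 invr1 mul1e => <-; apply: eq_integral => x _.
  by rewrite mulN1r addr0.
rewrite gE -[2]/(1 + 1) EFinD ge0_muleDl ?lee_fin// mul1e -{2}gN -ge0_integralD//.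
- apply: ae_eq_integral => //.
  + exact/measurable_EFinP.
  + apply: emeasurable_funD; first exact/measurable_EFinP.
    by apply/measurable_EFinP; apply: measurableT_comp => //; exact: measurable_funN.
  exists [set 0]; split; [exact: measurable_set1|exact: lebesgue_measure_set1|].
  move=> x /= H; apply: contrapT => /eqP x0; apply: H => _.
  have iP (y : R) : \1_P y = (0 < y)%R%:R :> R.
    rewrite indicE (_ : (y \in P) = (0 < y))//.
    by apply/idP/idP; rewrite inE /P /= in_itv/= andbT.
  rewrite -EFinD /g !iP oppr_gt0; case: (ltgtP x 0) x0 => // xx _.
    by rewrite ltr0_norm// mulr0 add0r mulr1.
  by rewrite gtr0_norm// mulr1 mulr0 addr0.
- by move=> x _; rewrite lee_fin.
- exact/measurable_EFinP.
- by move=> x _; rewrite lee_fin.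
- by apply/measurable_EFinP; apply: measurableT_comp => //; exact: measurable_funN.
Qed.

(** Majorants of [x (1 + x)^(-5/2)] and [x^(-3/4) (1 + x)^(-5/2)], the two one-dimensional
    integrands met below. They have the explicit antiderivatives [- 2 (1 + x)^(-1/2)] and
    [4 (x / (1 + x))^(1/4)]. *)
Definition tail32 (x : R) : R := (1 + x) `^ (- (3 / 2)).
Definition tail34 (x : R) : R := (x / (1 + x)) `^ (- (3 / 4)) * (1 + x) ^- 2.

Lemma is_derive_shift (a x : R) : is_derive x 1 (fun y => a + y) 1.
Proof.
have -> : (fun y : R => a + y) = cst a + id by [].
by apply: is_derive_eq; rewrite add0r.
Qed.

Lemma tail32_lty : (\int[leb1 R]_x (tail32 `|x|)%:E < +oo)%E.
Proof.
have mt : measurable_fun [set: R] tail32 by rewrite /tail32; mfun.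
rewrite integral_abs_half_line//; last by move=> x; exact: powR_ge0.
have d (r x : R) : 0 < x -> is_derive x 1 (fun y => (1 + y) `^ r) (r * (1 + x) `^ (r - 1)).
  move=> x0; have x1 : 0 < 1 + x by rewrite addr_gt0.
  have /is_derive_eq := @is_derive1_comp R (fun z : R => z `^ r) (fun y => 1 + y) x _ _
    (@is_derive1_powR R r (1 + x) x1) (is_derive_shift 1 x).
  by apply; rewrite mulr1.
have H := @half_line_integral_le tail32 (fun x => 2 - 2 * (1 + x) `^ (- 2^-1)) 2.
apply: (@le_lt_trans _ _ (2%:E * 2%:E)%E); last by rewrite -EFinM ltry.
apply: lee_wpmul2l; first by rewrite lee_fin.
apply: H; last exact: mt.
- move=> x x0.
  have -> : (fun x : R => 2 - 2 * (1 + x) `^ (- 2^-1)) =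
      cst 2 - (2 *: (fun x => (1 + x) `^ (- 2^-1) : R)) by [].
  have := d (- 2^-1) _ x0 => D; apply: is_derive_eq; rewrite /GRing.scale/= sub0r /tail32.
  have E : - 2^-1 - 1 = - (3 / 2) :> R by field.
  by rewrite E mulNr mulrN opprK mulrA divff// mul1r.
- move=> x x0; apply: differentiable_continuous; apply/derivable1_diffP.
  by have [] := d (- (3 / 2)) _ x0.
- by move=> x _; exact: powR_ge0.
- move=> x x0; have p1 (r : R) : 1 `^ r = 1 by rewrite powR1.
  rewrite subr_ge0 gerBl mulr_ge0 ?powR_ge0// andbT ler_piMr//.
  rewrite powRN invf_le1 ?powR_gt0 ?addr_gt0// -[leLHS](p1 2^-1).
  by rewrite ge0_ler_powR// ?nnegrE ?invr_ge0// ?addr_ge0 ?ltW// ltrDl.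
Qed.

Lemma tail34_lty : (\int[leb1 R]_x (tail34 `|x|)%:E < +oo)%E.
Proof.
have mt : measurable_fun [set: R] tail34 by rewrite /tail34; mfun.
have t0 x : 0 <= tail34 x by rewrite mulr_ge0 ?powR_ge0// invr_ge0 sqr_ge0.
rewrite integral_abs_half_line//.
have dg (x : R) : 0 < x -> is_derive x 1 (fun y => y / (1 + y)) ((1 + x) ^- 2).
  move=> x0; have x1 : 1 + x != 0 by rewrite gt_eqF// addr_gt0.
  have D1 : is_derive x 1 (fun y : R => (1 + y)^-1) (- (1 + x) ^- 2).
    have := @is_deriveV R (fun y : R => 1 + y) x _ _ x1 (is_derive_shift 1 x).
    by move=> D; apply: is_derive_eq; rewrite /GRing.scale/= mulr1.
  have /is_derive_eq := is_deriveM (is_derive_id x 1) D1.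
  by apply; rewrite /GRing.scale/=; field.
have g0 (x : R) : 0 < x -> 0 < x / (1 + x) by move=> x0; rewrite divr_gt0// addr_gt0.
have d (r x : R) : 0 < x -> is_derive x 1 (fun y => (y / (1 + y)) `^ r)
    (r * (x / (1 + x)) `^ (r - 1) * (1 + x) ^- 2).
  move=> x0; exact: (@is_derive1_comp R (fun z : R => z `^ r) (fun y => y / (1 + y)) x _ _
    (@is_derive1_powR R r (x / (1 + x)) (g0 x x0)) (dg x x0)).
have H := @half_line_integral_le tail34 (fun x => 4 * (x / (1 + x)) `^ 4^-1) 4.
apply: (@le_lt_trans _ _ (2%:E * 4%:E)%E); last by rewrite -EFinM ltry.
apply: lee_wpmul2l; first by rewrite lee_fin.
apply: H; last exact: mt.
- move=> x x0.
  have -> : (fun x : R => 4 * (x / (1 + x)) `^ 4^-1) =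
      4 *: (fun x => (x / (1 + x)) `^ 4^-1 : R) by [].
  have := d 4^-1 _ x0 => D; apply: is_derive_eq; rewrite /GRing.scale/= /tail34.
  have E : 4^-1 - 1 = - (3 / 4) :> R by field.
  by rewrite E !mulrA divff// mul1r.
- move=> x x0; have c : {for x, continuous (fun y : R => (y / (1 + y)) `^ (- (3 / 4)))}.
    apply: differentiable_continuous; apply/derivable1_diffP.
    by have [] := d (- (3 / 4)) _ x0.
  apply: cvgM; first exact: c.
  apply: cvgV; first by rewrite expf_neq0// gt_eqF// addr_gt0.
  have c1 : 1 + y @[y --> x] --> (1 + x : R) by apply: cvgD; [exact: cvg_cst|exact: cvg_id].
  exact: (cvgM c1 c1).
- by move=> x _; exact: t0.
- move=> x x0; have p1 (r : R) : 1 `^ r = 1 by rewrite powR1.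
  rewrite mulr_ge0 ?powR_ge0//= ler_piMr// -[leRHS](p1 4^-1).
  rewrite ge0_ler_powR// ?nnegrE ?invr_ge0// ?(ltW (g0 _ x0))//.
  by rewrite ler_pdivrMr ?addr_gt0// mul1r lerDr.
Qed.

Lemma tail34_le (y : R) : 0 <= y -> y `^ (- (3 / 4)) * (1 + y) `^ (- (5 / 2)) <= tail34 y.
Proof.
move=> yge; have [->|yn] := eqVneq y 0.
  (* At [y = 0] the negative power is 0 by convention, not infinite. *)
  rewrite powR0; last by rewrite oppr_eq0 mulf_neq0.
  by rewrite mul0r mulr_ge0 ?powR_ge0// invr_ge0 sqr_ge0.
have y0 : 0 < y by rewrite lt_neqAle eq_sym yn.
have y1 : 0 < 1 + y by rewrite addr_gt0.
have y1' := ltW y1; rewrite /tail34 powRM ?invr_ge0//.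
have E1 : (1 + y)^-1 `^ (- (3 / 4)) = (1 + y) `^ (3 / 4).
  by rewrite -(powR_inv1 y1') -powRrM mulN1r opprK.
have E2 : (1 + y) ^- 2 = (1 + y) `^ (- 2%:R) by rewrite powR_invn.
rewrite E1 E2 -mulrA; apply: ler_wpM2l; first exact: powR_ge0.
rewrite -powRD; last by rewrite (gt_eqF y1) implybT.
by apply: ler_powR; [rewrite lerDl|lra].
Qed.

(** The form [kS2] below at [t = 1]; it bounds [kS2] from below for every [t], up to the constant
    [kmin]. *)
Definition shearQ (eta : plane R) : R := 1 + eta.2 ^+ 2 + eta.1 ^+ 2 / (1 + `|eta.2|).

Lemma shearQ_ge1 eta : 1 <= shearQ eta.
Proof. by rewrite /shearQ -addrA lerDl addr_ge0 ?sqr_ge0// divr_ge0 ?sqr_ge0// addr_ge0. Qed.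

Lemma sqr_abs_le (y : R) : (1 + `|y|) ^+ 2 <= 2 * (1 + y ^+ 2).
Proof. by rewrite -(real_normK (num_real y)); have := sqr_ge0 (1 - `|y|); nra. Qed.

Lemma sqrt_tail_le (y : R) :
  Num.sqrt ((1 + `|y|) * (1 + y ^+ 2)) / (1 + y ^+ 2) ^+ 2 <= 3 * (1 + `|y|) `^ (- (5 / 2)).
Proof.
have m0 : 0 < 1 + `|y| by rewrite ltr_pwDl.
have A0 : 0 < 1 + y ^+ 2 by rewrite ltr_pwDl// sqr_ge0.
have mA := sqr_abs_le y.
move: (1 + `|y|) (1 + y ^+ 2) m0 A0 mA => m A m0 A0 mA.
have m0' := ltW m0; have A0' := ltW A0.
have -> : m `^ (- (5 / 2)) = Num.sqrt m / m ^+ 3.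
  have E : - (5 / 2) = 2^-1 - 3%:R :> R by field.
  by rewrite E powRD ?(gt_eqF m0) ?implybT// powR12_sqrt// powR_invn.
rewrite sqrtrM// ler_pdivrMr ?exprn_gt0//.
have -> : 3 * (Num.sqrt m / m ^+ 3) * A ^+ 2 = Num.sqrt m * (3 * A ^+ 2 / m ^+ 3).
  by field; rewrite (gt_eqF m0).
rewrite ler_wpM2l ?sqrtr_ge0// ler_pdivlMr ?exprn_gt0//.
rewrite -{2}(sqr_sqrtr A0'); have := sqrtr_ge0 A; have : m ^+ 2 <= 2 * Num.sqrt A ^+ 2.
  by rewrite sqr_sqrtr.
move: (Num.sqrt A) => r mr r0.
(* From [m^2 <= 2 r^2] one gets [m^6 <= 8 r^6], and [8 <= 3^2] explains the constant 3. *)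
have H : m ^+ 3 <= 3 * r ^+ 3.
  rewrite -ler_sqr ?nnegrE ?mulr_ge0 ?exprn_ge0//.
  have -> : (m ^+ 3) ^+ 2 = (m ^+ 2) ^+ 3 by rewrite -!exprM.
  have -> : (3 * r ^+ 3) ^+ 2 = 9 * (r ^+ 2) ^+ 3 by ring.
  have r20 := sqr_ge0 r.
  apply: (@le_trans _ _ ((2 * r ^+ 2) ^+ 3)).
    by rewrite lerXn2r ?nnegrE ?sqr_ge0 ?mulr_ge0.
  by rewrite exprMn ler_wpM2r ?exprn_ge0//; lra.
have -> : 3 * (r ^+ 2) ^+ 2 = r * (3 * r ^+ 3) by ring.
exact: ler_wpM2l.
Qed.

Lemma inv_quartic_lty : (\int[leb1 R]_x ((1 + x ^+ 2) ^- 2)%:E < +oo)%E.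
Proof.
apply: (@le_lt_trans _ _ (4%:E * \int[leb1 R]_x (tail32 `|x|)%:E)%E); last first.
  by rewrite lte_mul_pinfty ?lee_fin// tail32_lty.
rewrite -ge0_integralZl_real//; first last.
- by apply/measurable_EFinP; rewrite /tail32; mfun.
- by move=> x _; exact: powR_ge0.
apply: ge0_le_integral_any => x _; first by rewrite lee_fin invr_ge0 sqr_ge0.
rewrite lee_fin /tail32; have := sqr_abs_le x.
have m1 : 1 <= 1 + `|x| by rewrite lerDl.
have A0 : 0 < 1 + x ^+ 2 by rewrite ltr_pwDl// sqr_ge0.
move: (1 + `|x|) (1 + x ^+ 2) m1 A0 => m A m1 A0 mA.
have m0 : 0 < m by exact: lt_le_trans m1.
apply: (@le_trans _ _ (4 * m `^ (- 4%:R))); last first.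
  by rewrite ler_wpM2l// ler_powR//; lra.
rewrite powR_invn ?(ltW m0)// -[leLHS]mul1r ler_pdivrMr ?exprn_gt0// mulrAC.
rewrite ler_pdivlMr ?exprn_gt0// mul1r.
have -> : m ^+ 4 = (m ^+ 2) ^+ 2 by rewrite -exprM.
have -> : 4 * A ^+ 2 = (2 * A) ^+ 2 by ring.
by rewrite lerXn2r ?nnegrE ?sqr_ge0 ?mulr_ge0 ?(ltW A0).
Qed.

(** The first coordinate is integrated out by rescaling, which leaves a constant times the left side
    of [sqrt_tail_le]; [c] is the remaining weight in the second coordinate. *)
Lemma shearQ_integral_lty (c t : R -> R) : measurable_fun [set: R] c ->
  measurable_fun [set: R] t -> (forall y, 0 <= c y) ->
  (forall y, c y * (3 * (1 + `|y|) `^ (- (5 / 2))) <= t y) ->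
  (\int[leb1 R]_y (t y)%:E < +oo)%E ->
  (\int[leb2 R]_e (c e.2 * shearQ e ^- 2)%:E < +oo)%E.
Proof.
move=> mc mt c0 ct tfin.
have mQ : measurable_fun setT (fun e : plane R => (c e.2 * shearQ e ^- 2)%:E).
  by apply/measurable_EFinP; rewrite /shearQ; mfun.
have Q0 (e : plane R) : (0 <= (c e.2 * shearQ e ^- 2)%:E)%E.
  by rewrite lee_fin mulr_ge0// invr_ge0 sqr_ge0.
rewrite leb2_int21//.
pose J := (\int[leb1 R]_x ((1 + x ^+ 2) ^- 2)%:E)%E.
have J0 : (0 <= J)%E by apply: integral_ge0 => x _; rewrite lee_fin invr_ge0 sqr_ge0.
have Jfin : J = (fine J)%:E by rewrite fineK// ge0_fin_numE// inv_quartic_lty.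
have J0' : 0 <= fine J by rewrite fine_ge0.
apply: (@le_lt_trans _ _ (\int[leb1 R]_y (fine J * t y)%:E)%E); last first.
  rewrite ge0_integralZl_real//; last 2 first.
  - by move=> y _; apply: le_trans (ct y); rewrite mulr_ge0// mulr_ge0// powR_ge0.
  - exact/measurable_EFinP.
  rewrite lte_mul_pinfty ?lee_fin//.
apply: ge0_le_integral_any => y _; first by apply: integral_ge0 => x _; exact: Q0.
have m0 : 0 < 1 + `|y| by rewrite ltr_pwDl.
have A0 : 0 < 1 + y ^+ 2 by rewrite ltr_pwDl// sqr_ge0.
set m := 1 + `|y| in m0; set A := 1 + y ^+ 2 in A0.
have mA0 : 0 < m * A by rewrite mulr_gt0.
pose a := (Num.sqrt (m * A))^-1.
have a0 : 0 < a by rewrite invr_gt0 sqrtr_gt0.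
have a0' : a != 0 by rewrite gt_eqF.
have a2 : a ^+ 2 = (m * A)^-1 by rewrite exprVn sqr_sqrtr// ltW.
(* At fixed [y], [shearQ] is a quadratic polynomial in [x], of the form [A (1 + a^2 x^2)]. *)
have QE (x : R) : c y * shearQ (x, y) ^- 2 = (c y * A ^- 2) * (1 + (a * x + 0) ^+ 2) ^- 2.
  have -> : shearQ (x, y) = A * (1 + (a * x + 0) ^+ 2).
    rewrite addr0 (exprMn _ a x) a2 /shearQ /= -/m -/A.
    by field; rewrite (gt_eqF m0) (gt_eqF A0).
  by rewrite (exprMn _ A) invfM mulrA.
under eq_integral do rewrite /= QE.
have mh : measurable_fun [set: R] (fun x : R => ((1 + x ^+ 2) ^- 2)%:E).
  by apply/measurable_EFinP; mfun.
have h0 (x : R) : (0 <= ((1 + x ^+ 2) ^- 2)%:E)%E by rewrite lee_fin invr_ge0 sqr_ge0.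
rewrite ge0_integralZl_real//; first last.
- by apply/measurable_EFinP; mfun.
- by move=> x _; rewrite invr_ge0 sqr_ge0.
- by rewrite mulr_ge0// invr_ge0 sqr_ge0.
have := @ge0_integral_affine R a 0 (fun x => ((1 + x ^+ 2) ^- 2)%:E) a0' mh h0.
move=> ->; rewrite -/J Jfin -!EFinM lee_fin gtr0_norm// invrK mulrA mulrC ler_wpM2l//.
apply: le_trans (ct y); rewrite -mulrA ler_wpM2l// mulrC.
exact: sqrt_tail_le.
Qed.

Lemma shearQ_integral34_lty :
  (\int[leb2 R]_e (`|e.2| `^ (- (3 / 4)) * shearQ e ^- 2)%:E < +oo)%E.
Proof.
have mt : measurable_fun [set: R] (fun y : R => 3 * tail34 `|y|) by rewrite /tail34; mfun.
apply: (@shearQ_integral_lty (fun y => `|y| `^ (- (3 / 4))) (fun y => 3 * tail34 `|y|)) => //.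
- by mfun.
- by move=> y; rewrite mulrCA ler_wpM2l// tail34_le.
- rewrite ge0_integralZl_real//.
  + by rewrite lte_mul_pinfty ?lee_fin// tail34_lty.
  + by move=> x _; rewrite mulr_ge0 ?powR_ge0// invr_ge0 sqr_ge0.
  + by apply/measurable_EFinP; rewrite /tail34; mfun.
Qed.

Lemma shearQ_integral1_lty : (\int[leb2 R]_e (`|e.2| * shearQ e ^- 2)%:E < +oo)%E.
Proof.
have mt : measurable_fun [set: R] (fun y : R => 3 * tail32 `|y|) by rewrite /tail32; mfun.
apply: (@shearQ_integral_lty (fun y => `|y|) (fun y => 3 * tail32 `|y|)) => //.
- move=> y; rewrite mulrCA ler_wpM2l// /tail32.
  have m0 : 0 < 1 + `|y| by rewrite ltr_pwDl.
  have E : - (3 / 2) = 1 - 5 / 2 :> R by field.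
  rewrite E powRD ?(gt_eqF m0) ?implybT// powRr1 ?(ltW m0)//.
  by rewrite ler_wpM2r ?powR_ge0// lerDr.
- rewrite ge0_integralZl_real//.
  + by rewrite lte_mul_pinfty ?lee_fin// tail32_lty.
  + by move=> x _; exact: powR_ge0.
  + by apply/measurable_EFinP; rewrite /tail32; mfun.
Qed.

End one_dim_tails.

(** * The reproducing kernel *)

Section cosine_tensor.
Variable R : realType.

Lemma integrable_cos_gs (k : nat) : forall (c : plane R -> R), measurable_fun setT c ->
  (forall z, `|c z| <= 1) ->
  (leb2 R).-integrable setT (EFin \o (fun z => c z * (gs z.1 * (z.2 ^+ k * gs z.2)))).
Proof.
move=> c mc c1; have m1 : measurable_fun [set: R] (fun _ : R => 1 : R) by [].
have n1 (u : R) : `|1 : R| <= 1 by rewrite normr1.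
have ik : (leb1 R).-integrable setT (EFin \o (fun u : R => u ^+ k * gs u)).
  by apply: eq_integrable (integrable_bounded_mono_gs k m1 n1) => // u _ /=; rewrite mul1r.
have it := integrable_tensor (@integrable_gs R) ik.
apply: (@integrable_dominated _ _ _ (leb2 R) _ (fun z => `|gs z.1 * (z.2 ^+ k * gs z.2)|)).
- by mfun.
- exact: integrable_norm.
- by move=> z; rewrite (normrM (c z)) ler_piMl.
Qed.

(** In the addition formula the product of sines drops out, since [sin (u a) gs u] is odd. *)
Lemma Rintegral_cos_tensor (k : nat) (a b : R) :
  \int[leb2 R]_z (cos (z.1 * a + z.2 * b) * (gs z.1 * (z.2 ^+ k * gs z.2))) =
  Cgs 0 a * Cgs k b.
Proof.
have iC0 : (leb1 R).-integrable setT (EFin \o (fun u : R => cos (u * a) * gs u)).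
  by apply: eq_integrable (integrable_Cgs 0 a) => // u _ /=; rewrite expr0 mul1r.
have iS0 : (leb1 R).-integrable setT (EFin \o (fun u : R => sin (u * a) * gs u)).
  by apply: eq_integrable (integrable_Sgs 0 a) => // u _ /=; rewrite expr0 mul1r.
have i1 := integrable_tensor iC0 (integrable_Cgs k b).
have i2 := integrable_tensor iS0 (integrable_Sgs k b).
transitivity (\int[leb2 R]_z ((cos (z.1 * a) * gs z.1) * (cos (z.2 * b) * (z.2 ^+ k * gs z.2)) -
    (sin (z.1 * a) * gs z.1) * (sin (z.2 * b) * (z.2 ^+ k * gs z.2)))).
  apply: eq_Rintegral => z _; rewrite cosD.
  move: (cos (z.1 * a)) (cos (z.2 * b)) (sin (z.1 * a)) (sin (z.2 * b)) (gs z.1)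
    (z.2 ^+ k * gs z.2) => A B C D E F.
  by have H : forall A B C D E F : R, (A * B - C * D) * (E * F) = A * E * (B * F) - C * E * (D * F)
    by move=> *; ring.
rewrite (RintegralB measurableT i1 i2) (Rintegral_tensor iC0 (integrable_Cgs k b)).
rewrite (Rintegral_tensor iS0 (integrable_Sgs k b)).
have -> : \int[leb1 R]_x (sin (x * a) * gs x) = 0.
  by rewrite -[RHS](Sgs0 a); apply: eq_Rintegral => u _; rewrite expr0 mul1r.
rewrite mul0r subr0; congr (_ * _).
by apply: eq_Rintegral => u _; rewrite expr0 mul1r.
Qed.

Lemma Rintegral_sin_tensor (a b : R) :
  \int[leb2 R]_z (sin (z.1 * a + z.2 * b) * (gs z.1 * (z.2 ^+ 0 * gs z.2))) = 0.
Proof.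
have iC c : (leb1 R).-integrable setT (EFin \o (fun u : R => cos (u * c) * gs u)).
  by apply: eq_integrable (integrable_Cgs 0 c) => // u _ /=; rewrite expr0 mul1r.
have iS c : (leb1 R).-integrable setT (EFin \o (fun u : R => sin (u * c) * gs u)).
  by apply: eq_integrable (integrable_Sgs 0 c) => // u _ /=; rewrite expr0 mul1r.
have S0 c : \int[leb1 R]_x (sin (x * c) * gs x) = 0.
  by rewrite -[RHS](Sgs0 c); apply: eq_Rintegral => u _; rewrite expr0 mul1r.
have i1 := integrable_tensor (iS a) (iC b); have i2 := integrable_tensor (iC a) (iS b).
transitivity (\int[leb2 R]_z ((sin (z.1 * a) * gs z.1) * (cos (z.2 * b) * gs z.2) +
    (cos (z.1 * a) * gs z.1) * (sin (z.2 * b) * gs z.2))).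
  apply: eq_Rintegral => z _; rewrite sinD expr0 mul1r.
  move: (cos (z.1 * a)) (cos (z.2 * b)) (sin (z.1 * a)) (sin (z.2 * b)) (gs z.1)
    (gs z.2) => A B C D E F.
  by have H : forall A B C D E F : R, (C * B + A * D) * (E * F) = C * E * (B * F) + A * E * (D * F)
    by move=> *; ring.
rewrite (RintegralD measurableT i1 i2) (Rintegral_tensor (iS a) (iC b)).
by rewrite (Rintegral_tensor (iC a) (iS b)) !S0 mul0r mulr0 addr0.
Qed.

End cosine_tensor.

Section shkernel.
Variables (R : realType) (t : R).
Hypothesis t0 : 0 < t.
Let t0' : t != 0. Proof. by rewrite gt_eqF. Qed.

(** The signed square root, inverse to [s |-> s |s|], with the value 0 at 0. It recovers the first
    diagonal entry of an element of the conjugate group from the second. *)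
Definition sq (x : R) : R := x / Num.sqrt `|x|.

Lemma sqr_sq x : sq x ^+ 2 = `|x|.
Proof.
have [->|x0] := eqVneq x 0; first by rewrite /sq mul0r expr0n normr0.
rewrite /sq expr_div_n sqr_sqrtr// -(real_normK (num_real x)) expr2 mulfK// normr_eq0 //.
Qed.

Lemma normr_sq x : `|sq x| = Num.sqrt `|x|.
Proof. by rewrite -[in RHS]sqr_sq sqrtr_sqr. Qed.

Lemma sq_normM x : sq x * `|sq x| = x.
Proof.
rewrite normr_sq; have [->|x0] := eqVneq x 0; first by rewrite /sq !mul0r.
by rewrite /sq divfK// gt_eqF// sqrtr_gt0 normr_gt0.
Qed.

Lemma measurable_sq : measurable_fun [set: R] sq.
Proof. by rewrite /sq; mfun. Qed.

(** Why the fourth power: integrating over [eta] costs the Jacobian [xi2^-2], and the [xi2^2] that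
    remains is the one in the Fourier transform of [psiR]. *)
Definition gprof (xi : plane R) : R := gs xi.1 * (xi.2 ^+ 4 * gs xi.2).
Definition gwin (z : plane R) : R := gs (t * z.1) * gs (t * z.2).
(** [k^T xi] and, next, [k z], for the lower triangular [k] with bottom row [eta]. For fixed [xi]
    the former is a shear in [eta]. *)
Definition ktr (eta xi : plane R) : plane R :=
  (xi.2 * eta.1 + sq eta.2 * xi.1, xi.2 * eta.2).
Definition kact (eta z : plane R) : plane R :=
  (sq eta.2 * z.1, eta.1 * z.1 + eta.2 * z.2).

(* Inverse Fourier transform of xi |-> gprof xi * gwin (k^T xi), where
   k = [[sq eta2, 0], [eta1, eta2]] *)
Definition shkernel (x eta : plane R) : R :=
  \int[leb2 R]_xi (cos (xi.1 * x.1 + xi.2 * x.2) * gprof xi * gwin (ktr eta xi)).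

Lemma measurable_gprof : measurable_fun setT gprof.
Proof. by rewrite /gprof; mfun. Qed.
Lemma measurable_gwin : measurable_fun setT gwin.
Proof. by rewrite /gwin; mfun. Qed.

Lemma measurable_ktr d (T : measurableType d) (f g : T -> plane R) :
  measurable_fun setT f -> measurable_fun setT g ->
  measurable_fun setT (fun w => ktr (f w) (g w)).
Proof. by move=> mf mg; have ms := measurable_sq; rewrite /ktr; mfun. Qed.

Lemma measurable_kact d (T : measurableType d) (f g : T -> plane R) :
  measurable_fun setT f -> measurable_fun setT g ->
  measurable_fun setT (fun w => kact (f w) (g w)).
Proof. by move=> mf mg; have ms := measurable_sq; rewrite /kact; mfun. Qed.

Lemma measurable_shkernel d (T : measurableType d) (f g : T -> plane R) :
  measurable_fun setT f -> measurable_fun setT g ->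
  measurable_fun setT (fun w => shkernel (f w) (g w)).
Proof.
move=> mf mg; apply: (@measurable_param_Rintegral _ _ T (plane R) R (leb2 R)
  (@sigma_finite_leb2 R) (fun w xi => cos (xi.1 * (f w).1 + xi.2 * (f w).2) * gprof xi *
    gwin (ktr (g w) xi))).
have mp := measurable_gprof; have mw := measurable_gwin.
apply: measurable_funM; first by mfun.
by apply: (measurableT_comp mw); apply: measurable_ktr; mfun.
Qed.

(** Triangular factorization of the form [1 + t^2 k k^T]: [ktau^2] is its leading coefficient, [kS2]
    the Schur complement, and [kdelta] the off-diagonal multiplier. *)
Definition ktau (eta : plane R) : R := Num.sqrt (1 + t ^+ 2 * `|eta.2|).
Definition kS2 (eta : plane R) : R :=
  1 + t ^+ 2 * eta.2 ^+ 2 + t ^+ 2 * eta.1 ^+ 2 / (1 + t ^+ 2 * `|eta.2|).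
Definition kS (eta : plane R) : R := Num.sqrt (kS2 eta).

Let tt : 0 <= t ^+ 2. Proof. exact: sqr_ge0. Qed.

Lemma tau2_ge1 (eta : plane R) : 1 <= 1 + t ^+ 2 * `|eta.2|.
Proof. by rewrite lerDl mulr_ge0. Qed.

Lemma kS2_ge1 eta : 1 <= kS2 eta.
Proof.
have T1 := le_trans ler01 (tau2_ge1 eta).
rewrite /kS2 -addrA lerDl; apply: addr_ge0; first by rewrite mulr_ge0// sqr_ge0.
by rewrite mulr_ge0 ?invr_ge0// mulr_ge0// sqr_ge0.
Qed.

Lemma ktau_ge1 eta : 1 <= ktau eta.
Proof. by rewrite /ktau -[leLHS]sqrtr1 ler_wsqrtr// tau2_ge1. Qed.
Lemma kS_ge1 eta : 1 <= kS eta.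
Proof. by rewrite /kS -[leLHS]sqrtr1 ler_wsqrtr// kS2_ge1. Qed.

Lemma ktau2 eta : ktau eta ^+ 2 = 1 + t ^+ 2 * `|eta.2|.
Proof. by rewrite sqr_sqrtr// (le_trans _ (tau2_ge1 eta)). Qed.
Lemma kS2E eta : kS eta ^+ 2 = kS2 eta.
Proof. by rewrite sqr_sqrtr// (le_trans _ (kS2_ge1 eta)). Qed.

Definition kdelta (eta : plane R) : R := t ^+ 2 * sq eta.2 * eta.1 / ktau eta ^+ 2.

(* Diagonalizes the exponent of the Gaussian integrand of [shkernel]. *)
Lemma complete_square (eta xi : plane R) :
  xi.1 ^+ 2 + xi.2 ^+ 2 + t ^+ 2 * ((ktr eta xi).1 ^+ 2 + (ktr eta xi).2 ^+ 2) =
  (ktau eta * xi.1 + ktau eta * kdelta eta * xi.2) ^+ 2 + (kS eta * xi.2) ^+ 2.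
Proof.
have T1 : 1 + t ^+ 2 * `|eta.2| != 0 by rewrite gt_eqF// (lt_le_trans _ (tau2_ge1 eta)).
have -> : ktau eta * xi.1 + ktau eta * kdelta eta * xi.2 =
  ktau eta * (xi.1 + kdelta eta * xi.2) by rewrite mulrDr mulrA.
rewrite !exprMn kS2E ktau2 /kdelta ktau2 /kS2 /ktr /=.
have := sqr_sq eta.2; move: (sq eta.2) T1 => s; rewrite -!/(_ ^+ 2).
move: (`|eta.2|) => b T1 sb; rewrite -sb in T1 *.
move: eta.1 eta.2 xi.1 xi.2 => e1 e2 x1 x2 {eta xi}.
have E : forall e1 e2 x1 x2 u s : R, 1 + u * s ^+ 2 != 0 ->
  x1 ^+ 2 + x2 ^+ 2 + u * ((x2 * e1 + s * x1) ^+ 2 + x2 ^+ 2 * e2 ^+ 2) =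
  (1 + u * s ^+ 2) * (x1 + u * s * e1 / (1 + u * s ^+ 2) * x2) ^+ 2 +
  (1 + u * e2 ^+ 2 + u * e1 ^+ 2 / (1 + u * s ^+ 2)) * x2 ^+ 2.
  by move=> *; field.
exact: E.
Qed.

(** After the triangular substitution that completes the square the Gaussian integral factorizes.
    The Jacobian contributes [(ktau kS)^-1], and [xi2^4] contributes the other [kS^-4]. *)
Lemma kernelE (x eta : plane R) : shkernel x eta = (ktau eta * kS eta ^+ 5)^-1 *
  (Cgs 0 (x.1 / ktau eta) * Cgs 4 ((x.2 - kdelta eta * x.1) / kS eta)).
Proof.
have ta1 := ktau_ge1 eta; have S1 := kS_ge1 eta.
have CS := complete_square eta.
have ta0 : 0 < ktau eta by exact: lt_le_trans ta1.
have S0 : 0 < kS eta by exact: lt_le_trans S1.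
rewrite /shkernel; move: (ktau eta) (kS eta) (kdelta eta) CS ta0 S0 => ta S de CS ta0 S0.
have ta0' := lt0r_neq0 ta0; have S0' := lt0r_neq0 S0.
pose a := x.1 / ta; pose b := (x.2 - de * x.1) / S.
pose h (z : plane R) := cos (z.1 * a + z.2 * b) * (gs z.1 * (z.2 ^+ 4 * gs z.2)).
have mb : measurable_fun [set: R] (fun x2 : R => ta * de * x2) by mfun.
have mc : measurable_fun setT (fun z : plane R => cos (z.1 * a + z.2 * b)) by mfun.
have ih := integrable_cos_gs 4 mc (fun z => normr_cos_le1 _).
have H := @Rintegral_skew1 R ta S 0 _ ta0' S0' mb h ih.
rewrite Rintegral_cos_tensor -/a -/b in H *.
have cosE (u1 u2 y1 y2 : R) : u1 * y1 + u2 * y2 =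
    (ta * u1 + ta * de * u2) * (y1 / ta) + (S * u2 + 0) * ((y2 - de * y1) / S).
  by field; rewrite ta0' S0'.
have gsE (z : plane R) : gs z.1 * gs z.2 * gwin (ktr eta z) =
    gs (ta * z.1 + ta * de * z.2) * gs (S * z.2 + 0).
  rewrite /gwin /gs -!expRD addr0; congr expR; have := CS z.
  move: (ktr eta z) (ta * z.1 + ta * de * z.2) (S * z.2) z.1 z.2 => [k1 k2] A B z1 z2 /=.
  have E : forall z1 z2 k1 k2 A B : R,
      z1 ^+ 2 + z2 ^+ 2 + t ^+ 2 * (k1 ^+ 2 + k2 ^+ 2) = A ^+ 2 + B ^+ 2 ->
      - (z1 ^+ 2 / 2) + - (z2 ^+ 2 / 2) + (- ((t * k1) ^+ 2 / 2) + - ((t * k2) ^+ 2 / 2)) =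
      - (A ^+ 2 / 2) + - (B ^+ 2 / 2).
    move=> u1 u2 v1 v2 A' B' EE; rewrite -!opprD -!mulrDl -EE !exprMn; congr (- (_ / 2)); ring.
  exact: E.
transitivity (\int[leb2 R]_z (S ^- 4 * h (skew1 ta S 0 (fun x2 : R => ta * de * x2) z))).
  apply: eq_Rintegral => z _; rewrite /h /skew1 /= /a /b -cosE /gprof.
  have := gsE z; rewrite addr0 exprMn.
  move: (cos _) (gs z.1) (gs z.2) (gwin _) (gs (ta * _ + _)) (gs (S * _)) (z.2 ^+ 4)
    => c g1 g2 w G1 G2 z4.
  have E : forall c g1 g2 w G1 G2 z4 : R, g1 * g2 * w = G1 * G2 ->
      c * (g1 * (z4 * g2)) * w = S ^- 4 * (c * (G1 * (S ^+ 4 * z4 * G2))).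
    move=> c' g1' g2' w' G1' G2' z4' EE.
    have -> : c' * (g1' * (z4' * g2')) * w' = c' * z4' * (g1' * g2' * w') by ring.
    by rewrite EE; field.
  exact: E.
have ih' := @integrable_skew1 R ta S 0 _ ta0' S0' mb h ih.
rewrite (RintegralZl _ measurableT ih') H gtr0_norm ?mulr_gt0// mulrA; congr (_ * _).
by field; rewrite ta0' S0'.
Qed.

Lemma Cgs04_bound : exists2 K : R, 0 <= K &
  forall x : R, `|Cgs 0 x| <= K * gs4 x /\ `|Cgs 4 x| <= K * gs4 x.
Proof.
have [K0 k0 H0] := @gs_mono_bound R 0; have [K2 k2 H2] := @gs_mono_bound R 2.
have [K4 k4 H4] := @gs_mono_bound R 4.
pose w : R := Num.sqrt (pi *+ 2); have w0 : 0 <= w by exact: sqrtr_ge0.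
have g4 (x : R) : 0 <= gs4 x by exact: expR_ge0.
exists (w * (3 * K0 + 6 * K2 + K4)); first by rewrite mulr_ge0// !addr_ge0// mulr_ge0.
move=> x; have := H0 x; have := H2 x; have := H4 x; rewrite expr0 mul1r.
rewrite -!normrX (ger0_norm (sqr_ge0 x)) (_ : `|x ^+ 4| = x ^+ 4); last first.
  by rewrite ger0_norm// exprn_even_ge0.
move=> h4 h2 h0; have gg := gs_ge0 x; split.
  rewrite Cgs0 normrM (ger0_norm (sqrtr_ge0 _)) (ger0_norm gg) -mulrA ler_wpM2l//.
  by rewrite (le_trans h0)// ler_wpM2r//; lra.
rewrite Cgs4 normrM (ger0_norm (sqrtr_ge0 _)) -mulrA ler_wpM2l//.
have -> : (3 - 6 * x ^+ 2 + x ^+ 4) * gs x = 3 * gs x - 6 * (x ^+ 2 * gs x) + x ^+ 4 * gs x by ring.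
have x20 : 0 <= x ^+ 2 * gs x by rewrite mulr_ge0// sqr_ge0.
have x40 : 0 <= x ^+ 4 * gs x by rewrite mulr_ge0// exprn_even_ge0.
rewrite ler_norml; move: (gs x) (x ^+ 2 * gs x) (x ^+ 4 * gs x) (gs4 x) (g4 x) h0 h2 h4 gg x20 x40.
move=> a b c g g0 h0 h2 h4 a0 b0 c0; rewrite !mulrDl -!mulrA.
by apply/andP; split; lra.
Qed.

(** Termwise comparison. In the last term, clearing denominators leaves [e ((u - c) + u b (1 - c))],
    which is nonnegative because [c <= u] and [c <= 1]. *)
Lemma kS2_ge (eta : plane R) : Num.min 1 (t ^+ 2) * shearQ eta <= kS2 eta.
Proof.
set c := Num.min _ _; have c1 : c <= 1 by rewrite ge_min lexx.
have ct : c <= t ^+ 2 by rewrite ge_min lexx orbT.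
have c0 : 0 < c by rewrite lt_min ltr01 exprn_gt0.
have T1 := lt_le_trans ltr01 (tau2_ge1 eta).
have b0 : 0 <= `|eta.2| by [].
rewrite /shearQ /kS2 !mulrDr mulr1; apply: lerD; first apply: lerD => //.
  by rewrite ler_wpM2r// sqr_ge0.
have E (u e b : R) : c <= u -> 0 <= u -> 0 <= e -> 0 <= b -> c * (e / (1 + b)) <= u * e / (1 + u * b).
  move=> cu u0 e0 b0'; rewrite mulrA ler_pdivrMr ?ltr_pwDl// mulrAC.
  rewrite ler_pdivlMr; last by rewrite ltr_pwDl// mulr_ge0.
  rewrite -subr_ge0 (_ : _ - _ = e * ((u - c) + u * b * (1 - c))); last by ring.
  by rewrite mulr_ge0// addr_ge0 ?subr_ge0// mulr_ge0 ?subr_ge0// mulr_ge0.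
by apply: E => //; exact: sqr_ge0.
Qed.

Lemma kernel_gs4_bound : exists2 K : R, 0 <= K & forall x eta : plane R,
  `|shkernel x eta| <= K * (ktau eta * kS eta ^+ 5)^-1 *
    (gs4 (x.1 / ktau eta) * gs4 ((x.2 - kdelta eta * x.1) / kS eta)).
Proof.
have [K K0 HK] := Cgs04_bound; exists (K * K); first exact: mulr_ge0.
move=> x eta; rewrite kernelE normrM.
have ta0 := lt_le_trans ltr01 (ktau_ge1 eta); have S0 := lt_le_trans ltr01 (kS_ge1 eta).
rewrite [`|_^-1|]ger0_norm; last by rewrite invr_ge0 mulr_ge0 ?exprn_ge0// ltW.
rewrite [leRHS]mulrAC [leRHS]mulrC; apply: ler_wpM2l.
  by rewrite invr_ge0 mulr_ge0 ?exprn_ge0 ?(ltW ta0) ?(ltW S0).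
have [h1 _] := HK (x.1 / ktau eta); have [_ h2] := HK ((x.2 - kdelta eta * x.1) / kS eta).
by rewrite normrM mulrACA; apply: ler_pM.
Qed.

Definition kmin : R := Num.min 1 (t ^+ 2).

Lemma kmin_gt0 : 0 < kmin. Proof. by rewrite lt_min ltr01 exprn_gt0. Qed.

Lemma kS4_le eta : kS eta ^- 4 <= kmin ^- 2 * shearQ eta ^- 2.
Proof.
have c0 := kmin_gt0; have Q0 := lt_le_trans ltr01 (shearQ_ge1 eta).
have cQ0 : 0 < kmin * shearQ eta by rewrite mulr_gt0.
have E : kS eta ^+ 4 = kS2 eta ^+ 2 by rewrite -kS2E -exprM.
rewrite E -invfM -exprMn lef_pV2 ?posrE ?exprn_gt0//; last exact: lt_le_trans (kS2_ge1 _).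
by rewrite lerXn2r ?nnegrE ?(ltW cQ0)// ?kS2_ge// (le_trans _ (kS2_ge1 eta)).
Qed.

Lemma tauS_le eta : (ktau eta * kS eta ^+ 5)^-1 <= kS eta ^- 4.
Proof.
have ta1 := ktau_ge1 eta; have S1 := kS_ge1 eta.
have ta0 := lt_le_trans ltr01 ta1; have S0 := lt_le_trans ltr01 S1.
rewrite lef_pV2 ?posrE ?mulr_gt0 ?exprn_gt0//.
have -> : ktau eta * kS eta ^+ 5 = (ktau eta * kS eta) * kS eta ^+ 4 by rewrite exprS mulrA.
rewrite ler_peMl ?exprn_ge0 ?(ltW S0)//.
by rewrite -[leLHS]mulr1 ler_pM.
Qed.

Lemma gs4_le1 (x : R) : gs4 x <= 1.
Proof. by rewrite /gs4 -expR0 ler_expR oppr_le0 divr_ge0// sqr_ge0. Qed.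

(** The supremum uses [(ktau kS^5)^-1 <= kS^-4]. For the L^1 norm the rescaled profile has mass
    proportional to [ktau kS], which again leaves [kS^-4]; this is at most a constant times
    [shearQ^-2]. *)
Lemma kernel_bounds : exists2 K : R, 0 <= K & forall eta : plane R,
  (forall x : plane R, `|shkernel x eta| <= K * shearQ eta ^- 2) /\
  (\int[leb2 R]_x `|shkernel x eta|%:E <= (K * shearQ eta ^- 2)%:E)%E.
Proof.
have [K K0 HK] := kernel_gs4_bound.
have g4 (x : R) : 0 <= gs4 x by exact: expR_ge0.
have i4 := integrable_tensor (@integrable_gs4 R) (@integrable_gs4 R).
pose G := \int[leb2 R]_z (gs4 z.1 * gs4 z.2).
have G0 : 0 <= G by apply: Rintegral_ge0 => z _; rewrite mulr_ge0.
have c0 := kmin_gt0.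
exists (K * kmin ^- 2 * (1 + G)); first by rewrite !mulr_ge0 ?invr_ge0 ?exprn_ge0 ?(ltW c0)// addr_ge0.
move=> eta; have Q0 := lt_le_trans ltr01 (shearQ_ge1 eta).
have iQ : 0 <= shearQ eta ^- 2 by rewrite invr_ge0 sqr_ge0.
have ic : 0 <= kmin ^- 2 by rewrite invr_ge0 sqr_ge0.
have ta0 := lt_le_trans ltr01 (ktau_ge1 eta); have S0 := lt_le_trans ltr01 (kS_ge1 eta).
have TS := le_trans (tauS_le eta) (kS4_le eta).
have TS0 : 0 <= (ktau eta * kS eta ^+ 5)^-1 by rewrite invr_ge0 mulr_ge0 ?exprn_ge0// ltW.
split=> [x|].
  apply: (le_trans (HK x eta)); apply: (@le_trans _ _ (K * (kmin ^- 2 * shearQ eta ^- 2))).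
    rewrite -[leRHS]mulr1; apply: ler_pM; rewrite ?mulr_ge0//; last exact: mulr_ile1 (gs4_le1 _) (gs4_le1 _).
    exact: ler_wpM2l.
  rewrite -!mulrA; apply: ler_wpM2l => //; apply: ler_wpM2l => //.
  by rewrite ler_peMl// lerDl.
have ta0' : (ktau eta)^-1 != 0 by rewrite invr_eq0 gt_eqF.
have S0' : (kS eta)^-1 != 0 by rewrite invr_eq0 gt_eqF.
have mb : measurable_fun [set: R] (fun x1 : R => - (kdelta eta / kS eta) * x1) by mfun.
have H := @Rintegral_skew2 R (ktau eta)^-1 (kS eta)^-1 0 _ ta0' S0' mb _ i4.
have iH := @integrable_skew2 R (ktau eta)^-1 (kS eta)^-1 0 _ ta0' S0' mb _ i4.
pose h (x : plane R) := gs4 (x.1 / ktau eta) * gs4 ((x.2 - kdelta eta * x.1) / kS eta).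
have hE : (fun z : plane R => gs4 z.1 * gs4 z.2) \o
    skew2 (ktau eta)^-1 (kS eta)^-1 0 (fun x1 : R => - (kdelta eta / kS eta) * x1) = h.
  apply/funext => x; rewrite /h /skew2 /= addr0.
  have E1 : forall x1 a : R, a^-1 * x1 = x1 / a by move=> *; rewrite mulrC.
  have E : forall x1 x2 d b : R, b^-1 * x2 + - (d / b) * x1 = (x2 - d * x1) / b.
    by move=> *; ring.
  by rewrite E E1.
have ih : (leb2 R).-integrable setT (EFin \o h) by rewrite -hE.
have Ih : \int[leb2 R]_x h x = ktau eta * kS eta * G.
  rewrite -hE; apply: (etrans H); rewrite -/G -invfM normfV invrK gtr0_norm//.
  exact: mulr_gt0.
apply: (@le_trans _ _ (\int[leb2 R]_x (K * (ktau eta * kS eta ^+ 5)^-1 * h x)%:E)%E).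
  by apply: ge0_le_integral_any => x _; rewrite lee_fin//; exact: HK.
have ihE := integrable_fin_num measurableT ih.
rewrite ge0_integralZl_real//; first last.
- by case/integrableP: ih.
- by move=> x _; rewrite mulr_ge0.
- by rewrite mulr_ge0.
rewrite -(fineK ihE) -EFinM lee_fin -/(Rintegral _ _ _) Ih.
have -> : K * (ktau eta * kS eta ^+ 5)^-1 * (ktau eta * kS eta * G) = K * (kS eta ^- 4 * G).
  by field; rewrite (gt_eqF ta0) (gt_eqF S0).
have E : forall k a b g : R, k * a * g * b = k * ((a * b) * g) by move=> *; ring.
rewrite E; apply: ler_wpM2l => //; apply: ler_pM => //; last by rewrite lerDr.
  by rewrite invr_ge0 exprn_ge0// ltW.
exact: kS4_le.
Qed.

(** The Fourier transform of [gwin], a Gaussian of width [t]. *)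
Definition gwin_hat (z : plane R) : R := t ^- 2 * ((pi *+ 2) * gs2 t t z).

Lemma Rintegral_cos_gwin (c d : R) (z : plane R) :
  (leb2 R).-integrable setT (EFin \o (fun w : plane R =>
     cos (c - (w.1 * z.1 + w.2 * z.2)) * gwin w)) /\
  \int[leb2 R]_w (cos (c - (w.1 * z.1 + w.2 * z.2)) * gwin w) = cos c * gwin_hat z.
Proof.
have mc0 : measurable_fun [set: R] (fun _ : R => 0 : R) by [].
pose a := z.1 / t; pose b := z.2 / t.
pose hc (w : plane R) := cos (w.1 * a + w.2 * b) * (gs w.1 * (w.2 ^+ 0 * gs w.2)).
pose hs (w : plane R) := sin (w.1 * a + w.2 * b) * (gs w.1 * (w.2 ^+ 0 * gs w.2)).
have mc : measurable_fun setT (fun w : plane R => cos (w.1 * a + w.2 * b)) by mfun.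
have ms : measurable_fun setT (fun w : plane R => sin (w.1 * a + w.2 * b)) by mfun.
have s1 (x : R) : `|sin x| <= 1 := normr_sin_le1 x.
have ic := integrable_cos_gs 0 mc (fun w => normr_cos_le1 _).
have is_ := integrable_cos_gs 0 ms (fun w => s1 _).
pose h (w : plane R) := cos c * hc w + sin c * hs w.
have ih : (leb2 R).-integrable setT (EFin \o h).
  exact: (integrableD measurableT (integrableZl measurableT (cos c) ic)
    (integrableZl measurableT (sin c) is_)).
have Ih : \int[leb2 R]_w h w = cos c * ((pi *+ 2) * gs2 t t z).
  rewrite (RintegralD measurableT (integrableZl measurableT (cos c) ic)
    (integrableZl measurableT (sin c) is_)).
  rewrite (RintegralZl _ measurableT ic) (RintegralZl _ measurableT is_).
  rewrite Rintegral_cos_tensor Rintegral_sin_tensor mulr0 addr0 !Cgs0 /gs2 -/a -/b.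
  by rewrite mulrACA -expr2 sqr_sqrtr// mulrn_wge0// pi_ge0.
have mb : measurable_fun [set: R] (fun _ : R => 0 : R) by [].
have hE : h \o skew1 t t 0 (fun=> 0) = (fun w : plane R =>
     cos (c - (w.1 * z.1 + w.2 * z.2)) * gwin w).
  apply/funext => w; rewrite /h /hc /hs /skew1 /= !addr0 !expr0 !mul1r /gwin.
  have -> : t * w.1 * a + t * w.2 * b = w.1 * z.1 + w.2 * z.2.
    have E : forall w1 w2 z1 z2 : R, t * w1 * (z1 / t) + t * w2 * (z2 / t) = w1 * z1 + w2 * z2.
      by move=> *; field.
    exact: E.
  by rewrite cosB !mulrA -mulrDl -mulrDl.
have i' := @integrable_skew1 R t t 0 _ t0' t0' mb h ih.
have I' := @Rintegral_skew1 R t t 0 _ t0' t0' mb h ih.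
split; first by rewrite -hE.
rewrite -hE; apply: (etrans I'); rewrite Ih /gwin_hat -expr2 ger0_norm ?sqr_ge0//.
by rewrite mulrCA.
Qed.

Lemma integrable_gwin : (leb2 R).-integrable setT (EFin \o gwin).
Proof.
have [+ _] := Rintegral_cos_gwin 0 0 (0, 0).
apply: eq_integrable => // w _; rewrite /= !mulr0 addr0 subr0 cos0 mul1r //.
Qed.

(* For fixed xi the map eta |-> ktr eta xi is a shear scaled by xi.2. *)
Lemma kernel_reproducing (y z : plane R) :
  \int[leb2 R]_eta shkernel (y.1 - (kact eta z).1, y.2 - (kact eta z).2) eta =
  (pi *+ 2) * psiR y * gwin_hat z.
Proof.
have mp := measurable_gprof; have mw := measurable_gwin.
pose Phi (w : plane R * plane R) : R := cos (w.1.1 * y.1 + w.1.2 * y.2 -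
  ((ktr w.2 w.1).1 * z.1 + (ktr w.2 w.1).2 * z.2)) * gprof w.1 * gwin (ktr w.2 w.1).
have mk : measurable_fun setT (fun w : plane R * plane R => ktr w.2 w.1).
  by apply: measurable_ktr; mfun.
have mPhi : measurable_fun setT Phi by rewrite /Phi; mfun.
have gp0 xi : 0 <= gprof xi.
  by apply: mulr_ge0 (gs_ge0 _) (mulr_ge0 _ (gs_ge0 _)); exact: exprn_even_ge0.
have Phi0 (xi eta : plane R) : xi.2 = 0 -> Phi (xi, eta) = 0.
  move=> h; have gz : gprof xi = 0 by rewrite /gprof h expr0n /= mul0r mulr0.
  by rewrite /Phi [gprof _]gz mulr0 mul0r.
have gw0 w : 0 <= gwin w by rewrite mulr_ge0 ?gs_ge0.
have sksE (xi : plane R) : (fun eta => ktr eta xi) = skew1 xi.2 xi.2 0 (fun e2 => sq e2 * xi.1).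
  by apply/funext => eta; rewrite /ktr /skew1 addr0.
have msq (xi : plane R) : measurable_fun [set: R] (fun e2 : R => sq e2 * xi.1).
  by have ms := measurable_sq; mfun.
pose g0 := \int[leb2 R]_w gwin w.
(* For [xi2 != 0] substituting [w = ktr eta xi] costs [xi2^-2], absorbed by [xi2^4]. On the line
   [xi2 = 0] the map degenerates, but [gprof] vanishes. *)
have Kxi (xi : plane R) : (\int[leb2 R]_eta `|Phi (xi, eta)|%:E <=
    (g0 * (gs xi.1 * (xi.2 ^+ 2 * gs xi.2)))%:E)%E.
  have [x0|x0] := eqVneq xi.2 0.
    rewrite (_ : (\int[leb2 R]_eta _)%E = 0%E).
      by rewrite x0 expr0n/= mul0r !mulr0.
    under eq_integral => eta _ do rewrite Phi0// normr0.
    by rewrite integral0.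
  apply: (@le_trans _ _ (\int[leb2 R]_eta (gprof xi * gwin (ktr eta xi))%:E)%E).
    apply: ge0_le_integral_any => eta _; first by rewrite lee_fin.
    rewrite lee_fin /Phi /= -mulrA (normrM (cos _)) (ger0_norm (mulr_ge0 (gp0 _) (gw0 _))).
    by rewrite ler_piMl ?normr_cos_le1// mulr_ge0.
  rewrite ge0_integralZl_real//; last first.
    apply/measurable_EFinP; apply: (measurableT_comp mw); apply: measurable_ktr; [exact: measurable_id|exact: measurable_cst].
  have mwE : measurable_fun setT (fun w => (gwin w)%:E) by exact/measurable_EFinP.
  have := @ge0_integral_skew1 R xi.2 xi.2 0 _ x0 x0 (msq xi) (fun w => (gwin w)%:E) mwE
    (fun w => gw0 w).
  rewrite (_ : (\int[leb2 R]_x (gwin (skew1 xi.2 xi.2 0 (fun e2 => (sq e2 * xi.1)%R) x))%:E)%E =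
    \int[leb2 R]_eta (gwin (ktr eta xi))%:E)%E; last by rewrite -sksE.
  move=> ->.
  have ifn := integrable_fin_num measurableT integrable_gwin.
  rewrite -(fineK ifn) -/(Rintegral _ _ _) -/g0 -!EFinM lee_fin.
  rewrite -expr2 ger0_norm ?sqr_ge0// /gprof.
  have E : forall a b x g : R, x != 0 -> a * (x ^+ 4 * b) * (x ^- 2 * g) = g * (a * (x ^+ 2 * b)).
    by move=> *; field.
  by rewrite E.
have fPhi : (\int[leb2 R]_xi \int[leb2 R]_eta `|Phi (xi, eta)|%:E < +oo)%E.
  have mone : measurable_fun setT (fun _ : plane R => 1 : R) by [].
  have n1 (z' : plane R) : `|1 : R| <= 1 by rewrite normr1.
  have i2 := integrableZl measurableT g0 (integrable_cos_gs 2 mone n1).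
  apply: (@le_lt_trans _ _ (\int[leb2 R]_xi (g0 * (gs xi.1 * (xi.2 ^+ 2 * gs xi.2)))%:E)%E).
    by apply: ge0_le_integral_any => xi _; [exact: integral_ge0|exact: Kxi].
  rewrite (_ : (\int[leb2 R]_xi _)%E = \int[leb2 R]_xi (g0%:E *
    (EFin \o (fun z : plane R => (1 * (gs z.1 * (z.2 ^+ 2 * gs z.2)))%R)) xi)%E)%E.
    exact: (integrable_lty measurableT i2).
  by apply: eq_integral => xi _; rewrite /= -EFinM mul1r.
have Fub := @Rfubini _ _ _ _ R (leb2 R) (leb2 R) (@sigma_finite_leb2 R) (@sigma_finite_leb2 R)
  Phi mPhi fPhi.
transitivity (\int[leb2 R]_eta \int[leb2 R]_xi Phi (xi, eta)).
  apply: eq_Rintegral => eta _; apply: eq_Rintegral => xi _; rewrite /Phi /kact /ktr /=.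
  congr (cos _ * _ * _).
  have E : forall x1 x2 y1 y2 s z1 e1 e2 z2 : R,
    x1 * (y1 - s * z1) + x2 * (y2 - (e1 * z1 + e2 * z2)) =
    x1 * y1 + x2 * y2 - ((x2 * e1 + s * x1) * z1 + x2 * e2 * z2) by move=> *; ring.
  exact: E.
rewrite -Fub.
(* The integral over [eta] yields [gwin_hat z] and lowers [xi2^4] to [xi2^2]; the remaining cosine
   transform is [Cgs 0] times [Cgs 2], which is [2 pi psiR]. *)
transitivity (\int[leb2 R]_xi (gwin_hat z *
    (cos (xi.1 * y.1 + xi.2 * y.2) * (gs xi.1 * (xi.2 ^+ 2 * gs xi.2))))).
  apply: eq_Rintegral => xi _.
  have [x0|x0] := eqVneq xi.2 0.
    have gz : gs xi.1 * (xi.2 ^+ 2 * gs xi.2) = 0 by rewrite x0 expr0n /= mul0r mulr0.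
    rewrite gz !mulr0; transitivity (\int[leb2 R]_(eta in [set: plane R]) (0 : R)); last first.
      by rewrite /Rintegral integral0.
    by apply: eq_Rintegral => eta _; exact: Phi0.
  pose c := xi.1 * y.1 + xi.2 * y.2.
  have [ig Ig] := Rintegral_cos_gwin c 0 z.
  have Hs := @Rintegral_skew1 R xi.2 xi.2 0 _ x0 x0 (msq xi) _ ig.
  have is_ := @integrable_skew1 R xi.2 xi.2 0 _ x0 x0 (msq xi) _ ig.
  transitivity (\int[leb2 R]_eta (gprof xi * ((fun w : plane R =>
     cos (c - (w.1 * z.1 + w.2 * z.2)) * gwin w) \o
     skew1 xi.2 xi.2 0 (fun e2 => sq e2 * xi.1)) eta)).
    apply: eq_Rintegral => eta _.
    have skE : skew1 xi.2 xi.2 0 (fun e2 => sq e2 * xi.1) eta = ktr eta xi by rewrite -sksE.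
    rewrite [RHS]/= skE addr0; have E : forall a b e : R, a * b * e = b * (a * e) by move=> *; ring.
    exact: E.
  rewrite (RintegralZl _ measurableT is_).
  apply: (etrans (congr1 (fun u => gprof xi * u) Hs)).
  have nn : `|xi.2 * xi.2|^-1 = xi.2 ^- 2 by rewrite -expr2 ger0_norm ?sqr_ge0.
  rewrite Ig nn /gprof.
  have E : forall a b x g k : R, x != 0 -> a * (x ^+ 4 * b) * (x ^- 2 * (k * g)) = g * (k * (a * (x ^+ 2 * b))).
    by move=> *; field.
  exact: (E _ _ _ _ _ x0).
have mcy : measurable_fun setT (fun xi : plane R => cos (xi.1 * y.1 + xi.2 * y.2)) by mfun.
have icy := integrable_cos_gs 2 mcy (fun w => normr_cos_le1 _).
rewrite (RintegralZl _ measurableT icy) Rintegral_cos_tensor Cgs0 Cgs2 /psiR.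
have p0 : 0 <= (pi : R) *+ 2 by apply: mulrn_wge0; exact: pi_ge0.
have w2 := sqr_sqrtr p0.
have E : forall h s g1 q g2 p : R, s ^+ 2 = p -> h * (s * g1 * (s * (q * g2))) = p * (q * (g1 * g2)) * h.
  by move=> h s g1 q g2 p' <-; ring.
exact: (E _ _ _ _ _ _ w2).
Qed.

End shkernel.

Lemma sqint_gs2_shift (R : realType) (t : R) (x0 : plane R) : 0 < t ->
  sqint (leb2 R) (fun z => gs2 t t (z.1 - x0.1, z.2 - x0.2)).
Proof.
move=> t0; have m0 : measurable_fun [set: R] (fun _ : R => - x0.1) by [].
have it := @integrable_skew1 R 1 1 (- x0.2) _ (oner_neq0 _) (oner_neq0 _) m0 _
  (integrable_gs2 (lt0r_neq0 t0) (lt0r_neq0 t0)).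
apply: (@sqint_bounded_integrable _ _ _ (leb2 R) _ 1).
- apply: (measurableT_comp (@measurable_gs2 R t t)); mfun.
- have E : (fun z : plane R => gs2 t t (z.1 - x0.1, z.2 - x0.2)) =
    gs2 t t \o skew1 1 1 (- x0.2) (fun=> - x0.1).
    by apply/funext => z; rewrite /= /skew1 !mul1r.
  by rewrite E.
- move=> z; have g0 := @gs2_ge0 R t t (z.1 - x0.1, z.2 - x0.2).
  have g1 := @gs2_le1 R t t (z.1 - x0.1, z.2 - x0.2).
  by move: (gs2 _ _ _) g0 g1 => g g0 g1; rewrite ger0_norm.
Qed.

(** * The reproducing formula tested against two functions *)

Section reproducing.
Variables (R : realType) (t : R) (x0 : plane R).
Hypothesis t0 : 0 < t.

(** As [0 / 0] is 0, the factor [eta.2 / eta.2] is the indicator of [eta.2 != 0]. It removes the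
    null line on which [k] is singular while keeping measurability evident. *)
Definition kern (x eta : plane R) : R := eta.2 / eta.2 * shkernel t x eta.

Lemma kern0 x eta : eta.2 = 0 -> kern x eta = 0.
Proof. by move=> e0; rewrite /kern e0 !mul0r. Qed.

Lemma kern_kernel x eta : eta.2 != 0 -> kern x eta = shkernel t x eta.
Proof. by move=> e0; rewrite /kern divff// mul1r. Qed.

Lemma measurable_kern d (T : measurableType d) (f g : T -> plane R) :
  measurable_fun setT f -> measurable_fun setT g ->
  measurable_fun setT (fun w => kern (f w) (g w)).
Proof.
move=> mf mg; apply: measurable_funM; first by mfun.
exact: measurable_shkernel.
Qed.

Lemma normr_kern_le x eta : `|kern x eta| <= `|shkernel t x eta|.
Proof.
have [e0|e0] := eqVneq eta.2 0; first by rewrite kern0// normr0.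
by rewrite kern_kernel.
Qed.

Definition ddet (eta : plane R) : R := `|sq eta.2 * eta.2|.

Lemma ddet_gt0 eta : eta.2 != 0 -> 0 < ddet eta.
Proof.
move=> e0; rewrite normr_gt0 mulf_neq0//; apply/eqP => s0.
by move: (sq_normM eta.2); rewrite s0 mul0r => /esym/eqP; rewrite (negbTE e0).
Qed.

Lemma sq_neq0 (e : R) : e != 0 -> sq e != 0.
Proof.
move=> e0; apply/eqP => s0.
by move: (sq_normM e); rewrite s0 mul0r => /esym/eqP; rewrite (negbTE e0).
Qed.

Lemma ddetE eta : eta.2 != 0 -> ddet eta = `|eta.2| `^ (3 / 2).
Proof.
move=> e0; have n0 : 0 < `|eta.2| by rewrite normr_gt0.
rewrite /ddet normrM normr_sq -powR12_sqrt//.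
rewrite -[X in _ * X](powRr1 (ltW n0)) -powRD; last by rewrite (gt_eqF n0) implybT.
by congr (_ `^ _); field.
Qed.

Lemma ddetVE eta : eta.2 != 0 -> (ddet eta)^-1 = (`|eta.2| `^ (- (3 / 4))) ^+ 2.
Proof.
move=> e0; rewrite ddetE// -powRN -powR_mulrn ?powR_ge0// -powRrM.
by congr (_ `^ _); field.
Qed.

(** The value [y - k (z - x0)]. Shifting by [x0] centres the resulting Gaussian in [z] at [x0], so
    that all Gaussian bumps become available as tests. *)
Definition kshift (eta : plane R) (y z : plane R) : plane R :=
  (y.1 - (kact eta (z.1 - x0.1, z.2 - x0.2)).1,
   y.2 - (kact eta (z.1 - x0.1, z.2 - x0.2)).2).

Definition kk (y z eta : plane R) : R := kern (kshift eta y z) eta.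

Lemma measurable_kshift d (T : measurableType d) (e f g : T -> plane R) :
  measurable_fun setT e -> measurable_fun setT f -> measurable_fun setT g ->
  measurable_fun setT (fun w => kshift (e w) (f w) (g w)).
Proof.
move=> me mf mg.
have mk : measurable_fun setT (fun w => kact (e w) ((g w).1 - x0.1, (g w).2 - x0.2)).
  by apply: measurable_kact => //; mfun.
rewrite /kshift; apply: measurable_fun_pair; apply: measurable_funB.
- by mfun.
- exact: (measurableT_comp measurable_fst mk).
- by mfun.
- exact: (measurableT_comp measurable_snd mk).
Qed.

Lemma measurable_kk d (T : measurableType d) (f g e : T -> plane R) :
  measurable_fun setT f -> measurable_fun setT g -> measurable_fun setT e ->
  measurable_fun setT (fun w => kk (f w) (g w) (e w)).
Proof. by move=> mf mg me; apply: measurable_kern => //; exact: measurable_kshift. Qed.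

Lemma measurable_kernE eta : measurable_fun setT (fun x => (`|kern x eta|)%:E).
Proof.
have mk : measurable_fun setT (fun x => kern x eta).
  by apply: measurable_kern; [exact: measurable_id|exact: measurable_cst].
by mfun.
Qed.

Section bounds.
Variable K : R.
Hypothesis K0 : 0 <= K.
Hypothesis HK : forall eta : plane R,
  (forall x : plane R, `|shkernel t x eta| <= K * shearQ eta ^- 2) /\
  (\int[leb2 R]_x `|shkernel t x eta|%:E <= (K * shearQ eta ^- 2)%:E)%E.

Lemma kk_bound y z eta : `|kk y z eta| <= K * shearQ eta ^- 2.
Proof. by have [h _] := HK eta; exact: le_trans (normr_kern_le _ _) (h _). Qed.

Lemma int_kern_le eta : (\int[leb2 R]_x `|kern x eta|%:E <= (K * shearQ eta ^- 2)%:E)%E.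
Proof.
have [_ h] := HK eta; apply: le_trans h.
by apply: ge0_le_integral_any => x _; rewrite lee_fin//; exact: normr_kern_le.
Qed.

Lemma int_kk_y z eta : (\int[leb2 R]_y `|kk y z eta|%:E <= (K * shearQ eta ^- 2)%:E)%E.
Proof.
set k := kact eta (z.1 - x0.1, z.2 - x0.2).
have m0 : measurable_fun [set: R] (fun _ : R => - k.1) by [].
have := @ge0_integral_skew1 R 1 1 (- k.2) _ (oner_neq0 _) (oner_neq0 _) m0
  (fun x => `|kern x eta|%:E) (measurable_kernE eta) (fun x => normr_ge0 _).
rewrite mulr1 normr1 invr1 mul1e => H; apply: le_trans (int_kern_le eta); rewrite -H.
apply: ge0_le_integral_any => y _; first by rewrite lee_fin.
by rewrite lee_fin /kk /kshift /skew1 !mul1r.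
Qed.

(** In [z] the argument of the kernel changes with Jacobian [|det k|], in [y] with Jacobian 1; [wgt]
    balances this asymmetry. *)
Lemma int_kk_z y eta : eta.2 != 0 ->
  (\int[leb2 R]_z `|kk y z eta|%:E <= ((ddet eta)^-1 * (K * shearQ eta ^- 2))%:E)%E.
Proof.
move=> e0; have s0 := sq_neq0 e0.
have Ns : - sq eta.2 != 0 by rewrite oppr_eq0. have Ne : - eta.2 != 0 by rewrite oppr_eq0.
have mb : measurable_fun [set: R] (fun z1 : R => y.2 + eta.2 * x0.2 - eta.1 * (z1 - x0.1)) by mfun.
have := @ge0_integral_skew2 R (- sq eta.2) (- eta.2) (y.1 + sq eta.2 * x0.1) _ Ns Ne mb
  (fun x => `|kern x eta|%:E) (measurable_kernE eta) (fun x => normr_ge0 _).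
rewrite mulrNN -/(ddet eta) => H; rewrite EFinM.
have d0 : 0 <= (ddet eta)^-1 by rewrite invr_ge0; exact: normr_ge0.
have := lee_wpmul2l (_ : (0 <= (ddet eta)^-1%:E)%E) (int_kern_le eta); rewrite lee_fin => /(_ d0).
apply: le_trans; rewrite -H; apply: ge0_le_integral_any => z _; first by rewrite lee_fin.
rewrite lee_fin (_ : kk y z eta = kern (skew2 (- sq eta.2) (- eta.2) (y.1 + sq eta.2 * x0.1)
  (fun z1 : R => y.2 + eta.2 * x0.2 - eta.1 * (z1 - x0.1)) z) eta)//.
rewrite /kk; congr (kern _ _); rewrite /kshift /skew2 /kact /=.
have E1 : forall y1 s z1 x1 : R, y1 - s * (z1 - x1) = - s * z1 + (y1 + s * x1) by move=> *; ring.
have E2 : forall y2 e1 e2 z1 z2 x1 x2 : R, y2 - (e1 * (z1 - x1) + e2 * (z2 - x2)) =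
  - e2 * z2 + (y2 + e2 * x2 - e1 * (z1 - x1)) by move=> *; ring.
by rewrite E1 E2.
Qed.

Lemma amgm (a b l : R) : 0 < l -> a * b <= l * a ^+ 2 + l^-1 * b ^+ 2.
Proof.
move=> l0; have l0' := lt0r_neq0 l0.
have -> : l * a ^+ 2 + l^-1 * b ^+ 2 = l^-1 * ((l * a - b) ^+ 2 + 2 * (l * a * b)) by field.
have -> : a * b = l^-1 * (l * a * b) by field.
rewrite ler_wpM2l ?invr_ge0 ?(ltW l0)//.
have := sqr_ge0 (l * a - b); have := sqr_ge0 (l * a); have := sqr_ge0 b; rewrite sqrrB.
move: (l * a) => u; nra.
Qed.

Section pair.
Variables (p f : plane R -> R).
Hypotheses (sp : sqint (leb2 R) p) (sf : sqint (leb2 R) f).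
Let mp : measurable_fun setT p. Proof. by have [] := sp. Qed.
Let mf : measurable_fun setT f. Proof. by have [] := sf. Qed.
Let np := \int[leb2 R]_z (p z ^+ 2).
Let nf := \int[leb2 R]_z (f z ^+ 2).
Let np0 : 0 <= np. Proof. by apply: Rintegral_ge0 => z _; exact: sqr_ge0. Qed.
Let nf0 : 0 <= nf. Proof. by apply: Rintegral_ge0 => z _; exact: sqr_ge0. Qed.
Let npE : (\int[leb2 R]_z (p z ^+ 2)%:E = np%:E)%E.
Proof. by rewrite /np /Rintegral fineK//; exact: (integrable_fin_num measurableT sp.2). Qed.
Let nfE : (\int[leb2 R]_z (f z ^+ 2)%:E = nf%:E)%E.
Proof. by rewrite /nf /Rintegral fineK//; exact: (integrable_fin_num measurableT sf.2). Qed.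

(** The square root of [|det k|^-1], see [ddetVE]: the geometric mean of the bounds on the two
    marginals of the kernel, apart from the common factor [Q]. *)
Definition wgt (eta : plane R) : R := `|eta.2| `^ (- (3 / 4)).

Lemma wgt_gt0 eta : eta.2 != 0 -> 0 < wgt eta.
Proof. by move=> e0; rewrite powR_gt0// normr_gt0. Qed.

Let Q eta := K * shearQ eta ^- 2.
Let Q0 eta : 0 <= Q eta. Proof. by rewrite mulr_ge0// invr_ge0 sqr_ge0. Qed.

Lemma measurable_kk_z (y eta : plane R) : measurable_fun setT (fun z => kk y z eta).
Proof. by apply: measurable_kk; [exact: measurable_cst|exact: measurable_id|exact: measurable_cst]. Qed.

Lemma measurable_kk_y (z eta : plane R) : measurable_fun setT (fun y => kk y z eta).
Proof. by apply: measurable_kk; [exact: measurable_id|exact: measurable_cst|exact: measurable_cst]. Qed.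

Lemma section_z_le (y eta : plane R) :
  (\int[leb2 R]_z `|p z * kk y z eta|%:E <= ((np + 1) * (wgt eta * Q eta))%:E)%E.
Proof.
have [e0|e0] := eqVneq eta.2 0.
  under eq_integral do rewrite /kk (kern0 _ e0) mulr0 normr0.
  rewrite integral0 lee_fin; apply: mulr_ge0; first exact: addr_ge0.
  by apply: mulr_ge0; [exact: powR_ge0|exact: Q0].
have w0 := wgt_gt0 e0; have mk := measurable_kk_z y eta.
apply: (@le_trans _ _ (\int[leb2 R]_z ((wgt eta * Q eta * p z ^+ 2)%:E +
    ((wgt eta)^-1 * `|kk y z eta|)%:E))%E).
  apply: ge0_le_integral_any => z _; first by rewrite lee_fin.
  rewrite -EFinD lee_fin (normrM (p z)).
  have h := ler_wpM2r (normr_ge0 (kk y z eta)) (amgm `|p z| 1 w0).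
  rewrite mulr1 in h; apply: (le_trans h); rewrite expr1n mulr1 mulrDl lerD2r.
  have E : forall w a k q : R, 0 <= w -> k <= q -> w * a ^+ 2 * k <= w * q * a ^+ 2.
    by move=> w a k q w1 kq; rewrite mulrAC ler_wpM2r ?sqr_ge0// ler_wpM2l.
  rewrite real_normK ?num_real//; exact: E (ltW w0) (kk_bound _ _ _).
rewrite ge0_integralD//; last 4 first.
- move=> z _; rewrite lee_fin; apply: mulr_ge0; last exact: sqr_ge0.
  exact: mulr_ge0 (ltW w0) (Q0 _).
- by mfun.
- by move=> z _; rewrite lee_fin; apply: mulr_ge0; [rewrite invr_ge0 ltW|exact: normr_ge0].
- by mfun.
rewrite ge0_integralZl_real//; last 3 first.
- by rewrite mulr_ge0 ?(ltW w0).
- by move=> z _; exact: sqr_ge0.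
- by mfun.
rewrite ge0_integralZl_real//; last 2 first.
- by rewrite invr_ge0 ltW.
- by mfun.
rewrite npE mulrDl mul1r [np * _]mulrC EFinD -EFinM; apply: leeD2l.
apply: (le_trans (lee_wpmul2l _ (int_kk_z y e0))); first by rewrite lee_fin invr_ge0 ltW.
rewrite -EFinM lee_fin ddetVE// -/(wgt eta) mulrA expr2 mulKf// gt_eqF//.
Qed.

(** Schur's test. With [amgm] at [l = wgt^-1] the term in [f^2] meets the marginal [wgt^2 Q] and the
    term in [p^2] the marginal [Q]; both give [wgt Q]. *)
Lemma section_yz_le (eta : plane R) :
  (\int[leb2 R]_y \int[leb2 R]_z `|f y * (p z * kk y z eta)|%:E <=
   ((nf + np) * (wgt eta * Q eta))%:E)%E.
Proof.
have [e0|e0] := eqVneq eta.2 0.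
  under eq_integral do (under eq_integral do rewrite /kk (kern0 _ e0) !mulr0 normr0;
    rewrite integral0).
  rewrite integral0 lee_fin; apply: mulr_ge0; first exact: addr_ge0.
  by apply: mulr_ge0; [exact: powR_ge0|exact: Q0].
have w0 := wgt_gt0 e0; have w0' := lt0r_neq0 w0.
have iw0 : 0 < (wgt eta)^-1 by rewrite invr_gt0.
pose A (w : plane R * plane R) : \bar R := ((wgt eta)^-1 * (f w.1 ^+ 2 * `|kk w.1 w.2 eta|))%:E.
pose B (w : plane R * plane R) : \bar R := (wgt eta * (p w.2 ^+ 2 * `|kk w.1 w.2 eta|))%:E.
have mk : measurable_fun setT (fun w : plane R * plane R => kk w.1 w.2 eta).
  by apply: measurable_kk; mfun.
have mA : measurable_fun setT A by rewrite /A; mfun.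
have mB : measurable_fun setT B by rewrite /B; mfun.
have g0 (a b c : R) : 0 < a -> 0 <= a * (b ^+ 2 * `|c|).
  by move=> a0; apply: mulr_ge0; [exact: ltW|apply: mulr_ge0; [exact: sqr_ge0|exact: normr_ge0]].
have A0 w : (0 <= A w)%E by rewrite lee_fin; exact: g0.
have B0 w : (0 <= B w)%E by rewrite lee_fin; exact: g0.
have mzA y : measurable_fun setT (fun z => A (y, z)).
  by have mkz := measurable_kk_z y eta; rewrite /A /=; mfun.
have mzB y : measurable_fun setT (fun z => B (y, z)).
  by have mkz := measurable_kk_z y eta; rewrite /B /=; mfun.
have sf2 := @sigma_finite_leb2 R.
apply: (@le_trans _ _ (\int[leb2 R]_y (\int[leb2 R]_z A (y, z) + \int[leb2 R]_z B (y, z)))%E).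
  apply: ge0_le_integral_any => y _; first exact: integral_ge0.
  rewrite -ge0_integralD//; apply: ge0_le_integral_any => z _; first by rewrite lee_fin.
  rewrite /A /B /= -EFinD lee_fin (normrM (f y)) (normrM (p z)).
  have E : forall a b k u v w w' : R, a * b <= w * u + w' * v -> 0 <= k ->
      a * (b * k) <= w * (u * k) + w' * (v * k).
    by move=> a b k u v w w' H k0; rewrite !mulrA -mulrDl ler_wpM2r.
  apply: E (normr_ge0 _); have := amgm `|f y| `|p z| iw0.
  by rewrite invrK !real_normK ?num_real.
rewrite ge0_integralD//; last 4 first.
- by move=> y _; exact: integral_ge0.
- exact: (@measurable_tonelli_F _ _ _ _ R (leb2 R) sf2 A mA A0).
- by move=> y _; exact: integral_ge0.
- exact: (@measurable_tonelli_F _ _ _ _ R (leb2 R) sf2 B mB B0).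
rewrite mulrDl EFinD; apply: leeD.
  apply: (@le_trans _ _ (\int[leb2 R]_y (wgt eta * Q eta * f y ^+ 2)%:E)%E).
    apply: ge0_le_integral_any => y _; first exact: integral_ge0.
    rewrite /A /=; under eq_integral do rewrite mulrA.
    have mkz := measurable_kk_z y eta.
    rewrite ge0_integralZl_real//; last 2 first.
    - by rewrite mulr_ge0 ?(ltW iw0)// sqr_ge0.
    - by mfun.
    apply: (le_trans (lee_wpmul2l _ (int_kk_z y e0))).
      by rewrite lee_fin mulr_ge0 ?(ltW iw0)// sqr_ge0.
    rewrite -EFinM lee_fin ddetVE// -/(wgt eta) -/(Q eta).
    have E : forall w q g : R, w != 0 -> w^-1 * g * (w ^+ 2 * q) = w * q * g by move=> *; field.
    by rewrite E.
  rewrite ge0_integralZl_real//; last 3 first.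
  - by rewrite mulr_ge0 ?(ltW w0).
  - by move=> y _; exact: sqr_ge0.
  - by mfun.
  by rewrite nfE -EFinM mulrC.
rewrite (@sigma_finite_tonelli _ _ _ _ R (leb2 R) (leb2 R) sf2 sf2 B mB B0).
apply: (@le_trans _ _ (\int[leb2 R]_z (wgt eta * Q eta * p z ^+ 2)%:E)%E).
  apply: ge0_le_integral_any => z _; first exact: integral_ge0.
  rewrite /B /=; under eq_integral do rewrite mulrA.
  have mky := measurable_kk_y z eta.
  rewrite ge0_integralZl_real//; last 2 first.
  - by rewrite mulr_ge0 ?(ltW w0)// sqr_ge0.
  - by mfun.
  apply: (le_trans (lee_wpmul2l _ (int_kk_y z eta))).
    by rewrite lee_fin mulr_ge0 ?(ltW w0)// sqr_ge0.
  by rewrite -EFinM lee_fin -/(Q eta) mulrAC.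
rewrite ge0_integralZl_real//; last 3 first.
- by rewrite mulr_ge0 ?(ltW w0).
- by move=> y _; exact: sqr_ge0.
- by mfun.
by rewrite npE -EFinM mulrC.
Qed.

Lemma measurable_shearQ34 :
  measurable_fun setT (fun e : plane R => `|e.2| `^ (- (3 / 4)) * shearQ e ^- 2).
Proof. by rewrite /shearQ; mfun. Qed.

Lemma int_wQ_lty (c : R) : 0 <= c ->
  (\int[leb2 R]_eta (c * (wgt eta * Q eta))%:E < +oo)%E.
Proof.
move=> c0.
rewrite (eq_integral (fun e : plane R => (c * K * (`|e.2| `^ (- (3 / 4)) * shearQ e ^- 2))%:E)); last first.
  move=> e _; congr EFin; rewrite /Q /wgt.
  have E : forall a b k q : R, a * (b * (k * q)) = a * k * (b * q) by move=> *; ring.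
  exact: E.
rewrite ge0_integralZl_real//; last 3 first.
- exact: mulr_ge0.
- by move=> e _; apply: mulr_ge0; [exact: powR_ge0|rewrite invr_ge0; exact: sqr_ge0].
- by apply/measurable_EFinP; exact: measurable_shearQ34.
by rewrite lte_mul_pinfty ?lee_fin ?mulr_ge0// shearQ_integral34_lty.
Qed.

Lemma integrable_kk_eta (y z : plane R) :
  (leb2 R).-integrable setT (EFin \o (fun eta => kk y z eta)).
Proof.
have mQ : measurable_fun setT (fun e : plane R => shearQ e ^- 2) by rewrite /shearQ; mfun.
have q0 (e : plane R) : 0 <= shearQ e ^- 2 by rewrite invr_ge0; exact: sqr_ge0.
have i1 : (leb2 R).-integrable setT (EFin \o (fun e : plane R => `|e.2| `^ (- (3 / 4)) * shearQ e ^- 2)).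
  apply/integrableP; split; first by apply/measurable_EFinP; exact: measurable_shearQ34.
  apply: le_lt_trans (@shearQ_integral34_lty R); apply: ge0_le_integral_any => e _ //=.
  by rewrite lee_fin ger0_norm// mulr_ge0// powR_ge0.
have i2 : (leb2 R).-integrable setT (EFin \o (fun e : plane R => `|e.2| * shearQ e ^- 2)).
  apply/integrableP; split; first by apply/measurable_EFinP; rewrite /shearQ; mfun.
  apply: le_lt_trans (@shearQ_integral1_lty R); apply: ge0_le_integral_any => e _ //=.
  by rewrite lee_fin ger0_norm// mulr_ge0.
have i3 := integrableZl measurableT K (integrableD measurableT i1 i2).
(* Off the line [e.2 = 0] one has [1 <= |e.2|^(-3/4) + |e.2|], so the unweighted profile is
   dominated by the two weighted ones. *)
apply: (@integrable_dominated _ _ _ (leb2 R) _ (fun e : plane R => K *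
  (`|e.2| `^ (- (3 / 4)) * shearQ e ^- 2 + `|e.2| * shearQ e ^- 2))) => //.
  by apply: measurable_kk; [exact: measurable_cst|exact: measurable_cst|exact: measurable_id].
move=> e; have [e0|e0] := eqVneq e.2 0.
  rewrite /kk (kern0 _ e0) normr0; apply: mulr_ge0 => //.
  by apply: addr_ge0; apply: mulr_ge0 => //; exact: powR_ge0.
apply: (le_trans (kk_bound _ _ _)); apply: ler_wpM2l => //.
rewrite -mulrDl ler_peMl//; have n0 : 0 < `|e.2| by rewrite normr_gt0.
have [e1|e1] := leP 1 `|e.2|; first by rewrite (le_trans e1)// lerDr powR_ge0.
rewrite (le_trans _ (_ : `|e.2| `^ (- (3 / 4)) <= _)) ?lerDl//.
rewrite powRN invf_ge1 ?powR_gt0//.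
have := @ge0_ler_powR R (3 / 4) (ltW _) `|e.2| 1; rewrite powR1; apply; rewrite ?nnegrE ?ltW//.
Qed.

Lemma int_eta_z_lty y : (\int[leb2 R]_eta \int[leb2 R]_z `|p z * kk y z eta|%:E < +oo)%E.
Proof.
apply: le_lt_trans (@int_wQ_lty (np + 1) _); last exact: addr_ge0.
by apply: ge0_le_integral_any => e _; [exact: integral_ge0|exact: section_z_le].
Qed.

(** The constant of the reproducing formula; for its use it must be nonzero, which [t] and [x0] are
    chosen to ensure. *)
Definition kappa : R := \int[leb2 R]_z (p z * gwin_hat t (z.1 - x0.1, z.2 - x0.2)).

(** [kern] and [shkernel] differ only on the null line [eta.2 = 0], so this is [kernel_reproducing]
    at [z - x0]. *)
Lemma Rintegral_eta_kk y z : \int[leb2 R]_eta kk y z eta =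
  (pi *+ 2) * psiR y * gwin_hat t (z.1 - x0.1, z.2 - x0.2).
Proof.
rewrite -(kernel_reproducing t0); rewrite /Rintegral; congr fine; apply: ae_eq_integral => //.
- apply/measurable_EFinP.
  by apply: measurable_kk; [exact: measurable_cst|exact: measurable_cst|exact: measurable_id].
- apply/measurable_EFinP; apply: measurable_shkernel; last exact: measurable_id.
  have mk : measurable_fun setT (fun w : plane R => kact w (z.1 - x0.1, z.2 - x0.2)).
    by apply: measurable_kact; [exact: measurable_id|exact: measurable_cst].
  apply: measurable_fun_pair; apply: measurable_funB => //.
  + exact: (measurableT_comp measurable_fst mk).
  + exact: (measurableT_comp measurable_snd mk).
have := @ae_coord2_neq R 0; apply: filterS => e e0 _.
by congr EFin; exact: kern_kernel.
Qed.

Lemma measurable_pkk : measurable_fun setT (fun w : plane R * plane R * plane R =>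
  p w.2 * kk w.1.1 w.2 w.1.2).
Proof.
apply: measurable_funM; first exact: measurableT_comp mp measurable_snd.
by apply: measurable_kk; mfun.
Qed.

Lemma Rintegral_eta_z y : \int[leb2 R]_eta \int[leb2 R]_z (p z * kk y z eta) =
  (pi *+ 2) * psiR y * kappa.
Proof.
pose F (w : plane R * plane R) : R := p w.2 * kk y w.2 w.1.
have mF : measurable_fun setT F.
  apply: measurable_funM; first exact: measurableT_comp mp measurable_snd.
  by apply: measurable_kk; mfun.
have H := @Rfubini _ _ _ _ R (leb2 R) (leb2 R) (@sigma_finite_leb2 R) (@sigma_finite_leb2 R)
  F mF (int_eta_z_lty y).
rewrite (H : _ = _) /F /=.
have ig : (leb2 R).-integrable setT (EFin \o (fun z => p z * gwin_hat t (z.1 - x0.1, z.2 - x0.2))).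
  apply: (integrable_sqintM sp); apply: (@sqintZ _ _ _ (leb2 R) (t ^- 2)).
  exact: (@sqintZ _ _ _ (leb2 R) (pi *+ 2) _ (sqint_gs2_shift x0 t0)).
rewrite /kappa -(RintegralZl _ measurableT ig); apply: eq_Rintegral => z _.
rewrite (RintegralZl _ measurableT (integrable_kk_eta y z)) Rintegral_eta_kk.
by rewrite mulrCA.
Qed.

(** The contribution of one matrix [k] to the pairing of [f] with the witness. *)
Definition Govl (eta : plane R) : R :=
  \int[leb2 R]_y (f y * \int[leb2 R]_z (p z * kk y z eta)).

Let Lyz (w : plane R * plane R) : R := \int[leb2 R]_z (p z * kk w.1 z w.2).

Lemma measurable_Lyz : measurable_fun setT Lyz.
Proof.
exact: (@measurable_param_Rintegral _ _ (plane R * plane R)%type (plane R) R (leb2 R)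
  (@sigma_finite_leb2 R) (fun w z => p z * kk w.1 z w.2) measurable_pkk).
Qed.

Lemma int_fL_le eta : (\int[leb2 R]_y `|f y * Lyz (y, eta)|%:E <=
  ((nf + np) * (wgt eta * Q eta))%:E)%E.
Proof.
apply: le_trans (section_yz_le eta); apply: ge0_le_integral_any => y _; first by rewrite lee_fin.
have mz : measurable_fun setT (fun z => p z * kk y z eta).
  by apply: measurable_funM => //; exact: measurable_kk_z.
rewrite (normrM (f y)) EFinM.
have fy0 : (0 <= `|f y|%:E)%E by rewrite lee_fin.
have h := lee_wpmul2l fy0 (normr_Rintegral_le (leb2 R) mz).
refine (le_trans h _).
rewrite -ge0_integralZl//=; last by apply/measurable_EFinP; apply: measurableT_comp.
apply: ge0_le_integral_any => z _; first by rewrite mule_ge0// lee_fin.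
by rewrite -EFinM lee_fin -(normrM (f y)).
Qed.

(** Fubini puts the integral over [eta] innermost, where the kernel reproduces [psiR y]. Absolute
    convergence comes from Schur's test and the integrability of [wgt Q]. *)
Lemma Rintegral_Govl :
  (leb2 R).-integrable setT (EFin \o Govl) /\
  \int[leb2 R]_eta Govl eta = (pi *+ 2) * kappa * \int[leb2 R]_y (f y * psiR y).
Proof.
pose F (w : plane R * plane R) : R := f w.2 * Lyz (w.2, w.1).
have mF : measurable_fun setT F.
  apply: measurable_funM; first exact: measurableT_comp mf measurable_snd.
  by apply: (measurableT_comp measurable_Lyz); mfun.
have fF : (\int[leb2 R]_eta \int[leb2 R]_y `|F (eta, y)|%:E < +oo)%E.
  apply: le_lt_trans (@int_wQ_lty (nf + np) _); last exact: addr_ge0.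
  by apply: ge0_le_integral_any => e _; [exact: integral_ge0|exact: int_fL_le].
split.
  apply/integrableP; split.
    apply/measurable_EFinP.
    exact: (@measurable_param_Rintegral _ _ (plane R) (plane R) R (leb2 R)
      (@sigma_finite_leb2 R) (fun e y => F (e, y)) mF).
  apply: le_lt_trans fF; apply: ge0_le_integral_any => e _; first by rewrite lee_fin.
  apply: normr_Rintegral_le.
  exact: (measurableT_comp mF (measurable_pair1 e)).
have H := @Rfubini _ _ _ _ R (leb2 R) (leb2 R) (@sigma_finite_leb2 R) (@sigma_finite_leb2 R)
  F mF fF.
rewrite (H : \int[leb2 R]_eta Govl eta = _).
have ip : (leb2 R).-integrable setT (EFin \o (fun y => f y * psiR y)).
  exact: integrable_sqintM sf (@sqint_psiR R).
rewrite -(RintegralZl _ measurableT ip); apply: eq_Rintegral => y _.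
have iL : (leb2 R).-integrable setT (EFin \o (fun e => Lyz (y, e))).
  apply/integrableP; split.
    by apply/measurable_EFinP; exact: (measurableT_comp measurable_Lyz (measurable_pair1 y)).
  apply: le_lt_trans (int_eta_z_lty y); apply: ge0_le_integral_any => e _; first by rewrite lee_fin.
  have mz : measurable_fun setT (fun z => p z * kk y z e).
    exact: measurable_funM mp (measurable_kk_z y e).
  exact: (normr_Rintegral_le (leb2 R) mz).
rewrite /F /= (RintegralZl _ measurableT iL) [X in f y * X](Rintegral_eta_z y).
have E : forall a b c d : R, a * (b * c * d) = b * d * (a * c) by move=> *; ring.
exact: E.
Qed.

End pair.
End bounds.
End reproducing.

Section sections.
Context d1 d2 (T1 : measurableType d1) (T2 : measurableType d2) (R : realType).
Variables (m1 : {measure set T1 -> \bar R}) (m2 : {measure set T2 -> \bar R}).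
Hypotheses (s1 : sigma_finite setT m1) (s2 : sigma_finite setT m2).

Lemma integrable_section_Rintegral (f : T1 * T2 -> R) : measurable_fun setT f ->
  (\int[m1]_x \int[m2]_y `|f (x, y)|%:E < +oo)%E ->
  m1.-integrable setT (EFin \o (fun x => \int[m2]_y f (x, y))).
Proof.
move=> mf ff; apply/integrableP; split.
  apply/measurable_EFinP.
  have mf' : measurable_fun setT (fun z : T1 * T2 => f (z.1, z.2)).
    by rewrite (_ : (fun z => _) = f)//; apply/funext => -[].
  exact: (@measurable_param_Rintegral _ _ T1 T2 R m2 s2 (fun x y => f (x, y)) mf').
apply: le_lt_trans ff; apply: ge0_le_integral_any => x _; first exact: abse_ge0.
exact: (normr_Rintegral_le m2 (measurableT_comp mf (measurable_pair1 x))).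
Qed.

End sections.

(** * Changes of variables under lower triangular matrices *)

Section lower_triangular.
Variable R : realType.

(** The vector [k^-1 (y - x)] for [k] with rows [(s, 0)] and [(b, d)], written out because it serves
    as a substitution in [y] and in [x]. *)
Definition lact (s b d : R) (y x : plane R) : plane R :=
  ((y.1 - x.1) / s, (y.2 - x.2) / d - b / (s * d) * (y.1 - x.1)).

Lemma mxact_invmx_lt (s b d : R) (y x : R * R) : s != 0 -> d != 0 ->
  mxact (invmx (mx22 s 0 b d)) (y - x) = lact s b d y x.
Proof.
move=> s0 d0; rewrite invmx_mx22; last by rewrite mul0r subr0 mulf_neq0.
rewrite /mxact !mx22_ij mul0r subr0 /lact; congr pair; rewrite [LHS]/=.
  have E : forall u v : R, d / (s * d) * u + - 0 / (s * d) * v = u / s.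
    by move=> u v; field; rewrite s0 d0.
  exact: E.
have E : forall u v : R, - b / (s * d) * u + s / (s * d) * v = v / d - b / (s * d) * u.
  by move=> u v; field; rewrite s0 d0.
exact: E.
Qed.

Lemma lact_skew_y (s b d : R) (x y : plane R) : lact s b d y x =
  skew2 s^-1 d^-1 (- x.1 / s) (fun y1 => - x.2 / d - b / (s * d) * (y1 - x.1)) y.
Proof.
rewrite /lact /skew2; congr pair.
  have E : forall u v : R, (u - v) / s = s^-1 * u + - v / s by move=> *; ring.
  exact: E.
have E : forall u v w z : R, (u - v) / d - w * z = d^-1 * u + (- v / d - w * z).
  by move=> *; ring.
exact: E.
Qed.

Lemma lact_skew_x (s b d : R) (y x : plane R) : lact s b d y x =
  skew2 (- s^-1) (- d^-1) (y.1 / s) (fun x1 => y.2 / d - b / (s * d) * (y.1 - x1)) x.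
Proof.
rewrite /lact /skew2; congr pair.
  have E : forall u v : R, (u - v) / s = - s^-1 * v + u / s by move=> *; ring.
  exact: E.
have E : forall u v w z : R, (u - v) / d - w * z = - d^-1 * v + (u / d - w * z).
  by move=> *; ring.
exact: E.
Qed.

Lemma measurable_lact d' (T : measurableType d') (s b e : T -> R) (y x : T -> plane R) :
  measurable_fun setT s -> measurable_fun setT b -> measurable_fun setT e ->
  measurable_fun setT y -> measurable_fun setT x ->
  measurable_fun setT (fun w => lact (s w) (b w) (e w) (y w) (x w)).
Proof. by move=> ms mb me my mx; rewrite /lact; mfun. Qed.

Lemma normrVV (s d : R) : `|s^-1 * d^-1|^-1 = `|s * d|.
Proof. by rewrite -invfM normfV invrK mulrC. Qed.

Lemma normrNVV (s d : R) : `|- s^-1 * - d^-1|^-1 = `|s * d|.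
Proof. by rewrite mulrNN normrVV. Qed.

Section change.
Variables (s b d : R).
Hypotheses (s0 : s != 0) (d0 : d != 0).
Let s0' : s^-1 != 0. Proof. by rewrite invr_eq0. Qed.
Let d0' : d^-1 != 0. Proof. by rewrite invr_eq0. Qed.
Let s0n : - s^-1 != 0. Proof. by rewrite oppr_eq0 invr_eq0. Qed.
Let d0n : - d^-1 != 0. Proof. by rewrite oppr_eq0 invr_eq0. Qed.
Let my (x : plane R) : measurable_fun [set: R]
  (fun y1 : R => - x.2 / d - b / (s * d) * (y1 - x.1)).
Proof. by mfun. Qed.
Let mx (y : plane R) : measurable_fun [set: R]
  (fun x1 : R => y.2 / d - b / (s * d) * (y.1 - x1)).
Proof. by mfun. Qed.

Lemma ge0_integral_lact_y (x : plane R) (F : plane R -> \bar R) : measurable_fun setT F ->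
  (forall z, (0 <= F z)%E) ->
  (\int[leb2 R]_y F (lact s b d y x) = `|s * d|%:E * \int[leb2 R]_z F z)%E.
Proof.
move=> mF F0; rewrite -normrVV -(@ge0_integral_skew2 R _ _ (- x.1 / s) _ s0' d0' (my x) F mF F0).
by apply: eq_integral => y _; rewrite lact_skew_y.
Qed.

Lemma ge0_integral_lact_x (y : plane R) (F : plane R -> \bar R) : measurable_fun setT F ->
  (forall z, (0 <= F z)%E) ->
  (\int[leb2 R]_x F (lact s b d y x) = `|s * d|%:E * \int[leb2 R]_z F z)%E.
Proof.
move=> mF F0; rewrite -normrNVV -(@ge0_integral_skew2 R _ _ (y.1 / s) _ s0n d0n (mx y) F mF F0).
by apply: eq_integral => x _; rewrite lact_skew_x.
Qed.

Lemma integrable_lact_x (y : plane R) (F : plane R -> R) :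
  (leb2 R).-integrable setT (EFin \o F) ->
  (leb2 R).-integrable setT (EFin \o (fun x => F (lact s b d y x))).
Proof.
move=> iF; have H := @integrable_skew2 R _ _ (y.1 / s) _ s0n d0n (mx y) F iF.
have E : (fun x => F (lact s b d y x)) = F \o skew2 (- s^-1) (- d^-1) (y.1 / s)
    (fun x1 => y.2 / d - b / (s * d) * (y.1 - x1)).
  by apply/funext => x; rewrite /= lact_skew_x.
by rewrite E.
Qed.

Lemma Rintegral_lact_x (y : plane R) (F : plane R -> R) :
  (leb2 R).-integrable setT (EFin \o F) ->
  \int[leb2 R]_x F (lact s b d y x) = `|s * d| * \int[leb2 R]_z F z.
Proof.
move=> iF; rewrite -normrNVV -(@Rintegral_skew2 R _ _ (y.1 / s) _ s0n d0n (mx y) F iF).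
by apply: eq_Rintegral => x _; rewrite lact_skew_x.
Qed.

Lemma sqint_lact_y (x : plane R) (p : plane R -> R) : sqint (leb2 R) p ->
  sqint (leb2 R) (fun y => p (lact s b d y x)).
Proof.
move=> [mp ip]; split.
  apply: (measurableT_comp mp).
  by apply: measurable_lact; [| | |exact: measurable_id|]; exact: measurable_cst.
have H := @integrable_skew2 R _ _ (- x.1 / s) _ s0' d0' (my x) _ ip.
have E : (fun y => p (lact s b d y x) ^+ 2) = (fun z => p z ^+ 2) \o skew2 s^-1 d^-1 (- x.1 / s)
    (fun y1 => - x.2 / d - b / (s * d) * (y1 - x.1)).
  by apply/funext => y; rewrite /= lact_skew_y.
by rewrite E.
Qed.

End change.
End lower_triangular.

(** * The pairing expressed through overlaps with transformed windows *)

Section overlap.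
Variables (R : realType) (t : R) (x0 : plane R).
Hypothesis t0 : 0 < t.

Definition Mx (eta : plane R) : 'M[R]_2 := mx22 (sq eta.2) 0 eta.1 eta.2.

Definition rov (p f : plane R -> R) (x : R * R) (h : 'M[R]_2) : R :=
  \int[leb2 R]_y (f y * p (mxact (invmx h) (y - x))).

Definition kplus (eta x : plane R) : plane R :=
  (x.1 + (kact eta x0).1, x.2 + (kact eta x0).2).

(** With [z = k^-1 (y - x)] the argument [y - k (z - x0)] becomes [x + k x0], free of [y]. This is
    why the kernel factors out and the integral over [y] becomes the overlap [rov]. *)
Lemma kk_lact (eta y x : plane R) : eta.2 != 0 ->
  kk t x0 y (lact (sq eta.2) eta.1 eta.2 y x) eta = kern t (kplus eta x) eta.
Proof.
move=> e0; have s0 := sq_neq0 e0; rewrite /kk; congr (kern t _ eta).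
rewrite /kshift /kplus /lact /kact; congr pair; rewrite [LHS]/= [RHS]/=.
  have E : forall s y1 x1 z1 : R, s != 0 -> y1 - s * ((y1 - x1) / s - z1) = x1 + s * z1.
    by move=> *; field.
  exact: E.
have E : forall s b d y1 x1 z1 y2 x2 z2 : R, s != 0 -> d != 0 ->
    y2 - (b * ((y1 - x1) / s - z1) + d * ((y2 - x2) / d - b / (s * d) * (y1 - x1) - z2)) =
    x2 + (b * z1 + d * z2).
  by move=> s b d *; field; apply/andP.
exact: E.
Qed.

Lemma measurable_kplus d (T : measurableType d) (f g : T -> plane R) :
  measurable_fun setT f -> measurable_fun setT g ->
  measurable_fun setT (fun w => kplus (f w) (g w)).
Proof.
move=> mf mg.
have mk : measurable_fun setT (fun w => kact (f w) x0).
  by apply: measurable_kact => //; exact: measurable_cst.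
rewrite /kplus; apply: measurable_fun_pair; apply: measurable_funD.
- by mfun.
- exact: (measurableT_comp measurable_fst mk).
- by mfun.
- exact: (measurableT_comp measurable_snd mk).
Qed.

Section slice.
Variables (p f : plane R -> R) (eta : plane R).
Hypotheses (sp : sqint (leb2 R) p) (sf : sqint (leb2 R) f) (e0 : eta.2 != 0).
Let mp : measurable_fun setT p. Proof. by have [] := sp. Qed.
Let mf : measurable_fun setT f. Proof. by have [] := sf. Qed.
Let s0 := sq_neq0 e0.
Let A (y x : plane R) := lact (sq eta.2) eta.1 eta.2 y x.

Lemma integrable_rov_lact x :
  (leb2 R).-integrable setT (EFin \o (fun y => f y * p (A y x))).
Proof. exact: (integrable_sqintM sf (sqint_lact_y _ s0 e0 x sp)). Qed.

Lemma rovE x : rov p f x (Mx eta) = \int[leb2 R]_y (f y * p (A y x)).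
Proof. by apply: eq_Rintegral => y _; rewrite mxact_invmx_lt. Qed.

Let Phi (w : plane R * plane R) : R := f w.1 * (p (A w.1 w.2) * kern t (kplus eta w.2) eta).

Let mPhi : measurable_fun setT Phi.
Proof.
apply: measurable_funM; first exact: measurableT_comp mf measurable_fst.
apply: measurable_funM.
  apply: (measurableT_comp mp); apply: measurable_lact.
  - exact: measurable_cst.
  - exact: measurable_cst.
  - exact: measurable_cst.
  - exact: measurable_fst.
  - exact: measurable_snd.
apply: measurable_kern; last exact: measurable_cst.
by apply: measurable_kplus; [exact: measurable_cst|exact: measurable_snd].
Qed.

Let finPhi : (\int[leb2 R]_y \int[leb2 R]_x `|Phi (y, x)|%:E < +oo)%E.
Proof.
have [K K0 HK] := kernel_bounds t0.
pose G (w : plane R * plane R) : \bar R := `|f w.1 * (p w.2 * kk t x0 w.1 w.2 eta)|%:E.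
have mG : measurable_fun setT G.
  apply/measurable_EFinP; apply: measurableT_comp => //.
  apply: measurable_funM; first exact: measurableT_comp mf measurable_fst.
  apply: measurable_funM; first exact: measurableT_comp mp measurable_snd.
  by apply: measurable_kk; [exact: measurable_fst|exact: measurable_snd|exact: measurable_cst].
have G0 w : (0 <= G w)%E by rewrite lee_fin; exact: normr_ge0.
have E y : (\int[leb2 R]_x `|Phi (y, x)|%:E = `|sq eta.2 * eta.2|%:E * \int[leb2 R]_z G (y, z))%E.
  rewrite -(@ge0_integral_lact_x R (sq eta.2) eta.1 eta.2 s0 e0 y (fun z => G (y, z))).
  - by apply: eq_integral => x _; rewrite /G /Phi [in RHS]/= kk_lact.
  - exact: (measurableT_comp mG (measurable_pair1 y)).
  - by move=> z; exact: G0.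
rewrite (eq_integral _ _ (fun y _ => E y)).
have mI := @measurable_tonelli_F _ _ _ _ R (leb2 R) (@sigma_finite_leb2 R) G mG G0.
rewrite (@ge0_integralZl_EFin _ _ R (leb2 R) setT measurableT _ (fun y _ => integral_ge0 _ (fun z _ => G0 _)) mI) //.
have h := section_yz_le x0 K0 HK sp sf eta.
apply: lte_mul_pinfty; [by rewrite lee_fin; exact: normr_ge0|by []|].
exact: le_lt_trans h (ltry _).
Qed.

Lemma integrable_kern_rov : (leb2 R).-integrable setT
  (EFin \o (fun x => kern t (kplus eta x) eta * rov p f x (Mx eta))).
Proof.
have mP' : measurable_fun setT (fun w : plane R * plane R => Phi (w.2, w.1)).
  by apply: (measurableT_comp mPhi); exact: measurable_swap.
have mPE : measurable_fun setT (fun w : plane R * plane R => `|Phi w|%:E).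
  by apply/measurable_EFinP; exact: measurableT_comp.
have fin' : (\int[leb2 R]_x \int[leb2 R]_y `|Phi (y, x)|%:E < +oo)%E.
  rewrite -(@sigma_finite_tonelli _ _ _ _ R (leb2 R) (leb2 R) (@sigma_finite_leb2 R)
    (@sigma_finite_leb2 R) (fun w => `|Phi w|%:E) mPE)//.
have H := integrable_section_Rintegral (@sigma_finite_leb2 R) mP' fin'.
have E : (fun x => kern t (kplus eta x) eta * rov p f x (Mx eta)) =
    (fun x => \int[leb2 R]_y Phi (y, x)).
  apply/funext => x; rewrite rovE -(RintegralZl _ measurableT (integrable_rov_lact x)).
  apply: eq_Rintegral => y _; rewrite /Phi [in RHS]/=.
  have E : forall a b c : R, a * (b * c) = b * (c * a) by move=> *; ring.
  exact: E.
by rewrite E; exact: H.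
Qed.

(** Substitute [z = k^-1 (y - x)] at fixed [y], with Jacobian [|det k|^-1], then exchange the
    integrals over [x] and [y]. *)
Lemma GovlE : Govl t x0 p f eta = (ddet eta)^-1 *
  \int[leb2 R]_x (kern t (kplus eta x) eta * rov p f x (Mx eta)).
Proof.
have [K K0 HK] := kernel_bounds t0.
have d0 : `|sq eta.2 * eta.2| != 0 by rewrite normr_eq0 mulf_neq0.
have ikk y : (leb2 R).-integrable setT (EFin \o (fun z => p z * kk t x0 y z eta)).
  apply/integrableP; split.
    apply/measurable_EFinP; apply: measurable_funM => //; exact: measurable_kk_z.
  have h := section_z_le x0 K0 HK sp y eta.
  exact: le_lt_trans h (ltry _).
have iA y : (leb2 R).-integrable setT (EFin \o (fun x => p (A y x) * kern t (kplus eta x) eta)).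
  have H := integrable_lact_x eta.1 s0 e0 y (ikk y).
  have E : (fun x => p (A y x) * kern t (kplus eta x) eta) =
    (fun x => p (A y x) * kk t x0 y (A y x) eta).
    by apply/funext => x; rewrite kk_lact.
  by rewrite E; exact: H.
have E1 y : f y * \int[leb2 R]_z (p z * kk t x0 y z eta) =
    (ddet eta)^-1 * \int[leb2 R]_x Phi (y, x).
  have H := Rintegral_lact_x eta.1 s0 e0 y (ikk y).
  have -> : \int[leb2 R]_x Phi (y, x) = f y * (`|sq eta.2 * eta.2| * \int[leb2 R]_z (p z * kk t x0 y z eta)).
    rewrite -H -(RintegralZl _ measurableT); last exact: (integrable_lact_x eta.1 s0 e0 y (ikk y)).
    by apply: eq_Rintegral => x _; rewrite /Phi [in LHS]/= kk_lact.
  rewrite /ddet; move: `|sq eta.2 * eta.2| d0 => c c0.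
  have E : forall a c b : R, c != 0 -> a * b = c^-1 * (a * (c * b)) by move=> *; field.
  exact: E.
transitivity (\int[leb2 R]_y ((ddet eta)^-1 * \int[leb2 R]_x Phi (y, x))).
  by apply: eq_Rintegral => y _; exact: E1.
have iP := integrable_section_Rintegral (@sigma_finite_leb2 R) mPhi finPhi.
rewrite (RintegralZl _ measurableT iP); congr (_ * _).
have H := @Rfubini _ _ _ _ R (leb2 R) (leb2 R) (@sigma_finite_leb2 R) (@sigma_finite_leb2 R)
  Phi mPhi finPhi.
rewrite (H : \int[leb2 R]_y \int[leb2 R]_x Phi (y, x) = _).
apply: eq_Rintegral => x _; rewrite rovE -(RintegralZl _ measurableT (integrable_rov_lact x)).
apply: eq_Rintegral => y _; rewrite /Phi [in LHS]/=.
have E : forall a b c : R, a * (b * c) = c * (a * b) by move=> *; ring.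
exact: E.
Qed.

End slice.

Lemma Govl0 (p f : plane R -> R) (eta : plane R) : eta.2 = 0 -> Govl t x0 p f eta = 0.
Proof.
move=> e0; rewrite /Govl /Rintegral; under eq_integral => y _.
  rewrite (_ : fine _ = 0) ?mulr0; first over.
  under eq_integral do rewrite /kk (kern0 _ _ e0) mulr0.
  by rewrite integral0.
by rewrite integral0.
Qed.

(* Two summands, because the real and imaginary parts of an inner product of
   complex functions are sums of two real overlaps. *)
Lemma kernel_pairing_le (p1 f1 p2 f2 : plane R -> R) :
  sqint (leb2 R) p1 -> sqint (leb2 R) f1 -> sqint (leb2 R) p2 -> sqint (leb2 R) f2 ->
  (`|(pi *+ 2) * kappa t x0 p1 * \int[leb2 R]_y (f1 y * psiR y) +
     (pi *+ 2) * kappa t x0 p2 * \int[leb2 R]_y (f2 y * psiR y)|%:E <=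
   \int[leb2 R]_eta \int[leb2 R]_x ((ddet eta)^-1 * (`|kern t (kplus eta x) eta| *
      `|rov p1 f1 x (Mx eta) + rov p2 f2 x (Mx eta)|))%:E)%E.
Proof.
move=> sp1 sf1 sp2 sf2; have [K K0 HK] := kernel_bounds t0.
have [i1 <-] := Rintegral_Govl x0 t0 K0 HK sp1 sf1.
have [i2 <-] := Rintegral_Govl x0 t0 K0 HK sp2 sf2.
rewrite -(RintegralD measurableT i1 i2).
have mG : measurable_fun setT (fun eta => Govl t x0 p1 f1 eta + Govl t x0 p2 f2 eta).
  apply/measurable_EFinP; exact: (measurable_int _ (integrableD measurableT i1 i2)).
apply: (le_trans (normr_Rintegral_le (leb2 R) mG)).
apply: ge0_le_integral_any => eta _; first by rewrite lee_fin.
have [e0|e0] := eqVneq eta.2 0.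
  rewrite !Govl0// addr0 normr0; apply: integral_ge0 => x _; rewrite lee_fin.
  by rewrite mulr_ge0 ?invr_ge0 ?mulr_ge0//; exact: normr_ge0.
rewrite !GovlE// -mulrDr -(RintegralD measurableT (integrable_kern_rov sp1 sf1 e0)
  (integrable_kern_rov sp2 sf2 e0)).
have iD := integrableD measurableT (integrable_kern_rov sp1 sf1 e0) (integrable_kern_rov sp2 sf2 e0).
rewrite -(RintegralZl _ measurableT iD).
have iD' := integrableZl measurableT (ddet eta)^-1 iD.
have mD : measurable_fun setT (fun x => (ddet eta)^-1 *
   (kern t (kplus eta x) eta * rov p1 f1 x (Mx eta) + kern t (kplus eta x) eta * rov p2 f2 x (Mx eta))).
  by apply/measurable_EFinP; exact: measurable_int iD'.
apply: (le_trans (normr_Rintegral_le (leb2 R) mD)).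
apply: ge0_le_integral_any => x _; first by rewrite lee_fin.
rewrite lee_fin -mulrDr (normrM (ddet eta)^-1) (normrM (kern _ _ _)).
by rewrite ger0_norm// invr_ge0; exact: normr_ge0.
Qed.

End overlap.

(** * The lower triangular group *)

Section lower_group.
Variable R : realType.

Definition low (s b : R) : 'M[R]_2 := mx22 s 0 b (s * `|s|).

Definition lower_group : set 'M[R]_2 := conj_group (@rot90 R) (@shearlet_group R).

Lemma invmx_rot90 : invmx (@rot90 R) = mx22 0 1 (-1) 0.
Proof.
rewrite /rot90 invmx_mx22; first by apply: mx22_eq; rewrite ?mulr0 ?mul0r ?oppr0 ?mul0r//; field.
by rewrite mul0r mulr1 opprK add0r oner_neq0.
Qed.

Lemma unitmx_rot90 : @rot90 R \in unitmx.
Proof. by rewrite unitmxE det_mx22E mul0r mulr1 opprK add0r unitr1. Qed.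

Lemma conj_shr (s b : R) : invmx (@rot90 R) *m shr s b *m (@rot90 R) = low s (- b).
Proof. by rewrite invmx_rot90 /shr /rot90 /low !mulmx22; apply: mx22_eq; ring. Qed.

Lemma lower_groupP (h : 'M[R]_2) : lower_group h <-> exists s b, s != 0 /\ h = low s b.
Proof.
split=> [[k /shearletP[s [b [s0 ->]]] <-]|[s [b [s0 ->]]]].
  by exists s, (- b); rewrite conj_shr.
by exists (shr s (- b)); [apply/shearletP; exists s, (- b)|rewrite conj_shr opprK].
Qed.

Lemma conj_det_weight (h : 'M[R]_2) : conj_weight (@rot90 R) (@det_weight R) h = det_weight h.
Proof.
have u := unitmx_rot90; have du : \det (@rot90 R) \is a GRing.unit by rewrite -unitmxE.
by rewrite /conj_weight /det_weight !det_mulmx det_inv mulrAC divrr// mul1r.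
Qed.

Lemma low_mul s b t c : low s b *m low t c = low (s * t) (b * t + s * `|s| * c).
Proof. by rewrite /low mulmx22 normrM; apply: mx22_eq; ring. Qed.

Lemma det_low s b : \det (low s b) = s ^+ 2 * `|s|.
Proof. by rewrite det_mx22E; ring. Qed.

Lemma low_unit s b : s != 0 -> low s b \in unitmx.
Proof. by move=> s0; rewrite unitmxE det_low unitfE mulf_neq0 ?normr_eq0 ?expf_neq0. Qed.

Lemma normr_det_low s b : `|\det (low s b)| = `|s| ^+ 3.
Proof. by rewrite det_low normrM normrX normr_id -exprSr. Qed.

Lemma invmx_low s b : s != 0 -> invmx (low s b) = low s^-1 (- b / (s ^+ 2 * `|s|)).
Proof.
move=> s0; have n0 : `|s| != 0 by rewrite normr_eq0.
rewrite /low invmx_mx22; last by rewrite mul0r subr0 !mulf_neq0.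
by apply: mx22_eq; rewrite ?normfV ?oppr0 ?mul0r//; field; rewrite ?n0 ?s0.
Qed.

Lemma lower_unit h : lower_group h -> h \in unitmx.
Proof. by move=> /lower_groupP[s [b [s0 ->]]]; exact: low_unit. Qed.

Lemma lowerM h k : lower_group h -> lower_group k -> lower_group (h *m k).
Proof.
move=> /lower_groupP[s [b [s0 ->]]] /lower_groupP[t [c [t0 ->]]].
by apply/lower_groupP; exists (s * t), (b * t + s * `|s| * c); rewrite low_mul mulf_neq0.
Qed.

Lemma lowerV h : lower_group h -> lower_group (invmx h).
Proof.
move=> /lower_groupP[s [b [s0 ->]]]; apply/lower_groupP.
by exists s^-1, (- b / (s ^+ 2 * `|s|)); rewrite invr_eq0 s0 invmx_low.
Qed.

Lemma lower_entryP h : lower_group h <->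
  [/\ h ord0 ord_max = 0, h ord0 ord0 != 0 & h ord_max ord_max = h ord0 ord0 * `|h ord0 ord0|].
Proof.
split=> [/lower_groupP[s [b [s0 ->]]]|[h10 h11 h00]]; first by rewrite !mx22_ij.
apply/lower_groupP; exists (h ord0 ord0), (h ord_max ord0); split=> //.
by rewrite [LHS]mx22E h10 h00.
Qed.

Lemma measurable_lower : measurable (lower_group : set (borelM R)).
Proof.
have me i j := @measurable_entry R i j.
have -> : lower_group = ((fun h : borelM R => h ord0 ord_max) @^-1` [set 0]) `&`
    ~` ((fun h : borelM R => h ord0 ord0) @^-1` [set 0]) `&`
    ((fun h : borelM R => h ord_max ord_max - h ord0 ord0 * `|h ord0 ord0|) @^-1` [set 0]).
  apply/seteqP; split=> h.
    by move=> /lower_entryP[h10 h11 h00]; split; [split=> //=; exact/eqP|rewrite /= h00 subrr].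
  move=> [[h10 h11] /= /eqP]; rewrite subr_eq0 => /eqP h00.
  by apply/lower_entryP; split=> //; exact/eqP.
have H0 (f : borelM R -> R) : measurable_fun setT f -> measurable (f @^-1` [set 0]).
  by move=> mf; rewrite -[X in measurable X]setTI; apply: mf => //; exact: measurable_set1.
apply: measurableI; first apply: measurableI.
- exact: H0.
- by apply: measurableC; exact: H0.
- by apply: H0; have m1 := me ord_max ord_max; have m2 := me ord0 ord0; mfun.
Qed.

Lemma sqN (s : R) : sq (s * `|s|) = s.
Proof.
have [->|s0] := eqVneq s 0; first by rewrite /sq !mul0r.
have n0 : `|s| != 0 by rewrite normr_eq0.
by rewrite /sq normrM normr_id -expr2 sqrtr_sqr normr_id mulfK.
Qed.

Lemma Mx_low (eta : plane R) : Mx eta = low (sq eta.2) eta.1.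
Proof. by rewrite /Mx /low sq_normM. Qed.

Lemma Mx_lower (eta : plane R) : eta.2 != 0 -> lower_group (Mx eta).
Proof.
by move=> e0; apply/lower_groupP; exists (sq eta.2), eta.1; rewrite Mx_low sq_neq0.
Qed.

Lemma normr_det_Mx (eta : plane R) : `|\det (Mx eta)| = ddet eta.
Proof. by rewrite /Mx det_mx22E mul0r subr0. Qed.

(* The bottom row of M(eta) x is the row vector eta x. *)
Lemma Mx_mul (eta : plane R) (t c : R) :
  Mx eta *m low t c = Mx (skew1 t (t * `|t|) 0 (fun e2 => c * e2) eta).
Proof.
rewrite Mx_low low_mul Mx_low /skew1 /= addr0; congr low.
  have [->|e0] := eqVneq eta.2 0; first by rewrite mulr0 /sq !mul0r.
  by rewrite -[in RHS](sq_normM eta.2) mulrACA -normrM mulrC sqN.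
by rewrite sq_normM mulrC [c * _]mulrC.
Qed.

(* The adjugate formula gives a globally measurable inverse; it differs from
   [invmx] on singular matrices. *)
Definition imx (h : 'M[R]_2) : 'M[R]_2 :=
  mx22 (h ord_max ord_max / \det h) (- h ord0 ord_max / \det h)
       (- h ord_max ord0 / \det h) (h ord0 ord0 / \det h).

Lemma imxE h : h \in unitmx -> imx h = invmx h.
Proof.
rewrite unitmxE unitfE /imx det22 => d0; rewrite [in RHS](mx22E h) invmx_mx22//.
Qed.

Lemma measurable_det : measurable_fun [set: borelM R] (fun h : borelM R => \det (h : 'M[R]_2)).
Proof.
have me i j := @measurable_entry R i j.
have m0 := me ord0 ord0; have m1 := me ord0 ord_max; have m2 := me ord_max ord0.
have m3 := me ord_max ord_max.
rewrite (_ : (fun h => _) = (fun h : borelM R => (h : 'M[R]_2) ord0 ord0 * (h : 'M[R]_2) ord_max ord_max -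
  (h : 'M[R]_2) ord0 ord_max * (h : 'M[R]_2) ord_max ord0)); last first.
  by apply/funext => h; rewrite det22.
by mfun.
Qed.

Lemma mx22_cases (P : 'I_2 -> 'I_2 -> Prop) : P ord0 ord0 -> P ord0 ord_max ->
  P ord_max ord0 -> P ord_max ord_max -> forall i j, P i j.
Proof.
move=> h0 h1 h2 h3 i j; have E (k : 'I_2) : k = ord0 \/ k = ord_max.
  by case: k => [[|[|//]] Hk]; [left|right]; exact: val_inj.
by case: (E i) => ->; case: (E j) => ->.
Qed.

Lemma measurable_mx22 d (T : measurableType d) (a b c e : T -> R) :
  measurable_fun setT a -> measurable_fun setT b -> measurable_fun setT c ->
  measurable_fun setT e ->
  measurable_fun setT ((fun w => mx22 (a w) (b w) (c w) (e w)) : T -> borelM R).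
Proof.
move=> ma mb mc me; apply: measurable_fun_borelM.
by apply: mx22_cases; under eq_fun do rewrite mx22_ij.
Qed.

Lemma measurable_imx : measurable_fun [set: borelM R] (imx : borelM R -> borelM R).
Proof.
have me i j := @measurable_entry R i j.
have m0 := me ord0 ord0; have m1 := me ord0 ord_max; have m2 := me ord_max ord0.
have m3 := me ord_max ord_max; have md := measurable_det.
by apply: measurable_mx22; mfun.
Qed.

Lemma measurable_Mx : measurable_fun setT (@Mx R : plane R -> borelM R).
Proof.
have ms : measurable_fun setT (fun eta : plane R => sq eta.2).
  exact: (measurableT_comp (@measurable_sq R) measurable_snd).
by apply: measurable_mx22 => //; exact: measurable_cst.
Qed.

Lemma measurable_mulmx2 d (T : measurableType d) (f g : T -> borelM R) :
  measurable_fun setT f -> measurable_fun setT g ->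
  measurable_fun setT ((fun w => (f w : 'M[R]_2) *m (g w : 'M[R]_2)) : T -> borelM R).
Proof.
move=> mf mg; apply: measurable_fun_borelM => i j.
under eq_fun do rewrite mulmx_entry.
have me k l (u : T -> borelM R) : measurable_fun setT u ->
  measurable_fun setT (fun w => (u w : 'M[R]_2) k l).
  by move=> mu; exact: (measurableT_comp (@measurable_entry R k l) mu).
by apply: measurable_funD; apply: measurable_funM; exact: me.
Qed.

(** Compact parameter sets exhausting [s != 0]: they make an arbitrary Haar measure sigma-finite and
    provide a compact set of positive finite measure. *)
Definition low_box (n : nat) : set (R * R) :=
  (`[- n.+1%:R, n.+1%:R] `&` [set s | n.+1%:R^-1 <= `|s|]) `*` `[- n.+1%:R, n.+1%:R].

Definition low_compact (n : nat) : set 'M[R]_2 := [set low z.1 z.2 | z in low_box n].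

Lemma continuous_mx (T : topologicalType) (f : T -> 'M[R]_2) :
  (forall i j, continuous (fun x => f x i j)) -> continuous f.
Proof.
move=> cf x A /nbhs_ballP[e /= e0 eA].
have : \forall y \near x, forall i j, ball (f x i j) e (f y i j).
  apply: filter_forall => i; apply: filter_forall => j.
  by apply: (cf i j x); exact: nbhsx_ballx.
by apply: filterS => y Hy; apply: eA; split=> // i j; exact: Hy.
Qed.

Lemma low_compactP n : compact (low_compact n).
Proof.
apply: continuous_compact.
  apply: continuous_subspaceT; apply: continuous_mx => i j z.
  move: i j; apply: mx22_cases; under eq_fun do rewrite mx22_ij; rewrite ?mx22_ij.
  - exact: cvg_fst.
  - exact: cvg_cst.
  - exact: cvg_snd.
  - by apply: cvgM; [exact: cvg_fst|apply: cvg_norm; exact: cvg_fst].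
apply: compact_setX; last exact: segment_compact.
apply: compact_closedI; first exact: segment_compact.
apply: (@closed_comp _ _ (fun s : R => `|s|) [set x | n.+1%:R^-1 <= x]).
  by move=> s _; exact: norm_continuous.
exact: closed_ge.
Qed.

Lemma measurable_low_compact n : measurable (low_compact n : set (borelM R)).
Proof.
rewrite -[X in measurable X]setCK; apply: measurableC; apply: sub_sigma_algebra.
apply: closed_openC; apply: compact_closed; last exact: low_compactP.
exact: norm_hausdorff.
Qed.

Lemma bigcup_low_compact : lower_group = \bigcup_n low_compact n.
Proof.
apply/seteqP; split=> [h /lower_groupP[s [b [s0 ->]]]|h [n _ [[s b] [[_ /= hs] _] <-]]]; last first.
  apply/lower_groupP; exists s, b; split=> //; rewrite -normr_gt0.
  by apply: lt_le_trans hs; rewrite invr_gt0.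
pose m := `|s| + `|s|^-1 + `|b|; have m0 : 0 <= m by rewrite !addr_ge0// invr_ge0.
have [n nm] : exists n : nat, m < n.+1%:R.
  by exists (Num.truncn m); have := truncnS_gt m; rewrite -addn1 natrD.
have s00 : 0 < `|s| by rewrite normr_gt0.
have v0 : 0 <= `|s|^-1 by rewrite invr_ge0.
exists n => //; exists (s, b) => //; rewrite /low_box /m in nm *; split; first split.
- rewrite /= in_itv /= -ler_norml; apply: ltW; apply: le_lt_trans nm.
  by rewrite -addrA lerDl addr_ge0.
- rewrite /= -[leRHS]invrK lef_pV2 ?posrE ?invr_gt0//; apply: ltW; apply: le_lt_trans nm.
  by rewrite addrAC lerDr addr_ge0.
- rewrite /= in_itv /= -ler_norml; apply: ltW; apply: le_lt_trans nm.
  by rewrite lerDr addr_ge0.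
Qed.

End lower_group.

(** * Comparison of the chart with an arbitrary Haar measure *)

Section haar_comparison.
Variables (R : realType) (mu : {measure set (borelM R) -> \bar R}) (Delta : 'M[R]_2 -> R).
Let H := @lower_group R.
Hypotheses (haar_mu : left_haar H mu) (mod_Delta : modular_function H mu Delta).

Let mH := @measurable_lower R.
Let Hu := @lower_unit R.
Let HM := @lowerM R.
Let HV := @lowerV R.

Lemma haar_lower_sigma_finite : sigma_finite setT mu.
Proof.
exact: (haar_sigma_finite mH haar_mu (@low_compactP R) (@measurable_low_compact R)
  (@bigcup_low_compact R)).
Qed.
Let sfmu := haar_lower_sigma_finite.

Lemma haar_lower_setT (f : borelM R -> \bar R) : measurable_fun setT f ->
  (forall h, (0 <= f h)%E) -> (\int[mu]_(h in H) f h = \int[mu]_h f h)%E.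
Proof.
move=> mf f0; have [muH _ _ _] := haar_mu.
rewrite [RHS](@ge0_negligible_integral _ _ _ mu setT (~` H) f (measurableC mH) measurableT mf
  (fun h _ => f0 h) muH).
by congr (integral _ _ _); rewrite setTD setCK.
Qed.

Lemma haar_compact_pos : exists n, (0 < mu (@low_compact R n))%E.
Proof.
have [_ muH0 _ _] := haar_mu; apply/not_existsP => n0; apply: muH0.
apply: measure_negligible; first exact: mH.
rewrite /H (@bigcup_low_compact R); apply: negligible_bigcup => n.
apply/negligibleP; first exact: measurable_low_compact.
apply/eqP; rewrite eq_le measure_ge0 andbT leNgt; apply/negP; exact: n0.
Qed.

Section compact_set.
Variable n : nat.
Let K : set (borelM R) := @low_compact R n.
Let mK : measurable K := @measurable_low_compact R n.
Hypothesis K0 : (0 < mu K)%E.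
Let KH : K `<=` H.
Proof. by rewrite /H (@bigcup_low_compact R) => h Kh; exists n. Qed.
Let m := fine (mu K).
Let mE : mu K = m%:E.
Proof.
have [_ _ fin _] := haar_mu; rewrite fineK// ge0_fin_numE ?measure_ge0//.
exact: fin (@low_compactP R n) KH.
Qed.
Let m0 : 0 < m. Proof. by move: K0; rewrite mE lte_fin. Qed.

Let one (h : borelM R) : R := \1_K h.
Let m1K : measurable_fun setT one.
Proof. exact: measurable_indic. Qed.
Let one0 h : 0 <= one h. Proof. by rewrite /one indicE. Qed.
Let oneE0 h : (0 <= (one h)%:E)%E. Proof. by rewrite lee_fin one0. Qed.

Let int1K : (\int[mu]_(h in H) (one h)%:E = m%:E)%E.
Proof. by rewrite (integral_indic mu mH mK) setIidl. Qed.

Lemma int_indic_mulV (k : 'M[R]_2) : H k ->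
  (\int[mu]_(h in H) (one (h *m invmx k))%:E = (Delta k * m)%:E)%E.
Proof.
move=> Hk; have m1 : measurable_fun (H : set (borelM R)) (fun h : borelM R => (one h)%:E).
  by apply/measurable_EFinP; exact: measurable_funTS.
have := @haar_right_integral R H mu mH Hu HM HV haar_mu Delta (invmx k) (fun h => (one h)%:E)
  mod_Delta (HV Hk) m1 (fun h _ => oneE0 h).
move=> ->.
by rewrite invmxK int1K EFinM.
Qed.

(** Two opposite right translations of the indicator of [K] cancel, and [mu K] is positive and
    finite. *)
Lemma modularV (k : 'M[R]_2) : H k -> Delta k * Delta (invmx k) = 1.
Proof.
move=> Hk.
have m1 : measurable_fun (H : set (borelM R)) (fun h : borelM R => (one (h *m invmx k : borelM R))%:E).
  apply/measurable_EFinP; apply: measurable_funTS.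
  exact: (measurableT_comp m1K (measurable_mulmxr (invmx k))).
have := @haar_right_integral R H mu mH Hu HM HV haar_mu Delta k (fun h => (one (h *m invmx k))%:E)
  mod_Delta Hk m1 (fun h _ => oneE0 _).
have -> : (\int[mu]_(h in H) (one (h *m k *m invmx k))%:E = m%:E)%E.
  rewrite -int1K; apply: eq_integral => h _; rewrite mulmxK//; exact: Hu.
rewrite int_indic_mulV// -EFinM => -[E'].
move: E'; rewrite mulrA [Delta (invmx k) * _]mulrC => E'.
by apply: (mulIf (lt0r_neq0 m0)); rewrite mul1r.
Qed.

(** A measurable stand-in for the modular function: on [H] it equals [Delta k * m], and through
    [imx] it is defined on all matrices. Accordingly [dk] below extends [Delta (invmx k)]
    measurably. *)
Let Ek (k : borelM R) : \bar R := (\int[mu]_x (one (x *m imx k : borelM R))%:E)%E.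

Let mEk : measurable_fun setT Ek.
Proof.
apply: (@measurable_tonelli_F _ _ (borelM R) (borelM R) R mu sfmu
  (fun w => (one (w.2 *m imx w.1 : borelM R))%:E)).
  apply/measurable_EFinP; apply: (measurableT_comp m1K).
  apply: measurable_mulmx2; first exact: measurable_snd.
  exact: (measurableT_comp (@measurable_imx R) measurable_fst).
by move=> w; exact: oneE0.
Qed.

Let EkE k : H k -> Ek k = (Delta k * m)%:E.
Proof.
move=> Hk; rewrite -int_indic_mulV// /Ek -haar_lower_setT.
- by rewrite imxE//; exact: Hu.
- apply/measurable_EFinP; exact: (measurableT_comp m1K (measurable_mulmxr (imx k))).
- by move=> h; exact: oneE0.
Qed.

Let dk (k : borelM R) : R := m / fine (Ek k).
Let mdk : measurable_fun setT dk.
Proof.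
apply: measurable_funM; first exact: measurable_cst.
apply: measurable_fun_inv.
exact: (measurableT_comp (fine_measurable measurableT) mEk).
Qed.
Let dk0 k : 0 <= dk k.
Proof.
apply: divr_ge0; first exact: ltW.
by apply: fine_ge0; apply: integral_ge0 => h _; exact: oneE0.
Qed.
Let dkE k : H k -> dk k = Delta (invmx k).
Proof.
move=> Hk; rewrite /dk EkE//= -[Delta k]invrK -(_ : Delta (invmx k) = (Delta k)^-1).
  by have [d0 _] := mod_Delta (HV Hk); field; rewrite !gt_eqF.
have [d0 _] := mod_Delta Hk; apply: (mulfI (lt0r_neq0 d0)).
by rewrite modularV// divff// gt_eqF.
Qed.

Definition rhw (eta : plane R) : R := (ddet eta)^-1.

Lemma rhw_ge0 eta : 0 <= rhw eta.
Proof. by rewrite invr_ge0; exact: normr_ge0. Qed.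

Lemma measurable_rhw : measurable_fun setT rhw.
Proof.
have ms : measurable_fun setT (fun eta : plane R => sq eta.2).
  exact: (measurableT_comp (@measurable_sq R) measurable_snd).
by rewrite /rhw /ddet; mfun.
Qed.

Lemma rhw0 eta : eta.2 = 0 -> rhw eta = 0.
Proof. by move=> e0; rewrite /rhw /ddet e0 mulr0 normr0 invr0. Qed.

Let bK (eta : plane R) : R := rhw eta * one (imx (Mx eta) : borelM R).

Let m1MV : measurable_fun setT (fun eta : plane R => one (imx (Mx eta) : borelM R) : R).
Proof.
exact: (measurableT_comp m1K (measurableT_comp (@measurable_imx R) (@measurable_Mx R))).
Qed.

Let bK0 eta : (0 <= (bK eta)%:E)%E.
Proof. by rewrite lee_fin; apply: mulr_ge0; [exact: rhw_ge0|exact: one0]. Qed.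

Let mbK : measurable_fun setT bK.
Proof. by apply: measurable_funM; [exact: measurable_rhw|exact: m1MV]. Qed.

(** The bounded region is dominated by a Gaussian. Where the indicator is 1, [|eta1| <= N^4],
    [|eta2| <= N^2] and [rhw <= N^3], so the exponent is at least [- 1], whence the constant
    [N^3 e]. *)
Lemma rhw_compact_lty :
  (\int[leb2 R]_eta (rhw eta * one (imx (Mx eta) : borelM R))%:E < +oo)%E.
Proof.
pose N : R := n.+1%:R; have N0 : 0 < N by []. have N0' := lt0r_neq0 N0.
have N40 : N ^+ 4 != 0 by rewrite expf_neq0.
have N20 : N ^+ 2 != 0 by rewrite expf_neq0.
have ig := integrableZl measurableT (N ^+ 3 * expR 1) (integrable_gs2 N40 N20).
have /integrableP[_ fin] := ig; apply: le_lt_trans fin.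
apply: ge0_le_integral_any => eta _.
  by rewrite lee_fin mulr_ge0// rhw_ge0.
rewrite /= lee_fin (le_trans _ (ler_norm _))//.
have G0 : 0 <= N ^+ 3 * expR 1 * gs2 (N ^+ 4) (N ^+ 2) eta.
  by rewrite mulr_ge0 ?gs2_ge0// mulr_ge0 ?expR_ge0// exprn_ge0// ltW.
have [e0|e0] := eqVneq eta.2 0; first by rewrite rhw0// mul0r.
rewrite /one indicE; case: (boolP (_ \in _)) => [|_]; last by rewrite mulr0.
rewrite mulr1 inE imxE; last by apply: Hu; exact: Mx_lower.
have s0 := sq_neq0 e0; rewrite Mx_low invmx_low// => -[[s b] [[/= s1 s2] b1]].
move=> Eq; have := congr1 (fun h : 'M[R]_2 => h ord0 ord0) Eq.
have := congr1 (fun h : 'M[R]_2 => h ord_max ord0) Eq; rewrite /low !mx22_ij => Eb Es.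
have e2 : `|eta.2| = `|sq eta.2| ^+ 2 by rewrite real_normK ?num_real// sqr_sq.
have nb : `|- eta.1 / (sq eta.2 ^+ 2 * `|sq eta.2|)| = `|eta.1| / `|sq eta.2| ^+ 3.
  by rewrite normrM normrN normfV (normrM (_ ^+ 2)) normrX normr_id -exprSr.
move: s1 s2 b1; rewrite !in_itv /= -!ler_norml Eb Es -/N normfV nb.
have r3 : rhw eta = (`|sq eta.2| ^+ 3)^-1.
  by rewrite /rhw /ddet normrM e2; congr _^-1; rewrite [RHS]exprS.
rewrite r3 /gs2.
have u0 : 0 < `|sq eta.2| by rewrite normr_gt0.
move: `|sq eta.2| u0 e2 => u u0 e2 h1 h2 h3.
have u0' := lt0r_neq0 u0; have u30 : 0 < u ^+ 3 by rewrite exprn_gt0.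
have uN : u <= N by rewrite -(lef_pV2 N0 u0).
have G1 (a k : R) : 0 < k -> `|a| <= k -> (a / k) ^+ 2 <= 1.
  move=> k0 ak; rewrite -real_normK ?num_real// exprn_ile1//.
  by rewrite normrM normfV (gtr0_norm k0) ler_pdivrMr// mul1r.
have a1 : (eta.1 / N ^+ 4) ^+ 2 <= 1.
  apply: G1; first exact: exprn_gt0.
  move: h3; rewrite ler_pdivrMr// => h3.
  apply: (le_trans h3); rewrite [leRHS]exprS ler_wpM2l ?(ltW N0)//.
  by rewrite lerXn2r ?nnegrE ?(ltW u0) ?(ltW N0).
have a2 : (eta.2 / N ^+ 2) ^+ 2 <= 1.
  apply: G1; first exact: exprn_gt0.
  by rewrite e2 lerXn2r ?nnegrE ?(ltW u0) ?(ltW N0).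
rewrite -[leLHS]mulr1 -(mulrA (N ^+ 3) (expR 1)); apply: ler_pM => //.
- by rewrite invr_ge0 ltW.
- by rewrite -exprVn lerXn2r ?nnegrE ?(ltW N0)// invr_ge0 ltW.
- rewrite /gs -!expRD -[leLHS]expR0 ler_expR.
  by move: (_ ^+ 2) (_ ^+ 2) a1 a2 => p q a1 a2; lra.
Qed.

Variable F : borelM R -> \bar R.
Hypotheses (mF : measurable_fun setT F) (F0 : forall k, (0 <= F k)%E).

Let f (k : borelM R) : \bar R := ((dk k)%:E * F k)%E.
Let mf : measurable_fun setT f.
Proof. by apply: emeasurable_funM => //; apply/measurable_EFinP. Qed.
Let f0 k : (0 <= f k)%E. Proof. by rewrite mule_ge0// lee_fin. Qed.

(** The two integrands of the classical uniqueness proof for Haar measure, with [K] as test set;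
    they are related by a right translation of [Mx eta] by [x]. *)
Let J (w : plane R * borelM R) : \bar R :=
  ((rhw w.1 * one (w.2 *m imx (Mx w.1) : borelM R))%:E * f (Mx w.1))%E.
Let J' (w : plane R * borelM R) : \bar R :=
  ((bK w.1)%:E * f ((Mx w.1 : 'M[R]_2) *m (w.2 : 'M[R]_2) : borelM R))%E.

Let mMx1 : measurable_fun setT (fun w : plane R * borelM R => Mx w.1 : borelM R).
Proof. exact: (measurableT_comp (@measurable_Mx R) measurable_fst). Qed.

Let mJ : measurable_fun setT J.
Proof.
apply: emeasurable_funM; last exact: (measurableT_comp mf mMx1).
apply/measurable_EFinP; apply: measurable_funM.
  exact: (measurableT_comp measurable_rhw measurable_fst).
apply: (measurableT_comp m1K); apply: measurable_mulmx2; first exact: measurable_snd.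
exact: (measurableT_comp (@measurable_imx R) mMx1).
Qed.

Let mJ' : measurable_fun setT J'.
Proof.
apply: emeasurable_funM.
  by apply/measurable_EFinP; exact: (measurableT_comp mbK measurable_fst).
apply: (measurableT_comp mf); apply: measurable_mulmx2; [exact: mMx1|exact: measurable_snd].
Qed.

Let J0 w : (0 <= J w)%E.
Proof. by rewrite mule_ge0// lee_fin mulr_ge0// rhw_ge0. Qed.
Let J'0 w : (0 <= J' w)%E.
Proof. by rewrite mule_ge0// lee_fin mulr_ge0// rhw_ge0. Qed.

(** The integral over [x] produces the modular function at [Mx eta], which cancels the factor [dk]
    contained in [f]. *)
Let int_J : (\int[leb2 R]_eta \int[mu]_x J (eta, x) =
  \int[leb2 R]_eta (m%:E * ((rhw eta)%:E * F (Mx eta))))%E.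
Proof.
apply: eq_integral => eta _; rewrite /J /=.
have [e0|e0] := eqVneq eta.2 0.
  rewrite (rhw0 e0); under eq_integral do rewrite mul0r mul0e.
  by rewrite integral0 mul0e mule0.
have HMx := Mx_lower e0.
have m1 : measurable_fun setT (fun x : borelM R => (one (x *m imx (Mx eta) : borelM R))%:E).
  apply/measurable_EFinP; exact: (measurableT_comp m1K (measurable_mulmxr (imx (Mx eta)))).
under eq_integral => x _ do rewrite EFinM [X in (X * _)%E]muleC -muleA.
rewrite (ge0_integralZr mu measurableT m1); last 2 first.
- by move=> x _; exact: oneE0.
- by apply: mule_ge0; [rewrite lee_fin rhw_ge0|exact: f0].
rewrite -/(Ek (Mx eta)) EkE// /f dkE// !muleA -!EFinM; congr (_%:E * _)%E.
have E : forall a b c d : R, a * b = 1 -> a * c * d * b = c * d.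
  by move=> a b c d ab; rewrite (_ : a * c * d * b = a * b * (c * d)); [rewrite ab mul1r|ring].
exact: E (modularV HMx).
Qed.

(** For [x = low t c], [Mx_mul] turns right multiplication into a shear of [eta]; its Jacobian
    compensates the change of [rhw], which expresses that the chart measure is right invariant. *)
Let int_JJ' : (\int[mu]_x \int[leb2 R]_eta J (eta, x) =
  \int[mu]_x \int[leb2 R]_eta J' (eta, x))%E.
Proof.
have mGJ := @measurable_tonelli_G _ _ _ _ R (leb2 R) (@sigma_finite_leb2 R) J mJ J0.
have mGJ' := @measurable_tonelli_G _ _ _ _ R (leb2 R) (@sigma_finite_leb2 R) J' mJ' J'0.
have p1 x : (0 <= \int[leb2 R]_eta J (eta, x))%E by apply: integral_ge0 => z _; exact: J0.
have p2 x : (0 <= \int[leb2 R]_eta J' (eta, x))%E by apply: integral_ge0 => z _; exact: J'0.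
apply: (etrans (esym (haar_lower_setT mGJ p1))).
apply: (etrans _ (haar_lower_setT mGJ' p2)).
apply: eq_integral => x; rewrite inE => /lower_groupP[t [c [t0 ->]]] {x}.
have tt0 : t * `|t| != 0 by rewrite mulf_neq0// normr_eq0.
have mc : measurable_fun [set: R] (fun e2 : R => c * e2) by mfun.
have mJx : measurable_fun setT (fun eta => J (eta, low t c)).
  exact: (measurableT_comp mJ (measurable_pair2 (low t c : borelM R))).
have mJx' : measurable_fun setT (fun eta => J' (eta, low t c)).
  exact: (measurableT_comp mJ' (measurable_pair2 (low t c : borelM R))).
have S := @ge0_integral_skew1 R t (t * `|t|) 0 _ t0 tt0 mc (fun eta => J (eta, low t c)) mJx
  (fun eta => J0 _).
have T3 : 0 < `|t * (t * `|t|)| by rewrite normr_gt0 mulf_neq0.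
have JE eta : J (skew1 t (t * `|t|) 0 (fun e2 => c * e2) eta, low t c) =
    ((`|t * (t * `|t|)|^-1)%:E * J' (eta, low t c))%E.
  rewrite /J /J' [(_, low t c).1]/= [(_, low t c).2]/= -Mx_mul [RHS]muleA -EFinM; congr (_%:E * _)%E.
  have [e0|e0] := eqVneq eta.2 0.
    by rewrite /bK (rhw0 e0) rhw0 ?mul0r ?mulr0// /skew1 /= e0 mulr0 addr0.
  have Ht : H (low t c) by apply/lower_groupP; exists t, c.
  have HMx := Mx_lower e0.
  change (bK (eta, low t c).1) with (bK eta).
  rewrite /bK (imxE (Hu (HM HMx Ht))) (imxE (Hu HMx)) [RHS]mulrA; congr (_ * one _).
    rewrite /rhw -!normr_det_Mx -Mx_mul det_mulmx normrM normr_det_low -invfM mulrC.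
    by congr (_ * _)^-1; rewrite !normrM normr_id -expr2 -exprS.
  rewrite -[RHS]mulmx1 -(mulmxV (Hu (HM HMx Ht))) !mulmxA mulVmx ?mul1mx//; exact: Hu.
have TT : (`|t * (t * `|t|)|%:E * (`|t * (t * `|t|)|^-1)%:E = 1)%E.
  by rewrite -EFinM divff// gt_eqF.
have S' : (\int[leb2 R]_eta J (skew1 t (t * `|t|) 0 (fun e2 => (c * e2)%R) eta, low t c) =
    (`|t * (t * `|t|)|^-1)%:E * \int[leb2 R]_eta J' (eta, low t c))%E.
  rewrite -(ge0_integralZl_EFin (leb2 R) measurableT (fun eta _ => J'0 _) mJx'); last first.
    by rewrite invr_ge0 ltW.
  by apply: eq_integral => eta _; exact: JE.
have cancel (a b : \bar R) : ((`|t * (t * `|t|)|^-1)%:E * a = (`|t * (t * `|t|)|^-1)%:E * b)%E -> a = b.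
  by move=> ab; rewrite -[a]mul1e -TT -muleA ab muleA TT mul1e.
exact: (cancel _ _ (esym (etrans (esym S') S))).
Qed.

(** Evaluates the double integral of [J] in both orders: integrating first in [x] gives the chart
    integral of [F]; passing to [J'] and using left invariance of [mu] separates the other side into
    a product. *)
Lemma right_haar_chart : (m%:E * \int[leb2 R]_eta ((rhw eta)%:E * F (Mx eta)) =
  (\int[leb2 R]_eta (bK eta)%:E) * \int[mu]_(k in H) ((Delta (invmx k))%:E * F k))%E.
Proof.
have mFM : measurable_fun setT (fun eta : plane R => ((rhw eta)%:E * F (Mx eta))%E).
  apply: emeasurable_funM; first by apply/measurable_EFinP; exact: measurable_rhw.
  exact: (measurableT_comp mF (@measurable_Mx R)).
rewrite -(@ge0_integralZl_EFin _ _ R (leb2 R) setT measurableT _ (fun eta _ => _) mFM m (ltW m0)).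
  rewrite -int_J.
  have T := @sigma_finite_tonelli _ _ _ _ R (leb2 R) mu (@sigma_finite_leb2 R) sfmu.
  rewrite (T _ mJ J0) int_JJ' -(T _ mJ' J'0).
  have If : (\int[mu]_(k in H) ((Delta (invmx k))%:E * F k) = \int[mu]_(k in H) f k)%E.
    by apply: eq_integral => k; rewrite inE => Hk; rewrite /f dkE.
  rewrite If -(ge0_integralZr (leb2 R) measurableT); last 3 first.
  - by apply/measurable_EFinP.
  - by move=> eta _; exact: bK0.
  - by apply: integral_ge0 => k _; exact: f0.
  apply: eq_integral => eta _; rewrite /J' /=.
  have [e0|e0] := eqVneq eta.2 0.
    rewrite /bK (rhw0 e0) mul0r mul0e; under eq_integral do rewrite mul0e.
    by rewrite integral0.
  have mfM : measurable_fun setT (fun x : borelM R => f (Mx eta *m x : borelM R)).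
    exact: (measurableT_comp mf (measurable_mulmxl (Mx eta))).
  rewrite (ge0_integralZl_EFin mu measurableT (fun x _ => f0 _) mfM); last first.
    exact: (bK0 eta).
  have fM0 (h : borelM R) : (0 <= f (Mx eta *m h : borelM R))%E by exact: f0.
  have E1 := haar_lower_setT mfM fM0.
  have E2 := haar_left_integral mH Hu HM HV haar_mu (Mx_lower e0) (measurable_funTS mf) (fun h _ => f0 h).
  exact: (congr1 (fun u => ((bK eta)%:E * u)%E) (etrans (esym E1) E2)).
by move=> eta _; apply: mule_ge0; [rewrite lee_fin rhw_ge0|exact: F0].
Qed.

End compact_set.

(** The constant is the ratio of the chart integral of the reflected test set to its Haar measure,
    finite by [rhw_compact_lty] and [haar_compact_pos]. *)
Lemma haar_chart_le : exists2 C : R, 0 <= C &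
  forall F : borelM R -> \bar R, measurable_fun setT F -> (forall k, (0 <= F k)%E) ->
  (\int[leb2 R]_eta ((rhw eta)%:E * F (Mx eta)) <=
    C%:E * \int[mu]_(k in H) ((Delta (invmx k))%:E * F k))%E.
Proof.
have [n K0] := haar_compact_pos; have [_ _ fin _] := haar_mu.
have mfin : mu (@low_compact R n) = (fine (mu (@low_compact R n)))%:E.
  rewrite fineK// ge0_fin_numE ?measure_ge0//; apply: fin (@low_compactP R n) _.
  by move=> h Kh; rewrite /H (@bigcup_low_compact R); exists n.
have Rlty := rhw_compact_lty n.
have Rge0 : (0 <= \int[leb2 R]_eta (rhw eta * \1_(@low_compact R n) (imx (Mx eta) : borelM R))%:E)%E.
  by apply: integral_ge0 => eta _; rewrite lee_fin mulr_ge0 ?rhw_ge0// indicE.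
exists (fine (\int[leb2 R]_eta (rhw eta * \1_(@low_compact R n) (imx (Mx eta) : borelM R))%:E) /
  fine (mu (@low_compact R n))).
  by apply: divr_ge0; apply: fine_ge0 => //; exact: measure_ge0.
move=> F mF F0; have := right_haar_chart K0 mF F0.
rewrite mfin lte_fin in K0; set m := fine (mu _) in K0 *.
rewrite -[X in _ = (X * _)%E -> _]fineK ?ge0_fin_numE//; set c := fine (\int[_]_eta _).
move=> E; rewrite mulrC EFinM -muleA -E muleA -EFinM mulVf ?gt_eqF// mul1e//.
Qed.

End haar_comparison.

(** * Voice transforms *)

Section voice_parts.
Variable R : realType.
Implicit Types (f psi : R * R -> R[i]) (h : 'M[R]_2).

Definition fRe f : plane R -> R := fun y => complex.Re (f y).
Definition fIm f : plane R -> R := fun y => complex.Im (f y).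

Lemma normc_sqrtE (z : R[i]) : Normc.normc z = Num.sqrt (complex.Re z ^+ 2 + complex.Im z ^+ 2).
Proof. by case: z. Qed.

Lemma sqr_normc (z : R[i]) : Normc.normc z ^+ 2 = complex.Re z ^+ 2 + complex.Im z ^+ 2.
Proof. by rewrite normc_sqrtE sqr_sqrtr// addr_ge0// sqr_ge0. Qed.

Lemma L2_sqint f : L2 f -> sqint (leb2 R) (fRe f) /\ sqint (leb2 R) (fIm f).
Proof.
move=> [m1 m2 fin].
have H (u : plane R -> R) : measurable_fun setT u -> (forall y, u y ^+ 2 <= Normc.normc (f y) ^+ 2) ->
    sqint (leb2 R) u.
  move=> mu le; split=> //; apply/integrableP; split.
    by apply/measurable_EFinP; exact: measurable_funX.
  apply: le_lt_trans fin; apply: ge0_le_integral_any => y _; first exact: abse_ge0.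
  by rewrite /= lee_fin ger0_norm ?sqr_ge0.
by split; apply: H => // y; rewrite sqr_normc ?lerDl ?lerDr sqr_ge0.
Qed.

Lemma sqint_L2 f : sqint (leb2 R) (fRe f) -> sqint (leb2 R) (fIm f) -> L2 f.
Proof.
move=> [m1 i1] [m2 i2]; split=> //.
have /integrableP[_] := integrableD measurableT i1 i2; apply: le_lt_trans.
apply: ge0_le_integral_any => y _; first by rewrite lee_fin sqr_ge0.
by rewrite lee_fin sqr_normc /= ler_norm.
Qed.

Lemma Re_mul_conj (a b : R[i]) (c : R) : complex.Re (a * conjc (real_complex R c * b)) =
  c * (complex.Re a * complex.Re b + complex.Im a * complex.Im b).
Proof. by case: a => a1 a2; case: b => b1 b2 /=; ring. Qed.

Lemma Im_mul_conj (a b : R[i]) (c : R) : complex.Im (a * conjc (real_complex R c * b)) =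
  c * (complex.Im a * complex.Re b - complex.Re a * complex.Im b).
Proof. by case: a => a1 a2; case: b => b1 b2 /=; ring. Qed.

Definition dt h : R := `|\det h| `^ (- 2^-1).

(** [rov] with [imx] for the inverse, so that it is jointly measurable on all matrices; on
    invertible ones nothing changes. *)
Definition rovm (p f : plane R -> R) (x : plane R) h : R :=
  \int[leb2 R]_y (f y * p (mxact (imx h) (y.1 - x.1, y.2 - x.2))).

Lemma rovmE (p f : plane R -> R) (x : plane R) h : h \in unitmx -> rovm p f x h = rov p f x h.
Proof. by move=> hu; rewrite /rovm imxE. Qed.

Lemma measurable_mxact d (T : measurableType d) (k : T -> borelM R) (x : T -> plane R) :
  measurable_fun setT k -> measurable_fun setT x ->
  measurable_fun setT (fun w => mxact (k w : 'M[R]_2) (x w) : plane R).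
Proof.
move=> mk mx; have me i j : measurable_fun setT (fun w => (k w : 'M[R]_2) i j).
  exact: (measurableT_comp (@measurable_entry R i j) mk).
have m0 := me ord0 ord0; have m1 := me ord0 ord_max; have m2 := me ord_max ord0.
have m3 := me ord_max ord_max.
by rewrite /mxact; mfun.
Qed.

Lemma measurable_rovm (p f : plane R -> R) : measurable_fun setT p -> measurable_fun setT f ->
  measurable_fun setT (fun w : plane R * borelM R => rovm p f w.1 w.2).
Proof.
move=> mp mf.
apply: (@measurable_param_Rintegral _ _ (plane R * borelM R)%type (plane R) R (leb2 R)
  (@sigma_finite_leb2 R)
  (fun w y => f y * p (mxact (imx w.2) (y.1 - w.1.1, y.2 - w.1.2)))).
apply: measurable_funM; first exact: (measurableT_comp mf measurable_snd).
apply: (measurableT_comp mp); apply: measurable_mxact; last by mfun.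
apply: (measurableT_comp (@measurable_imx R)).
exact: (measurableT_comp measurable_snd measurable_fst).
Qed.

Lemma measurable_dt : measurable_fun setT (dt : borelM R -> R).
Proof.
have md := @measurable_det R.
have mn := measurableT_comp (@normr_measurable R setT) md.
have H := measurableT_comp (@measurable_powR R (- 2^-1)) mn.
by rewrite /dt; exact: H.
Qed.

Lemma dt_ge0 h : 0 <= dt h. Proof. exact: powR_ge0. Qed.

Lemma dtM h k : dt (h *m k) = dt h * dt k.
Proof. by rewrite /dt det_mulmx normrM powRM. Qed.

Lemma dt_sqr h : h \in unitmx -> dt h * dt h * `|\det h| = 1.
Proof.
rewrite unitmxE unitfE => d0; have n0 : 0 < `|\det h| by rewrite normr_gt0.
rewrite /dt -powRD; last by rewrite (gt_eqF n0) implybT.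
rewrite (_ : - 2^-1 + - 2^-1 = - 1); last by field.
by rewrite powR_inv1 ?mulVf ?gt_eqF.
Qed.

Lemma dt_gt0 h : h \in unitmx -> 0 < dt h.
Proof. by rewrite unitmxE unitfE => d0; rewrite powR_gt0// normr_gt0. Qed.

Section one_voice.
Variables (p q f1 f2 : plane R -> R).

(** For [p + i q] the window and [f1 + i f2] the function, [vRe], [vIm] and [vN] extend the real
    part, imaginary part and modulus of the voice transform measurably beyond the group. *)
Definition vRe (x : plane R) h : R := dt h * (rovm p f1 x h + rovm q f2 x h).
Definition vIm (x : plane R) h : R := dt h * (rovm p f2 x h - rovm q f1 x h).
Definition vN (x : plane R) h : R := Num.sqrt (vRe x h ^+ 2 + vIm x h ^+ 2).

Lemma vN_ge0 x h : 0 <= vN x h. Proof. exact: sqrtr_ge0. Qed.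

Lemma vRe_le x h : `|vRe x h| <= vN x h.
Proof. by rewrite -sqrtr_sqr ler_wsqrtr// lerDl sqr_ge0. Qed.

Lemma vIm_le x h : `|vIm x h| <= vN x h.
Proof. by rewrite -sqrtr_sqr ler_wsqrtr// lerDr sqr_ge0. Qed.

Hypotheses (mp : measurable_fun setT p) (mq : measurable_fun setT q)
  (mf1 : measurable_fun setT f1) (mf2 : measurable_fun setT f2).

Lemma measurable_vRe : measurable_fun setT (fun w : plane R * borelM R => vRe w.1 w.2).
Proof.
apply: measurable_funM; first exact: (measurableT_comp measurable_dt measurable_snd).
by apply: measurable_funD; exact: measurable_rovm.
Qed.

Lemma measurable_vIm : measurable_fun setT (fun w : plane R * borelM R => vIm w.1 w.2).
Proof.
apply: measurable_funM; first exact: (measurableT_comp measurable_dt measurable_snd).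
by apply: measurable_funB; exact: measurable_rovm.
Qed.

Lemma measurable_vN : measurable_fun setT (fun w : plane R * borelM R => vN w.1 w.2).
Proof. by have m1 := measurable_vRe; have m2 := measurable_vIm; rewrite /vN; mfun. Qed.

Definition vTheta (h : borelM R) : \bar R := (\int[leb2 R]_x (vN x h)%:E)%E.

Lemma vTheta_ge0 h : (0 <= vTheta h)%E.
Proof. by apply: integral_ge0 => x _; rewrite lee_fin vN_ge0. Qed.

Lemma measurable_vTheta : measurable_fun setT vTheta.
Proof.
apply: (@measurable_tonelli_G _ _ _ _ R (leb2 R) (@sigma_finite_leb2 R)
  (fun w : plane R * borelM R => (vN w.1 w.2)%:E)).
  by apply/measurable_EFinP; exact: measurable_vN.
by move=> w; rewrite lee_fin vN_ge0.
Qed.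

End one_voice.

Section voice_formula.
Variables psi f : R * R -> R[i].
Hypotheses (Lpsi : L2 psi) (Lf : L2 f).
Let p := fRe psi.
Let q := fIm psi.
Let f1 := fRe f.
Let f2 := fIm f.

Lemma integrable_rov_lower (a b : plane R -> R) (x : plane R) h : lower_group h ->
  sqint (leb2 R) a -> sqint (leb2 R) b ->
  (leb2 R).-integrable setT (EFin \o (fun y => b y * a (mxact (invmx h) (y - x)))).
Proof.
move=> /lower_groupP[s [c [s0 ->]]] sa sb.
have d0 : s * `|s| != 0 by rewrite mulf_neq0// normr_eq0.
have H := integrable_sqintM sb (sqint_lact_y c s0 d0 x sa).
have E : (fun y : plane R => b y * a (mxact (invmx (low s c)) (y - x))) =
   (fun y => b y * a (lact s c (s * `|s|) y x)).
  by apply/funext => y; rewrite mxact_invmx_lt.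
by rewrite E.
Qed.

Lemma voiceE (x : plane R) h : lower_group h ->
  voice psi (dotL2 f) x h = Complex (vRe p q f1 f2 x h) (vIm p q f1 f2 x h).
Proof.
move=> Hh; have [sp sq'] := L2_sqint Lpsi; have [sf1 sf2] := L2_sqint Lf.
have hu := lower_unit Hh.
have i1 := integrable_rov_lower x Hh sp sf1; have i2 := integrable_rov_lower x Hh sq' sf2.
have i3 := integrable_rov_lower x Hh sp sf2; have i4 := integrable_rov_lower x Hh sq' sf1.
rewrite /voice /dotL2 /vRe /vIm !rovmE//; congr Complex.
  rewrite -(RintegralD measurableT i1 i2) -(RintegralZl _ measurableT (integrableD measurableT i1 i2)).
  by apply: eq_Rintegral => y _; rewrite /quasireg Re_mul_conj.
rewrite -(RintegralB measurableT i3 i4) -(RintegralZl _ measurableT (integrableB measurableT i3 i4)).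
by apply: eq_Rintegral => y _; rewrite /quasireg Im_mul_conj.
Qed.

Lemma normc_voice (x : plane R) h : lower_group h ->
  Normc.normc (voice psi (dotL2 f) x h) = vN p q f1 f2 x h.
Proof. by move=> Hh; rewrite voiceE// normc_sqrtE. Qed.

Lemma L1norm_voice (mu : {measure set (borelM R) -> \bar R}) (w : 'M[R]_2 -> R) :
  (forall h, lower_group h -> 0 <= w h) ->
  L1norm (@lower_group R) mu w (voice psi (dotL2 f)) =
  (\int[mu]_(h in @lower_group R) ((w h / `|\det (h : 'M[R]_2)|)%:E * vTheta p q f1 f2 h))%E.
Proof.
move=> w0; apply: eq_integral => h; rewrite inE => Hh.
have [[mp _] [mq _]] := L2_sqint Lpsi; have [[mf1 _] [mf2 _]] := L2_sqint Lf.
have mv : measurable_fun setT (fun x : plane R => (vN p q f1 f2 x h)%:E).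
  apply/measurable_EFinP.
  exact: (measurableT_comp (measurable_vN mp mq mf1 mf2) (measurable_pair2 (h : borelM R))).
rewrite -(ge0_integralZl_real (leb2 R) measurableT _ (fun x _ => vN_ge0 p q f1 f2 x h) mv); last first.
  by rewrite divr_ge0 ?w0.
apply: eq_integral => x _; rewrite normc_voice//; congr EFin.
by rewrite [RHS]mulrC mulrA.
Qed.

Lemma measurable_voice :
  measurable_fun (setT `*` @lower_group R : set (plane R * borelM R))
    (fun z : plane R * borelM R => complex.Re (voice psi (dotL2 f) z.1 z.2)) /\
  measurable_fun (setT `*` @lower_group R : set (plane R * borelM R))
    (fun z : plane R * borelM R => complex.Im (voice psi (dotL2 f) z.1 z.2)).
Proof.
have [[mp _] [mq _]] := L2_sqint Lpsi; have [[mf1 _] [mf2 _]] := L2_sqint Lf.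
split.
  apply: (@eq_measurable_fun _ _ _ _ _ (fun z : plane R * borelM R => vRe p q f1 f2 z.1 z.2)).
    by move=> z; rewrite inE => -[_ Hz]; rewrite voiceE.
  by apply: measurable_funTS; exact: measurable_vRe.
apply: (@eq_measurable_fun _ _ _ _ _ (fun z : plane R * borelM R => vIm p q f1 f2 z.1 z.2)).
  by move=> z; rewrite inE => -[_ Hz]; rewrite voiceE.
by apply: measurable_funTS; exact: measurable_vIm.
Qed.

End voice_formula.
End voice_parts.

(** * The pairing inequality for complex windows *)

Section complex_pairing.
Variables (R : realType) (t : R) (x0 : plane R).
Hypothesis t0 : 0 < t.
Variables (p q : plane R -> R).
Hypotheses (sp : sqint (leb2 R) p) (sq' : sqint (leb2 R) q).

Definition kapnorm : R := Num.sqrt (kappa t x0 p ^+ 2 + kappa t x0 q ^+ 2).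

(** Half of the density [|det k|^-1] becomes the unitary normalization of the representation, the
    other half remains as [wgt]. *)
Lemma wgt_dt (eta : plane R) : eta.2 != 0 -> (ddet eta)^-1 = wgt eta * dt (Mx eta).
Proof.
move=> e0; rewrite ddetVE// /dt normr_det_Mx ddetE// -powRrM expr2 /wgt.
by congr (_ * _ `^ _); field.
Qed.

(** The real and imaginary parts of a product of two complex numbers, of moduli [2 pi kapnorm] and
    that of the pairing, are each bounded by the right side. Then [|z| <= |Re z| + |Im z|] costs a
    factor 2, hence [pi]. *)
Lemma pairing_le (f1 f2 : plane R -> R) : sqint (leb2 R) f1 -> sqint (leb2 R) f2 ->
  ((pi * kapnorm * Num.sqrt ((\int[leb2 R]_y (f1 y * psiR y)) ^+ 2 +
      (\int[leb2 R]_y (f2 y * psiR y)) ^+ 2))%:E <=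
   \int[leb2 R]_eta \int[leb2 R]_x (wgt eta * `|kern t (kplus x0 eta x) eta| *
      vN p q f1 f2 x (Mx eta))%:E)%E.
Proof.
move=> sf1 sf2.
set X1 := \int[leb2 R]_y (f1 y * psiR y); set X2 := \int[leb2 R]_y (f2 y * psiR y).
set I := (X in (_ <= X)%E).
have sNf1 : sqint (leb2 R) (fun y => -1 * f1 y) by exact: sqintZ.
have H1 := kernel_pairing_le x0 t0 sp sf1 sq' sf2.
have H2 := kernel_pairing_le x0 t0 sp sf2 sq' sNf1.
have ip : (leb2 R).-integrable setT (EFin \o (fun y => f1 y * psiR y)).
  exact: integrable_sqintM sf1 (@sqint_psiR R).
have X1N : \int[leb2 R]_y (-1 * f1 y * psiR y) = - X1.
  rewrite /X1 -[RHS]mulN1r -(RintegralZl _ measurableT ip); apply: eq_Rintegral => y _.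
  by rewrite mulrA.
rewrite X1N in H2; rewrite -/X1 -/X2 in H1 H2.
have bound (g : plane R -> 'M[R]_2 -> R) (c : R) :
   (forall eta x, eta.2 != 0 -> dt (Mx eta) * `|g x (Mx eta)| <= vN p q f1 f2 x (Mx eta)) ->
   (`|c|%:E <= \int[leb2 R]_eta \int[leb2 R]_x ((ddet eta)^-1 *
     (`|kern t (kplus x0 eta x) eta| * `|g x (Mx eta)|))%:E)%E -> (`|c|%:E <= I)%E.
  move=> gN h; apply: (le_trans h); apply: ge0_le_integral_any => eta _.
    apply: integral_ge0 => x _; rewrite lee_fin; apply: mulr_ge0; last exact: mulr_ge0.
    by rewrite invr_ge0; exact: normr_ge0.
  apply: ge0_le_integral_any => x _.
    rewrite lee_fin; apply: mulr_ge0; last exact: mulr_ge0.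
    by rewrite invr_ge0; exact: normr_ge0.
  rewrite lee_fin; have [e0|e0] := eqVneq eta.2 0.
    by rewrite (kern0 _ _ e0) normr0 !(mul0r, mulr0).
  rewrite wgt_dt//; have := gN eta x e0; move: (wgt_gt0 e0).
  move: (wgt eta) (dt _) `|kern _ _ _| `|g _ _| (vN _ _ _ _ _ _) (normr_ge0 (kern t (kplus x0 eta x) eta)).
  move=> w d k u v k0 w0 duv.
  have -> : w * d * (k * u) = w * k * (d * u) by ring.
  by rewrite ler_wpM2l// mulr_ge0// ltW.
have B1 : (`|(pi *+ 2) * kappa t x0 p * X1 + (pi *+ 2) * kappa t x0 q * X2|%:E <= I)%E.
  apply: (bound (fun x h => rov p f1 x h + rov q f2 x h) _ _ H1) => eta x e0.
  have hu := lower_unit (Mx_lower e0).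
  apply: le_trans (vRe_le p q f1 f2 x (Mx eta)).
  by rewrite /vRe !rovmE// (normrM (dt _)) (ger0_norm (dt_ge0 _)).
have B2 : (`|(pi *+ 2) * kappa t x0 p * X2 + (pi *+ 2) * kappa t x0 q * - X1|%:E <= I)%E.
  apply: (bound (fun x h => rov p f2 x h + rov q (fun y => -1 * f1 y) x h) _ _ H2) => eta x e0.
  have hu := lower_unit (Mx_lower e0).
  apply: le_trans (vIm_le p q f1 f2 x (Mx eta)).
  have -> : rov q (fun y => -1 * f1 y) x (Mx eta) = - rov q f1 x (Mx eta).
    have ir := integrable_rov_lower x (Mx_lower e0) sq' sf1.
    rewrite -[RHS]mulN1r /rov -(RintegralZl _ measurableT ir); apply: eq_Rintegral => y _.
    by rewrite mulrA.
  by rewrite /vIm !rovmE// (normrM (dt _)) (ger0_norm (dt_ge0 _)).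
have pi0 : 0 <= (pi : R) by exact: pi_ge0.
(* The identity [(a^2 + b^2) (x^2 + y^2) = (a x + b y)^2 + (a y - b x)^2] recovers the modulus of
   the product from its two parts. *)
have key : pi * kapnorm * Num.sqrt (X1 ^+ 2 + X2 ^+ 2) <=
    2^-1 * (`|(pi *+ 2) * kappa t x0 p * X1 + (pi *+ 2) * kappa t x0 q * X2| +
     `|(pi *+ 2) * kappa t x0 p * X2 + (pi *+ 2) * kappa t x0 q * - X1|).
  rewrite /kapnorm -mulrA -sqrtrM ?addr_ge0 ?sqr_ge0//.
  move: (kappa t x0 p) (kappa t x0 q) X1 X2 {X1N H1 H2 B1 B2 bound I ip} => a b x y.
  have -> : pi *+ 2 * a * x + pi *+ 2 * b * y = 2 * pi * (a * x + b * y) by ring.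
  have -> : pi *+ 2 * a * y + pi *+ 2 * b * - x = 2 * pi * (a * y - b * x) by ring.
  rewrite !normrM (ger0_norm pi0) ger0_norm// -mulrDr mulrA.
  have -> : 2^-1 * (2 * (pi : R)) = pi by field.
  rewrite ler_wpM2l//.
  have -> : (a ^+ 2 + b ^+ 2) * (x ^+ 2 + y ^+ 2) = (a * x + b * y) ^+ 2 + (a * y - b * x) ^+ 2 by ring.
  move: (a * x + b * y) (a * y - b * x) => u v.
  rewrite -[leRHS]ger0_norm ?addr_ge0// -sqrtr_sqr ler_wsqrtr// sqrrD.
  rewrite !real_normK ?num_real// addrAC lerDl mulrn_wge0// mulr_ge0//.
have I0 : (0 <= I)%E by apply: le_trans B1; rewrite lee_fin.
apply: (@le_trans _ _ ((2^-1)%:E * (I + I))%E).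
  apply: (@le_trans _ _ _ _ _ _ (lee_wpmul2l _ (leeD B1 B2))); last by rewrite lee_fin invr_ge0.
  by rewrite -EFinD -EFinM lee_fin.
have half (J : \bar R) : (0 <= J)%E -> ((2^-1)%:E * (J + J) <= J)%E.
  case: J => [r _|_|//]; last by rewrite leey.
  by rewrite -EFinD -EFinM lee_fin -mulr2n -[r *+ 2]mulr_natl mulKf.
exact: half I0.
Qed.

End complex_pairing.

Section window_nonzero.
Variable R : realType.

(** As [t] and [x0] vary, [kappa] runs through multiples of all Gaussian averages of [p], and those
    determine [p]. *)
Lemma kappa_eq0 (p : plane R -> R) : sqint (leb2 R) p ->
  (forall t x0, 0 < t -> kappa t x0 p = 0) -> {ae leb2 R, forall z, p z = 0}.
Proof.
move=> sp k0; apply: ae_eq0_of_gauss => // x r r0; have := k0 r x r0.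
have ig := integrable_sqintM sp (sqint_gs2_shift x r0).
have -> : kappa r x p = r ^- 2 * (pi *+ 2) * \int[leb2 R]_z (p z * gs2 r r (z.1 - x.1, z.2 - x.2)).
  rewrite -(RintegralZl _ measurableT ig); apply: eq_Rintegral => z _; rewrite /gwin_hat.
  have E : forall a b c d : R, a * (b * (c * d)) = b * c * (a * d) by move=> *; ring.
  exact: E.
move/eqP; rewrite mulf_eq0 => /orP[|/eqP//].
by rewrite mulf_eq0 invr_eq0 expf_eq0 (gt_eqF r0) /= mulrn_eq0 /= gt_eqF// pi_gt0.
Qed.

Lemma kapnorm_gt0 (psi : R * R -> R[i]) : L2 psi -> nonzeroL2 psi ->
  exists t x0, 0 < t /\ 0 < kapnorm t x0 (fRe psi) (fIm psi).
Proof.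
move=> Lpsi psiN0; have [sp sq'] := L2_sqint Lpsi; apply: contrapT => /forallNP H.
have Z t x0 : 0 < t -> kapnorm t x0 (fRe psi) (fIm psi) = 0.
  move=> t0; have /forallNP/(_ x0)/not_andP[//|/negP] := H t.
  by rewrite -leNgt => h; apply/eqP; rewrite eq_le h sqrtr_ge0.
have K t x0 : 0 < t -> kappa t x0 (fRe psi) = 0 /\ kappa t x0 (fIm psi) = 0.
  move=> t0; have /eqP := Z t x0 t0; rewrite sqrtr_eq0 => h.
  have a0 := sqr_ge0 (kappa t x0 (fRe psi)); have b0 := sqr_ge0 (kappa t x0 (fIm psi)).
  split; apply/eqP; rewrite -sqrf_eq0 eq_le ?a0 ?b0 andbT;
    by apply: le_trans h; rewrite ?lerDl ?lerDr.
apply: psiN0.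
have zp := kappa_eq0 sp (fun t x0 t0 => proj1 (K t x0 t0)).
have zq := kappa_eq0 sq' (fun t x0 t0 => proj2 (K t x0 t0)).
apply: filterS2 zp zq => z /=; rewrite /fRe /fIm.
by case: (psi z) => a b /= -> ->.
Qed.

End window_nonzero.

(** * Bounds on the control weight *)

Section weights.
Variables (R : realType) (mu : {measure set (borelM R) -> \bar R}) (Delta : 'M[R]_2 -> R).
Hypotheses (haar_mu : left_haar (@lower_group R) mu)
  (mod_Delta : modular_function (@lower_group R) mu Delta).
Let dw := @det_weight R.
Let w := control_weight dw Delta.

Lemma conj_det_weightE : conj_weight (@rot90 R) (@det_weight R) = @det_weight R.
Proof. by apply/funext => h; exact: conj_det_weight. Qed.

Lemma det_weight1 : @det_weight R 1%:M = 1.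
Proof. by rewrite /det_weight det1 normr1 powR1. Qed.

Lemma det_weightM (h k : 'M[R]_2) : det_weight (h *m k) = det_weight h * det_weight k.
Proof. by rewrite /det_weight det_mulmx normrM powRM. Qed.

Lemma det_weight_ge0 (h : 'M[R]_2) : 0 <= det_weight h.
Proof. exact: powR_ge0. Qed.

Lemma ge1_powR (a r : R) : 1 <= a -> 0 <= r -> 1 <= a `^ r.
Proof. by move=> a1 r0; rewrite -[leLHS](powRr0 a) ler_powR. Qed.

Section weight_bounds.
Variable h : 'M[R]_2.
Hypothesis Hh : lower_group h.
Let D := `|\det h|.
Let D0 : 0 < D.
Proof. by have := lower_unit Hh; rewrite unitmxE unitfE normr_gt0. Qed.
Let DV : `|\det (invmx h)| = D^-1. Proof. by rewrite det_inv normfV. Qed.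
Let Dl0 : 0 < Delta h. Proof. by have [] := mod_Delta Hh. Qed.
Let DlV0 : 0 < Delta (invmx h). Proof. by have [] := mod_Delta (lowerV Hh). Qed.

Lemma symmax_dw_ge1 : 1 <= symmax dw h.
Proof.
rewrite /symmax le_max; have [D1|D1] := leP 1 D; first by rewrite ge1_powR// divr_ge0.
apply/orP; right; rewrite /dw /det_weight DV; apply: ge1_powR; last by rewrite divr_ge0.
by rewrite invf_ge1// ltW.
Qed.

Lemma symmax_det_ge1 : 1 <= symmax (fun k => `|\det k|) h.
Proof.
rewrite /symmax le_max DV -/D; have [//|D1] := leP 1 D.
by rewrite /= invf_ge1// ltW.
Qed.

(** The values at [h] and at its inverse have product 1, so one of them is at least 1. *)
Lemma symmax_Delta_ge1 : 1 <= symmax Delta h.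
Proof.
have [n K0] := haar_compact_pos haar_mu.
have M := modularV haar_mu mod_Delta K0 Hh.
rewrite /symmax le_max; have [//|D1] := leP 1 (Delta h); rewrite /= -M.
by rewrite ler_piMl// ltW.
Qed.

Lemma control_weightE : w h = symmax dw h * symmax (fun k => `|\det k|) h * symmax Delta h.
Proof. by rewrite /w /control_weight /dw det_weight1 mul1r. Qed.

Lemma control_weight_ge0 : 0 <= w h.
Proof.
rewrite control_weightE !mulr_ge0//.
- exact: le_trans symmax_dw_ge1.
- exact: le_trans symmax_det_ge1.
- exact: le_trans symmax_Delta_ge1.
Qed.

Lemma det_weight_le_control : det_weight h <= w h.
Proof.
rewrite control_weightE -mulrA -[leLHS]mulr1; apply: ler_pM => //.
- exact: det_weight_ge0.
- by rewrite /symmax le_max lexx.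
- by rewrite -[leLHS]mulr1 ler_pM ?symmax_det_ge1 ?symmax_Delta_ge1.
Qed.

(** After clearing denominators the determinant enters as [D^(3/2)]. For [D >= 1] this is at most
    [D^(7/6) * D], supplied by two factors of the control weight; for [D < 1] it is at most 1. *)
Lemma modular_le_control : Delta (invmx h) * (`|\det h| * dt h) <= w h / `|\det h|.
Proof.
rewrite ler_pdivlMr// control_weightE -/D.
rewrite (_ : Delta (invmx h) * (D * dt h) * D = D * dt h * D * Delta (invmx h)); last by ring.
apply: ler_pM.
- by apply: mulr_ge0 (ltW D0); exact: mulr_ge0 (ltW D0) (dt_ge0 h).
- exact: ltW.
- have -> : D * dt h * D = D `^ (3 / 2).
    rewrite /dt -/D -{1 3}(powRr1 (ltW D0)) -!powRD ?(gt_eqF D0) ?implybT//.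
    by congr (_ `^ _); field.
  have [D1|D1] := leP 1 D.
    apply: (@le_trans _ _ (D `^ (7 / 6) * D)).
      rewrite -{3}(powRr1 (ltW D0)) -powRD ?(gt_eqF D0) ?implybT// ler_powR//.
      by rewrite -subr_ge0 (_ : _ - _ = 2 / 3); [rewrite divr_ge0|field].
    apply: ler_pM; [exact: powR_ge0|exact: ltW|by rewrite /symmax le_max lexx|].
    by rewrite /symmax le_max lexx.
  apply: (@le_trans _ _ 1); last by rewrite -[leLHS]mulr1 ler_pM ?symmax_dw_ge1 ?symmax_det_ge1.
  have := @ge0_ler_powR R (3 / 2) (divr_ge0 _ _) D 1; rewrite powR1; apply => //.
  + by rewrite nnegrE ltW.
  + by rewrite nnegrE.
  + exact: ltW.
- by rewrite /symmax le_max lexx orbT.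
Qed.

End weight_bounds.
End weights.

(** * The witness as a bounded antilinear functional *)

Section antidual.
Variables (R : realType) (mu : {measure set (borelM R) -> \bar R}) (Delta : 'M[R]_2 -> R).
Hypotheses (haar_mu : left_haar (@lower_group R) mu)
  (mod_Delta : modular_function (@lower_group R) mu Delta).
Variable psi0 : R * R -> R[i].
Hypotheses (Lpsi : L2 psi0) (psiN0 : nonzeroL2 psi0).
Let w := control_weight (@det_weight R) Delta.

Definition psiC (y : R * R) : R[i] := real_complex R (psiR (y : plane R)).

Let X (u : plane R -> R) : R := \int[leb2 R]_y (u y * psiR y).

Lemma L2_psiC : L2 psiC.
Proof.
apply: sqint_L2; first exact: (@sqint_psiR R).
have := sqintZ 0 (@sqint_psiR R); rewrite (_ : (fun x => 0 * psiR x) = fIm psiC)//.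
by apply/funext => y; rewrite mul0r.
Qed.

Lemma dotL2_psiC (f : R * R -> R[i]) : L2 f ->
  dotL2 psiC f = Complex (X (fRe f)) (- X (fIm f)).
Proof.
move=> Lf; have [s1 s2] := L2_sqint Lf.
have i2 := integrable_sqintM s2 (@sqint_psiR R).
rewrite /dotL2 /X; congr Complex.
  apply: eq_Rintegral => y _; rewrite /fRe /psiC; case: (f y) => a b /=.
  by rewrite mul0r subr0 mulrC.
rewrite -[RHS]mulN1r -(RintegralZl _ measurableT i2).
apply: eq_Rintegral => y _; rewrite /fIm /psiC; case: (f y) => a b /=.
by rewrite mul0r addr0 mulrN mulN1r mulrC.
Qed.

Lemma L2_lincomb (a : R[i]) (f1 f2 : R * R -> R[i]) : L2 f1 -> L2 f2 ->
  L2 (fun x => a * f1 x + f2 x).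
Proof.
move=> L1 L2'; have [s11 s12] := L2_sqint L1; have [s21 s22] := L2_sqint L2'.
case: a => a1 a2; apply: sqint_L2.
  have := sqintD (sqintD (sqintZ a1 s11) (sqintZ (- a2) s12)) s21.
  congr (sqint _ _); apply/funext => y; rewrite /fRe /fIm.
  by case: (f1 y) => u v; case: (f2 y) => u' v' /=; rewrite mulNr.
have := sqintD (sqintD (sqintZ a1 s12) (sqintZ a2 s11)) s22.
congr (sqint _ _); apply/funext => y; rewrite /fRe /fIm.
by case: (f1 y) => u v; case: (f2 y) => u' v' /=.
Qed.

Lemma dotL2_psiC_antilinear (a : R[i]) (f1 f2 : R * R -> R[i]) : L2 f1 -> L2 f2 ->
  dotL2 psiC (fun x => a * f1 x + f2 x) = conjc a * dotL2 psiC f1 + dotL2 psiC f2.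
Proof.
move=> L1 L2'; rewrite (dotL2_psiC (L2_lincomb a L1 L2')) !dotL2_psiC//.
have [s11 s12] := L2_sqint L1; have [s21 s22] := L2_sqint L2'.
have XD u v : sqint (leb2 R) u -> sqint (leb2 R) v -> X (fun y => u y + v y) = X u + X v.
  move=> su sv; rewrite /X -(RintegralD measurableT (integrable_sqintM su (@sqint_psiR R))
    (integrable_sqintM sv (@sqint_psiR R))).
  by apply: eq_Rintegral => y _; rewrite mulrDl.
have XZ c u : sqint (leb2 R) u -> X (fun y => c * u y) = c * X u.
  move=> su; rewrite /X -(RintegralZl _ measurableT (integrable_sqintM su (@sqint_psiR R))).
  by apply: eq_Rintegral => y _; rewrite mulrA.
case: a => a1 a2.
have -> : fRe (fun x => Complex a1 a2 * f1 x + f2 x) =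
    (fun y => (a1 * fRe f1 y + (- a2) * fIm f1 y) + fRe f2 y).
  apply/funext => y; rewrite /fRe /fIm.
  by case: (f1 y) => u v; case: (f2 y) => u' v' /=; rewrite mulNr.
have -> : fIm (fun x => Complex a1 a2 * f1 x + f2 x) =
    (fun y => (a1 * fIm f1 y + a2 * fRe f1 y) + fIm f2 y).
  apply/funext => y; rewrite /fRe /fIm.
  by case: (f1 y) => u v; case: (f2 y) => u' v' /=.
rewrite !XD ?XZ//; try (by apply: sqintZ); try (by apply: sqintD; exact: sqintZ).
by apply/eqP; rewrite eq_complex /=; apply/andP; split; apply/eqP; ring.
Qed.

Lemma normc_dotL2_psiC (f : R * R -> R[i]) : L2 f ->
  Normc.normc (dotL2 psiC f) = Num.sqrt (X (fRe f) ^+ 2 + X (fIm f) ^+ 2).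
Proof. by move=> Lf; rewrite dotL2_psiC// normc_sqrtE /= sqrrN. Qed.

(** The kernel is estimated by its supremum, with [shearQ^-2 <= 1]; the chart integral is then
    carried to the given Haar measure and [modular_le_control] absorbs the modular factor. *)
Lemma dotL2_psiC_antidual : antidual (@lower_group R) mu w psi0 (dotL2 psiC).
Proof.
split=> [a f1 f2 [L1 _] [L2' _]|]; first exact: dotL2_psiC_antilinear.
have [t [x0 [t0 k0]]] := kapnorm_gt0 Lpsi psiN0.
have [sp sq'] := L2_sqint Lpsi.
have [K K0 HK] := kernel_bounds t0; have [C C0 HC] := haar_chart_le haar_mu mod_Delta.
set c := pi * kapnorm t x0 (fRe psi0) (fIm psi0).
have c0 : 0 < c by rewrite mulr_gt0// pi_gt0.
exists (c^-1 * (K * C)) => f [Lf _]; have [s1 s2] := L2_sqint Lf.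
have [mp _] := sp; have [mq _] := sq'; have [m1 _] := s1; have [m2 _] := s2.
pose Th := vTheta (fRe psi0) (fIm psi0) (fRe f) (fIm f).
have Th0 := vTheta_ge0 (fRe psi0) (fIm psi0) (fRe f) (fIm f).
have mTh : measurable_fun setT Th by exact: measurable_vTheta.
(* The factor [|det k|^(1/2)] is chosen so that [rhw eta * F (Mx eta)] carries exactly the weight
   [wgt eta] of [pairing_le]. *)
pose F (k : borelM R) : \bar R := ((`|\det (k : 'M[R]_2)| * dt k)%:E * Th k)%E.
have mF : measurable_fun setT F.
  apply: emeasurable_funM => //; apply/measurable_EFinP; apply: measurable_funM.
    exact: (measurableT_comp (@normr_measurable R setT) (@measurable_det R)).
  exact: measurable_dt.
have F0 k : (0 <= F k)%E.
  by apply: mule_ge0 => //; rewrite lee_fin mulr_ge0// dt_ge0.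
have P := pairing_le x0 t0 sp sq' s1 s2; rewrite -/(X (fRe f)) -/(X (fIm f)) -/c in P.
rewrite -(normc_dotL2_psiC Lf) in P.
have step1 : (\int[leb2 R]_eta \int[leb2 R]_x (wgt eta * `|kern t (kplus x0 eta x) eta| *
    vN (fRe psi0) (fIm psi0) (fRe f) (fIm f) x (Mx eta))%:E <=
   \int[leb2 R]_eta (K%:E * ((rhw eta)%:E * F (Mx eta))))%E.
  apply: ge0_le_integral_any => eta _.
    apply: integral_ge0 => x _; rewrite lee_fin; apply: mulr_ge0; last exact: vN_ge0.
    by apply: mulr_ge0 => //; exact: powR_ge0.
  have [e0|e0] := eqVneq eta.2 0.
    under eq_integral do rewrite (kern0 _ _ e0) normr0 mulr0 mul0r.
    rewrite integral0; apply: mule_ge0; first by rewrite lee_fin.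
    by apply: mule_ge0; [rewrite lee_fin rhw_ge0|exact: F0].
  have hu := lower_unit (Mx_lower e0); have d0 := dt_gt0 hu.
  have W0 : 0 <= wgt eta by exact: powR_ge0.
  have E1 : K * (rhw eta * (`|\det (Mx eta)| * dt (Mx eta))) = wgt eta * K.
    have D1 := dt_sqr hu; rewrite /rhw wgt_dt//.
    have E : forall k W d D : R, d * d * D = 1 -> k * (W * d * (D * d)) = W * k.
      move=> k W d D H; have -> : k * (W * d * (D * d)) = W * k * (d * d * D) by ring.
      by rewrite H mulr1.
    exact: E.
  rewrite /F !muleA -!EFinM -(mulrA K) E1.
  have mv : measurable_fun setT (fun x : plane R =>
      (vN (fRe psi0) (fIm psi0) (fRe f) (fIm f) x (Mx eta))%:E).
    apply/measurable_EFinP.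
    exact: (measurableT_comp (measurable_vN mp mq m1 m2) (measurable_pair2 (Mx eta : borelM R))).
  rewrite -(ge0_integralZl_real (leb2 R) measurableT _ (fun x _ => vN_ge0 _ _ _ _ x (Mx eta)) mv);
    last exact: mulr_ge0.
  apply: ge0_le_integral_any => x _.
    rewrite lee_fin; apply: mulr_ge0; last exact: vN_ge0.
    exact: mulr_ge0.
  rewrite lee_fin; apply: ler_wpM2r; first exact: vN_ge0.
  apply: ler_wpM2l => //; apply: (le_trans (normr_kern_le _ _ _)).
  have [HK1 _] := HK eta; apply: (le_trans (HK1 _)).
  rewrite -[leRHS]mulr1; apply: ler_wpM2l => //.
  by rewrite invf_le1 ?exprn_ege1 ?exprn_gt0 ?shearQ_ge1// (lt_le_trans ltr01 (shearQ_ge1 eta)).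
have mRF : measurable_fun setT (fun eta : plane R => ((rhw eta)%:E * F (Mx eta))%E).
  apply: emeasurable_funM; first by apply/measurable_EFinP; exact: measurable_rhw.
  exact: (measurableT_comp mF (@measurable_Mx R)).
have RF0 eta : (0 <= (rhw eta)%:E * F (Mx eta))%E.
  by apply: mule_ge0; [rewrite lee_fin rhw_ge0|exact: F0].
rewrite (ge0_integralZl_EFin (leb2 R) measurableT (fun eta _ => RF0 eta) mRF K0) in step1.
have step2 : (\int[mu]_(k in @lower_group R) ((Delta (invmx k))%:E * F k) <= H1norm (@lower_group R) mu w psi0 f)%E.
  rewrite /H1norm L1norm_voice//; last by move=> h Hh; exact: (control_weight_ge0 haar_mu mod_Delta Hh).
  apply: ge0_le_integral_any => k Hk.
    apply: mule_ge0; last exact: F0.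
    by rewrite lee_fin ltW//; have [] := mod_Delta (lowerV Hk).
  rewrite /F muleA -EFinM; apply: lee_wpmul2r; first exact: Th0.
  by rewrite lee_fin; exact: (modular_le_control mod_Delta Hk).
have step3 : ((c * Normc.normc (dotL2 psiC f))%:E <= (K * C)%:E * H1norm (@lower_group R) mu w psi0 f)%E.
  apply: (le_trans P); apply: (le_trans step1); rewrite EFinM -muleA.
  apply: lee_wpmul2l; first by rewrite lee_fin.
  apply: (le_trans (HC F mF F0)); apply: lee_wpmul2l; first by rewrite lee_fin.
  exact: step2.
have -> : Normc.normc (dotL2 psiC f) = c^-1 * (c * Normc.normc (dotL2 psiC f)).
  by rewrite mulKf// gt_eqF.
rewrite EFinM [X in (_ <= X * _)%E]EFinM -muleA; apply: lee_wpmul2l => //.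
by rewrite lee_fin invr_ge0 ltW.
Qed.

End antidual.

(** * Covariance of the voice transform *)

Section covariance.
Variable R : realType.

Lemma Rintegral_lact_y (s b d : R) (x : plane R) (F : plane R -> R) : s != 0 -> d != 0 ->
  (leb2 R).-integrable setT (EFin \o F) ->
  \int[leb2 R]_y F (lact s b d y x) = `|s * d| * \int[leb2 R]_z F z.
Proof.
move=> s0 d0 iF; have s0' : s^-1 != 0 by rewrite invr_eq0.
have d0' : d^-1 != 0 by rewrite invr_eq0.
have my : measurable_fun [set: R] (fun y1 : R => - x.2 / d - b / (s * d) * (y1 - x.1)) by mfun.
rewrite -normrVV -(@Rintegral_skew2 R _ _ (- x.1 / s) _ s0' d0' my F iF).
by apply: eq_Rintegral => y _; rewrite lact_skew_y.
Qed.

(** Substitute [y = k z + x']; the new group element is [(x', k)^-1 (x, h)] and the roles of window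
    and function are exchanged. *)
Lemma rov_covariant (a b : plane R -> R) (x x' : plane R) (h k : 'M[R]_2) :
  lower_group h -> lower_group k -> sqint (leb2 R) a -> sqint (leb2 R) b ->
  rov a (fun y => b (mxact (invmx h) (y - x))) x' k =
  `|\det k| * rov b a (mxact (invmx k) (x - x')) (invmx k *m h).
Proof.
move=> Hh Hk sa sb; have hu := lower_unit Hh; have ku := lower_unit Hk.
have Hl := lowerM (lowerV Hk) Hh; have lu := lower_unit Hl.
pose G (z : plane R) : R := a z * b (mxact (invmx (invmx k *m h)) (z - mxact (invmx k) (x - x'))).
have iG : (leb2 R).-integrable setT (EFin \o G).
  exact: (integrable_rov_lower (mxact (invmx k) (x - x')) Hl sb sa).
have Ek (y : plane R) : b (mxact (invmx h) (y - x)) * a (mxact (invmx k) (y - x')) =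
    G (mxact (invmx k) (y - x')).
  rewrite [RHS]mulrC; congr (b _ * _).
  rewrite -mxactB opprB addrA subrK -mxact_mul; congr (mxact _ _).
  by rewrite -[LHS]mul1mx -(mulVmx lu) -!mulmxA mulmxV// mulmx1.
have rovG : rov b a (mxact (invmx k) (x - x')) (invmx k *m h) = \int[leb2 R]_z G z by [].
rewrite rovG; have [s [c [s0 Ekl]]] := (lower_groupP k).1 Hk.
have d0 : s * `|s| != 0 by rewrite mulf_neq0// normr_eq0.
have nE : `|\det k| = `|s * (s * `|s|)| by rewrite Ekl det_low expr2 mulrA.
rewrite nE -(Rintegral_lact_y c x' s0 d0 iG).
apply: eq_Rintegral => y _; rewrite Ek; congr G.
by rewrite Ekl mxact_invmx_lt.
Qed.

Lemma dtV (k : 'M[R]_2) : k \in unitmx -> dt (invmx k) = dt k * `|\det k|.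
Proof.
move=> ku; have d0 := dt_gt0 ku; apply: (mulfI (lt0r_neq0 d0)); rewrite -dtM mulmxV//.
by rewrite mulrA dt_sqr// /dt det1 normr1 powR1.
Qed.

Lemma rovZ (a b : plane R -> R) (c : R) (x : plane R) (k : 'M[R]_2) :
  lower_group k -> sqint (leb2 R) a -> sqint (leb2 R) b ->
  rov a (fun y => c * b y) x k = c * rov a b x k.
Proof.
move=> Hk sa sb; rewrite /rov -(RintegralZl _ measurableT (integrable_rov_lower x Hk sa sb)).
by apply: eq_Rintegral => y _; rewrite mulrA.
Qed.

Lemma sqint_lower (b : plane R -> R) (x : plane R) (h : 'M[R]_2) : lower_group h ->
  sqint (leb2 R) b -> sqint (leb2 R) (fun y => b (mxact (invmx h) (y - x))).
Proof.
move=> /lower_groupP[s [c [s0 ->]]] sb.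
have d0 : s * `|s| != 0 by rewrite mulf_neq0// normr_eq0.
have H := sqint_lact_y c s0 d0 x sb.
have E : (fun y : plane R => b (mxact (invmx (low s c)) (y - x))) =
   (fun y => b (lact s c (s * `|s|) y x)).
  by apply/funext => y; rewrite mxact_invmx_lt.
by rewrite E.
Qed.

(** By unitarity the overlap of [pi g psi0] with [pi g' psi0] is the complex conjugate of the
    transform of [psi0] at [g'^-1 g]; conjugation flips the imaginary part and keeps the modulus. *)
Lemma vN_covariant (p q : plane R -> R) (x x' : plane R) (h k : 'M[R]_2) :
  lower_group h -> lower_group k -> sqint (leb2 R) p -> sqint (leb2 R) q ->
  vN p q (fun y => dt h * p (mxact (invmx h) (y - x))) (fun y => dt h * q (mxact (invmx h) (y - x))) x' k =
  vN p q p q (mxact (invmx k) (x - x')) (invmx k *m h).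
Proof.
move=> Hh Hk sp sq'; have ku := lower_unit Hk; have lu := lower_unit (lowerM (lowerV Hk) Hh).
have sph := sqint_lower x Hh sp; have sqh := sqint_lower x Hh sq'.
have dl : dt (invmx k *m h) = dt k * `|\det k| * dt h by rewrite dtM dtV.
have Re : vRe p q (fun y => dt h * p (mxact (invmx h) (y - x))) (fun y => dt h * q (mxact (invmx h) (y - x))) x' k =
    vRe p q p q (mxact (invmx k) (x - x')) (invmx k *m h).
  rewrite /vRe !rovmE// !rovZ// !rov_covariant// dl.
  have E : forall a b c u v : R, a * (c * (b * u) + c * (b * v)) = a * b * c * (u + v).
    by move=> *; ring.
  exact: E.
have Im : vIm p q (fun y => dt h * p (mxact (invmx h) (y - x))) (fun y => dt h * q (mxact (invmx h) (y - x))) x' k =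
    - vIm p q p q (mxact (invmx k) (x - x')) (invmx k *m h).
  rewrite /vIm !rovmE// !rovZ// !rov_covariant// dl.
  have E : forall a b c u v : R, a * (c * (b * u) - c * (b * v)) = - (a * b * c * (v - u)).
    by move=> *; ring.
  exact: E.
by rewrite /vN Re Im sqrrN.
Qed.

End covariance.

(** * Integrability over the conjugate group *)

Section voice_integrable.
Variables (R : realType) (mu : {measure set (borelM R) -> \bar R}) (Delta : 'M[R]_2 -> R).
Hypotheses (haar_mu : left_haar (@lower_group R) mu)
  (mod_Delta : modular_function (@lower_group R) mu Delta).
Variable psi0 : R * R -> R[i].
Hypotheses (Lpsi : L2 psi0) (psiN0 : nonzeroL2 psi0).
Let w := control_weight (@det_weight R) Delta.
Hypothesis psi0fin : (L1norm (@lower_group R) mu w (voice psi0 (dotL2 psi0)) < +oo)%E.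
Let H := @lower_group R.
Let p := fRe psi0.
Let q := fIm psi0.
Let sp : sqint (leb2 R) p. Proof. by have [] := L2_sqint Lpsi. Qed.
Let sq' : sqint (leb2 R) q. Proof. by have [] := L2_sqint Lpsi. Qed.
Let mp : measurable_fun setT p. Proof. by have [] := sp. Qed.
Let mq : measurable_fun setT q. Proof. by have [] := sq'. Qed.

(** The weight together with the density of the Haar measure of the semidirect product. It is
    multiplicative, which makes a convolution estimate possible. *)
Definition detq (h : borelM R) : R := det_weight (h : 'M[R]_2) / `|\det (h : 'M[R]_2)|.

Lemma detq_ge0 h : 0 <= detq h.
Proof. by rewrite divr_ge0// det_weight_ge0. Qed.

Lemma detqM (h k : 'M[R]_2) : detq (h *m k : borelM R) = detq h * detq k.
Proof. by rewrite /detq det_weightM det_mulmx normrM invfM mulrACA. Qed.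

Lemma measurable_detq : measurable_fun setT detq.
Proof.
have mn := measurableT_comp (@normr_measurable R setT) (@measurable_det R).
have H1 := measurableT_comp (@measurable_powR R (7 / 6)) mn.
by apply: measurable_funM; [exact: H1|exact: measurable_fun_inv].
Qed.

Let Th := vTheta p q p q.
Let mTh : measurable_fun setT Th. Proof. exact: measurable_vTheta. Qed.
Let Th0 h : (0 <= Th h)%E. Proof. exact: vTheta_ge0. Qed.

Let B := (\int[mu]_(h in H) ((detq h)%:E * Th h))%E.
Let Bfin : (B < +oo)%E.
Proof.
apply: le_lt_trans psi0fin.
rewrite L1norm_voice//; last by move=> h Hh; exact: (control_weight_ge0 haar_mu mod_Delta Hh).
apply: ge0_le_integral_any => h Hh; first by rewrite mule_ge0// lee_fin detq_ge0.
apply: lee_wpmul2r; first exact: Th0.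
rewrite lee_fin ler_wpM2r ?invr_ge0//; exact: (det_weight_le_control haar_mu mod_Delta Hh).
Qed.

Section window.
Variables (t K : R) (x0 : plane R).
Hypotheses (t0 : 0 < t) (k0 : 0 < kapnorm t x0 p q) (K0 : 0 <= K).
Hypothesis HK : forall eta : plane R,
  (forall x : plane R, `|shkernel t x eta| <= K * shearQ eta ^- 2) /\
  (\int[leb2 R]_x `|shkernel t x eta|%:E <= (K * shearQ eta ^- 2)%:E)%E.
Let c := pi * kapnorm t x0 p q.
Let c0 : 0 < c. Proof. by rewrite mulr_gt0// pi_gt0. Qed.

Let z0 : plane R -> R := fIm (@psiC R).
Let mz0 : measurable_fun setT z0.
Proof. by have [] := (L2_sqint (@L2_psiC R)).2. Qed.

Definition vW (h : borelM R) : \bar R := vTheta p q (@psiR R) z0 h.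

Let G (h : 'M[R]_2) (v : plane R * plane R * plane R) : \bar R :=
  (wgt v.1.2 * `|kern t (kplus x0 v.1.2 v.2) v.1.2| *
    vN p q p q (mxact (imx (Mx v.1.2)) (v.1.1.1 - v.2.1, v.1.1.2 - v.2.2))
      (imx (Mx v.1.2) *m h))%:E.

Let G0 h v : (0 <= G h v)%E.
Proof.
rewrite lee_fin; apply: mulr_ge0; last exact: vN_ge0.
by apply: mulr_ge0; [exact: powR_ge0|exact: normr_ge0].
Qed.

Let m112 : measurable_fun setT (fun v : plane R * plane R * plane R => v.1.2).
Proof. exact: (measurableT_comp measurable_snd measurable_fst). Qed.

Let mG h : measurable_fun setT (G h).
Proof.
apply/measurable_EFinP; apply: measurable_funM.
  apply: measurable_funM.
    have mw : measurable_fun setT (@wgt R) by rewrite /wgt; mfun.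
    exact: (measurableT_comp mw m112).
  apply: (measurableT_comp (@normr_measurable R setT)); apply: measurable_kern; last exact: m112.
  by apply: measurable_kplus; [exact: m112|exact: measurable_snd].
have mi : measurable_fun setT (fun v : plane R * plane R * plane R => imx (Mx v.1.2) : borelM R).
  exact: (measurableT_comp (@measurable_imx R) (measurableT_comp (@measurable_Mx R) m112)).
have mv := measurable_vN mp mq mp mq.
have m2 : measurable_fun setT (fun v : plane R * plane R * plane R =>
    (mxact (imx (Mx v.1.2)) (v.1.1.1 - v.2.1, v.1.1.2 - v.2.2) : plane R,
      imx (Mx v.1.2) *m h : borelM R)).
  apply: measurable_fun_pair.
    apply: measurable_mxact => //; mfun.
  exact: (measurableT_comp (measurable_mulmxr h) mi).
exact: (measurableT_comp mv m2).
Qed.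

(** The convolver: [vW h] is bounded by the integral of [convw eta] times the norm profile [Th] of
    the transform of [psi0] at [Mx eta ^-1 h]. *)
Definition convw (eta : plane R) : R := c^-1 * (wgt eta * ddet eta * (K * shearQ eta ^- 2)).

Lemma convwE eta : (c%:E * (convw eta)%:E = (wgt eta * ddet eta)%:E * (K * shearQ eta ^- 2)%:E)%E.
Proof. by rewrite -!EFinM /convw mulVKf// gt_eqF. Qed.

(** The weight contributes [|eta2|^(7/4)] and [wgt] contributes [|eta2|^(-3/4)]. The resulting power
    1 is within the range where the kernel profile is integrable. *)
Lemma detq_convw (eta : plane R) : eta.2 != 0 ->
  detq (Mx eta) * convw eta = c^-1 * K * (`|eta.2| * shearQ eta ^- 2).
Proof.
move=> e0; have n0 : 0 < `|eta.2| by rewrite normr_gt0.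
have E1 : ddet eta `^ (7 / 6) * wgt eta = `|eta.2|.
  rewrite ddetE// -powRrM /wgt -powRD; last by rewrite (gt_eqF n0) implybT.
  by rewrite (_ : _ + _ = 1) ?powRr1 ?(ltW n0)//; field.
have D0 := lt0r_neq0 (ddet_gt0 e0).
rewrite /convw /detq /det_weight normr_det_Mx.
have E : forall v d c' W k Q e : R, d != 0 -> v * W = e ->
    v / d * (c' * (W * d * (k * Q))) = c' * k * (e * Q).
  by move=> v d c' W k Q e d0 <-; field.
exact: E D0 E1.
Qed.

Lemma convw_ge0 eta : 0 <= convw eta.
Proof.
apply: mulr_ge0; first by rewrite invr_ge0 ltW.
apply: mulr_ge0; last by apply: mulr_ge0 => //; rewrite invr_ge0; exact: sqr_ge0.
by apply: mulr_ge0; [exact: powR_ge0|exact: normr_ge0].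
Qed.

Lemma measurable_convw : measurable_fun setT convw.
Proof.
have mw : measurable_fun setT (@wgt R) by rewrite /wgt; mfun.
have md : measurable_fun setT (@ddet R).
  have ms : measurable_fun setT (fun eta : plane R => sq eta.2).
    exact: (measurableT_comp (@measurable_sq R) measurable_snd).
  by rewrite /ddet; mfun.
have mQ : measurable_fun setT (fun e : plane R => shearQ e ^- 2) by rewrite /shearQ; mfun.
apply: measurable_funM; first exact: measurable_cst.
by apply: measurable_funM; [exact: measurable_funM|apply: measurable_funM].
Qed.

Lemma int_kern_kplus eta :
  (\int[leb2 R]_x `|kern t (kplus x0 eta x) eta|%:E <= (K * shearQ eta ^- 2)%:E)%E.
Proof.
set k := kact eta x0.
have m0 : measurable_fun [set: R] (fun _ : R => k.1) by [].
have := @ge0_integral_skew1 R 1 1 k.2 _ (oner_neq0 _) (oner_neq0 _) m0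
  (fun x => `|kern t x eta|%:E) (measurable_kernE t eta) (fun x => normr_ge0 _).
rewrite mulr1 normr1 invr1 mul1e => E; apply: le_trans (int_kern_le HK eta); rewrite -E.
apply: ge0_le_integral_any => y _; first by rewrite lee_fin.
by rewrite lee_fin /kplus /skew1 !mul1r.
Qed.

(** The modulus of the transform of the witness at [(x, h)] is that of its pairing with
    [pi (x, h) psi0]; [pairing_le] applies to this function, and covariance rewrites the
    integrand. *)
Lemma voice_psiC_le (h : 'M[R]_2) (x : plane R) : lower_group h ->
  ((c * vN p q (@psiR R) z0 x h)%:E <=
    \int[leb2 R]_eta \int[leb2 R]_x' G h (x, eta, x'))%E.
Proof.
move=> Hh; have sph := sqintZ (dt h) (sqint_lower x Hh sp).
have sqh := sqintZ (dt h) (sqint_lower x Hh sq').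
have P := pairing_le x0 t0 sp sq' sph sqh; rewrite -/c in P.
have Lq : L2 (quasireg x h psi0).
  apply: sqint_L2.
    have E : fRe (quasireg x h psi0) = (fun y => dt h * p (mxact (invmx h) (y - x))).
      apply/funext => y; rewrite /fRe /quasireg /p /fRe -/(dt h).
      by case: (psi0 _) => a b /=; rewrite mul0r subr0.
    by rewrite E.
  have E : fIm (quasireg x h psi0) = (fun y => dt h * q (mxact (invmx h) (y - x))).
    apply/funext => y; rewrite /fIm /quasireg /q /fIm -/(dt h).
    by case: (psi0 _) => a b /=; rewrite mul0r addr0.
  by rewrite E.
have NE : vN p q (@psiR R) z0 x h = Num.sqrt
    ((\int[leb2 R]_y (dt h * p (mxact (invmx h) (y - x)) * psiR y)) ^+ 2 +
     (\int[leb2 R]_y (dt h * q (mxact (invmx h) (y - x)) * psiR y)) ^+ 2).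
  have <- := normc_voice Lpsi (@L2_psiC R) x Hh.
  rewrite /voice (normc_dotL2_psiC Lq); congr (Num.sqrt (_ ^+ 2 + _ ^+ 2)).
    apply: eq_Rintegral => y _; congr (_ * _); rewrite /fRe /quasireg /p /fRe -/(dt h).
    by case: (psi0 _) => a b /=; rewrite mul0r subr0.
  apply: eq_Rintegral => y _; congr (_ * _); rewrite /fIm /quasireg /q /fIm -/(dt h).
  by case: (psi0 _) => a b /=; rewrite mul0r addr0.
rewrite NE; apply: (le_trans P); apply: ge0_le_integral_any => eta _.
  apply: integral_ge0 => x' _; rewrite lee_fin; apply: mulr_ge0; last exact: vN_ge0.
  by apply: mulr_ge0 => //; exact: powR_ge0.
apply: ge0_le_integral_any => x' _.
  rewrite lee_fin; apply: mulr_ge0; last exact: vN_ge0.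
  by apply: mulr_ge0 => //; exact: powR_ge0.
rewrite /G lee_fin; have [e0|e0] := eqVneq eta.2 0.
  by rewrite (kern0 _ _ e0) normr0 !(mul0r, mulr0).
by rewrite vN_covariant ?(imxE (lower_unit (Mx_lower e0)))//; exact: Mx_lower.
Qed.

(** Integrates the previous bound over [x], which is moved innermost: only the transform of [psi0]
    depends on it, and the kernel is left for the integral over [x']. *)
Lemma vW_le (h : 'M[R]_2) : lower_group h ->
  (vW h <= \int[leb2 R]_eta ((convw eta)%:E * Th (imx (Mx eta) *m h : borelM R)))%E.
Proof.
move=> Hh; have s2 := @sigma_finite_leb2 R.
have ms2 := sigma_finite_product s2 s2.
have mvx : measurable_fun setT (fun x : plane R => (vN p q (@psiR R) z0 x h)%:E).
  apply/measurable_EFinP.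
  exact: (measurableT_comp (measurable_vN mp mq (@measurable_psiR R) mz0) (measurable_pair2 (h : borelM R))).
have S1 : (c%:E * vW h <= \int[leb2 R]_x \int[leb2 R]_eta \int[leb2 R]_x' G h (x, eta, x'))%E.
  rewrite -(ge0_integralZl_real (leb2 R) measurableT (ltW c0) (fun x _ => vN_ge0 p q _ z0 x h) mvx).
  apply: ge0_le_integral_any => x _; last exact: voice_psiC_le.
  by rewrite lee_fin; apply: mulr_ge0 (ltW c0) (vN_ge0 _ _ _ _ _ _).
pose F (v : plane R * plane R) : \bar R := (\int[leb2 R]_x' G h (v, x'))%E.
have mF : measurable_fun setT F by exact: (measurable_tonelli_F s2 (mG h) (G0 h)).
have F0 v : (0 <= F v)%E by apply: integral_ge0 => x' _; exact: G0.
have S2 := @sigma_finite_tonelli _ _ _ _ R (leb2 R) (leb2 R) s2 s2 F mF F0.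
have S3 eta : (\int[leb2 R]_x F (x, eta) <= c%:E * ((convw eta)%:E * Th (imx (Mx eta) *m h : borelM R)))%E.
  have [e0|e0] := eqVneq eta.2 0.
    rewrite /F; under eq_integral => x _ do (under eq_integral do
      rewrite /G /= (kern0 _ _ e0) normr0 mulr0 mul0r; rewrite integral0).
    rewrite integral0; apply: mule_ge0; first by rewrite lee_fin ltW.
    by apply: mule_ge0; [rewrite lee_fin convw_ge0|exact: Th0].
  have mGe : measurable_fun setT (fun u : plane R * plane R => G h (u.1, eta, u.2)).
    apply: (measurableT_comp (mG h)); apply: measurable_fun_pair; last exact: measurable_snd.
    by apply: measurable_fun_pair; [exact: measurable_fst|exact: measurable_cst].
  have S4 := @sigma_finite_tonelli _ _ _ _ R (leb2 R) (leb2 R) s2 s2 _ mGe (fun u => G0 h _).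
  rewrite /F S4.
  have s0 := sq_neq0 e0; have HMx := Mx_lower e0.
  set l := imx (Mx eta) *m h.
  have ml : measurable_fun setT (fun z : plane R => (vN p q p q z l)%:E).
    apply/measurable_EFinP.
    exact: (measurableT_comp (measurable_vN mp mq mp mq) (measurable_pair2 (l : borelM R))).
  have AE (x x' : plane R) : mxact (imx (Mx eta)) (x.1 - x'.1, x.2 - x'.2) =
      lact (sq eta.2) eta.1 eta.2 x x'.
    by rewrite (imxE (lower_unit HMx)); exact: (mxact_invmx_lt eta.1 x x' s0 e0).
  (* The substitution [z = k^-1 (x - x')] in [x] has Jacobian [|det k|] and removes all dependence
     on [x'] from the transform. *)
  have S5 x' : (\int[leb2 R]_x G h (x, eta, x') =
      (wgt eta * ddet eta * `|kern t (kplus x0 eta x') eta|)%:E * Th l)%E.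
    have L := @ge0_integral_lact_y R (sq eta.2) eta.1 eta.2 s0 e0 x' _ ml (fun z => vN_ge0 p q p q z l).
    rewrite -/(ddet eta) in L.
    have mL : measurable_fun setT (fun x : plane R => (vN p q p q (lact (sq eta.2) eta.1 eta.2 x x') l)%:E).
      apply: (measurableT_comp ml).
      by apply: measurable_lact; [exact: measurable_cst|exact: measurable_cst|exact: measurable_cst|exact: measurable_id|exact: measurable_cst].
    rewrite (mulrAC (wgt eta)) EFinM -muleA -L.
    rewrite -(ge0_integralZl_real (leb2 R) measurableT _ (fun x _ => vN_ge0 _ _ _ _ _ _) mL); last first.
      by apply: mulr_ge0; [exact: powR_ge0|exact: normr_ge0].
    apply: eq_integral => x _; rewrite -AE; exact: erefl.
  rewrite (eq_integral (fun x' => (wgt eta * ddet eta * `|kern t (kplus x0 eta x') eta|)%:E * Th l)%E); last first.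
    by move=> x' _; exact: S5.
  have mkR : measurable_fun setT (fun x' : plane R => `|kern t (kplus x0 eta x') eta|).
    apply: (measurableT_comp (@normr_measurable R setT)).
    apply: measurable_kern; last exact: measurable_cst.
    by apply: measurable_kplus; [exact: measurable_cst|exact: measurable_id].
  have mk : measurable_fun setT (fun x' : plane R => `|kern t (kplus x0 eta x') eta|%:E).
    by apply/measurable_EFinP; exact: mkR.
  have W0 : 0 <= wgt eta * ddet eta by apply: mulr_ge0; [exact: powR_ge0|exact: normr_ge0].
  have mk' : measurable_fun setT (fun x' : plane R => (wgt eta * ddet eta * `|kern t (kplus x0 eta x') eta|)%:E).
    apply/measurable_EFinP.
    exact: (measurable_funM (measurable_cst (wgt eta * ddet eta)) mkR).
  rewrite (ge0_integralZr (leb2 R) measurableT mk'); last 2 first.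
  - by move=> x' _; rewrite lee_fin; apply: mulr_ge0.
  - exact: Th0.
  rewrite muleA; apply: lee_wpmul2r; first exact: Th0.
  rewrite (ge0_integralZl_real (leb2 R) measurableT W0 (fun x' _ => normr_ge0 _) mk).
  rewrite convwE.
  by apply: lee_wpmul2l; [rewrite lee_fin|exact: int_kern_kplus].
have mC : measurable_fun setT (fun eta : plane R => ((convw eta)%:E * Th (imx (Mx eta) *m h : borelM R))%E).
  apply: emeasurable_funM; first by apply/measurable_EFinP; exact: measurable_convw.
  apply: (measurableT_comp mTh); apply: (measurableT_comp (measurable_mulmxr h)).
  exact: (measurableT_comp (@measurable_imx R) (@measurable_Mx R)).
have C0 eta : (0 <= (convw eta)%:E * Th (imx (Mx eta) *m h : borelM R))%E.
  by apply: mule_ge0; [rewrite lee_fin convw_ge0|exact: Th0].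
have S6 : (c%:E * vW h <= c%:E * \int[leb2 R]_eta ((convw eta)%:E * Th (imx (Mx eta) *m h : borelM R)))%E.
  apply: (le_trans S1); rewrite S2 -(ge0_integralZl_EFin (leb2 R) measurableT (fun eta _ => C0 eta) mC (ltW c0)).
  by apply: ge0_le_integral_any => eta _; [apply: integral_ge0 => x _; exact: F0|exact: S3].
by move: S6; rewrite lee_pmul2l// lte_fin.
Qed.

(** Young's inequality on the group: after Tonelli, the left translation [h |-> Mx eta h] splits
    [detq] into a factor in [eta] and one in [h], so the bound is a product of two finite
    integrals. *)
Lemma int_vW_lty : (\int[mu]_(h in H) ((detq h)%:E * vW h) < +oo)%E.
Proof.
have sfmu := haar_lower_sigma_finite haar_mu; have s2 := @sigma_finite_leb2 R.
pose J (v : borelM R * plane R) : \bar R :=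
  ((detq v.1 * convw v.2)%:E * Th ((imx (Mx v.2) : 'M[R]_2) *m (v.1 : 'M[R]_2) : borelM R))%E.
have J0 v : (0 <= J v)%E.
  by apply: mule_ge0; [rewrite lee_fin; apply: mulr_ge0 (detq_ge0 _) (convw_ge0 _)|exact: Th0].
have mJ : measurable_fun setT J.
  apply: emeasurable_funM.
    apply/measurable_EFinP; apply: measurable_funM.
      exact: (measurableT_comp measurable_detq measurable_fst).
    exact: (measurableT_comp measurable_convw measurable_snd).
  apply: (measurableT_comp mTh); apply: measurable_mulmx2; last exact: measurable_fst.
  apply: (measurableT_comp (@measurable_imx R)).
  exact: (measurableT_comp (@measurable_Mx R) measurable_snd).
have mC (h : 'M[R]_2) : measurable_fun setT (fun eta : plane R => ((convw eta)%:E * Th (imx (Mx eta) *m h : borelM R))%E).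
  apply: emeasurable_funM; first by apply/measurable_EFinP; exact: measurable_convw.
  apply: (measurableT_comp mTh); apply: (measurableT_comp (measurable_mulmxr h)).
  exact: (measurableT_comp (@measurable_imx R) (@measurable_Mx R)).
have C0 h eta : (0 <= (convw eta)%:E * Th (imx (Mx eta) *m h : borelM R))%E.
  by apply: mule_ge0; [rewrite lee_fin convw_ge0|exact: Th0].
have S1 : (\int[mu]_(h in H) ((detq h)%:E * vW h) <= \int[mu]_(h in H) \int[leb2 R]_eta J (h, eta))%E.
  apply: ge0_le_integral_any => h Hh.
    by apply: mule_ge0; [rewrite lee_fin detq_ge0|exact: vTheta_ge0].
  have h1 := lee_wpmul2l (_ : (0 <= (detq h)%:E)%E) (vW_le Hh).
  have d0 : (0 <= (detq h)%:E)%E by rewrite lee_fin detq_ge0.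
  apply: (le_trans (h1 d0)).
  rewrite -(ge0_integralZl_EFin (leb2 R) measurableT (fun eta _ => C0 h eta) (mC h) (detq_ge0 h)).
  apply: ge0_le_integral_any => eta _; first exact: mule_ge0.
  by rewrite /J muleA -EFinM.
apply: (le_lt_trans S1).
have mJF := measurable_tonelli_F s2 mJ J0.
have J0F h : (0 <= \int[leb2 R]_eta J (h, eta))%E by apply: integral_ge0 => eta _; exact: J0.
rewrite (haar_lower_setT haar_mu mJF J0F).
rewrite (@sigma_finite_tonelli _ _ _ _ R mu (leb2 R) sfmu s2 J mJ J0).
pose q1 (eta : plane R) : R := c^-1 * K * (`|eta.2| * shearQ eta ^- 2).
have S2 eta : (\int[mu]_h J (h, eta) <= (q1 eta)%:E * B)%E.
  have [e0|e0] := eqVneq eta.2 0.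
    have cw0 : convw eta = 0 by rewrite /convw /ddet e0 mulr0 normr0 mulr0 mul0r mulr0.
    under eq_integral do rewrite /J /= cw0 mulr0 mul0e.
    rewrite integral0; apply: mule_ge0; last by apply: integral_ge0 => h _; rewrite mule_ge0// lee_fin detq_ge0.
    rewrite lee_fin; apply: mulr_ge0; first by apply: mulr_ge0 => //; rewrite invr_ge0 ltW.
    by apply: mulr_ge0 => //; rewrite invr_ge0; exact: sqr_ge0.
  have HMx := Mx_lower e0; have Mu := lower_unit HMx.
  have mJe : measurable_fun setT (fun h : borelM R => J (h, eta)).
    exact: (measurableT_comp mJ (measurable_pair2 eta)).
  rewrite -(haar_lower_setT haar_mu mJe (fun h => J0 (h, eta))).
  pose f (h : 'M[R]_2) : \bar R := J (h, eta).
  have LI := haar_left_integral (@measurable_lower R) (@lower_unit R) (@lowerM R) (@lowerV R) haar_mu HMx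
    (measurable_funTS mJe : measurable_fun (H : set (borelM R)) (f : borelM R -> \bar R)) (fun h _ => J0 (h, eta)).
  rewrite -LI.
  have mDT : measurable_fun setT (fun h : borelM R => ((detq h)%:E * Th h)%E).
    apply: emeasurable_funM; last exact: mTh.
    by apply/measurable_EFinP; exact: measurable_detq.
  have gen (a b e : R) (T : \bar R) : ((a * b * e)%:E * T = (a * e)%:E * (b%:E * T))%E.
    by rewrite muleA -EFinM mulrAC.
  have JE (h : 'M[R]_2) : f (Mx eta *m h) = ((detq (Mx eta) * convw eta)%:E * ((detq h)%:E * Th h))%E.
    have A1 : imx (Mx eta) *m (Mx eta *m h) = h by rewrite (imxE Mu) mulmxA (mulVmx Mu) mul1mx.
    have JJ : f (Mx eta *m h) = ((detq (Mx eta *m h : borelM R) * convw eta)%:E *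
      Th (imx (Mx eta) *m (Mx eta *m h) : borelM R))%E by [].
    apply: (etrans JJ).
    rewrite A1.
    rewrite detqM.
    exact: gen.
  rewrite (eq_integral (fun h : borelM R => (detq (Mx eta) * convw eta)%:E * ((detq h)%:E * Th h))%E); last first.
    by move=> h _; exact: JE.
  have q10 : 0 <= detq (Mx eta) * convw eta by apply: mulr_ge0 (detq_ge0 _) (convw_ge0 _).
  rewrite (ge0_integralZl_EFin mu (@measurable_lower R) (fun h _ => mule_ge0 _ (Th0 h)) (measurable_funTS mDT) q10).
    by rewrite (detq_convw e0).
  by move=> h' _; rewrite lee_fin; exact: detq_ge0.
have q10 eta : 0 <= q1 eta.
  apply: mulr_ge0; first by apply: mulr_ge0 => //; rewrite invr_ge0 ltW.
  by apply: mulr_ge0 => //; rewrite invr_ge0; exact: sqr_ge0.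
have mq1 : measurable_fun setT (fun eta => (q1 eta)%:E).
  by apply/measurable_EFinP; rewrite /q1 /shearQ; mfun.
have B0 : (0 <= B)%E by apply: integral_ge0 => h _; rewrite mule_ge0// lee_fin detq_ge0.
apply: (@le_lt_trans _ _ (\int[leb2 R]_eta ((q1 eta)%:E * B))%E).
  by apply: ge0_le_integral_any => eta _; [apply: integral_ge0 => h _; exact: J0|exact: S2].
rewrite (ge0_integralZr (leb2 R) measurableT mq1 (fun eta _ => _) B0); last first.
  by move=> e _; rewrite lee_fin; exact: q10.
rewrite muleC; apply: lte_mul_pinfty => //; first by rewrite ge0_fin_numE.
have mS : measurable_fun setT (fun e : plane R => (`|e.2| * shearQ e ^- 2)%:E).
  by apply/measurable_EFinP; rewrite /shearQ; mfun.
have cK0 : 0 <= c^-1 * K by apply: mulr_ge0 => //; rewrite invr_ge0 ltW.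
rewrite (ge0_integralZl_real (leb2 R) measurableT cK0 (fun e _ => mulr_ge0 (normr_ge0 _) _) mS); last first.
  by move=> e _; rewrite invr_ge0; exact: sqr_ge0.
by apply: lte_mul_pinfty; [rewrite lee_fin|by []|exact: shearQ_integral1_lty].
Qed.

End window.

Lemma voice_psiC_L1 : L1 (@lower_group R) mu (@det_weight R) (voice psi0 (dotL2 (@psiC R))).
Proof.
have [m1 m2] := measurable_voice Lpsi (@L2_psiC R); split; [exact: m1|exact: m2|].
have [t [x0 [t0 k0]]] := kapnorm_gt0 Lpsi psiN0.
have [K K0 HK] := kernel_bounds t0.
rewrite (L1norm_voice Lpsi (@L2_psiC R) mu (fun h _ => det_weight_ge0 h)).
exact: (int_vW_lty t0 k0 K0 HK).
Qed.

End voice_integrable.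

(** * Failure of integrability over the shearlet group *)

Section not_in_coorbit.
Variable R : realType.

Lemma sqint_shearlet (b : plane R -> R) (x : R * R) (h : 'M[R]_2) : shearlet_group h ->
  sqint (leb2 R) b -> sqint (leb2 R) (fun y => b (mxact (invmx h) (y - x))).
Proof.
move=> /shearletP[s [c [s0 ->]]] [mb ib].
have a0 : (s * `|s|)^-1 != 0 by rewrite invr_eq0 mulf_neq0// normr_eq0.
have d0 : s^-1 != 0 by rewrite invr_eq0.
have mc : measurable_fun [set: R] (fun y2 : R => - c / (s ^+ 2 * `|s|) * (y2 - x.2) - (s * `|s|)^-1 * x.1).
  by mfun.
have AE : (fun y : plane R => mxact (invmx (shr s c)) (y - x)) = skew1 (s * `|s|)^-1 s^-1 (- (s^-1 * x.2))
    (fun y2 : R => - c / (s ^+ 2 * `|s|) * (y2 - x.2) - (s * `|s|)^-1 * x.1).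
  apply/funext => y; rewrite mxact_invmx_shr// /skew1; congr pair; rewrite /=.
    have E : forall a1 b1 u v u' v' : R, a1 * (u - u') + b1 * (v - v') = a1 * u + (b1 * (v - v') - a1 * u').
      by move=> *; ring.
    exact: E.
  by rewrite mulrBr.
have E1 : (fun y : plane R => b (mxact (invmx (shr s c)) (y - x))) = b \o
    (fun y : plane R => mxact (invmx (shr s c)) (y - x)) by [].
rewrite E1 AE; split.
  exact: (measurableT_comp mb (measurable_skew1 _ _ _ mc)).
exact: (@integrable_skew1 R _ _ (- (s^-1 * x.2)) _ a0 d0 mc (fun z => b z ^+ 2) ib).
Qed.

Lemma voice_psiC_shearlet (psi0 : R * R -> R[i]) (x : R * R) (h : 'M[R]_2) : L2 psi0 ->
  shearlet_group h -> voice psi0 (dotL2 (@psiC R)) x h =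
  Complex (psi_voice (fRe psi0) x h) (- psi_voice (fIm psi0) x h).
Proof.
move=> Lpsi Hh; have [sp sq'] := L2_sqint Lpsi.
have ip := integrable_sqintM (@sqint_psiR R) (sqint_shearlet x Hh sp).
have iq := integrable_sqintM (@sqint_psiR R) (sqint_shearlet x Hh sq').
rewrite /voice /dotL2; congr Complex.
  rewrite /psi_voice -(RintegralZl _ measurableT ip); apply: eq_Rintegral => y _.
  by rewrite /quasireg Re_mul_conj /psiC /= mul0r addr0.
rewrite /psi_voice -mulNr -(RintegralZl _ measurableT iq); apply: eq_Rintegral => y _.
by rewrite /quasireg Im_mul_conj /psiC /= mul0r sub0r mulrN mulNr.
Qed.

(** Integrability of the modulus passes to the real and imaginary parts, and the obstruction makes
    both parts of [psi0] vanish almost everywhere. *)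
Lemma voice_psiC_notin_L1 (mu : {measure set (borelM R) -> \bar R}) (psi0 : R * R -> R[i]) :
  left_haar (@shearlet_group R) mu -> L2 psi0 -> nonzeroL2 psi0 ->
  ~ L1 (@shearlet_group R) mu (@det_weight R) (voice psi0 (dotL2 (@psiC R))).
Proof.
move=> haar_mu Lpsi psiN0 [_ _ fin]; have [sp sq'] := L2_sqint Lpsi.
have obstruct (u : plane R -> R) : sqint (leb2 R) u ->
    (forall x h, shearlet_group h -> `|psi_voice u x h| <=
      Normc.normc (voice psi0 (dotL2 (@psiC R)) x h)) -> {ae leb2 R, forall z, u z = 0}.
  move=> su le; apply: (shearlet_obstruction su haar_mu); apply: le_lt_trans fin.
  apply: ge0_le_integral_any => h Hh.
    apply: integral_ge0 => x _; rewrite lee_fin; apply: mulr_ge0; last by rewrite invr_ge0.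
    by apply: mulr_ge0 => //; exact: det_weight_ge0.
  apply: ge0_le_integral_any => x _.
    rewrite lee_fin; apply: mulr_ge0; last by rewrite invr_ge0.
    by apply: mulr_ge0 => //; exact: det_weight_ge0.
  rewrite lee_fin; apply: ler_wpM2r; first by rewrite invr_ge0.
  by apply: ler_wpM2r; [exact: det_weight_ge0|exact: le].
have zp := obstruct _ sp; have zq := obstruct _ sq'; apply: psiN0.
apply: filterS2 (zp _) (zq _) => [z /=|x h Hh|x h Hh].
- by rewrite /fRe /fIm; case: (psi0 z) => a b /= -> ->.
- by rewrite voice_psiC_shearlet// normc_sqrtE /= -sqrtr_sqr ler_wsqrtr// lerDl sqr_ge0.
- by rewrite voice_psiC_shearlet// normc_sqrtE /= sqrrN -sqrtr_sqr ler_wsqrtr// lerDr sqr_ge0.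
Qed.

End not_in_coorbit.

Theorem mainTheorem4 (R : realType)
  (H := @shearlet_group R) (Hg := conj_group (@rot90 R) H)
  (v := @det_weight R) (vg := conj_weight (@rot90 R) v)
  (mu mug : {measure set (borelM R) -> \bar R})
  (Delta Deltag : 'M[R]_2 -> R)
  (psi0 psi0g : R * R -> R[i])
  (haar_mu : left_haar H mu) (haar_mug : left_haar Hg mug)
  (mod_Delta : modular_function H mu Delta)
  (mod_Deltag : modular_function Hg mug Deltag)
  (psi0A : analyzing H mu (control_weight v Delta) psi0)
  (psi0N0 : nonzeroL2 psi0)
  (psi0gA : analyzing Hg mug (control_weight vg Deltag) psi0g)
  (psi0gN0 : nonzeroL2 psi0g) :
  exists psi : R * R -> R[i], schwartz psi /\
    (Co Hg mug Deltag vg vg psi0g `\` Co H mu Delta v v psi0) (dotL2 psi).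
Proof.
exists (@psiC R); split; first exact: schwartz_psiR.
(* Conjugation preserves determinants, so both sides carry the same weight function and only the
   groups differ. *)
have vgE : vg = @det_weight R by exact: conj_det_weightE.
rewrite vgE in psi0gA *; have [Lg [_ _ fing]] := psi0gA; have [Lp _] := psi0A.
split; last by move=> [_]; exact: (voice_psiC_notin_L1 haar_mu Lp psi0N0).
split; first exact: (dotL2_psiC_antidual haar_mug mod_Deltag Lg psi0gN0).
exact: (voice_psiC_L1 haar_mug mod_Deltag Lg psi0gN0 fing).
Qed.
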